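(* Assume that $R$ is an equidimensional excellent (Noetherian) local ring of prime characteristic $p$ and of dimension $d$, and let $x_1,\ldots,x_d$ form a system of parameters for $R$. Let $\mathfrak{a}$ denote a proper ideal of $R$ generated by polynomials in $x_1,\ldots,x_d$ with coefficients in the prime subfield of $R$ (that is, by elements of the form $g(x_1,\ldots,x_d)$ with $g\in\mathbb{F}_p[X_1,\ldots,X_d]$). Then (i) $\mathfrak{a}^*S^{-1}R=(\mathfrak{a}S^{-1}R)^*$ for every multiplicatively closed subset $S$ of $R$; (ii) the ideal of $R^{\infty}$ to which the $f$-sequence $\big((\mathfrak{a}^{[p^n]})^*\big)_{n\in\mathbb{N}_0}$ corresponds has a primary decomposition, so that the $f$-sequence $\big((\mathfrak{a}^{[p^n]})^*\big)_{n\in\mathbb{N}_0}$ has linear growth of primary decompositions; and (iii) the set $\bigcup_{n\in\mathbb{N}_0}\operatorname{ass}(\mathfrak{a}^{[p^n]})^*$ is finite.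
   Context: Rings are commutative with identity; $\mathbb{N}_0$ is the set of non-negative integers. $f:R\to R$, $r\mapsto r^p$, is the Frobenius homomorphism. For an ideal $\mathfrak{b}$, $\mathfrak{b}^{[p^n]}$ is the ideal generated by all $p^n$-th powers of elements of $\mathfrak{b}$. $R$ is equidimensional if $\dim R/\mathfrak{p}=\dim R$ for every minimal prime $\mathfrak{p}$ of $R$. For a commutative Noetherian ring $A$ of characteristic $p$, $A^{\circ}$ is the complement in $A$ of the union of the minimal primes of $A$. The tight closure $\mathfrak{b}^*$ of an ideal $\mathfrak{b}$ of $A$ is the ideal of all $r\in A$ for which there exists $c\in A^{\circ}$ with $cr^{p^n}\in\mathfrak{b}^{[p^n]}$ for all $n\gg0$. (Thus $(\mathfrak{a}S^{-1}R)^*$ is computed in $S^{-1}R$.) Perfect closure: a ring of characteristic $p$ is perfect if its Frobenius homomorphism is bijective. $R^{\infty}$ is the perfect closure of $R$: a perfect commutative ring with a ring homomorphism $\psi_0:R\to R^{\infty}$ that is universal for ring homomorphisms from $R$ to perfect commutative rings of characteristic $p$. One has $\ker\psi_0=\sqrt{(0)}$, and each $\alpha\in R^\infty$ satisfies $\alpha^{p^m}\in\psi_0(R)$ for some $m\ge 0$. Put $\overline{r}=\psi_0(r)$, let $\overline{r}^{1/p^n}$ be its unique $p^n$-th root in $R^{\infty}$, and let $\psi_n:R\to R^{\infty}$ be the ring homomorphism $\psi_n(r)=\overline{r}^{1/p^n}$. An $f$-sequence of ideals of $R$ is a sequence $(\mathfrak{a}_n)_{n\in\mathbb{N}_0}$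 of ideals of $R$ with $f^{-1}(\mathfrak{a}_{n+1})=\mathfrak{a}_n$ for all $n$. The map $\mathfrak{A}\mapsto(\psi_n^{-1}(\mathfrak{A}))_{n\in\mathbb{N}_0}$ is a bijection from the set of ideals of $R^{\infty}$ to the set of $f$-sequences of ideals of $R$, with inverse $(\mathfrak{a}_n)_n\mapsto\bigcup_n\psi_n(\mathfrak{a}_n)$; ''corresponds'' refers to this bijection. The sequence $\big((\mathfrak{a}^{[p^n]})^*\big)_n$ is an $f$-sequence. An ideal of a (not necessarily Noetherian) commutative ring has a primary decomposition if it is an intersection of finitely many primary ideals. For an ideal $\mathfrak{b}$ of $R$, $\operatorname{ass}\mathfrak{b}$ is the set of associated primes of $\mathfrak{b}$, i.e. the radicals of the components of a minimal primary decomposition of $\mathfrak{b}$. An $f$-sequence $(\mathfrak{a}_n)_n$ of proper ideals of $R$ has linear growth of primary decompositions if there is a positive integer $h$ such that for every $n\in\mathbb{N}_0$ there is a minimal primary decomposition $\mathfrak{a}_n=\mathfrak{q}_{1,n}\cap\cdots\cap\mathfrak{q}_{k_n,n}$ with $\big((\sqrt{\mathfrak{q}_{i,n}})^{[p^n]}\big)^h\subseteq\mathfrak{q}_{i,n}$ for all $i=1,\ldots,k_n$. *)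

(* Defs.v *)
From HB Require Import structures.
From mathcomp Require Import all_boot all_order all_algebra all_field.
From mathcomp Require Import boolp classical_sets cardinality.
From mathcomp Require mpoly.

Set Implicit Arguments.
Unset Strict Implicit.
Unset Printing Implicit Defensive.

Import GRing.Theory.
Local Open Scope classical_set_scope.
Local Open Scope ring_scope.

(* Ideals are plain subsets [set R].  The [idealr_closed] of MathComp is not
   used because it forces ideals to be proper and because rings here may be
   zero (a localization, for instance), whence also [comPzRingType]. *)

Section Ideals.
Variable R : comPzRingType.
Implicit Types (I J P Q m b : set R) (n h : nat).

Definition is_ideal I :=
  [/\ I 0, forall u v, I u -> I v -> I (u + v) & forall r u, I u -> I (r * u)].

Definition gen_ideal (E : set R) : set R := smallest is_ideal E.

Definition prime_ideal P :=
  [/\ is_ideal P, ~ P 1 & forall u v, P (u * v) -> P u \/ P v].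

Definition maximal_ideal m :=
  [/\ is_ideal m, ~ m 1 &
      forall I, is_ideal I -> ~ I 1 -> m `<=` I -> I = m].

Definition minimal_prime P :=
  prime_ideal P /\ forall Q, prime_ideal Q -> Q `<=` P -> Q = P.

Definition ideal_radical I : set R := [set r | exists n, I (r ^+ n)].

Definition primary_ideal Q :=
  [/\ is_ideal Q, ~ Q 1 &
      forall u v, Q (u * v) -> Q u \/ ideal_radical Q v].

Definition idealM I J : set R := gen_ideal [set u * v | u in I & v in J].

Definition idealX I h : set R := iter h (idealM I) setT.

Definition mult_closed (S : set R) :=
  S 1 /\ forall u v, S u -> S v -> S (u * v).

Definition is_primary_decomp b k (q : 'I_k -> set R) :=
  (forall i, primary_ideal (q i)) /\ b = \bigcap_(i in [set: 'I_k]) q i.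

Definition has_primary_decomp b :=
  exists k (q : 'I_k -> set R), is_primary_decomp b q.

Definition is_minimal_primary_decomp b k (q : 'I_k -> set R) :=
  [/\ is_primary_decomp b q,
      injective (fun i => ideal_radical (q i)) &
      forall i, ~ (\bigcap_(j in [set j | j <> i]) q j `<=` q i)].

Definition ass b : set (set R) :=
  [set P | exists k (q : 'I_k -> set R),
     is_minimal_primary_decomp b q /\ exists i, P = ideal_radical (q i)].

Definition prime_chain n (c : nat -> set R) :=
  (forall i, (i <= n)%N -> prime_ideal (c i)) /\
  (forall i, (i < n)%N -> c i `<` c i.+1).

(* The Krull dimension exists, is finite and equals n. *)
Definition has_krull_dim n :=
  (exists c, prime_chain n c) /\
  (forall k c, prime_chain k c -> (k <= n)%N).

Definition chain_between P Q n (c : nat -> set R) :=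
  [/\ prime_chain n c, c 0%N = P & c n = Q].

Definition saturated_chain n (c : nat -> set R) :=
  forall i, (i < n)%N ->
    ~ exists2 P', prime_ideal P' & c i `<` P' /\ P' `<` c i.+1.

Definition catenary :=
  forall P Q, prime_ideal P -> prime_ideal Q -> P `<=` Q ->
  exists n, forall k c, chain_between P Q k c ->
    (k <= n)%N /\ (saturated_chain k c -> k = n).

Definition noetherian :=
  forall I, is_ideal I -> exists s : seq R, I = gen_ideal [set` s].

Definition local_ring m :=
  maximal_ideal m /\ forall m', maximal_ideal m' -> m' = m.

Definition system_of_parameters m d (x : 'I_d -> R) :=
  [/\ has_krull_dim d, primary_ideal (gen_ideal (range x)) &
      ideal_radical (gen_ideal (range x)) = m].

Definition regular_local :=
  exists m d, [/\ noetherian, local_ring m, has_krull_dim d &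
    exists x : 'I_d -> R, m = gen_ideal (range x)].

End Ideals.

(* Localizations, quotients, completions, tensor products and residue fields
   are characterized up to unique isomorphism rather than constructed. *)

Definition ideal_ext (R A : comPzRingType) (phi : {rmorphism R -> A})
  (I : set R) : set A := gen_ideal (phi @` I).

Definition is_quotient (R A : comPzRingType) (I : set R)
    (phi : {rmorphism R -> A}) :=
  (forall y, exists r, phi r = y) /\ (forall r, phi r = 0 <-> I r).

Definition is_localization (R L : comPzRingType) (S : set R)
    (phi : {rmorphism R -> L}) :=
  [/\ forall s, S s -> exists y, phi s * y = 1,
      forall y, exists r s, S s /\ phi s * y = phi r &
      forall r, phi r = 0 <-> exists2 s, S s & s * r = 0].

(* [A] is the inverse limit of the rings [R / I ^ n], where [J n] is the
   kernel of the projection [A -> R / I ^ n]. *)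
Definition is_completion (R A : comPzRingType) (I : set R)
    (phi : {rmorphism R -> A}) :=
  exists J : nat -> set A,
  [/\ forall n, is_ideal (J n) /\ J n.+1 `<=` J n,
      forall n, phi @^-1` J n = idealX I n,
      forall n y, exists r, J n (y - phi r) &
      forall x : nat -> R, (forall n, idealX I n (x n.+1 - x n)) ->
        exists! y, forall n, J n (y - phi (x n))].

(* [T] is the tensor product of [A] and [B] over [R], that is, their pushout
   in the category of commutative rings. *)
Definition is_tensor (R A B T : comPzRingType)
    (f : {rmorphism R -> A}) (g : {rmorphism R -> B})
    (i : {rmorphism A -> T}) (j : {rmorphism B -> T}) :=
  (forall r, i (f r) = j (g r)) /\
  forall (C : comPzRingType)
      (u : {rmorphism A -> C}) (v : {rmorphism B -> C}),
    (forall r, u (f r) = v (g r)) ->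
    exists w : {rmorphism T -> C},
      [/\ forall a, w (i a) = u a, forall b, w (j b) = v b &
          forall w' : {rmorphism T -> C},
            (forall a, w' (i a) = u a) -> (forall b, w' (j b) = v b) ->
            w' =1 w].

Definition is_residue_field (R : comPzRingType) (K : fieldType) (P : set R)
    (f : {rmorphism R -> K}) :=
  (forall r, f r = 0 <-> P r) /\
  (forall y, exists r s, ~ P s /\ y = f r / f s).

Definition equidimensional (R : comPzRingType) :=
  forall P : set R, minimal_prime P ->
  forall (Q : comPzRingType) (pi : {rmorphism R -> Q}), is_quotient P pi ->
  forall n, has_krull_dim Q n <-> has_krull_dim R n.

Section Excellence.

Definition regular_at (A : comPzRingType) (P : set A) :=
  forall (L : comPzRingType) (phi : {rmorphism A -> L}),
    is_localization (~` P) phi -> regular_local L.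

Definition regular_ring (A : comPzRingType) :=
  noetherian A /\ forall P : set A, prime_ideal P -> regular_at P.

Definition finite_type (R A : comPzRingType) (f : {rmorphism R -> A}) :=
  exists s : seq A,
    smallest (fun B : set A => (forall u v, B u -> B v -> B (u + v)) /\
                               (forall u v, B u -> B v -> B (u * v)))
             (range f `|` [set` s]) = setT.

(* [in_alg K'] is the embedding of [K] into its finite extension [K']. *)
Definition geometrically_regular (K : fieldType) (F : comPzRingType)
    (iota : {rmorphism K -> F}) :=
  forall (K' : fieldExtType K) (T : comPzRingType)
    (i : {rmorphism K' -> T}) (j : {rmorphism F -> T}),
  is_tensor (GRing.in_alg K' : {rmorphism K -> K'}) iota i j -> regular_ring T.

Definition geometrically_regular_formal_fibres (A : comPzRingType) :=
  forall (m : set A), local_ring m ->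
  forall (A' : comPzRingType) (phi : {rmorphism A -> A'}),
    is_completion m phi ->
  forall q : set A, prime_ideal q ->
  forall (K : fieldType) (f : {rmorphism A -> K}), is_residue_field q f ->
  forall (F : comPzRingType)
    (i : {rmorphism K -> F}) (j : {rmorphism A' -> F}),
    is_tensor f phi i j -> geometrically_regular i.

Definition G_ring (R : comPzRingType) :=
  forall P : set R, prime_ideal P ->
  forall (L : comPzRingType) (phi : {rmorphism R -> L}),
    is_localization (~` P) phi -> geometrically_regular_formal_fibres L.

Definition open_regular_locus (A : comPzRingType) :=
  exists E : set A, forall P : set A, prime_ideal P ->
    (regular_at P <-> ~ (E `<=` P)).

Definition J2 (R : comPzRingType) :=
  forall (A : comPzRingType) (f : {rmorphism R -> A}),
    finite_type f -> open_regular_locus A.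

Definition universally_catenary (R : comPzRingType) :=
  forall (A : comPzRingType) (f : {rmorphism R -> A}),
    finite_type f -> catenary A.

Definition excellent (R : comPzRingType) :=
  [/\ noetherian R, universally_catenary R, G_ring R & J2 R].

End Excellence.

Section Frobenius.
Variable p : nat.

Definition frob_power (R : comPzRingType) (b : set R) (n : nat) : set R :=
  gen_ideal [set r ^+ (p ^ n) | r in b].

Definition ring_circ (A : comPzRingType) : set A :=
  [set c | forall P, minimal_prime P -> ~ P c].

Definition tight_closure (A : comPzRingType) (b : set A) : set A :=
  [set r | exists2 c, ring_circ c &
     exists N, forall n, (N <= n)%N -> frob_power b n (c * r ^+ (p ^ n))].

Definition perfect_ring (A : comPzRingType) :=
  (p%:R = 0 :> A) /\ bijective (fun r : A => r ^+ p).

Definition is_perfect_closure (R Rinf : comPzRingType)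
    (psi0 : {rmorphism R -> Rinf}) :=
  perfect_ring Rinf /\
  forall (B : comPzRingType) (g : {rmorphism R -> B}), perfect_ring B ->
    exists h : {rmorphism Rinf -> B},
      (forall r, h (psi0 r) = g r) /\
      forall h' : {rmorphism Rinf -> B},
        (forall r, h' (psi0 r) = g r) -> h' =1 h.

(* [psi_n r], the [p ^ n]-th root of [psi0 r], unique in a perfect ring. *)
Definition psi (R Rinf : comPzRingType) (psi0 : {rmorphism R -> Rinf})
    (n : nat) (r : R) : Rinf :=
  xget 0 [set y | y ^+ (p ^ n) = psi0 r].

Definition f_sequence (R : comPzRingType) (a : nat -> set R) :=
  (forall n, is_ideal (a n)) /\
  (forall n, (fun r => r ^+ p) @^-1` a n.+1 = a n).

(* The ideal of [Rinf] corresponding to the f-sequence [a]; it is the unique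
   ideal whose preimage under [psi psi0 n] is [a n] for all [n]. *)
Definition f_sequence_ideal (R Rinf : comPzRingType)
    (psi0 : {rmorphism R -> Rinf}) (a : nat -> set R) : set Rinf :=
  \bigcup_n (psi psi0 n @` a n).

Definition linear_growth (R : comPzRingType) (a : nat -> set R) :=
  [/\ f_sequence a, forall n, ~ a n 1 &
      exists2 h, (0 < h)%N & forall n,
        exists k (q : 'I_k -> set R), is_minimal_primary_decomp (a n) q /\
          forall i, idealX (frob_power (ideal_radical (q i)) n) h `<=` q i].

End Frobenius.

(* The value [g(x_1, ..., x_d)] in [R], of characteristic [p]. *)
Definition mpeval (p d : nat) (R : comNzRingType) (x : 'I_d -> R)
    (g : mpoly.mpoly d 'F_p) : R :=
  mpoly.mmap (fun c : 'F_p => (c : nat)%:R) x g.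

(* Main.v *)
Require Import Defs.
From HB Require Import structures.
From mathcomp Require Import all_boot all_order all_algebra all_field.
From mathcomp Require Import boolp classical_sets cardinality.
From mathcomp Require Import ring zify.
From mathcomp Require mpoly.

Set Implicit Arguments.
Unset Strict Implicit.
Unset Printing Implicit Defensive.

Import GRing.Theory.
Local Open Scope classical_set_scope.
Local Open Scope ring_scope.

(** For a minimal prime [P] of [R] let [B] be the completion of [R] modulo [P],
    and let [A] be the ring of power series in [d] variables over a coefficient
    field, mapped to [B] by [X_i |-> x_i]; then [B] is finite over [A].  By
    Ratliff's argument every minimal prime of [B] has dimension [d], so that [A]
    embeds into [B] modulo each of them.  As the formal fibres of [R] are
    regular, [B] is flat over [A] at all primes that do not meet [R \ P], and
    multiplication by some [c0 \notin P] on [B] factors through a finite free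
    [A]-module.  Let [a_A] be the ideal of [A] generated by the same polynomials as [a].  Since the
    Frobenius of [A] is flat, the [p ^ n]-th Frobenius powers of the components
    of a primary decomposition of [a_A] are primary with intersection
    [a_A ^ [p ^ n]].  Contracting their components from [B] to [R] yields, up to
    [c0] and modulo [P], decompositions of [a ^ [p ^ n]] that involve the same
    finitely many primes [q_i] for all [n], with a uniform exponent.  Tight
    closure absorbs [c0] and [P]: [(a ^ [p ^ n])^*] is the intersection of
    ideals [E_(i, n)], each of which is [R] or [q_i]-primary and which form an
    f-sequence for each [i]. *)

(** * Ideals and primes of Noetherian rings *)

(** The obstacle is that [B] need not be flat over [A], so that decompositions of [a_A ^ [p ^ n]]
    cannot simply be extended. The substitute [factors] asks only for enough linear forms from [B]
    to [A]: applying them moves membership in an extended ideal back to [A], at the cost of one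
    fixed multiplier. Near a regular prime its existence follows from the flatness of Frobenius on
    both sides ([factors_at_prime]); equational criteria take the place of homological algebra.
    Equidimensionality matters because a minimal prime of [B] of too small a dimension would
    contract to a nonzero prime of [A], and nonzero elements of [A] would become zero divisors on
    [B]. The multiplier [c0] depends on [P] but not on [n]; tight closure tolerates such a factor,
    so no test element has to be produced. Returning from the quotients by minimal primes to [R]
    costs one more Frobenius power, which kills the nilradical. The primes [q i] and exponents [h i]
    are chosen before [n], whence both the finiteness and the linear growth. *)

Section Basics.
Variable R : comPzRingType.
Implicit Types (I J P Q : set R) (a b u v y : R).

Lemma idl0 I : is_ideal I -> I 0. Proof. by case. Qed.

Lemma idlD I u v : is_ideal I -> I u -> I v -> I (u + v).
Proof. by case=> _ + _; apply. Qed.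

Lemma idlM I r u : is_ideal I -> I u -> I (r * u).
Proof. by case=> _ _; apply. Qed.

Lemma idlMr I r u : is_ideal I -> I u -> I (u * r).
Proof. by rewrite mulrC; apply idlM. Qed.

Lemma idlN I u : is_ideal I -> I u -> I (- u).
Proof. by move=> hI Iu; rewrite -mulN1r; apply idlM. Qed.

Lemma idlB I u v : is_ideal I -> I u -> I v -> I (u - v).
Proof. by move=> hI Iu Iv; apply idlD => //; apply idlN. Qed.

Lemma idlDr I u v : is_ideal I -> I v -> I (u + v) -> I u.
Proof. by move=> hI Iv Iuv; rewrite -(addrK v u); apply idlB. Qed.

Lemma idlDl I u v : is_ideal I -> I v -> I (v + u) -> I u.
Proof. by move=> hI Iv; rewrite addrC; apply idlDr. Qed.

Lemma idl_sum I (T : finType) (f : T -> R) : is_ideal I -> (forall i, I (f i)) ->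
  I (\sum_i f i).
Proof.
by move=> hI If; apply: big_ind => [|u v|i _]; [by apply idl0|apply idlD|exact: If].
Qed.

Lemma idl_sumP I (T : finType) (f : T -> R) (D : pred T) : is_ideal I ->
  (forall i, D i -> I (f i)) -> I (\sum_(i | D i) f i).
Proof.
by move=> hI If; apply: big_ind => [|u v|i Di]; [by apply idl0|apply idlD|exact: If].
Qed.

Lemma idl1 I u : is_ideal I -> I 1 -> I u.
Proof. by move=> hI I1; rewrite -(mulr1 u); apply idlM. Qed.

Lemma idlX I u n : is_ideal I -> I u -> I (u ^+ n.+1).
Proof. by move=> hI Iu; rewrite exprS; apply idlMr. Qed.

Lemma gen_ideal_ideal (E : set R) : is_ideal (gen_ideal E).
Proof.
split=> [J [hJ _]|u v hu hv J hJ|r u hu J hJ].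
- by apply idl0.
- by apply: (idlD _ (hu _ hJ) (hv _ hJ)); case: hJ.
- by apply: (idlM _ _ (hu _ hJ)); case: hJ.
Qed.
Hint Resolve gen_ideal_ideal : core.

Lemma gen_sub (E : set R) : E `<=` gen_ideal E.
Proof. by move=> u Eu J [_ hJ]; apply: hJ. Qed.

Lemma gen_min (E : set R) I : is_ideal I -> E `<=` I -> gen_ideal E `<=` I.
Proof. by move=> hI hE u hu; apply: hu. Qed.

Lemma gen_idealS (E F : set R) : E `<=` F -> gen_ideal E `<=` gen_ideal F.
Proof. by move=> EF; apply: gen_min => // u /EF; apply: gen_sub. Qed.

Lemma gen_id I : is_ideal I -> gen_ideal I = I.
Proof. by move=> hI; apply/seteqP; split; [exact: gen_min|exact: gen_sub]. Qed.

Lemma setT_ideal : is_ideal (setT : set R). Proof. by []. Qed.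

Lemma set0_ideal : is_ideal ([set 0] : set R).
Proof. by split=> [//|u v -> ->|r u ->]; rewrite /= ?addr0 ?mulr0. Qed.

Lemma setI_ideal I J : is_ideal I -> is_ideal J -> is_ideal (I `&` J).
Proof.
move=> hI hJ; split=> [|u v [Iu Ju] [Iv Jv]|r u [Iu Ju]].
- by split; apply idl0.
- by split; apply idlD.
- by split; apply idlM.
Qed.

Lemma bigcap_ideal T (D : set T) (F : T -> set R) :
  (forall i, D i -> is_ideal (F i)) -> is_ideal (\bigcap_(i in D) F i).
Proof.
move=> hF; split=> [i Di|u v hu hv i Di|r u hu i Di].
- by apply idl0; apply: hF.
- exact: (idlD (hF _ Di) (hu _ Di) (hv _ Di)).
- exact: (idlM _ (hF _ Di) (hu _ Di)).
Qed.

Lemma gen_idealP (E : set R) y : gen_ideal E y <->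
  exists n (c e : 'I_n -> R), (forall i, E (e i)) /\ y = \sum_i c i * e i.
Proof.
split=> [|[n [c [e [he ->]]]]]; last first.
  by apply idl_sum => // i; apply idlM => //; apply: gen_sub; apply: he.
apply: (gen_min (I := [set y | exists n (c e : 'I_n -> R),
  (forall i, E (e i)) /\ y = \sum_i c i * e i])) => [|u Eu]; last first.
  by exists 1%N, (fun=> 1), (fun=> u); rewrite big_ord1 mul1r.
split=> [|u v [n [c [e [he ->]]]] [n' [c' [e' [he' ->]]]]
  |r u [n [c [e [he ->]]]]].
- by exists 0%N, (fun=> 0), (fun=> 0); split=> [[]//|]; rewrite big_ord0.
- exists (n + n')%N, (fun i => match split i with inl j => c j | inr j => c' j end),
    (fun i => match split i with inl j => e j | inr j => e' j end).
  split=> [i|]; first by case: (split i).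
  rewrite big_split_ord /=; congr (_ + _); apply: eq_bigr => i _.
    by rewrite (unsplitK (inl _ i)).
  by rewrite (unsplitK (inr _ i)).
- exists n, (fun i => r * c i), e; split=> //.
  by rewrite mulr_sumr; apply: eq_bigr => i _; rewrite mulrA.
Qed.

Lemma gen_rangeP n (x : 'I_n -> R) y : gen_ideal (range x) y <->
  exists c : 'I_n -> R, y = \sum_i c i * x i.
Proof.
split=> [|[c ->]]; last first.
  by apply idl_sum => // i; apply idlM => //; apply: gen_sub; exists i.
apply: (gen_min (I := [set y | exists c : 'I_n -> R, y = \sum_i c i * x i])).
  split=> [|u v [c ->] [c' ->]|r u [c ->]].
  - by exists (fun=> 0); rewrite big1 // => i _; rewrite mul0r.
  - exists (fun i => c i + c' i); rewrite -big_split /=.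
    by apply: eq_bigr => i _; rewrite mulrDl.
  - exists (fun i => r * c i); rewrite mulr_sumr.
    by apply: eq_bigr => i _; rewrite mulrA.
move=> _ [i _ <-]; exists (fun j => (j == i)%:R).
by rewrite (bigD1 i) //= eqxx mul1r big1 ?addr0 // => j /negPf ->; rewrite mul0r.
Qed.

Definition fin_gen I := exists n (x : 'I_n -> R), I = gen_ideal (range x).

Lemma noetherian_fg I : noetherian R -> is_ideal I -> fin_gen I.
Proof.
move=> nR /nR [s ->]; exists (size s), (fun i => s`_i); congr gen_ideal.
apply/seteqP; split=> [u /= us|_ [i _ <-]]; last by rewrite /= mem_nth.
by exists (Ordinal (etrans (index_mem u s) us)); rewrite //= nth_index.
Qed.

Lemma fg_noetherian : (forall I, is_ideal I -> fin_gen I) -> noetherian R.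
Proof.
move=> h I /h [n [x ->]]; exists (codom x); congr gen_ideal.
apply/seteqP; split=> [_ [i _ <-]|u /= /codomP[i ->]]; first exact: codom_f.
by exists i.
Qed.

Definition addI I J : set R := [set y | exists u v, [/\ I u, J v & y = u + v]].
Definition prI a : set R := [set y | exists r, y = r * a].

Lemma addI_ideal I J : is_ideal I -> is_ideal J -> is_ideal (addI I J).
Proof.
move=> hI hJ; split=> [|_ _ [u [v [Iu Jv ->]]] [u' [v' [Iu' Jv' ->]]]
  |r _ [u [v [Iu Jv ->]]]].
- by exists 0, 0; rewrite addr0; split=> //; apply idl0.
- by exists (u + u'), (v + v'); rewrite addrACA; split=> //; apply idlD.
- by exists (r * u), (r * v); rewrite mulrDr; split=> //; apply idlM.
Qed.

Lemma prI_ideal a : is_ideal (prI a).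
Proof.
split=> [|_ _ [r ->] [s ->]|r _ [s ->]].
- by exists 0; rewrite mul0r.
- by exists (r + s); rewrite mulrDl.
- by exists (r * s); rewrite mulrA.
Qed.
Hint Resolve prI_ideal : core.

Lemma prI_self a : prI a a. Proof. by exists 1; rewrite mul1r. Qed.

Lemma prI_sub a I : is_ideal I -> I a -> prI a `<=` I.
Proof. by move=> hI Ia _ [r ->]; apply idlM. Qed.

Lemma addI_l I J : is_ideal J -> I `<=` addI I J.
Proof. by move=> hJ u Iu; exists u, 0; rewrite addr0; split=> //; apply idl0. Qed.

Lemma addI_r I J : is_ideal I -> J `<=` addI I J.
Proof. by move=> hI u Iu; exists 0, u; rewrite add0r; split=> //; apply idl0. Qed.

Lemma addI_min I J Q : is_ideal Q -> I `<=` Q -> J `<=` Q -> addI I J `<=` Q.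
Proof. by move=> hQ IQ JQ _ [u [v [/IQ Iu /JQ Jv ->]]]; apply idlD. Qed.

Lemma addI_prP I a y : addI I (prI a) y <-> exists r, I (y - r * a).
Proof.
split=> [[u [_ [Iu [r ->] ->]]]|[r Ir]]; first by exists r; rewrite addrK.
by exists (y - r * a), (r * a); rewrite subrK; split=> //; exists r.
Qed.

Lemma prime_is_ideal P : prime_ideal P -> is_ideal P. Proof. by case. Qed.

Lemma prime_mult_closed P : prime_ideal P -> mult_closed (~` P).
Proof. by case=> hP P1 hm; split=> // u v Pu Pv /= /hm []. Qed.

Lemma prime_X P u n : prime_ideal P -> P (u ^+ n) -> P u.
Proof.
move=> hP; elim: n => [|n IH]; first by rewrite expr0; case: hP.
by rewrite exprS; case: hP => _ _ h /h [].
Qed.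

Lemma mult_closedX (S : set R) u n : mult_closed S -> S u -> S (u ^+ n).
Proof.
by move=> [S1 SM] Su; elim: n => [|n IH]; rewrite ?expr0 // exprS; apply: SM.
Qed.

Lemma maximal_prime (M : set R) : maximal_ideal M -> prime_ideal M.
Proof.
move=> [hM M1 mM]; split=> // u v Muv; apply: contrapT => /not_orP [Mu Mv].
have h x : ~ M x -> exists r, M (1 - r * x).
  move=> Mx; apply/addI_prP; apply: contrapT => n1.
  have e : addI M (prI x) = M.
    by apply: mM => //; [exact: addI_ideal|exact: addI_l].
  by apply: Mx; rewrite -e; apply: addI_r => //; apply: prI_self.
have [r Mr] := h _ Mu; have [s Ms] := h _ Mv.
apply: M1; have -> : 1 = (1 - r * u) + (r * u) * (1 - s * v) + r * s * (u * v) by ring.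
by apply idlD; [|apply idlD => //; apply idlM|by apply idlM].
Qed.

Section Noeth.
Hypothesis nR : noetherian R.

Lemma noetherian_max (Phi : set R -> Prop) :
  (exists I, is_ideal I /\ Phi I) ->
  exists I, [/\ is_ideal I, Phi I &
    forall J, is_ideal J -> Phi J -> I `<=` J -> J = I].
Proof.
move=> [I0 [hI0 PI0]]; apply: contrapT => nomax.
pose T := {I : set R | is_ideal I /\ Phi I}.
have step (t : T) : exists t' : T, sval t `<=` sval t' /\ sval t' <> sval t.
  apply: contrapT => nt; apply: nomax; exists (sval t).
  case: t nt => I [hI PI] /= nt; split=> // J hJ PJ IJ; apply: contrapT => nJ.
  by apply: nt; exists (exist _ J (conj hJ PJ)).
have [f hf] := choice step.
pose g n := iter n f (exist _ I0 (conj hI0 PI0)).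
have gS n : sval (g n) `<=` sval (g n.+1) by case: (hf (g n)).
have gM m n : (m <= n)%N -> sval (g m) `<=` sval (g n).
  elim: n => [|n IH]; first by rewrite leqn0 => /eqP ->.
  by rewrite leq_eqVlt => /predU1P[->//|/IH h] u /h; apply: gS.
have hU : is_ideal (\bigcup_n sval (g n)).
  split=> [|u v [m _ hu] [n _ hv]|r u [m _ hu]].
  - by exists 0%N => //; apply idl0.
  - exists (maxn m n) => //; apply idlD; first by case: (svalP (g (maxn m n))).
      by apply: gM hu; rewrite leq_maxl.
    by apply: gM hv; rewrite leq_maxr.
  - by exists m => //; apply idlM => //; case: (svalP (g m)).
have [n [x eU]] := noetherian_fg nR hU.
have hx i : exists m, sval (g m) (x i).
  have : (\bigcup_n sval (g n)) (x i) by rewrite eU; apply: gen_sub; exists i.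
  by case=> m _; exists m.
have [m hm] := choice hx.
pose N := (\max_i m i)%N.
have UN : \bigcup_n sval (g n) `<=` sval (g N).
  rewrite eU; apply: gen_min; first by case: (svalP (g N)).
  by move=> _ [i _ <-]; apply: gM (hm i); apply: leq_bigmax.
case: (hf (g N)) => h1 h2; apply: h2; apply/seteqP; split=> // u hu.
by apply: UN; exists N.+1.
Qed.

Lemma noetherian_ind (Psi : set R -> Prop) :
  (forall I, is_ideal I ->
     (forall J, is_ideal J -> I `<=` J -> J <> I -> Psi J) -> Psi I) ->
  forall I, is_ideal I -> Psi I.
Proof.
move=> h I hI; apply: contrapT => nI.
have [|J [hJ nJ mJ]] := @noetherian_max (fun I => ~ Psi I); first by exists I.
apply: nJ; apply: h => // K hK JK KJ; apply: contrapT => nK.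
by apply: KJ; apply: mJ.
Qed.

Lemma noetherian_acc (F : nat -> set R) : (forall n, is_ideal (F n)) ->
  (forall n, F n `<=` F n.+1) -> exists n, forall m, (n <= m)%N -> F m = F n.
Proof.
move=> hF FS.
have FM m n : (m <= n)%N -> F m `<=` F n.
  elim: n => [|n IH]; first by rewrite leqn0 => /eqP ->.
  by rewrite leq_eqVlt => /predU1P[->//|/IH h] u /h; apply: FS.
have [|I [hI [n eI] mI]] := @noetherian_max (fun I => exists n, I = F n).
  by exists (F 0%N); split; [|exists 0%N].
exists n => m nm; rewrite -eI; apply: mI => //; first by exists m.
by rewrite eI; apply: FM.
Qed.

(** An ideal maximal among those that contain [I] and miss [S] is prime: adding [u] or [v] makes it
    meet [S], and the product of the two elements of [S] lies in [Q] modulo [u * v]. *)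
Lemma prime_avoiding I (S : set R) : is_ideal I -> mult_closed S ->
  (forall u, I u -> ~ S u) ->
  exists Q, [/\ prime_ideal Q, I `<=` Q & forall u, Q u -> ~ S u].
Proof.
move=> hI [S1 SM] IS.
have [|Q [hQ [IQ QS] mQ]] := @noetherian_max
    (fun J => I `<=` J /\ forall u, J u -> ~ S u); first by exists I; split=> //; split.
exists Q; split=> //; split=> [//|Q1|u v Quv]; first exact: QS Q1 S1.
apply: contrapT => /not_orP [Qu Qv].
have h x : ~ Q x -> exists s r, S s /\ Q (s - r * x).
  move=> Qx; apply: contrapT => nS; apply: Qx.
  have e : addI Q (prI x) = Q.
    apply: mQ; [exact: addI_ideal| |exact: addI_l].
    split=> [y /IQ Qy|y /addI_prP[r hr] Sy]; first exact: addI_l.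
    by apply: nS; exists y, r.
  by rewrite -e; apply: addI_r => //; apply: prI_self.
have [s [r [Ss Qs]]] := h _ Qu; have [t [q [St Qt]]] := h _ Qv.
apply: (QS (s * t)); last exact: SM.
have -> : s * t = (s - r * u) * t + (r * u) * (t - q * v) + r * q * (u * v) by ring.
by apply idlD => //; [by apply idlD => //; [by apply idlMr|by apply idlM]|by apply idlM].
Qed.

Lemma radical_primes I y : is_ideal I ->
  (forall Q, prime_ideal Q -> I `<=` Q -> Q y) -> exists n, I (y ^+ n).
Proof.
move=> hI hy; apply: contrapT => nI.
have [||Q [pQ IQ QS]] := @prime_avoiding I [set u | exists n, u = y ^+ n] hI.
- split; first by exists 0%N.
  by move=> _ _ [n ->] [m ->]; exists (n + m)%N; rewrite exprD.
- by move=> u Iu [n e]; apply: nI; exists n; rewrite -e.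
- by apply: (QS y); [exact: hy|exists 1%N].
Qed.

(** Noetherian induction: if [u * v] lies in [I] but neither factor does, each prime over [I]
    contains [u] or [v], and the lists of the two larger ideals are concatenated. Listed primes need
    not be minimal; [seq_min_set] selects afterwards. *)
Lemma prime_list I : is_ideal I -> exists s : seq (set R),
  (forall P, P \in s -> prime_ideal P /\ I `<=` P) /\
  (forall Q, prime_ideal Q -> I `<=` Q -> exists2 P, P \in s & P `<=` Q).
Proof.
move: I; apply: noetherian_ind => I hI IH.
have [I1|I1] := pselect (I 1).
  by exists [::]; split=> // Q [_ Q1 _] IQ; case: Q1; apply: IQ.
have [pI|npI] := pselect (prime_ideal I).
  exists [:: I]; split=> [P|Q _ IQ]; last by exists I; rewrite ?inE.
  by rewrite inE => /eqP ->; split.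
have [u [v [Iuv Iu Iv]]] : exists u v, [/\ I (u * v), ~ I u & ~ I v].
  apply: contrapT => n; apply: npI; split=> // u v Iuv.
  by apply: contrapT => /not_orP [Iu Iv]; apply: n; exists u, v.
have h x : ~ I x -> exists s : seq (set R),
    (forall P, P \in s -> prime_ideal P /\ I `<=` P) /\
    (forall Q, prime_ideal Q -> I `<=` Q -> Q x -> exists2 P, P \in s & P `<=` Q).
  move=> Ix; have [] := IH (addI I (prI x)).
  - exact: addI_ideal.
  - exact: addI_l.
  - by move=> e; apply: Ix; rewrite -e; apply: addI_r => //; apply: prI_self.
  move=> s [h1 h2]; exists s; split=> [P /h1 [pP sP]|Q pQ IQ Qx].
    by split=> // y Iy; apply: sP; apply: addI_l.
  apply: h2 => //; apply: addI_min => //; first by case: pQ.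
  by apply: prI_sub => //; case: pQ.
have [s [hs1 hs2]] := h _ Iu; have [t [ht1 ht2]] := h _ Iv.
exists (s ++ t); split=> [P|Q pQ IQ].
  by rewrite mem_cat => /orP[/hs1|/ht1].
case: (pQ) => _ _ /(_ _ _ (IQ _ Iuv)) [Qu|Qv].
  by have [P Ps PQ] := hs2 _ pQ IQ Qu; exists P; rewrite // mem_cat Ps.
by have [P Ps PQ] := ht2 _ pQ IQ Qv; exists P; rewrite // mem_cat Ps orbT.
Qed.

Lemma seq_min_set (s : seq (set R)) P0 : P0 \in s ->
  exists P, [/\ P \in s, P `<=` P0 & forall P', P' \in s -> P' `<=` P -> P' = P].
Proof.
elim: s P0 => [//|a s IH] P0.
have h P1 : P1 \in s -> exists P, [/\ P \in a :: s, P `<=` P1 &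
    forall P', P' \in a :: s -> P' `<=` P -> P' = P].
  move=> /IH [P [Ps PP1 mP]]; have [aP|naP] := pselect (a `<=` P).
    have [aeP|aneP] := pselect (a = P).
      exists P; split=> // [|P']; first by rewrite inE Ps orbT.
      by rewrite inE => /predU1P[->//|]; apply: mP.
    exists a; split; [by rewrite inE eqxx|exact: subset_trans aP PP1|].
    move=> P'; rewrite inE => /predU1P[->//|P's P'a].
    have e := mP _ P's (subset_trans P'a aP); rewrite e in P'a.
    by rewrite e; apply/seteqP.
  exists P; split=> // [|P']; first by rewrite inE Ps orbT.
  by rewrite inE => /predU1P[->//|]; apply: mP.
rewrite inE => /predU1P[->|/h//].
have [[P1 P1s P1a]|na] := pselect (exists2 P1, P1 \in s & P1 `<=` a).
  have [P [h1 h2 h3]] := h _ P1s; exists P; split=> //.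
  exact: subset_trans h2 P1a.
exists a; split=> //; first by rewrite inE eqxx.
by move=> P'; rewrite inE => /predU1P[//|P's P'a]; case: na; exists P'.
Qed.

Lemma minimal_over I Q : is_ideal I -> prime_ideal Q -> I `<=` Q ->
  exists P, [/\ prime_ideal P, I `<=` P, P `<=` Q &
    forall P', prime_ideal P' -> I `<=` P' -> P' `<=` P -> P' = P].
Proof.
move=> hI pQ IQ; have [s [h1 h2]] := prime_list hI.
have [P0 P0s P0Q] := h2 _ pQ IQ.
have [P [Ps PP0 mP]] := seq_min_set P0s.
have [pP IP] := h1 _ Ps.
exists P; split=> // [|P' pP' IP' PP']; first exact: subset_trans PP0 P0Q.
have [P2 P2s P2P'] := h2 _ pP' IP'.
apply/seteqP; split=> //; rewrite -(mP P2) //.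
exact: subset_trans P2P' PP'.
Qed.
End Noeth.
End Basics.

(** * Powers of ideals and primary decompositions *)

#[export] Hint Resolve gen_ideal_ideal prI_ideal setT_ideal set0_ideal
  prime_is_ideal : core.
#[export] Hint Extern 0 (is_ideal (addI _ _)) =>
  solve [apply: addI_ideal; auto] : core.
#[export] Hint Extern 0 (is_ideal (setI _ _)) =>
  solve [apply: setI_ideal; auto] : core.

Ltac id0 := match goal with |- ?I 0 => refine (@idl0 _ I _) end.
Ltac idD := match goal with |- ?I (_ + _) => refine (@idlD _ I _ _ _ _ _) end.
Ltac idB := match goal with |- ?I (_ - _) => refine (@idlB _ I _ _ _ _ _) end.
Ltac idN := match goal with |- ?I (- _) => refine (@idlN _ I _ _ _) end.
Ltac idM := match goal with |- ?I (_ * _) => refine (@idlM _ I _ _ _ _) end.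
Ltac idMr := match goal with |- ?I (_ * _) => refine (@idlMr _ I _ _ _ _) end.
Ltac idS := match goal with |- ?I _ => refine (@idl_sum _ I _ _ _ _); cbv beta end.
Ltac idSP := match goal with |- ?I _ => refine (@idl_sumP _ I _ _ _ _ _); cbv beta end.

Section IdealPowers.
Variable R : comPzRingType.
Implicit Types (I J K L N P Q : set R) (a b u v y : R).

Lemma idealM_ideal I J : is_ideal (idealM I J). Proof. exact: gen_ideal_ideal. Qed.
Hint Resolve idealM_ideal : core.

Lemma idealM_in I J u v : I u -> J v -> idealM I J (u * v).
Proof. by move=> Iu Jv; apply: gen_sub; exists u => //; exists v. Qed.

Lemma idealM_min I J K : is_ideal K -> (forall u v, I u -> J v -> K (u * v)) ->
  idealM I J `<=` K.
Proof. by move=> hK h; apply: gen_min => // _ [u Iu [v Jv <-]]; apply: h. Qed.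

Lemma idealMS I J I' J' : I `<=` I' -> J `<=` J' -> idealM I J `<=` idealM I' J'.
Proof.
by move=> II JJ; apply: idealM_min => // u v /II Iu /JJ Jv; apply: idealM_in.
Qed.

Lemma idealM_subl I J : is_ideal I -> idealM I J `<=` I.
Proof. by move=> hI; apply: idealM_min => // u v Iu _; idMr. Qed.

Lemma idealM_subr I J : is_ideal J -> idealM I J `<=` J.
Proof. by move=> hI; apply: idealM_min => // u v _ Iu; idM. Qed.

Lemma idealM_gen I n (x : 'I_n -> R) y : is_ideal I ->
  idealM I (gen_ideal (range x)) y ->
  exists c, (forall i, I (c i)) /\ y = \sum_i c i * x i.
Proof.
move=> hI; pose K := [set y | exists c, (forall i, I (c i)) /\ y = \sum_i c i * x i].
apply: (idealM_min (K := K)).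
  split=> [|u v [c [hc ->]] [c' [hc' ->]]|r u [c [hc ->]]].
  - exists (fun=> 0); split=> [_|]; first by id0.
    by rewrite big1 // => i _; rewrite mul0r.
  - exists (fun i => c i + c' i); split=> [i|]; first by idD.
    by rewrite -big_split; apply: eq_bigr => i _; rewrite mulrDl.
  - exists (fun i => r * c i); split=> [i|]; first by idM.
    by rewrite mulr_sumr; apply: eq_bigr => i _; rewrite mulrA.
move=> u v Iu /gen_rangeP [c ->]; exists (fun i => u * c i); split=> [i|].
  by idMr.
by rewrite mulr_sumr; apply: eq_bigr => i _; rewrite mulrA.
Qed.

Lemma idealX_ideal I n : is_ideal (idealX I n).
Proof. by case: n => [|n]; [exact: setT_ideal|exact: idealM_ideal]. Qed.
Hint Resolve idealX_ideal : core.

Lemma idealXS I n : idealX I n.+1 = idealM I (idealX I n). Proof. by []. Qed.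

Lemma idealX_mulS I n u v : I u -> idealX I n v -> idealX I n.+1 (u * v).
Proof. exact: idealM_in. Qed.

Lemma idealXD I n m : idealX I (n + m) `<=` idealM (idealX I n) (idealX I m).
Proof.
elim: n => [|n IH].
  by rewrite add0n => u hu; rewrite -(mul1r u); apply: idealM_in.
rewrite addSn idealXS; apply: idealM_min => // u v Iu /IH.
apply: (gen_min (I := [set v | idealM (idealX I n.+1) (idealX I m) (u * v)])).
  split=> [|w z hw hz|r w hw] /=; first by rewrite mulr0; id0.
    by rewrite mulrDr; idD.
  by rewrite mulrCA; idM.
move=> _ [w hw [z hz <-]] /=; rewrite mulrA; apply: idealM_in => //.
exact: idealX_mulS.
Qed.

Lemma idealX_mul I n m u v : idealX I n u -> idealX I m v ->
  idealX I (n + m) (u * v).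
Proof.
elim: n u => [|n IH] u hu hv; first by idM.
move: u hu; apply: (gen_min (I := [set u | idealX I (n.+1 + m) (u * v)])).
  split=> [|w z hw hz|r w hw] /=; first by rewrite mul0r; id0.
    by rewrite mulrDl; idD.
  by rewrite -mulrA; idM.
move=> _ [w hw [z hz <-]]; rewrite /= -mulrA; apply: idealX_mulS => //.
exact: IH.
Qed.

Lemma idealX_exp I u n : I u -> idealX I n (u ^+ n).
Proof.
by move=> Iu; elim: n => [|n IH] //; rewrite exprS; apply: idealX_mulS.
Qed.

Lemma idealX_le I m n : (m <= n)%N -> idealX I n `<=` idealX I m.
Proof.
move=> /subnK <-; elim: (n - m)%N => [//|k IH].
by rewrite addSn idealXS; apply: subset_trans IH; apply: idealM_subr.
Qed.

Lemma idealX1 I : is_ideal I -> idealX I 1 = I.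
Proof.
move=> hI; apply/seteqP; split; first exact: idealM_subl.
by move=> u Iu; rewrite -(mulr1 u); apply: idealX_mulS.
Qed.

Lemma idealX_sub I n : is_ideal I -> (0 < n)%N -> idealX I n `<=` I.
Proof. by move=> hI n0; rewrite -{2}(idealX1 hI); apply: idealX_le. Qed.

Lemma idealX_prod I n (f : 'I_n -> R) : (forall i, I (f i)) ->
  idealX I n (\prod_i f i).
Proof.
elim: n f => [|n IH] f hf; first by [].
by rewrite big_ord_recl; apply: idealX_mulS => //; apply: IH.
Qed.

Definition jac I := forall r, I r -> exists s, s * (1 - r) = 1.

Lemma jac_cancel I L c y : is_ideal L -> jac I -> I c -> L ((1 - c) * y) -> L y.
Proof.
move=> hL jI /jI [s hs] hy; have -> : y = s * ((1 - c) * y) by rewrite mulrA hs mul1r.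
by idM.
Qed.

(** Nakayama's lemma in coordinates, without determinants: [1 - c m m] is a unit for the last index
    [m], so the last unknown can be eliminated, and the smaller system again has coefficients in
    [I]. *)
Lemma nak_sys I L n (x : 'I_n -> R) (c : 'I_n -> 'I_n -> R) :
  is_ideal I -> jac I -> is_ideal L -> (forall i j, I (c i j)) ->
  (forall i, L (x i - \sum_j c i j * x j)) -> forall i, L (x i).
Proof.
move=> hI jI hL; elim: n x c => [|n IH] x c hc hx; first by case.
have [s hs] := jI _ (hc ord_max ord_max).
pose w := widen_ord (leqnSn n).
pose d j := s * c ord_max (w j).
have xm : L (x ord_max - \sum_j d j * x (w j)).
  have := hx ord_max; rewrite big_ord_recr /= => h.
  have -> : x ord_max - \sum_j d j * x (w j) = s * (x ord_max -
      (\sum_(i < n) c ord_max (w i) * x (w i) + c ord_max ord_max * x ord_max)).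
    have -> : \sum_j d j * x (w j) = s * \sum_(i < n) c ord_max (w i) * x (w i).
      by rewrite mulr_sumr; apply: eq_bigr => i _; rewrite /d mulrA.
    rewrite -[in LHS](mul1r (x ord_max)) -hs; ring.
  by idM.
have hw : forall j, L (x (w j)).
  apply: (IH (fun j => x (w j)) (fun i j => c (w i) (w j) + c (w i) ord_max * d j)).
    by move=> i j; idD => //; idMr.
  move=> i; have := hx (w i); rewrite big_ord_recr /= => h.
  have -> : x (w i) - \sum_j (c (w i) (w j) + c (w i) ord_max * d j) * x (w j) =
     (x (w i) - (\sum_(i0 < n) c (w i) (w i0) * x (w i0) + c (w i) ord_max * x ord_max))
     + c (w i) ord_max * (x ord_max - \sum_j d j * x (w j)).
    have -> : \sum_j (c (w i) (w j) + c (w i) ord_max * d j) * x (w j) =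
      \sum_j c (w i) (w j) * x (w j) + c (w i) ord_max * \sum_j d j * x (w j).
      by rewrite mulr_sumr -big_split /=; apply: eq_bigr => j _; ring.
    ring.
  by idD => //; idM.
move=> i; have [j ->|->] := unliftP ord_max i; last first.
  apply: (@idlDr _ L _ (- \sum_j d j * x (w j)) hL) => //.
  by idN => //; idS => // j; idM.
suff -> : lift ord_max j = w j by [].
by apply: val_inj; rewrite /= /bump leqNgt ltn_ord.
Qed.

Section Noeth.
Hypothesis nR : noetherian R.

Lemma nak_ideal I L N : is_ideal I -> jac I -> is_ideal L -> is_ideal N ->
  N `<=` addI L (idealM I N) -> N `<=` L.
Proof.
move=> hI jI hL hN hNL; have [n [x eN]] := noetherian_fg nR hN.
have /choice [c hc] : forall i, exists c : 'I_n -> R,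
    (forall j, I (c j)) /\ L (x i - \sum_j c j * x j).
  move=> i; have : N (x i) by rewrite eN; apply: gen_sub; exists i.
  move=> /hNL [u [v [Lu]]]; rewrite {1}eN => /idealM_gen => /(_ hI) [c [hc ->]] ->.
  by exists c; split=> //; rewrite addrK.
rewrite eN; apply: gen_min => // _ [i _ <-].
by apply: (@nak_sys I L n x c) => // [j k|j]; case: (hc j).
Qed.

Lemma idealX_of_rad I J : is_ideal I -> is_ideal J ->
  (forall x, I x -> exists s, J (x ^+ s)) -> exists n, idealX I n `<=` J.
Proof.
move=> hI hJ hx; apply: contrapT => nJ.
have [|P [hP [JP nP] mP]] := noetherian_max nR
    (Phi := fun P => J `<=` P /\ ~ exists n, idealX I n `<=` P).
  by exists J; split=> //; split.
suff pP : prime_ideal P.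
  apply: nP; exists 1%N; rewrite idealX1 // => x Ix.
  by have [s Js] := hx _ Ix; apply: (@prime_X _ P x s) => //; apply: JP.
split=> // [P1|u v Puv]; first by apply: nP; exists 0%N => w _; apply idl1.
apply: contrapT => /not_orP [Pu Pv].
have h w : ~ P w -> exists n, idealX I n `<=` addI P (prI w).
  move=> Pw; apply: contrapT => nw; apply: Pw.
  have <- : addI P (prI w) = P.
    apply: mP => //; [|exact: addI_l].
    by split=> // y /JP Py; apply: addI_l.
  by apply: addI_r => //; apply: prI_self.
have [n hn] := h _ Pu; have [m hm] := h _ Pv.
apply: nP; exists (n + m)%N => w /idealXD; apply: idealM_min => // y z.
move=> /hn /addI_prP [r hr] /hm /addI_prP [t ht].
have -> : y * z = (y - r * u) * z + (r * u) * (z - t * v) + r * t * (u * v) by ring.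
by idD => //; [idD => //; [idMr|idM]|idM].
Qed.

(** Maximality replaces Rees algebras: let [J] be maximal among the ideals over [K] that meet [N']
    only inside [K]. Once the colon ideals of [J] by the powers of some [a] in [I] are stable, a
    power of [a] can be added to [J] without violating this; so [J] contains a power of [I]. *)
Lemma weak_artin_rees I L N k : is_ideal I -> is_ideal L -> is_ideal N ->
  exists n, forall u, addI L (idealX I n) u -> N u ->
    addI L (idealM (idealX I k) N) u.
Proof.
move=> hI hL hN; set K := addI L (idealM (idealX I k) N).
have hK : is_ideal K by apply: addI_ideal.
pose N' := addI N L.
have KN' : K `<=` N'.
  apply: addI_min => //; [exact: addI_ideal|exact: addI_r|].
  by apply: subset_trans (addI_l _) => //; apply: idealM_subr.
have akK a y : I a -> N' y -> K (a ^+ k * y).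
  move=> Ia [u [v [Nu Lv ->]]]; rewrite mulrDr; idD => //.
    by apply: addI_r => //; apply: idealM_in => //; apply: idealX_exp.
  by apply: addI_l => //; idM.
have [|J [hJ [KJ JN] mJ]] := noetherian_max nR
    (Phi := fun J => K `<=` J /\ forall u, J u -> N' u -> K u).
  by exists K; split=> //; split.
have [n hn] : exists n, idealX I n `<=` J.
  apply: idealX_of_rad => // a Ia.
  have [s hs] := noetherian_acc nR (F := fun j => [set r | J (r * a ^+ j)])
    (fun j => ltac:(split=> [|u v hu hv|r u hu] /=;
       [by rewrite mul0r; id0|by rewrite mulrDl; idD
       |by rewrite -mulrA; idM]))
    (fun j => ltac:(by move=> r /= hr; rewrite exprS mulrCA; idM)).
  exists s; suff e : addI J (prI (a ^+ s)) = J.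
    by rewrite -e; apply: addI_r => //; apply: prI_self.
  apply: mJ; [exact: addI_ideal| |exact: addI_l].
  split=> [y /KJ Jy|y /addI_prP [r hr] N'y]; first exact: addI_l.
  have Jr : J (r * a ^+ (s + k)).
    have -> : r * a ^+ (s + k) = a ^+ k * y - a ^+ k * (y - r * a ^+ s).
      by rewrite exprD; ring.
    by idB => //; [apply: KJ; apply: akK|idM].
  have : [set r | J (r * a ^+ (s + k))] r by [].
  rewrite (hs _ (leq_addr _ _)) /= => Jr'.
  by apply: JN => //; rewrite -(subrK (r * a ^+ s) y); idD.
exists n => u hu Nu; apply: JN; last exact: addI_l.
apply: (addI_min (I := L) (J := idealX I n)) hu => //.
by apply: subset_trans KJ; apply: addI_l.
Qed.

(** Artin-Rees for the ideal of [y] puts [y] in [L + I y], that is, [(1 - c) * y] in [L] for some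
    [c] in [I], where [1 - c] is a unit. *)
Lemma krull_intersection I L y : is_ideal I -> jac I -> is_ideal L ->
  (forall n, addI L (idealX I n) y) -> L y.
Proof.
move=> hI jI hL hy.
have [n hn] := weak_artin_rees 1 hI hL (prI_ideal y).
have [u [v [Lu hv e]]] := hn _ (hy n) (prI_self y).
have [c Ic ec] : exists2 c, I c & v = c * y.
  move: hv; rewrite idealX1 //.
  apply: (idealM_min (K := [set v | exists2 c, I c & v = c * y])).
    split=> [|_ _ [c Ic ->] [d Id ->]|r _ [c Ic ->]].
    - by exists 0; rewrite ?mul0r //; id0.
    - by exists (c + d); rewrite ?mulrDl //; idD.
    - by exists (r * c); rewrite ?mulrA //; idM.
  by move=> c _ Ic [r ->]; exists (c * r); rewrite ?mulrA //; idMr.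
apply: (jac_cancel hL jI Ic); rewrite mulrBl mul1r {1}e ec addrK.
exact: Lu.
Qed.

Lemma radical_ideal I : is_ideal I -> is_ideal (ideal_radical I).
Proof.
move=> hI; have e : ideal_radical I =
    \bigcap_(Q in [set Q | prime_ideal Q /\ I `<=` Q]) Q.
  apply/seteqP; split=> [y [n Iy] Q [pQ IQ]|y hy].
    by apply: (@prime_X _ Q y n) => //; apply: IQ.
  by apply: radical_primes => // Q pQ IQ; apply: hy.
by rewrite e; apply: bigcap_ideal => Q [/prime_is_ideal].
Qed.

Lemma radical_primary Q : primary_ideal Q -> prime_ideal (ideal_radical Q).
Proof.
move=> [hQ Q1 hq]; split; first exact: radical_ideal.
  by move=> [n]; rewrite expr1n.
move=> u v [n]; rewrite exprMn => /hq [Qu|[m Qv]]; first by left; exists n.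
by right; exists (n * m)%N; rewrite exprM.
Qed.

(** If [I] contains [u * v] but neither [u] nor a power of [v], it is the intersection of [I + (u)]
    and [I + (v ^+ s)], where the colon ideals of [I] by powers of [v] are stable from [s] on;
    Noetherian induction decomposes both. *)
Lemma primary_decomposition I : is_ideal I -> exists s : seq (set R),
  (forall q, q \in s -> primary_ideal q) /\
  forall y, I y <-> forall q, q \in s -> q y.
Proof.
move: I; apply: noetherian_ind => // I hI IH.
have [I1|I1] := pselect (I 1).
  by exists [::]; split=> // y; split=> // _; apply idl1.
have [pI|npI] := pselect (primary_ideal I).
  exists [:: I]; split=> [q|y]; first by rewrite inE => /eqP ->.
  by split=> [Iy q|h]; [rewrite inE => /eqP ->|apply: h; rewrite inE].
have [u [v [Iuv Iu Iv]]] : exists u v, [/\ I (u * v), ~ I u & ~ ideal_radical I v].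
  apply: contrapT => n; apply: npI; split=> // u v Iuv.
  by apply: contrapT => /not_orP [Iu Iv]; apply: n; exists u, v.
have [s hs] := noetherian_acc nR (F := fun j => [set r | I (r * v ^+ j)])
  (fun j => ltac:(split=> [|x z hu hv|r x hu] /=;
     [by rewrite mul0r; id0|by rewrite mulrDl; idD
     |by rewrite -mulrA; idM]))
  (fun j => ltac:(by move=> r /= hr; rewrite exprS mulrCA; idM)).
have h w : ~ I w -> exists s : seq (set R),
    (forall q, q \in s -> primary_ideal q) /\ forall y, addI I (prI w) y <-> forall q, q \in s -> q y.
  move=> Iw; apply: IH; [exact: addI_ideal|exact: addI_l|].
  by move=> e; apply: Iw; rewrite -e; apply: addI_r => //; apply: prI_self.
have [s1 [p1 h1]] := h _ Iu.
have [|s2 [p2 h2]] := h (v ^+ s); first by move=> Ivs; apply: Iv; exists s.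
exists (s1 ++ s2); split=> [q|y].
  by rewrite mem_cat => /orP[/p1|/p2].
split=> [Iy q|hy].
  rewrite mem_cat => /orP[|]; [apply: (proj1 (h1 y))|apply: (proj1 (h2 y))];
  exact: addI_l.
have /addI_prP [r hr] : addI I (prI u) y.
  by apply/h1 => q qs; apply: hy; rewrite mem_cat qs.
have /addI_prP [t ht] : addI I (prI (v ^+ s)) y.
  by apply/h2 => q qs; apply: hy; rewrite mem_cat qs orbT.
have It : I (t * v ^+ s.+1).
  have -> : t * v ^+ s.+1 = (y - r * u) * v + r * (u * v) - (y - t * v ^+ s) * v.
    by rewrite exprS; ring.
  by idB => //; [idD => //; [idMr|idM]|idMr].
have : [set r | I (r * v ^+ s.+1)] t by [].
rewrite (hs _ (leqnSn _)) /= => It'.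
by rewrite -(subrK (t * v ^+ s) y); idD.
Qed.
End Noeth.
End IdealPowers.

(** * Flatness of the Frobenius *)

#[export] Hint Resolve idealM_ideal idealX_ideal : core.

Section FrobeniusPowers.
Variables (p : nat) (R : comPzRingType).
Hypotheses (pp : prime p) (pR : p%:R = 0 :> R).
Implicit Types (I J b : set R).

Lemma frob1D (x y : R) : (x + y) ^+ p = x ^+ p + y ^+ p.
Proof.
case: p pp pR => [//|k pk kR].
rewrite exprDn big_ord_recl big_ord_recr /= subn0 subnn bin0 binn !expr0 mulr1 mul1r.
rewrite !mulr1n big1 ?add0r // => i _.
have /dvdnP [c ->] : (k.+1 %| 'C(k.+1, bump 0 i))%N.
  by apply: prime_dvd_bin => //; rewrite /bump /= add1n ltnS ltn_ord.
by rewrite mulrnA -mulr_natr kR mulr0.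
Qed.

Lemma frobD n (x y : R) : (x + y) ^+ (p ^ n) = x ^+ (p ^ n) + y ^+ (p ^ n).
Proof.
elim: n => [|n IH]; first by rewrite expn0 !expr1.
by rewrite expnS mulnC !exprM IH frob1D.
Qed.

Lemma expp_gt0 n : (0 < p ^ n)%N. Proof. by rewrite expn_gt0 prime_gt0. Qed.

Lemma frob0 n : 0 ^+ (p ^ n) = 0 :> R.
Proof. by rewrite expr0n -leqn0 leqNgt expp_gt0. Qed.

Lemma frobN n (x : R) : (- x) ^+ (p ^ n) = - (x ^+ (p ^ n)).
Proof. by apply/eqP; rewrite -addr_eq0 -frobD addNr frob0. Qed.

Lemma frobB n (x y : R) : (x - y) ^+ (p ^ n) = x ^+ (p ^ n) - y ^+ (p ^ n).
Proof. by rewrite frobD frobN. Qed.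

Lemma frob_sum n T (r : seq T) (P : pred T) (F : T -> R) :
  (\sum_(i <- r | P i) F i) ^+ (p ^ n) = \sum_(i <- r | P i) F i ^+ (p ^ n).
Proof. by apply: (big_morph (fun x => x ^+ (p ^ n))) => [x y|]; rewrite ?frobD ?frob0. Qed.

Lemma frob_power_ideal b n : is_ideal (frob_power p b n).
Proof. exact: gen_ideal_ideal. Qed.

Lemma frob_power_in b n r : b r -> frob_power p b n (r ^+ (p ^ n)).
Proof. by move=> br; apply: gen_sub; exists r. Qed.

Lemma frob_power_min b n I : is_ideal I -> (forall r, b r -> I (r ^+ (p ^ n))) ->
  frob_power p b n `<=` I.
Proof. by move=> hI h; apply: gen_min => // _ [r br <-]; apply: h. Qed.

Lemma frob_power_gen (E : set R) n :
  frob_power p (gen_ideal E) n = gen_ideal [set r ^+ (p ^ n) | r in E].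
Proof.
apply/seteqP; split; last first.
  by apply: gen_idealS => _ [r Er <-]; exists r => //; apply: gen_sub.
apply: frob_power_min => // r /gen_idealP [k [c [e [he ->]]]].
rewrite frob_sum; idS => // i; rewrite exprMn; idM => //.
by apply: gen_sub; exists (e i).
Qed.

Lemma frob_power0 b : is_ideal b -> frob_power p b 0 = b.
Proof.
move=> hb; rewrite -[RHS](gen_id hb); congr gen_ideal; apply/seteqP; split.
  by move=> _ [r br <-]; rewrite expn0 expr1.
by move=> r br; exists r; rewrite // expn0 expr1.
Qed.

Lemma frob_powerD b n k : frob_power p (frob_power p b n) k = frob_power p b (n + k).
Proof.
rewrite /frob_power -/(frob_power p _ _) frob_power_gen; congr gen_ideal.
apply/seteqP; split=> [_ [_ [r br <-] <-]|_ [r br <-]].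
  by exists r; rewrite // expnD exprM.
by exists (r ^+ (p ^ n)); [exists r|rewrite expnD exprM].
Qed.

Lemma frob_powerS b c n : b `<=` c -> frob_power p b n `<=` frob_power p c n.
Proof. by move=> bc; apply: gen_idealS => _ [r /bc cr <-]; exists r. Qed.

Lemma frob_power_sub b n : is_ideal b -> frob_power p b n `<=` b.
Proof.
move=> hb; apply: frob_power_min => // r br.
by rewrite -(prednK (expp_gt0 n)); apply: idlX.
Qed.
End FrobeniusPowers.

Section FrobSpan.
Variable R : comPzRingType.

(** The span of the coordinatewise [q]-th powers of the vectors in [H]. For [H] the solutions of
    linear equations, flatness of Frobenius says that it contains all solutions of the equations
    with coefficients raised to the [q]-th power. *)
Definition frspan (T : finType) (q : nat) (H : (T -> R) -> Prop) (v : T -> R) :=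
  exists (K : finType) (w : K -> R) (h : K -> T -> R),
    (forall k, H (h k)) /\ forall j, v j = \sum_k w k * h k j ^+ q.

Variables (T : finType) (q : nat).
Implicit Types (H : (T -> R) -> Prop) (v : T -> R).

Lemma frspan0 H : frspan q H (fun=> 0).
Proof.
exists void, (fun=> 0), (fun=> fun=> 0); split=> [[]//|j].
by rewrite big1 // => -[].
Qed.

Lemma frspanD H v v' : frspan q H v -> frspan q H v' ->
  frspan q H (fun j => v j + v' j).
Proof.
move=> [K [w [h [hH e]]]] [K' [w' [h' [hH' e']]]].
exists (K + K')%type, (fun k => match k with inl k => w k | inr k => w' k end),
  (fun k => match k with inl k => h k | inr k => h' k end).
by split=> [[]//|j]; rewrite big_sumType /= e e'.
Qed.

Lemma frspanZ H v c : frspan q H v -> frspan q H (fun j => c * v j).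
Proof.
move=> [K [w [h [hH e]]]]; exists K, (fun k => c * w k), h; split=> // j.
by rewrite e mulr_sumr; apply: eq_bigr => k _; rewrite mulrA.
Qed.

Lemma frspan_in H h c : H h -> frspan q H (fun j => c * h j ^+ q).
Proof.
move=> Hh; exists unit, (fun=> c), (fun=> h); split=> // j.
by rewrite (big_pred1 tt) // => -[].
Qed.

Lemma frspan_sum H (K : finType) (F : K -> T -> R) :
  (forall k, frspan q H (F k)) -> frspan q H (fun j => \sum_k F k j).
Proof.
move=> hF; suff h (r : seq K) : frspan q H (fun j => \sum_(k <- r) F k j) by apply: h.
elim: r => [|k r IH].
  have -> : (fun j => \sum_(k <- [::]) F k j) = (fun=> 0).
    by apply/funext => j; rewrite big_nil.
  exact: frspan0.
have -> : (fun j => \sum_(k <- k :: r) F k j) =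
    (fun j => F k j + \sum_(k <- r) F k j).
  by apply/funext => j; rewrite big_cons.
exact: frspanD.
Qed.

Lemma frspan_ind H (Psi : (T -> R) -> Prop) : Psi (fun=> 0) ->
  (forall v v', Psi v -> Psi v' -> Psi (fun j => v j + v' j)) ->
  (forall c h, H h -> Psi (fun j => c * h j ^+ q)) ->
  forall v, frspan q H v -> Psi v.
Proof.
move=> P0 PD Ph v [K [w [h [hH e]]]].
suff hs (r : seq K) : Psi (fun j => \sum_(k <- r) w k * h k j ^+ q).
  have -> : v = (fun j => \sum_k w k * h k j ^+ q) by apply/funext.
  exact: hs.
elim: r => [|k r IH].
  have -> // : (fun j => \sum_(k <- [::]) w k * h k j ^+ q) = (fun=> 0).
  by apply/funext => j; rewrite big_nil.
have -> : (fun j => \sum_(k <- k :: r) w k * h k j ^+ q) =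
    (fun j => w k * h k j ^+ q + \sum_(k <- r) w k * h k j ^+ q).
  by apply/funext => j; rewrite big_cons.
by apply: PD => //; apply: Ph.
Qed.

Lemma frspan_sub H H' v : (forall h, H h -> H' h) -> frspan q H v -> frspan q H' v.
Proof. by move=> HH [K [w [h [hH e]]]]; exists K, w, h; split=> // k; apply: HH. Qed.
End FrobSpan.

(* The equational criterion for the flatness of the Frobenius of [R / J]. *)
Definition frob_flat (R : comPzRingType) (J : set R) (q : nat) :=
  forall (T : finType) (f v : T -> R), J (\sum_j f j ^+ q * v j) ->
  exists2 v0, frspan q (fun h => J (\sum_j f j * h j)) v0 &
    forall j, J (v j - v0 j).

(** * Lifting the flatness of Frobenius along a nonzero-divisor *)

Section Kunz.
Variables (p : nat) (R : comPzRingType).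
Hypotheses (pp : prime p) (pR : p%:R = 0 :> R) (nR : noetherian R).
Variables (J : set R) (y : R).
Hypotheses (hJ : is_ideal J) (jy : jac (prI y)).
Hypothesis (nzd : forall u, J (y * u) -> J u).
Hypothesis ff : frob_flat (addI J (prI y)) p.

Let A N := addI J (prI (y ^+ N)).
Let hA N : is_ideal (A N). Proof. by apply: addI_ideal. Qed.
Local Hint Resolve hA : core.

Let A_le m n : (m <= n)%N -> A n `<=` A m.
Proof.
move=> mn; apply: addI_min => //; first exact: addI_l.
apply: prI_sub => //; rewrite -(subnK mn) exprD; idM => //.
by apply: addI_r => //; apply: prI_self.
Qed.

Let A_cancel N k u : A (N + k) (y ^+ N * u) -> A k u.
Proof.
move=> /addI_prP [r hr]; apply/addI_prP; exists r.
elim: N hr => [|N IH]; first by rewrite expr0 mul1r.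
rewrite addSn !exprS => h; apply: IH; apply: nzd.
by have -> : y * (y ^+ N * u - r * y ^+ (N + k)) =
   y * y ^+ N * u - r * (y * y ^+ (N + k)) by ring.
Qed.

Let Ay N u : A N (u * y ^+ N).
Proof. by apply: addI_r => //; exists u. Qed.

Let A_mul N k u : A N u -> A (N + k) (y ^+ k * u).
Proof.
move=> /addI_prP [r hr]; apply/addI_prP; exists r.
have -> : y ^+ k * u - r * y ^+ (N + k) = y ^+ k * (u - r * y ^+ N) by rewrite exprD; ring.
by idM.
Qed.

Let A_pow u : A 1 u -> A p (u ^+ p).
Proof.
move=> /addI_prP [r hr]; rewrite -(subrK (r * y ^+ 1) u) (frob1D pp pR).
idD => //; last by rewrite expr1 exprMn; apply: Ay.
by apply: addI_l => //; rewrite -(prednK (prime_gt0 pp)); apply: idlX.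
Qed.

Let A0 u : A 0 u.
Proof. by rewrite -(mulr1 u) -(expr0 y); apply: Ay. Qed.

(** Precision grows one power of [y] at a time up to [y ^+ p]: the [p]-th power of an element of
    [J + (y)] lies in [J + (y ^+ p)], so the approximation [v0] solves the equation modulo
    [y ^+ i.+1] as well, and the error divided by [y ^+ i] solves it modulo [y]. *)
Let lift1 (T : finType) (f v : T -> R) i : (i <= p)%N ->
  A i (\sum_j f j ^+ p * v j) ->
  exists2 v0, frspan p (fun h => A 1 (\sum_j f j * h j)) v0 &
    forall j, A i (v j - v0 j).
Proof.
elim: i => [|i IH] ip hi.
  by exists (fun=> 0) => [|j]; [exact: frspan0|exact: A0].
have [v0 hv0 e0] := IH (ltnW ip) (A_le (leqnSn i) hi).
have /choice [v' hv'] : forall j, exists r, J (v j - v0 j - r * y ^+ i).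
  by move=> j; apply/addI_prP; apply: e0.
have A0i : A i.+1 (\sum_j f j ^+ p * v0 j).
  apply: (A_le ip); move: v0 hv0 {e0 hv'}; apply: frspan_ind => [|v1 v2 h1 h2|c h hh].
  - by rewrite big1 // => [|j _]; [id0|rewrite mulr0].
  - have -> : \sum_j f j ^+ p * (v1 j + v2 j) =
      \sum_j f j ^+ p * v1 j + \sum_j f j ^+ p * v2 j.
      by rewrite -big_split /=; apply: eq_bigr => j _; rewrite mulrDr.
    by idD.
  - have -> : \sum_j f j ^+ p * (c * h j ^+ p) = c * (\sum_j f j * h j) ^+ p.
      have := frob_sum pp pR 1 (index_enum T) xpredT (fun j => f j * h j).
      rewrite expn1 => ->; rewrite mulr_sumr; apply: eq_bigr => j _.
      by rewrite exprMn; ring.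
    by idM => //; apply: A_pow.
have h1 : A 1 (\sum_j f j ^+ p * v' j).
  apply: (A_cancel (N := i)); rewrite addn1.
  have -> : y ^+ i * (\sum_j f j ^+ p * v' j) = \sum_j f j ^+ p * v j -
     \sum_j f j ^+ p * v0 j - \sum_j f j ^+ p * (v j - v0 j - v' j * y ^+ i).
    rewrite mulr_sumr -!sumrB; apply: eq_bigr => j _; ring.
  idB => //; first by idB.
  apply: addI_l => //; idSP => // j _; idM => //.
have [|v1 hv1 e1] := ff (v := v') (f := f).
  by move: h1; rewrite /A expr1.
exists (fun j => v0 j + y ^+ i * v1 j) => [|j].
  apply: frspanD => //; apply: frspanZ.
  by apply: frspan_sub hv1 => h; rewrite /A expr1.
have -> : v j - (v0 j + y ^+ i * v1 j) =
  (v j - v0 j - v' j * y ^+ i) + y ^+ i * (v' j - v1 j) by ring.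
idD => //; first by apply: addI_l.
rewrite -add1n; apply: A_mul; rewrite /A expr1; exact: e1.
Qed.

(** After [lift1], write [v = v0 + y ^+ p * v'] modulo [J] and let [s k * y] be the value of the
    equation at [h k]. Then [w] and [v'] together solve an enlarged equation with coefficients [s]
    and [f], at a precision lower by [y ^+ p], to which the induction applies. *)
Let liftN N : forall (T : finType) (f v : T -> R),
  A (N * p) (\sum_j f j ^+ p * v j) ->
  exists2 v0, frspan p (fun h => A N (\sum_j f j * h j)) v0 &
    forall j, A (N * p) (v j - v0 j).
Proof.
elim: N => [|N IH] T f v hN.
  by exists (fun=> 0) => [|j]; [exact: frspan0|exact: A0].
have [|v0 [K [w [h [hh e0]]]] ev] := lift1 (leqnn p) (f := f) (v := v).
  by apply: A_le hN; rewrite mulSn leq_addr.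
have /choice [v' hv'] : forall j, exists r, J (v j - v0 j - r * y ^+ p).
  by move=> j; apply/addI_prP; apply: ev.
have /choice [s hs] : forall k, exists r, J (\sum_j f j * h k j - r * y ^+ 1).
  by move=> k; apply/addI_prP; apply: hh.
pose f2 (x : K + T) := match x with inl k => s k | inr j => f j end.
pose v2 (x : K + T) := match x with inl k => w k | inr j => v' j end.
have [|v3 hv3 e3] := IH _ f2 v2.
  apply: (A_cancel (N := p)); rewrite -mulSn big_sumType /=.
  have -> : y ^+ p * (\sum_k s k ^+ p * w k + \sum_j f j ^+ p * v' j) =
    \sum_j f j ^+ p * v j - \sum_j f j ^+ p * (v j - v0 j - v' j * y ^+ p) -
    \sum_k w k * (\sum_j f j * h k j - s k * y ^+ 1) ^+ p.
    have -> : \sum_k w k * (\sum_j f j * h k j - s k * y ^+ 1) ^+ p =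
        \sum_j f j ^+ p * v0 j - y ^+ p * (\sum_k s k ^+ p * w k).
      have -> : \sum_j f j ^+ p * v0 j = \sum_k w k * (\sum_j f j * h k j) ^+ p.
        under eq_bigr do rewrite e0 mulr_sumr.
        rewrite exchange_big; apply: eq_bigr => k _.
        have := frob_sum pp pR 1 (index_enum T) xpredT (fun j => f j * h k j).
        rewrite expn1 => ->; rewrite mulr_sumr; apply: eq_bigr => j _.
        by rewrite exprMn; ring.
      rewrite mulr_sumr -sumrB; apply: eq_bigr => k _.
      have := frobB pp pR 1 (\sum_j f j * h k j) (s k * y ^+ 1).
      by rewrite !expn1 => ->; rewrite expr1 exprMn; ring.
    have -> : \sum_j f j ^+ p * (v j - v0 j - v' j * y ^+ p) = \sum_j f j ^+ p * v j
      - \sum_j f j ^+ p * v0 j - y ^+ p * (\sum_j f j ^+ p * v' j).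
      by rewrite mulr_sumr -!sumrB; apply: eq_bigr => j _; ring.
    ring.
  idB => //; first idB => //.
    by apply: addI_l => //; idSP => // j _; idM.
  idSP => // k _; idM => //; apply: addI_l => //.
  by rewrite -(prednK (prime_gt0 pp)); apply: idlX.
have /choice [r hr] : forall k, exists r, J (w k - v3 (inl k) - r * y ^+ (N * p)).
  by move=> k; apply/addI_prP; apply: (e3 (inl k)).
(* The last sum corrects [w - v3], which is divisible by [y ^+ (N * p)] modulo [J]; the vectors
   [y ^+ N * h k] in it are solutions modulo [y ^+ N.+1]. *)
exists (fun j => (\sum_k v3 (inl k) * h k j ^+ p + y ^+ p * v3 (inr j)) +
   \sum_k r k * (y ^+ N * h k j) ^+ p) => [|j]; last first.
  have -> : v j - ((\sum_k v3 (inl k) * h k j ^+ p + y ^+ p * v3 (inr j)) +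
     \sum_k r k * (y ^+ N * h k j) ^+ p) =
     (v j - v0 j - v' j * y ^+ p) + y ^+ p * (v2 (inr j) - v3 (inr j)) +
     \sum_k (w k - v3 (inl k) - r k * y ^+ (N * p)) * h k j ^+ p.
    rewrite e0 /v2.
    have -> : \sum_k (w k - v3 (inl k) - r k * y ^+ (N * p)) * h k j ^+ p =
       \sum_k w k * h k j ^+ p - \sum_k v3 (inl k) * h k j ^+ p -
       \sum_k r k * (y ^+ N * h k j) ^+ p.
      rewrite -!sumrB; apply: eq_bigr => k _; rewrite exprMn -exprM; ring.
    ring.
  idD => //; last first.
    by apply: addI_l => //; idSP => // k _; idMr.
  idD => //; first by apply: addI_l.
  by rewrite mulSn addnC; apply: A_mul; apply: e3.
apply: frspanD; last first.
  apply: frspan_sum => k; apply: frspan_in.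
  have -> : \sum_j f j * (y ^+ N * h k j) = y ^+ N * \sum_j f j * h k j.
    by rewrite mulr_sumr; apply: eq_bigr => j _; ring.
  by rewrite -add1n; apply: A_mul.
move: v3 hv3 {e3 r hr}; apply: frspan_ind => [|v3 v4 h3 h4|c g hg].
- have -> : (fun j => \sum_k 0 * h k j ^+ p + y ^+ p * 0) = (fun=> 0).
    by apply/funext => j; rewrite mulr0 addr0 big1 // => k _; rewrite mul0r.
  exact: frspan0.
- have -> : (fun j => \sum_k (v3 (inl k) + v4 (inl k)) * h k j ^+ p +
      y ^+ p * (v3 (inr j) + v4 (inr j))) =
    (fun j => (\sum_k v3 (inl k) * h k j ^+ p + y ^+ p * v3 (inr j)) +
      (\sum_k v4 (inl k) * h k j ^+ p + y ^+ p * v4 (inr j))).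
    apply/funext => j.
    have -> : \sum_k (v3 (inl k) + v4 (inl k)) * h k j ^+ p =
      \sum_k v3 (inl k) * h k j ^+ p + \sum_k v4 (inl k) * h k j ^+ p.
      by rewrite -big_split /=; apply: eq_bigr => k _; ring.
    ring.
  exact: frspanD.
pose g2 j := \sum_k g (inl k) * h k j + y * g (inr j).
have -> : (fun j => \sum_k c * g (inl k) ^+ p * h k j ^+ p +
    y ^+ p * (c * g (inr j) ^+ p)) = (fun j => c * g2 j ^+ p).
  apply/funext => j; rewrite /g2 (frob1D pp pR).
  have := frob_sum pp pR 1 (index_enum K) xpredT (fun k => g (inl k) * h k j).
  rewrite expn1 => ->; rewrite mulrDr mulr_sumr exprMn; congr (_ + _); last by ring.
  by apply: eq_bigr => k _; rewrite exprMn; ring.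
apply: frspan_in; rewrite /g2.
have -> : \sum_j f j * (\sum_k g (inl k) * h k j + y * g (inr j)) =
  y * (\sum_x f2 x * g x) +
  \sum_k g (inl k) * (\sum_j f j * h k j - s k * y ^+ 1).
  rewrite big_sumType /= mulrDr.
  have -> : \sum_k g (inl k) * (\sum_j f j * h k j - s k * y ^+ 1) =
    \sum_k g (inl k) * (\sum_j f j * h k j) - y * \sum_k s k * g (inl k).
    by rewrite mulr_sumr -sumrB; apply: eq_bigr => k _; rewrite expr1; ring.
  have -> : \sum_j f j * (\sum_k g (inl k) * h k j + y * g (inr j)) =
     \sum_k g (inl k) * (\sum_j f j * h k j) + y * \sum_j f j * g (inr j).
    have -> : \sum_k g (inl k) * (\sum_j f j * h k j) =
        \sum_j f j * (\sum_k g (inl k) * h k j).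
      under eq_bigr do rewrite mulr_sumr.
      rewrite exchange_big; apply: eq_bigr => j _; rewrite mulr_sumr.
      by apply: eq_bigr => k _; ring.
    by rewrite mulr_sumr -big_split /=; apply: eq_bigr => j _ /=; ring.
  ring.
idD => //; first by rewrite -(expr1 y) -addn1; apply: A_mul.
by apply: addI_l => //; idSP => // k _; idM.
Qed.

(** Up to [J], the values at [j0] of combinations of true solutions form the ideal [D]. By
    Artin-Rees, a solution modulo a high power of [y] differs from a true one by a multiple of
    [y ^+ n]; so [v j0] lies in [D + (y ^+ n)] for all [n], and Krull's intersection theorem
    applies. *)
Let coord (T : finType) (f v : T -> R) j0 : J (\sum_j f j ^+ p * v j) ->
  exists2 v0, frspan p (fun h => J (\sum_j f j * h j)) v0 & J (v j0 - v0 j0).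
Proof.
move=> hv; pose H h := J (\sum_j f j * h j).
pose D := [set u | exists2 v0, frspan p H v0 & J (u - v0 j0)].
have hD : is_ideal D.
  split=> [|u u' [v1 h1 e1] [v2 h2 e2]|r u [v1 h1 e1]].
  - by exists (fun=> 0); [exact: frspan0|rewrite subrr; id0].
  - exists (fun j => v1 j + v2 j); first exact: frspanD.
    have -> : u + u' - (v1 j0 + v2 j0) = (u - v1 j0) + (u' - v2 j0) by ring.
    by idD.
  - exists (fun j => r * v1 j); first exact: frspanZ.
    by rewrite -mulrBr; idM.
have JD : J `<=` D.
  by move=> u Ju; exists (fun=> 0); [exact: frspan0|rewrite subr0].
suff : D (v j0) by [].
apply: (krull_intersection nR (prI_ideal y) jy hD) => n.
pose I := gen_ideal [set f j | j in [set: T]].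
have hI0 : is_ideal I by exact: gen_ideal_ideal.
have [N0 hN0] := weak_artin_rees nR n (prI_ideal y) hJ hI0.
pose N := maxn N0 n.
have [|v0 hv0 e0] := liftN (N := N) (f := f) (v := v); first by apply: addI_l.
have yX k : idealX (prI y) k `<=` prI (y ^+ k).
  elim: k => [|k IH]; first by move=> u _; exists u; rewrite mulr1.
  rewrite idealXS; apply: idealM_min => // _ b [r ->] /IH [t ->].
  by exists (r * t); rewrite exprS; ring.
have Xy k : idealX (prI y) k (y ^+ k) by apply: idealX_exp; apply: prI_self.
have np : (n <= N * p)%N.
  by apply: leq_trans (leq_maxr N0 n) _; rewrite leq_pmulr // prime_gt0.
have DX k : (n <= k)%N -> A k `<=` addI D (idealX (prI y) n).
  move=> nk; apply: addI_min; [exact: addI_ideal|by move=> u /JD; apply: addI_l|].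
  apply: prI_sub => //; apply: addI_r => //.
  by apply: (idealX_le (n := k) nk).
have -> : v j0 = (v j0 - v0 j0) + v0 j0 by ring.
idD => //; first exact: (DX _ np).
move: v0 hv0 {e0}; apply: frspan_ind => [|v1 v2 h1 h2|c h hh].
- by id0.
- by idD.
idM => //.
have hI : I (\sum_j f j * h j).
  by idSP => [//|j _]; idMr => //; apply: gen_sub; exists j.
have AN : addI J (idealX (prI y) N0) (\sum_j f j * h j).
  have : A N0 (\sum_j f j * h j) by apply: (A_le (leq_maxl N0 n)).
  by apply: addI_min => //; [exact: addI_l|];
     apply: prI_sub => //; apply: addI_r.
have [a [b [Ja hb eab]]] := hN0 _ AN hI.
have [h' eb] : exists h', b = y ^+ n * \sum_j f j * h' j.
  move: b hb {eab}; apply: idealM_min.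
    split=> [|_ _ [h1 ->] [h2 ->]|r _ [h1 ->]].
    - by exists (fun=> 0); rewrite big1 ?mulr0 // => j _; rewrite mulr0.
    - exists (fun j => h1 j + h2 j); rewrite -mulrDr; congr (y ^+ n * _).
      by rewrite -big_split /=; apply: eq_bigr => j _; rewrite mulrDr.
    - exists (fun j => r * h1 j); rewrite mulrCA; congr (y ^+ n * _).
      by rewrite mulr_sumr; apply: eq_bigr => j _; rewrite mulrCA.
  move=> u w /yX [r ->] Iw; have [h1 ->] : exists h1, w = \sum_j f j * h1 j.
    move: w Iw; apply: gen_min.
      split=> [|_ _ [h1 ->] [h2 ->]|r' _ [h1 ->]].
      - by exists (fun=> 0); rewrite big1 // => j _; rewrite mulr0.
      - exists (fun j => h1 j + h2 j); rewrite -big_split.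
        by apply: eq_bigr => j _; rewrite mulrDr.
      - exists (fun j => r' * h1 j); rewrite mulr_sumr.
        by apply: eq_bigr => j _; rewrite mulrCA.
    move=> _ [j _ <-]; exists (fun i => (i == j)%:R).
    by rewrite (bigD1 j) //= eqxx mulr1 big1 ?addr0 // => i /negPf ->; rewrite mulr0.
  exists (fun j => r * h1 j); rewrite -mulrA mulrCA; congr (y ^+ n * _).
  by rewrite mulr_sumr; apply: eq_bigr => j _; ring.
rewrite -(subrK (y ^+ n * h' j0) (h j0)) (frob1D pp pR); idD => //.
  apply: addI_l => //; exists (fun j => 1 * (h j - y ^+ n * h' j) ^+ p).
    apply: frspan_in; rewrite /H.
    have -> : \sum_j f j * (h j - y ^+ n * h' j) = a.
      have -> : a = (a + b) - b by ring.
      rewrite -eab eb mulr_sumr -sumrB; apply: eq_bigr => j _; ring.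
    by [].
  by rewrite mul1r subrr; id0.
rewrite exprMn; idMr => //; rewrite -exprM; apply: (DX (n * p)%N).
  by rewrite leq_pmulr // prime_gt0.
by rewrite -(mul1r (y ^+ _)).
Qed.

(** [coord] controls one coordinate only, because Krull's theorem is applied to an ideal.
    Subtracting the combination it provides kills that coordinate modulo [J]; solutions are set to
    zero outside [X], so the support shrinks and induction on its size concludes. *)
Lemma kunz_step : frob_flat J p.
Proof.
suff main k (T : finType) (f v : T -> R) (X : {set T}) : (#|X| <= k)%N ->
    (forall j, j \notin X -> v j = 0) -> J (\sum_j f j ^+ p * v j) ->
    exists2 v0, frspan p (fun h => J (\sum_j f j * h j)) v0 &
    forall j, J (v j - v0 j).
  move=> T f v hv; refine (main _ T f v [set: T]%SET (leqnn _) _ hv).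
  by move=> j; rewrite inE.
elim: k T f v X => [|k IH] T f v X.
  rewrite leqn0 => /eqP/cards0_eq -> v0 _; exists (fun=> 0) => [|j].
    exact: frspan0.
  by rewrite v0 ?inE // subrr; id0.
move=> cX vX hv; have [X0|[j0 jX]] := set_0Vmem X.
  by apply: (IH _ _ _ X) => //; rewrite X0 cards0.
pose f' j := if j \in X then f j else 0.
have [|v1 [K [w [h [hh e1]]]] ev] := @coord T f' v j0.
  suff -> : \sum_j f' j ^+ p * v j = \sum_j f j ^+ p * v j by [].
  apply: eq_bigr => j _; rewrite /f'; case: ifP => // jX'.
  by rewrite vX ?jX' // !mulr0.
pose h' k j := if j \in X then h k j else 0.
pose v2 j := \sum_k w k * h' k j ^+ p.
have hv2 : frspan p (fun h => J (\sum_j f j * h j)) v2.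
  apply: frspan_sum => i; apply: frspan_in.
  suff -> : \sum_j f j * h' i j = \sum_j f' j * h i j by [].
  by apply: eq_bigr => j _; rewrite /f' /h'; case: ifP; rewrite ?mul0r ?mulr0.
have J2 : J (\sum_j f j ^+ p * v2 j).
  move: v2 hv2; apply: frspan_ind => [|v2 v3 h2 h3|c g hg].
  - by rewrite big1 // => [|j _]; [id0|rewrite mulr0].
  - have -> : \sum_j f j ^+ p * (v2 j + v3 j) =
      \sum_j f j ^+ p * v2 j + \sum_j f j ^+ p * v3 j.
      by rewrite -big_split /=; apply: eq_bigr => j _; rewrite mulrDr.
    by idD.
  - have -> : \sum_j f j ^+ p * (c * g j ^+ p) = c * (\sum_j f j * g j) ^+ p.
      have := frob_sum pp pR 1 (index_enum T) xpredT (fun j => f j * g j).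
      rewrite expn1 => ->; rewrite mulr_sumr; apply: eq_bigr => j _.
      by rewrite exprMn; ring.
    by idM => //; rewrite -(prednK (prime_gt0 pp)); apply: idlX.
pose v3 j := if j == j0 then 0 else v j - v2 j.
have v2X j : j \notin X -> v2 j = 0.
  move=> jX'; rewrite /v2 big1 // => i _.
  by rewrite /h' (negPf jX') expr0n -leqn0 leqNgt prime_gt0 // mulr0.
have v30 : J (v j0 - v2 j0).
  suff -> : v2 j0 = v1 j0 by [].
  by rewrite e1; apply: eq_bigr => i _; rewrite /h' jX.
have [|||v4 hv4 e4] := IH T f v3 (X :\ j0).
- by rewrite -ltnS; apply: leq_trans cX; rewrite (cardsD1 j0 X) jX.
- move=> j; rewrite !inE /v3; case: eqP => //= _ jX'.
  by rewrite v2X // vX // subr0.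
- have -> : \sum_j f j ^+ p * v3 j = \sum_j f j ^+ p * v j - \sum_j f j ^+ p * v2 j
     - f j0 ^+ p * (v j0 - v2 j0).
    rewrite -sumrB (bigD1 j0) //= [in RHS](bigD1 j0) //= /v3 eqxx.
    rewrite (eq_bigr (fun j => f j ^+ p * v j - f j ^+ p * v2 j)); first by ring.
    by move=> j /negPf ->; ring.
  by idB => //; [idB|idM].
exists (fun j => v2 j + v4 j) => [|j]; first exact: frspanD.
have [->|jj] := eqVneq j j0.
  have -> : v j0 - (v2 j0 + v4 j0) = (v j0 - v2 j0) + (v3 j0 - v4 j0).
    by rewrite /v3 eqxx; ring.
  by idD.
have -> : v j - (v2 j + v4 j) = v3 j - v4 j by rewrite /v3 (negPf jj); ring.
exact: e4.
Qed.
End Kunz.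

Definition frob_flat_sys (R : comPzRingType) (J : set R) (q : nat) :=
  forall (T : finType) (s : seq (T -> R)) (v : T -> R),
    (forall f, f \in s -> J (\sum_j f j ^+ q * v j)) ->
  exists2 v0, frspan q (fun h => forall f, f \in s -> J (\sum_j f j * h j)) v0 &
    forall j, J (v j - v0 j).

(** * Iterated Frobenius and Frobenius powers of primary ideals *)

Section FrobFlat.
Variables (p : nat) (R : comPzRingType).
Hypotheses (pp : prime p) (pR : p%:R = 0 :> R).
Implicit Types (I J Q b : set R).

Lemma sum_frob (T : finType) n (f h : T -> R) c :
  \sum_j f j ^+ (p ^ n) * (c * h j ^+ (p ^ n)) = c * (\sum_j f j * h j) ^+ (p ^ n).
Proof.
rewrite (frob_sum pp pR) mulr_sumr; apply: eq_bigr => j _.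
by rewrite exprMn; ring.
Qed.

(** If [s] inverts [f j0] modulo [J], the solutions are spanned by the vectors
    [e_j - s * f j * e_j0]; their coordinatewise [p]-th powers span the solutions for the
    coefficients [f j ^+ p]. *)
Lemma frob_flat_field J : is_ideal J ->
  (forall r, ~ J r -> exists s, J (1 - s * r)) -> frob_flat J p.
Proof.
move=> hJ inv T f v hv.
have [hf|nf] := pselect (forall j, J (f j)).
  exists (fun i => \sum_j v j * ((i == j)%:R) ^+ p) => [|i].
    apply: frspan_sum => j; apply: (@frspan_in _ _ _ _ (fun i => (i == j)%:R)).
    by idSP => // i _; idMr.
  rewrite (bigD1 i) //= eqxx expr1n mulr1 big1 => [|j /negPf].
    by rewrite addr0 subrr; id0.
  by rewrite eq_sym => ->; rewrite expr0n -leqn0 leqNgt prime_gt0 // mulr0.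
have [j0 /inv [s hs]] : exists j0, ~ J (f j0).
  by apply: contrapT => n; apply: nf => j; apply: contrapT => nj; apply: n; exists j.
pose h j i := if j == j0 then 0 else if i == j0 then - (s * f j) else (i == j)%:R.
have p0 : 0 ^+ p = 0 :> R by rewrite expr0n -leqn0 leqNgt prime_gt0.
exists (fun i => \sum_j v j * h j i ^+ p) => [|i].
  apply: frspan_sum => j; apply: frspan_in.
  have [->|jj] := eqVneq j j0.
    by rewrite big1 => [|i _]; [id0|rewrite /h eqxx mulr0].
  have -> : \sum_j1 f j1 * h j j1 = f j * (1 - s * f j0).
    rewrite (bigD1 j0) //= (bigD1 j) //= /h eqxx (negPf jj) eqxx /= big1 => [|i].
      by rewrite addr0; ring.
    by case/andP => /negPf -> /negPf ->; rewrite mulr0.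
  by idM.
have [->|ij] := eqVneq i j0; last first.
  rewrite (bigD1 i) //= /h (negPf ij) eqxx expr1n mulr1 big1 => [|j].
    by rewrite addr0 subrr; id0.
  by rewrite eq_sym => /negPf ->; case: ifP => _; rewrite p0 mulr0.
have e : v j0 - \sum_j v j * h j j0 ^+ p =
    v j0 * (1 - s * f j0) ^+ p + s ^+ p * (\sum_j f j ^+ p * v j).
  have hB : (1 - s * f j0) ^+ p = 1 - (s * f j0) ^+ p.
    by have := frobB pp pR 1 1 (s * f j0); rewrite !expn1 expr1n.
  rewrite hB (bigD1 j0) //= [in RHS](bigD1 j0) //= /h eqxx p0 mulr0 add0r.
  have -> : \sum_(i0 | i0 != j0) v i0 * (if i0 == j0 then 0 else - (s * f i0)) ^+ p =
      - (s ^+ p * \sum_(i0 | i0 != j0) f i0 ^+ p * v i0).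
    rewrite mulr_sumr -sumrN; apply: eq_bigr => j /negPf ->.
    have := frobN pp pR 1 (s * f j); rewrite expn1 => ->.
    by rewrite exprMn; ring.
  rewrite exprMn; ring.
rewrite e; idD => //; idM => //.
by rewrite -(prednK (prime_gt0 pp)); apply: idlX.
Qed.

(** Solve the first equation; the remaining ones become equations for the coefficients [w] of the
    solution, again with [p ^ n]-th powers as coefficients, and there is one fewer of them. *)
Lemma frob_flat_to_sys J n : is_ideal J -> frob_flat J (p ^ n) ->
  frob_flat_sys J (p ^ n).
Proof.
move=> hJ ff T s v; move: {2}(size s) (leqnn (size s)) => k.
elim: k T s v => [|k IH] T [|f s] v // hk hs.
1,2: exists v => [|j]; last by rewrite subrr; id0.
1,2: have -> : v = (fun i => \sum_j v j * ((i == j)%:R) ^+ (p ^ n));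
  [apply/funext => i; rewrite (bigD1 i) //= eqxx expr1n mulr1 big1 ?addr0 // => j;
   by rewrite eq_sym => /negPf ->; rewrite (frob0 _ pp) mulr0
  |by apply: frspan_sum => j; apply: (@frspan_in _ _ _ _ (fun i => (i == j)%:R))].
have [v0 [K [w [h [hh ev0]]]] e0] := ff T f v (hs f (mem_head _ _)).
have [||w0 hw0 ew] := IH K [seq (fun k => \sum_j g j * h k j) | g : T -> R <- s] w.
- by rewrite size_map.
- move=> _ /mapP [g gs ->].
  have -> : \sum_k0 (\sum_j g j * h k0 j) ^+ (p ^ n) * w k0 =
     \sum_j g j ^+ (p ^ n) * v j - \sum_j g j ^+ (p ^ n) * (v j - v0 j).
    rewrite -sumrB (eq_bigr (fun j => \sum_k0 g j ^+ (p ^ n) * (w k0 * h k0 j ^+ (p ^ n)))).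
      rewrite exchange_big /=; apply: eq_bigr => i _.
      by rewrite sum_frob mulrC.
    by move=> j _; rewrite -mulrBr subKr ev0 mulr_sumr.
  idB => //; first by apply: hs; rewrite inE gs orbT.
  by idSP => // j _; idM.
exists (fun j => \sum_k0 w0 k0 * h k0 j ^+ (p ^ n)) => [|j]; last first.
  have -> : v j - \sum_k0 w0 k0 * h k0 j ^+ (p ^ n) =
     (v j - v0 j) + \sum_k0 (w k0 - w0 k0) * h k0 j ^+ (p ^ n).
    have -> : \sum_k0 (w k0 - w0 k0) * h k0 j ^+ (p ^ n) =
        \sum_k0 w k0 * h k0 j ^+ (p ^ n) - \sum_k0 w0 k0 * h k0 j ^+ (p ^ n).
      by rewrite -sumrB; apply: eq_bigr => i _; rewrite mulrBl.
    by rewrite ev0; ring.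
  by idD => //; idSP => // i _; idMr.
move: w0 hw0 {ew}; apply: frspan_ind => [|w1 w2 h1 h2|c g hg].
- have -> : (fun j => \sum_k0 0 * h k0 j ^+ (p ^ n)) = (fun=> 0).
    by apply/funext => j; rewrite big1 // => i _; rewrite mul0r.
  exact: frspan0.
- have -> : (fun j => \sum_k0 (w1 k0 + w2 k0) * h k0 j ^+ (p ^ n)) =
     (fun j => \sum_k0 w1 k0 * h k0 j ^+ (p ^ n) + \sum_k0 w2 k0 * h k0 j ^+ (p ^ n)).
    by apply/funext => j; rewrite -big_split /=; apply: eq_bigr => i _; rewrite mulrDl.
  exact: frspanD.
have -> : (fun j => \sum_k0 c * g k0 ^+ (p ^ n) * h k0 j ^+ (p ^ n)) =
    (fun j => c * (\sum_k0 g k0 * h k0 j) ^+ (p ^ n)).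
  apply/funext => j; rewrite -sum_frob; apply: eq_bigr => i _; ring.
apply: frspan_in => f'.
have sw (f0 : T -> R) : \sum_j f0 j * \sum_k0 g k0 * h k0 j =
    \sum_k0 (\sum_j f0 j * h k0 j) * g k0.
  under eq_bigr do rewrite mulr_sumr.
  rewrite exchange_big /=; apply: eq_bigr => i _; rewrite mulr_suml.
  by apply: eq_bigr => j _; ring.
rewrite inE sw => /predU1P [->|fs]; first by idSP => // i _; idMr.
by apply: (hg (fun k0 => \sum_j f' j * h k0 j)); apply/mapP; exists f'.
Qed.

Lemma frob_flat_iter J n : is_ideal J -> frob_flat J p -> frob_flat_sys J (p ^ n).
Proof.
move=> hJ ff; elim: n => [|n IH].
  move=> T s v hs; exists v => [|j]; last by rewrite subrr; id0.
  exists unit, (fun=> 1), (fun=> v); split=> [_ f fs|j].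
    by have := hs f fs; rewrite expn0 (eq_bigr (fun j => f j * v j)) // => j _; rewrite expr1.
  by rewrite (big_pred1 tt) => [|[]//]; rewrite mul1r expn0 expr1.
have fs1 : frob_flat_sys J (p ^ 1) by apply: frob_flat_to_sys; rewrite ?expn1.
move=> T s v hs.
have [|v0 hv0 e0] := fs1 T [seq (fun j => f j ^+ (p ^ n)) | f : T -> R <- s] v.
  move=> _ /mapP [f /hs fv ->]; rewrite expn1.
  rewrite (eq_bigr (fun j => f j ^+ (p ^ n.+1) * v j)) // => j _.
  by rewrite -exprM mulnC -expnS.
suff [v1 hv1 e1] : exists2 v1,
    frspan (p ^ n.+1) (fun h => forall f, f \in s -> J (\sum_j f j * h j)) v1 &
    forall j, J (v0 j - v1 j).
  exists v1 => // j; rewrite -(subrK (v0 j) (v j)) -addrA; idD => //; exact: e0.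
move: v0 hv0 {e0}; apply: frspan_ind => [|v1 v2 [w1 h1 e1] [w2 h2 e2]|c h hh].
- by exists (fun=> 0) => [|j]; [exact: frspan0|rewrite subrr; id0].
- exists (fun j => w1 j + w2 j) => [|j]; first exact: frspanD.
  by rewrite opprD addrACA; idD.
have [|v1 [K [w [g [hg ev1]]]] e1] := IH T s h.
  move=> f fs; apply: (hh (fun j => f j ^+ (p ^ n))); apply/mapP; by exists f.
exists (fun j => c * \sum_k w k ^+ p * g k j ^+ (p ^ n.+1)) => [|j].
  apply: frspanZ; apply: frspan_sum => k; apply: frspan_in; exact: hg.
have -> : \sum_k w k ^+ p * g k j ^+ (p ^ n.+1) = v1 j ^+ p.
  rewrite ev1; have := frob_sum pp pR 1 (index_enum K) xpredT
    (fun k => w k * g k j ^+ (p ^ n)); rewrite !expn1 => ->.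
  by apply: eq_bigr => k _; rewrite exprMn -exprM -expnSr.
rewrite expn1 -mulrBr; idM => //.
have := frobB pp pR 1 (h j) (v1 j); rewrite !expn1 => <-.
by rewrite -(prednK (prime_gt0 pp)); apply: idlX.
Qed.

Section Consequences.
Hypothesis ff : frob_flat ([set 0] : set R) p.

Lemma frob_relation n (T : finType) (f v : T -> R) :
  \sum_j f j ^+ (p ^ n) * v j = 0 ->
  frspan (p ^ n) (fun h => \sum_j f j * h j = 0) v.
Proof.
move=> hv; have [|v0 hv0 e0] := frob_flat_iter (n := n) (set0_ideal R) ff (s := [:: f]) (v := v).
  by move=> g; rewrite inE => /eqP ->.
have -> : v = v0 by apply/funext => j; apply/eqP; rewrite -subr_eq0; apply/eqP/e0.
by apply: frspan_sub hv0 => h hh; apply: hh; rewrite inE.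
Qed.

Lemma frob_powerP b n y : frob_power p b n y -> exists k (c e : 'I_k -> R),
  (forall i, b (e i)) /\ y = \sum_i c i * e i ^+ (p ^ n).
Proof.
move=> /gen_idealP [k [c [e [he ->]]]].
have /choice [e' h'] : forall i, exists r, b r /\ r ^+ (p ^ n) = e i.
  by move=> i; have [r br <-] := he i; exists r.
exists k, c, e'; split=> [i|]; first by case: (h' i).
by apply: eq_bigr => i _; case: (h' i) => _ ->.
Qed.

(** With [q = p ^ n], flatness is applied to a relation [t ^ q * u = \sum_i c i * e i ^ q]. The
    solutions of the relation without exponents have their first coordinate in the colon ideal, and
    [u] is a combination of the [q]-th powers of these coordinates. *)
Lemma frob_power_colon I t n u : is_ideal I -> frob_power p I n (t ^+ (p ^ n) * u) ->
  frob_power p [set r | I (t * r)] n u.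
Proof.
move=> hI /frob_powerP [k [c [e [he eu]]]].
pose f (x : unit + 'I_k) := match x with inl _ => t | inr i => e i end.
pose v (x : unit + 'I_k) := match x with inl _ => u | inr i => - c i end.
have : \sum_x f x ^+ (p ^ n) * v x = 0.
  rewrite big_sumType /= (big_pred1 tt) => [|[]//]; rewrite /= eu -big_split /=.
  by rewrite big1 // => i _; ring.
move=> /frob_relation [K [w [h [hh ev]]]].
have -> : u = v (inl tt) by []. rewrite ev.
idS => [|i]; first exact: frob_power_ideal.
idM; first exact: frob_power_ideal.
apply: frob_power_in => /=; have := hh i.
rewrite big_sumType /= (big_pred1 tt) => [|[]//]; move=> /= /eqP.
rewrite addr_eq0 => /eqP ->; idN => //; idSP => // j _; by idMr.
Qed.

Lemma frob_powerI I J n y : is_ideal I -> is_ideal J ->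
  frob_power p I n y -> frob_power p J n y -> frob_power p (I `&` J) n y.
Proof.
move=> hI hJ /frob_powerP [k [c [e [he ey]]]] /frob_powerP [k' [c' [e' [he' ey']]]].
pose f (x : 'I_k + 'I_k') := match x with inl i => e i | inr i => e' i end.
pose v (x : 'I_k + 'I_k') := match x with inl i => c i | inr i => - c' i end.
have : \sum_x f x ^+ (p ^ n) * v x = 0.
  rewrite big_sumType /=; apply/eqP; rewrite addr_eq0; apply/eqP.
  transitivity y; first by rewrite ey; apply: eq_bigr => i _; rewrite mulrC.
  by rewrite ey' -sumrN; apply: eq_bigr => i _; rewrite mulrN opprK mulrC.
move=> /frob_relation [K [w [h [hh ev]]]].
have -> : y = \sum_k0 w k0 * (\sum_i e i * h k0 (inl i)) ^+ (p ^ n).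
  rewrite ey; under [RHS]eq_bigr do rewrite -sum_frob.
  rewrite exchange_big /=; apply: eq_bigr => i _.
  have -> : c i = v (inl i) by []. rewrite ev mulr_suml.
  by apply: eq_bigr => i0 _; ring.
idS => [|i]; first exact: frob_power_ideal.
idM; first exact: frob_power_ideal.
apply: frob_power_in; split; first by idSP => // j _; idMr.
have := hh i; rewrite big_sumType /= => /eqP; rewrite addr_eq0 => /eqP ->.
by idN => //; idSP => // j _; idMr.
Qed.

(** For [t] outside its radical, [Q] equals its colon ideal by [t]. Here the primes become
    independent of [n]: zero divisors modulo the Frobenius power still lie in the radical of [Q]. *)
Lemma frob_power_primary Q t n u : primary_ideal Q -> ~ ideal_radical Q t ->
  frob_power p Q n (t * u) -> frob_power p Q n u.
Proof.
move=> [hQ _ pQ] Qt htu; have : frob_power p [set r | Q (t * r)] n u.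
  apply: frob_power_colon => //.
  rewrite -(prednK (expp_gt0 pp n)) exprSr -mulrA.
  by idM => //; apply: frob_power_ideal.
apply: frob_powerS => r /=; rewrite mulrC => /pQ [] //.
Qed.

Lemma frob_power_bigcap (s : seq (set R)) n y : (forall q, q \in s -> is_ideal q) ->
  (forall q, q \in s -> frob_power p q n y) ->
  frob_power p [set u : R | forall q, q \in s -> q u] n y.
Proof.
elim: s => [|q s IH] hs hy.
  by rewrite -(mulr1 y) -(expr1n _ (p ^ n)); idM;
    [exact: frob_power_ideal|exact: frob_power_in].
have : frob_power p (q `&` [set u : R | forall q, q \in s -> q u]) n y.
  apply: frob_powerI.
  - by apply: hs; rewrite mem_head.
  - split=> [q' q's|u v hu hv q' q's|r u hu q' q's].
    + by id0; apply: hs; rewrite inE q's orbT.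
    + by idD; [apply: hs; rewrite inE q's orbT|exact: hu|exact: hv].
    + by idM; [apply: hs; rewrite inE q's orbT|exact: hu].
  - by apply: hy; rewrite mem_head.
  - by apply: IH => q' q's; [apply: hs|apply: hy]; rewrite inE q's orbT.
apply: frob_powerS => u [qu hu] q'; rewrite inE => /predU1P [->//|].
exact: hu.
Qed.
End Consequences.
End FrobFlat.

(** * Krull's height theorem *)

Section Dimension.
Variable R : comPzRingType.
Hypothesis nR : noetherian R.
Implicit Types (I J L M P Q w : set R).

(** Nakayama's lemma in the localization at [P] with denominators cleared: the multipliers [s i]
    stand for units. *)
Lemma nak_sys_prime P L n (x s : 'I_n -> R) (c : 'I_n -> 'I_n -> R) :
  prime_ideal P -> is_ideal L -> (forall i j, P (c i j)) -> (forall i, ~ P (s i)) ->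
  (forall i, L (s i * x i - \sum_j c i j * x j)) ->
  forall i, exists t, ~ P t /\ L (t * x i).
Proof.
move=> pP hL; have hP := prime_is_ideal pP.
have PM u v : ~ P u -> ~ P v -> ~ P (u * v).
  by move=> Pu Pv; case: pP => _ _ h /h [].
elim: n x s c => [|n IH] x s c hc hs hx; first by case.
pose w := widen_ord (leqnSn n); pose m : 'I_n.+1 := ord_max.
pose si := s m - c m m.
have Psi : ~ P si by move=> h; apply: (hs m); rewrite -(subrK (c m m) (s m)); idD.
have xm : L (si * x m - \sum_j c m (w j) * x (w j)).
  have := hx m; rewrite big_ord_recr /= -/m => h.
  rewrite /si; have -> : (s m - c m m) * x m - \sum_j c m (w j) * x (w j) =
    s m * x m - (\sum_(i < n) c m (w i) * x (w i) + c m m * x m) by ring.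
  exact: h.
have hw : forall j, exists t, ~ P t /\ L (t * x (w j)).
  apply: (IH (fun j => x (w j)) (fun i => si * s (w i))
            (fun i j => si * c (w i) (w j) + c (w i) m * c m (w j))).
  - by move=> i j; idD => //; idM.
  - by move=> i; apply: (PM).
  move=> i; have := hx (w i); rewrite big_ord_recr /= -/m => h.
  have -> : si * s (w i) * x (w i) -
     \sum_j (si * c (w i) (w j) + c (w i) m * c m (w j)) * x (w j) =
     si * (s (w i) * x (w i) - (\sum_(i0 < n) c (w i) (w i0) * x (w i0) + c (w i) m * x m))
     + c (w i) m * (si * x m - \sum_j c m (w j) * x (w j)).
    have -> : \sum_j (si * c (w i) (w j) + c (w i) m * c m (w j)) * x (w j) =
      si * (\sum_j c (w i) (w j) * x (w j)) + c (w i) m * \sum_j c m (w j) * x (w j).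
      by rewrite !mulr_sumr -big_split /=; apply: eq_bigr => j _; ring.
    ring.
  by idD => //; idM.
have /choice [t ht] := hw.
move=> i; have [j ->|->] := unliftP m i.
  have -> : lift m j = w j by apply: val_inj; rewrite /= /bump leqNgt ltn_ord.
  exact: hw.
exists ((\prod_j t j) * si); split.
  apply: (PM) => //; apply: (big_ind (fun u => ~ P u)) => [|u v|j _].
  - by case: pP.
  - exact: PM.
  - by case: (ht j).
have -> : \prod_j t j * si * x m = \prod_j t j * (si * x m - \sum_j c m (w j) * x (w j))
  + \sum_j c m (w j) * (\prod_j t j * x (w j)).
  have -> : \sum_j c m (w j) * (\prod_j t j * x (w j)) =
    \prod_j t j * \sum_j c m (w j) * x (w j).
    by rewrite mulr_sumr; apply: eq_bigr => j _; ring.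
  ring.
idD => //; first by idM.
idS => // j; idM => //; rewrite (bigD1 j) //= mulrAC; idMr => //.
by case: (ht j).
Qed.

Lemma nak_prime P L (N : set R) : prime_ideal P -> is_ideal L -> is_ideal N ->
  (forall u, N u -> exists s, ~ P s /\ addI L (idealM P N) (s * u)) ->
  forall u, N u -> exists t, ~ P t /\ L (t * u).
Proof.
move=> pP hL hN h; have [n [x eN]] := noetherian_fg nR hN.
have hP := prime_is_ideal pP.
have /choice [sc hsc] : forall i, exists sc : R * ('I_n -> R),
    [/\ ~ P sc.1, forall j, P (sc.2 j) & L (sc.1 * x i - \sum_j sc.2 j * x j)].
  move=> i; have : N (x i) by rewrite eN; apply: gen_sub; exists i.
  move=> /h [s [Ps [u [v [Lu]]]]]; rewrite {1}eN => /idealM_gen => /(_ hP).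
  by move=> [c [hc ->]] e; exists (s, c); split=> //=; rewrite e addrK.
have hx := @nak_sys_prime P L n x (fun i => (sc i).1) (fun i => (sc i).2) pP hL.
have /choice [t ht] : forall i, exists t, ~ P t /\ L (t * x i).
  by apply: hx => [i j|i|i]; case: (hsc i).
move=> u; rewrite eN => /gen_rangeP [c ->]; exists (\prod_j t j); split.
  apply: (big_ind (fun u => ~ P u)) => [|a b Pa Pb|j _].
  - by case: pP.
  - by case: pP => _ _ hm /hm [].
  - by case: (ht j).
rewrite mulr_sumr; idS => // i; rewrite mulrCA; idM => //.
by rewrite (bigD1 i) //= mulrAC; idMr => //; case: (ht i).
Qed.

Definition minimal_prime_over I P := [/\ prime_ideal P, I `<=` P &
  forall P', prime_ideal P' -> I `<=` P' -> P' `<=` P -> P' = P].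

(** A prime over [I] that avoids all [s * z ^+ N] with [s] outside [P] would be contained in [P],
    hence equal to [P], without containing [z]. *)
Lemma minimal_prime_pow I P z : is_ideal I -> minimal_prime_over I P -> P z ->
  exists s N, ~ P s /\ I (s * z ^+ N).
Proof.
move=> hI [pP IP mP] Pz; apply: contrapT => nI.
have [P1 PM] := prime_mult_closed pP.
have [||Q [pQ IQ QS]] := @prime_avoiding _ nR I
    [set u | exists s N, ~ P s /\ u = s * z ^+ N] hI.
- split; first by exists 1, 0%N; rewrite mulr1.
  move=> _ _ [s [N [Ps ->]]] [t [K [Pt ->]]].
  exists (s * t), (N + K)%N; split; first exact: PM.
  by rewrite exprD; ring.
- by move=> u Iu [s [N [Ps e]]]; apply: nI; exists s, N; rewrite -e.
have QP : Q `<=` P.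
  move=> u Qu; apply: contrapT => Pu; apply: (QS _ Qu).
  by exists u, 0%N; rewrite mulr1.
have : Q z by rewrite (mP Q).
by move=> /QS; apply; exists 1, 1%N; rewrite mul1r expr1.
Qed.

(** * Krull's principal ideal theorem, modulo [w0] and local at [P] *)

Section PIT.
Variables (w0 w P : set R) (y : R).
Hypotheses (pw0 : prime_ideal w0) (pw : prime_ideal w).
Hypotheses (w0w : w0 `<=` w) (wP : w `<=` P) (nwP : w <> P).
Hypothesis mP : minimal_prime_over (addI w0 (prI y)) P.

Let pP : prime_ideal P. Proof. by case: mP. Qed.
Let hw0 := prime_is_ideal pw0.
Let hw := prime_is_ideal pw.
Let PM u v : ~ P u -> ~ P v -> ~ P (u * v).
Proof. by move=> Pu Pv; case: pP => _ _ h /h []. Qed.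
Let wM u v : ~ w u -> ~ w v -> ~ w (u * v).
Proof. by move=> Pu Pv; case: pw => _ _ h /h []. Qed.

Let loc I : set R := [set r | exists s, ~ P s /\ I (s * r)].

Let loc_ideal I : is_ideal I -> is_ideal (loc I).
Proof.
move=> hI; split=> [|u v [s [Ps hs]] [t [Pt ht]]|r u [s [Ps hs]]].
- by exists 1; split; [case: pP|rewrite mulr0; id0].
- exists (s * t); split; first exact: PM.
  have -> : s * t * (u + v) = t * (s * u) + s * (t * v) by ring.
  by idD => //; idM.
- by exists s; split=> //; rewrite mulrCA; idM.
Qed.

Let sub_loc I : I `<=` loc I.
Proof. by move=> u Iu; exists 1; split; [case: pP|rewrite mul1r]. Qed.

Let Y := loc (addI w0 (prI y)).
Let hY : is_ideal Y. Proof. exact: loc_ideal. Qed.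

(** A substitute for finite length: each step adds a generator that [P] multiplies into the previous
    ideal, so that locally at [P] the step has length at most one. *)
Inductive simple_tower : set R -> Prop :=
| simple_tower0 : simple_tower Y
| simple_towerS F g : simple_tower F -> (forall r, P r -> F (r * g)) ->
    simple_tower (addI F (prI g)).

Let tower_ideal F : simple_tower F -> is_ideal F /\ Y `<=` F.
Proof.
elim=> [|{}F g _ [hF YF] _]; first by split.
by split=> // u /YF; apply: addI_l.
Qed.

(** [Y] contains a power of [P], as [P] is minimal over [w0 + (y)]. If the maximal tower ideal [F]
    were proper, take the least [k] with [P ^ k] inside [F]: an element of the preceding power
    outside [F] could still be added. *)
Let tower_T : simple_tower setT.
Proof.
have [|F [hF tF mF]] := noetherian_max nR (Phi := simple_tower).
  by exists Y; split=> //; apply: simple_tower0.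
have [_ YF] := tower_ideal tF.
suff F1 : F 1 by have -> : setT = F; [apply/seteqP; split=> // u _; exact: idl1|].
apply: contrapT => F1.
have [k hk] : exists k, idealX P k `<=` Y.
  apply: idealX_of_rad => //; first exact: prime_is_ideal.
  move=> x Px; have [|s [N [Ps hs]]] := minimal_prime_pow _ mP Px; first by auto.
  by exists N, s.
have : exists k, `[< idealX P k `<=` F >].
  by exists k; apply/asboolP => u /hk /YF.
move=> /ex_minnP [[|j] /asboolP hj mj]; first by apply: F1; apply: hj.
have [g [Pg Fg]] : exists g, idealX P j g /\ ~ F g.
  apply: contrapT => ng; have : (j.+1 <= j)%N; last by rewrite ltnn.
  apply: mj; apply/asboolP => u hu; apply: contrapT => nu; apply: ng; by exists u.
apply: Fg; have <- : addI F (prI g) = F.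
  apply: mF; [by auto| |exact: addI_l].
  by apply: simple_towerS => // r Pr; apply: hj; apply: idealX_mulS.
by apply: addI_r => //; apply: prI_self.
Qed.

(** Induction on the tower. If every [K n] contains some [v] of the new step outside [F], then [v]
    generates that step over [F] locally at [P], which reduces the claim to elements of [F];
    otherwise the chain eventually meets the step only inside [F]. *)
Let tower_dcc F : simple_tower F -> forall K : nat -> set R,
  (forall n, is_ideal (K n)) -> (forall n u s, ~ P s -> K n (s * u) -> K n u) ->
  (forall n, Y `<=` K n) -> (forall n, K n.+1 `<=` K n) ->
  exists n0, forall n u, (n0 <= n)%N -> F u -> K n0 u -> K n u.
Proof.
elim=> [|{}F g tF IH Pg] K hK cK YK dK.
  by exists 0%N => n u _ Yu _; apply: YK.
have KM m n : (m <= n)%N -> K n `<=` K m.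
  move=> /subnK <-; elim: (n - m)%N => [//|k IHk] u; rewrite addSn => /dK; exact: IHk.
have [hF YF] := tower_ideal tF.
have [n1 h1] := IH K hK cK YK dK.
have [[N hN]|nN] := pselect (exists N, forall u, K N u -> addI F (prI g) u -> F u).
  exists (maxn N n1) => n u; rewrite geq_max => /andP[Nn n1n] Fu Ku.
  apply: h1 => //; last by apply: KM Ku; rewrite leq_maxr.
  by apply: hN => //; apply: KM Ku; rewrite leq_maxl.
exists n1 => n u n1n /addI_prP [r' hr'] Ku.
have [v [Kv /addI_prP [r hr] Fv]] : exists v, [/\ K n v, addI F (prI g) v & ~ F v].
  apply: contrapT => nv; apply: nN; exists n => v Kv Fv; apply: contrapT => nF.
  by apply: nv; exists v.
have Pr : ~ P r.
  by move=> Pr; apply: Fv; rewrite -(subrK (r * g) v); idD => //; exact: Pg.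
apply: (cK _ _ r) => //.
have -> : r * u = (r * (u - r' * g) - r' * (v - r * g)) + r' * v by ring.
idD => //; last by idM.
apply: h1 => //; first by idB => //; idM.
have -> : r * (u - r' * g) - r' * (v - r * g) = r * u - r' * v by ring.
by idB => //; idM => //; exact: (KM _ _ n1n).
Qed.

(** The symbolic powers of [w] modulo [w0]. *)
Let sym n : set R := [set r | exists s, ~ w s /\ addI w0 (idealX w n) (s * r)].

Let sym_ideal n : is_ideal (sym n).
Proof.
have hA : is_ideal (addI w0 (idealX w n)) by auto.
split=> [|u v [s [Ps hs]] [t [Pt ht]]|r u [s [Ps hs]]].
- by exists 1; split; [case: pw|rewrite mulr0; id0].
- exists (s * t); split; first exact: wM.
  have -> : s * t * (u + v) = t * (s * u) + s * (t * v) by ring.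
  by idD => //; idM.
- by exists s; split=> //; rewrite mulrCA; idM.
Qed.

Lemma principal_ideal_theorem : w = w0.
Proof.
have wy : ~ w y.
  move=> wy; apply: nwP; case: mP => _ _; apply=> //.
  by apply: addI_min => //; apply: prI_sub.
have w0s n : w0 `<=` sym n.
  by move=> u wu; exists 1; split; [case: pw|rewrite mul1r; apply: addI_l].
pose K n := loc (addI (sym n) (prI y)).
have [||||n0 hn0] := tower_dcc tower_T (K := K).
- by move=> n; apply: loc_ideal; apply: addI_ideal.
- move=> n u s Ps [t [Pt ht]]; exists (t * s); split; first exact: PM.
  by rewrite -mulrA.
- move=> n u [s [Ps hs]]; exists s; split=> //.
  apply: (addI_min (I := w0) (J := prI y)) hs; first exact: addI_ideal.
    by move=> v /(w0s n); apply: addI_l.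
  exact: addI_r.
- move=> n u [s [Ps hs]]; exists s; split=> //.
  apply: (addI_min (I := sym n.+1) (J := prI y)) hs; first exact: addI_ideal.
    move=> v [t [wt ht]]; apply: addI_l => //; exists t; split=> //.
    apply: (addI_min (I := w0) (J := idealX w n.+1)) ht => //; first exact: addI_l.
    by apply: subset_trans (addI_r _) => //; apply: idealX_le.
  exact: addI_r.
(* Since [y] is outside [w], an element [r * y] of [sym n0] has [r] in [sym n0]. Thus, locally at
   [P], the [n0]-th symbolic power is contained in the next one plus [P] times itself, and Nakayama
   identifies the two. *)
have hs : forall u, sym n0 u -> exists t, ~ P t /\ sym n0.+1 (t * u).
  apply: nak_prime => // u hu.
  have : K n0 u by apply: sub_loc; apply: addI_l.
  move=> /(hn0 _ _ (leqnSn _) I) [s [Ps [v [_ [hv [r ->] e]]]]].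
  exists s; split=> //; exists v, (r * y); split=> //.
  rewrite mulrC; apply: idealM_in; first by case: mP => _ h _; apply: h;
    apply: addI_r => //; apply: prI_self.
  have [t [wt ht]] : sym n0 (r * y).
    have -> : r * y = s * u - v by rewrite e addrC addKr.
    idB => //; first by idM.
    have [t [wt ht]] := hv; exists t; split=> //.
    apply: (addI_min (I := w0) (J := idealX w n0.+1)) ht => //; first exact: addI_l.
    by apply: subset_trans (addI_r _) => //; apply: idealX_le.
  by exists (t * y); split; [exact: wM|rewrite mulrAC -mulrA].
(* Now [w ^ n0] is contained in [w0 + w ^ n0.+1] locally at [w]; a second use of Nakayama, at [w],
   puts it in [w0]. *)
have hw' : forall u, idealX w n0 u -> exists t, ~ w t /\ w0 (t * u).
  apply: nak_prime => // u hu.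
  have : sym n0 u.
    by exists 1; split; [case: pw|rewrite mul1r; apply: addI_r].
  move=> /hs [t [Pt [s [ws h]]]]; exists (s * t); split; last by rewrite -mulrA.
  by apply: wM => // /wP.
apply/seteqP; split=> // u wu; apply: (@prime_X _ w0 u n0) => //.
have [t [wt]] := hw' _ (idealX_exp n0 wu).
by case: pw0 => _ _ h /h [/w0w|].
Qed.
End PIT.

Lemma prime_chain_le l c : prime_chain l c ->
  forall i j, (i <= j <= l)%N -> c i `<=` (c j : set R).
Proof.
move=> [_ cs] i j /andP[/subnK <-]; elim: (j - i)%N => [|k IH] h; first by rewrite add0n.
apply: subset_trans (IH (ltnW h)) _; by case: (cs _ h).
Qed.

(** A prime [q] maximal among those strictly below [P] and above the penultimate prime misses some
    [x i], and [P] is minimal over [q + (x i)]. Up to a factor outside [P], a power of each other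
    [x j] is congruent modulo [x i] to some [a j] in [q]. By the principal ideal theorem [q] is
    minimal over [J] and these [k] elements, so the chain with its penultimate prime replaced by [q]
    has length at most [k] up to [q]. *)
Lemma krull_height k : forall J (x : 'I_k -> R) P, is_ideal J ->
  prime_ideal P -> J `<=` P -> (forall i, P (x i)) ->
  (forall P', prime_ideal P' -> J `<=` P' -> (forall i, P' (x i)) -> P' `<=` P -> P' = P) ->
  forall l c, prime_chain l c -> J `<=` c 0%N -> c l = P -> (l <= k)%N.
Proof.
elim: k => [|k IH] J x P hJ pP JP Px mP l c [cp cs] Jc cl.
  case: l cp cs cl => [//|l] cp cs cl.
  have cM := prime_chain_le (conj cp cs : prime_chain l.+1 c).
  have e : c 0%N = P.
    apply: mP => //; [exact: cp|by case|by rewrite -cl; apply: cM; rewrite leqnn].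
  have : c 1%N `<=` P.
    by rewrite -cl; apply: cM; rewrite leqnn.
  by rewrite -e; case: (cs 0%N isT) => _.
case: l cp cs cl => [//|l] cp cs cl; rewrite ltnS.
have clP : c l `<` P by rewrite -cl; apply: cs.
have [|q [hq [pq clq qP nqP] mq]] := noetherian_max nR
    (Phi := fun q => [/\ prime_ideal q, c l `<=` q, q `<=` P & q <> P]).
  exists (c l); have pc := cp _ (leqnSn l); split; first by case: pc.
  by split=> //; [case: clP|move=> e; case: clP => _; rewrite e; apply].
have Jcl : J `<=` c l.
  apply: subset_trans Jc _.
  by apply: (prime_chain_le (conj cp cs : prime_chain l.+1 c)); rewrite leqnSn.
have Jq : J `<=` q := subset_trans Jcl clq.
have [i qi] : exists i, ~ q (x i).
  apply: contrapT => ni; apply: nqP; apply: mP => // i.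
  by apply: contrapT => nq; apply: ni; exists i.
have mPq : minimal_prime_over (addI q (prI (x i))) P.
  split=> //; first by apply: addI_min => //; [case: pP|apply: prI_sub => //; case: pP].
  move=> P' pP' qP' P'P; apply: contrapT => nP'; apply: qi.
  have <- : P' = q.
    apply: mq; [by case: pP'| |by move=> u qu; apply: qP'; apply: addI_l].
    by split=> //; apply: subset_trans clq _ => u qu; apply: qP'; apply: addI_l.
  by apply: qP'; apply: addI_r => //; apply: prI_self.
have /choice [a ha] : forall j, exists a, q a /\ exists s N r, ~ P s /\ s * x (lift i j) ^+ N = a + r * x i.
  move=> j; have [|s [N [Ps [a [_ [qa [r ->] e]]]]]] := minimal_prime_pow _ mPq (Px (lift i j)).
    by auto.
  by exists a; split=> //; exists s, N, r.
pose c' n := if (n < l)%N then c n else q.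
apply: (IH J a q hJ pq Jq) (c' : nat -> set R) _ _ _ => [j|q' pq' Jq' aq' q'q||//|].
- by case: (ha j).
- apply: contrapT => nq'.
  suff mPq' : minimal_prime_over (addI q' (prI (x i))) P.
    by apply: nq'; rewrite (principal_ideal_theorem pq' pq q'q qP nqP mPq').
  split=> //.
    by apply: addI_min; [case: pP|exact: subset_trans q'q qP|apply: prI_sub => //; case: pP].
  move=> P' pP' qP' P'P; apply: mP => //.
    by move=> u /Jq' qu; apply: qP'; apply: addI_l.
  have xi : P' (x i) by apply: qP'; apply: addI_r; [case: pq'|exact: prI_self].
  move=> j; have [j' ->|->//] := unliftP i j.
  have [qa [s [N [r [Ps e]]]]] := ha j'.
  have : P' (s * x (lift i j') ^+ N).
    rewrite e; idD; [by case: pP'|by apply: qP'; apply: addI_l|by idM; case: pP'].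
  by case: (pP') => _ _ h /h [/P'P //|]; apply: prime_X.
- split=> [n nl|n nl]; rewrite /c'.
    by case: ifP => // nl'; apply: cp; rewrite ltnW // ltnS ltnW.
  rewrite nl; case: ifP => [_|/negbT]; first by apply: cs; rewrite ltnS ltnW.
  rewrite -leqNgt => ln; have e : n.+1 = l by apply/eqP; rewrite eqn_leq nl.
  have [h1 h2] := cs n (leqW nl); rewrite e in h1 h2; split.
    exact: subset_trans h1 clq.
  by move=> h; apply: h2; apply: subset_trans clq h.
- by rewrite /c'; case: (l) Jc Jcl => [|l'] // Jc Jcl u /Jq.
- by rewrite /c' ltnn.
Qed.

Lemma prime_avoidance I (s : seq (set R)) : is_ideal I ->
  (forall L, L \in s -> prime_ideal L /\ ~ I `<=` L) ->
  exists y, I y /\ forall L, L \in s -> ~ L y.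
Proof.
move=> hI; move: {2}(size s) (leqnn (size s)) => n.
elim: n s => [|n IH] [|L1 s] // sn hs.
- by exists 0; split; [id0|].
- by exists 0; split; [id0|].
have [s0|s0] := eqVneq s [::].
  have [_ nI] := hs L1 (mem_head _ _).
  have [y [Iy Ly]] : exists y, I y /\ ~ L1 y.
    apply: contrapT => ny; apply: nI => u Iu; apply: contrapT => nL; apply: ny; by exists u.
  by exists y; split=> // L; rewrite s0 inE => /eqP ->.
have [||y1 [Iy1 hy1]] := IH s; [by []|by move=> L Ls; apply: hs; rewrite inE Ls orbT|].
apply: contrapT => ny.
have L1y1 : L1 y1.
  apply: contrapT => nL; apply: ny; exists y1; split=> // L.
  by rewrite inE => /predU1P [->//|]; apply: hy1.
have /choice [yL hyL] : forall L, exists y, L \in s -> [/\ I y, ~ L1 y & L y].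
  move=> L; have [Ls|Ls] := boolP (L \in s); last by exists 0.
  have [||y [Iy hy]] := IH (L1 :: rem L s).
  - by rewrite /= size_rem // prednK // lt0n size_eq0.
  - move=> L'; rewrite inE => /predU1P [->|/mem_rem h]; apply: hs.
      exact: mem_head.
    by rewrite inE h orbT.
  exists y => _; split=> //; first by apply: hy; rewrite mem_head.
  apply: contrapT => nL; apply: ny; exists y; split=> // L'.
  have [->//|ne] := eqVneq L' L.
  rewrite inE => /predU1P [->|L's]; apply: hy; rewrite inE ?eqxx //.
  have := perm_to_rem Ls => /perm_mem /(_ L'); rewrite L's inE (negPf ne) /= => <-.
  by rewrite orbT.
pose z := \prod_(L <- s) yL L.
have Iz : I z.
  case: (s) s0 hyL @z => [//|L s'] _ hyL /=; rewrite big_cons; idMr => //.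
  by case: (hyL L (mem_head _ _)).
have L1p : prime_ideal L1 by case: (hs L1 (mem_head _ _)).
have L1z : ~ L1 z.
  have h (s' : seq (set R)) : {subset s' <= s} -> ~ L1 (\prod_(L <- s') yL L).
    elim: s' => [|L s' IHs] ss; first by rewrite big_nil; case: L1p.
    rewrite big_cons => hL; case: (L1p) => _ _ /(_ _ _ hL) [].
      by case: (hyL L (ss _ (mem_head _ _))).
    by apply: IHs => L' h; apply: ss; rewrite inE h orbT.
  exact: h.
apply: ny; exists (y1 + z); split; first by idD.
move=> L; rewrite inE => /predU1P [->|Ls] h.
  by apply: L1z; apply: (@idlDl _ L1 z y1) => //; case: L1p.
have pL : prime_ideal L by case: (hs L); rewrite ?inE ?Ls ?orbT.
have Lz : L z.
  rewrite /z (big_rem L) //=; idMr; first by case: pL.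
  by case: (hyL L Ls).
by apply: (hy1 L Ls); apply: (@idlDr _ L y1 z) => //; case: pL.
Qed.

Section Local.
Variable M : set R.
Hypotheses (mM : maximal_ideal M) (lM : forall P, prime_ideal P -> P `<=` M).
Let pM := maximal_prime mM.

Lemma dim_le k J (x : 'I_k -> R) : is_ideal J ->
  (forall P, prime_ideal P -> J `<=` P -> (forall i, P (x i)) -> P = M) ->
  (forall i, M (x i)) ->
  forall l c, prime_chain l c -> J `<=` c 0%N -> (l <= k)%N.
Proof.
move=> hJ hx Mx l c hc Jc; have [cp cs] := hc.
have kh l' c' : prime_chain l' c' -> J `<=` c' 0%N -> c' l' = M -> (l' <= k)%N.
  apply: (krull_height (J := J) (x := x) (P := M)) => //.
    apply: subset_trans Jc _; apply: lM; exact: cp.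
  by move=> P' pP' JP' xP' _; apply: hx.
have [e|ne] := pselect (c l = M); first exact: (kh l c).
apply: leq_trans (leqnSn l) _.
apply: (kh l.+1 (fun n => if (n <= l)%N then c n else M)) => //; last by rewrite ltnn.
split=> n nl; first by case: ifP => // /cp.
rewrite -ltnS nl; case: ifP => [|/negbT]; first exact: cs.
rewrite -leqNgt => ln; have -> : n = l by apply/eqP; rewrite eqn_leq -ltnS nl.
have cM : c l `<=` M by apply: lM; apply: cp.
by split=> // h; apply: ne; apply/seteqP.
Qed.

(** An element [y] of [M] outside the listed primes over [J] other than [M] lowers the bound: a
    nontrivial chain above [J + (y)] can be prolonged downwards by a listed prime. *)
Lemma sop_exists k : forall J, is_ideal J ->
  (forall l c, prime_chain l c -> J `<=` c 0%N -> (l <= k)%N) ->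
  exists x : 'I_k -> R, (forall i, M (x i)) /\
    forall P, prime_ideal P -> J `<=` P -> (forall i, P (x i)) -> P = M.
Proof.
elim: k => [|k IH] J hJ hk.
  exists (fun=> 0); split=> [[]//|P pP JP _]; apply: contrapT => nP.
  suff : (1 <= 0)%N by [].
  apply: (hk _ (fun n => if n == 0%N then P else M)) => //.
  split=> -[|[|n]] //= _; split; first exact: lM.
  by move=> h; apply: nP; apply/seteqP; split=> //; apply: lM.
have [s [hs1 hs2]] := prime_list nR hJ.
have [||y [My hy]] := @prime_avoidance M [seq L <- s | L != M].
- by case: mM.
- move=> L; rewrite mem_filter => /andP [/eqP LM /hs1 [pL JL]]; split=> // h.
  by apply: LM; apply/seteqP; split=> //; apply: lM.
have [||x [Mx hx]] := IH (addI J (prI y)); first by auto.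
  move=> l c hc Jyc; have [cp cs] := hc.
  have pc0 : prime_ideal (c 0%N) by apply: cp.
  have cy : c 0%N y by apply: Jyc; apply: addI_r => //; apply: prI_self.
  have [L Ls Lc] : exists2 L, L \in s & L `<=` c 0%N.
    by apply: hs2 => //; apply: subset_trans Jyc; apply: addI_l.
  have [pL JL] := hs1 _ Ls.
  have [LM|LM] := eqVneq L M.
    case: l cp cs hc => [//|l] cp cs _; have [_] := cs 0%N isT; case.
    by apply: subset_trans Lc; rewrite LM; apply: lM; apply: cp.
  suff : (l.+1 <= k.+1)%N by [].
  apply: (hk _ (fun n => if n is n'.+1 then c n' else L)) => //.
  split=> -[|n] //= nl; [exact: cp| |exact: cs].
  split=> // h; apply: (hy L); first by rewrite mem_filter LM.
  exact: h.
exists (fun i => if unlift ord0 i is Some j then x j else y); split=> [i|P pP JP hP].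
  by case: unliftP => [j _|_].
apply: hx => // [|i].
  apply: addI_min => //; first by case: pP.
  apply: prI_sub; first by case: pP.
  by have := hP ord0; rewrite unlift_none.
by have := hP (lift ord0 i); rewrite liftK.
Qed.
End Local.
End Dimension.

(** * Subquotients and localizations *)

Section SubQuotient.
Variable R : comPzRingType.

(** One construction serves quotients ([B] the whole ring), subrings ([I] zero), completions (Cauchy
    sequences modulo null sequences) and germs of sequences. Accordingly [I] is an ideal of [B]
    only. *)
Definition subquotient_axiom (B I : set R) :=
  [/\ B 1, forall u v, B u -> B v -> B (u - v) /\ B (u * v),
      I `<=` B, I 0 &
      forall u v, I v -> (forall w, I w -> I (w - v)) /\ (B u -> I (u * v))].

(* The quotient of the subring [B] by [I], represented by cosets. *)
Definition subquotient (B I : set R) (h : subquotient_axiom B I) :=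
  {C : set R | exists r, B r /\ C = [set s | I (s - r)]}.

Variables (B I : set R) (h : subquotient_axiom B I).
Local Notation T := (subquotient h).

HB.instance Definition _ := gen_eqMixin T.
HB.instance Definition _ := gen_choiceMixin T.

Let B0 : B 0.
Proof. by case: h => B1 /(_ 1 1 B1 B1) [h0 _] _ _ _; move: h0; rewrite subrr. Qed.
Let BN u : B u -> B (- u).
Proof. by case: h => _ hB _ _ _ Bu; have [+ _] := hB _ _ B0 Bu; rewrite sub0r. Qed.
Let BD u v : B u -> B v -> B (u + v).
Proof. by case: (h) => _ hB _ _ _ Bu /BN Bv; have [+ _] := hB _ _ Bu Bv; rewrite opprK. Qed.
Let BM u v : B u -> B v -> B (u * v).
Proof. by case: (h) => _ hB _ _ _ Bu Bv; have [] := hB _ _ Bu Bv. Qed.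
Let I0 : I 0. Proof. by case: h. Qed.
Let IB u v : I u -> I v -> I (u - v).
Proof. by case: (h) => _ _ _ _ hI Iu Iv; have [+ _] := hI 0 _ Iv; apply. Qed.
Let IN u : I u -> I (- u). Proof. by move=> Iu; rewrite -sub0r; apply: IB. Qed.
Let ID u v : I u -> I v -> I (u + v).
Proof. by move=> Iu /IN Iv; rewrite -(opprK v); apply: IB. Qed.
Let IM u v : B u -> I v -> I (u * v).
Proof. by case: (h) => _ _ _ _ hI Bu Iv; have [_] := hI u _ Iv; apply. Qed.

Let inB r := if `[< B r >] then r else 0.
Let inBE r : B r -> inB r = r. Proof. by move=> Br; rewrite /inB asboolT. Qed.

Fact sq_pi_subproof r : exists r', B r' /\
  [set s | I (s - inB r)] = [set s | I (s - r')].
Proof. by exists (inB r); split=> //; rewrite /inB; case: asboolP. Qed.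

Definition sq_pi r : T := exist _ _ (sq_pi_subproof r).
Definition sq_repr (x : T) : R := sval (cid (svalP x)).

Lemma sq_reprB x : B (sq_repr x).
Proof. exact: (proj1 (svalP (cid (svalP x)))). Qed.

Lemma sq_pi_eq r s : B r -> B s -> sq_pi r = sq_pi s <-> I (r - s).
Proof.
move=> Br Bs; split=> [e|Irs].
  have : sval (sq_pi s) r.
    by rewrite -e /= inBE // subrr.
  by rewrite /= inBE.
apply: eq_exist => /=; rewrite !inBE //; apply/seteqP; split=> u hu /=.
  by rewrite -(subrK r u) -addrA; apply: ID.
have -> : u - r = (u - s) - (r - s) by ring.
exact: IB.
Qed.

Lemma sq_reprK x : sq_pi (sq_repr x) = x.
Proof.
have e : sval (sq_pi (sq_repr x)) = sval x.
  rewrite /= inBE; last exact: sq_reprB.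
  exact: (esym (proj2 (svalP (cid (svalP x))))).
by move: (sq_pi _) e; case: x => C hC [C' hC'] /= e; apply: eq_exist.
Qed.

Lemma sq_ind (P : T -> Prop) : (forall r, B r -> P (sq_pi r)) -> forall x, P x.
Proof. by move=> hP x; rewrite -(sq_reprK x); apply: hP; apply: sq_reprB. Qed.

Lemma sq_repr_pi r : B r -> I (sq_repr (sq_pi r) - r).
Proof. by move=> Br; apply/sq_pi_eq => //; [exact: sq_reprB|rewrite sq_reprK]. Qed.

Definition sq_add (x y : T) : T := sq_pi (sq_repr x + sq_repr y).
Definition sq_opp (x : T) : T := sq_pi (- sq_repr x).
Definition sq_mul (x y : T) : T := sq_pi (sq_repr x * sq_repr y).

Lemma sq_addE r s : B r -> B s -> sq_add (sq_pi r) (sq_pi s) = sq_pi (r + s).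
Proof.
move=> Br Bs; apply/sq_pi_eq; [by apply: BD; apply: sq_reprB|exact: BD|].
by rewrite opprD addrACA; apply: ID; apply: sq_repr_pi.
Qed.

Lemma sq_oppE r : B r -> sq_opp (sq_pi r) = sq_pi (- r).
Proof.
move=> Br; apply/sq_pi_eq; [by apply: BN; apply: sq_reprB|exact: BN|].
by rewrite -opprD; apply: IN; apply: sq_repr_pi.
Qed.

Lemma sq_mulE r s : B r -> B s -> sq_mul (sq_pi r) (sq_pi s) = sq_pi (r * s).
Proof.
move=> Br Bs; apply/sq_pi_eq; [by apply: BM; apply: sq_reprB|exact: BM|].
set a := sq_repr _; set b := sq_repr _.
have -> : a * b - r * s = a * (b - s) + s * (a - r) by ring.
by apply: ID; apply: IM => //; [exact: sq_reprB|exact: sq_repr_pi|exact: sq_repr_pi].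
Qed.

Fact sq_addA : associative sq_add.
Proof.
apply: sq_ind => r Br; apply: sq_ind => s Bs; apply: sq_ind => t Bt.
by rewrite !sq_addE // ?addrA //; apply: BD.
Qed.
Fact sq_addC : commutative sq_add.
Proof. by apply: sq_ind => r Br; apply: sq_ind => s Bs; rewrite !sq_addE // addrC. Qed.
Fact sq_add0 : left_id (sq_pi 0) sq_add.
Proof. by apply: sq_ind => r Br; rewrite sq_addE // add0r. Qed.
Fact sq_addN : left_inverse (sq_pi 0) sq_opp sq_add.
Proof. by apply: sq_ind => r Br; rewrite sq_oppE // sq_addE ?addNr //; apply: BN. Qed.

HB.instance Definition _ :=
  GRing.isZmodule.Build T sq_addA sq_addC sq_add0 sq_addN.

Fact sq_mulA : associative sq_mul.
Proof.
apply: sq_ind => r Br; apply: sq_ind => s Bs; apply: sq_ind => t Bt.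
by rewrite !sq_mulE // ?mulrA //; apply: BM.
Qed.
Fact sq_mulC : commutative sq_mul.
Proof. by apply: sq_ind => r Br; apply: sq_ind => s Bs; rewrite !sq_mulE // mulrC. Qed.
Fact sq_mul1 : left_id (sq_pi 1) sq_mul.
Proof.
have B1 : B 1 by case: (h).
by apply: sq_ind => r Br; rewrite sq_mulE // mul1r.
Qed.
Fact sq_mulD : left_distributive sq_mul +%R.
Proof.
apply: sq_ind => r Br; apply: sq_ind => s Bs; apply: sq_ind => t Bt.
by rewrite /GRing.add /= !(sq_addE, sq_mulE) // ?mulrDl //; [exact: BM|exact: BM|exact: BD].
Qed.

HB.instance Definition _ :=
  GRing.Zmodule_isComPzRing.Build T sq_mulA sq_mulC sq_mul1 sq_mulD.

Lemma sq_piD r s : B r -> B s -> sq_pi (r + s) = sq_pi r + sq_pi s :> T.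
Proof. by move=> Br Bs; rewrite -sq_addE. Qed.

Lemma sq_piN r : B r -> sq_pi (- r) = - sq_pi r :> T.
Proof. by move=> Br; rewrite -sq_oppE. Qed.

Lemma sq_piB r s : B r -> B s -> sq_pi (r - s) = sq_pi r - sq_pi s :> T.
Proof. by move=> Br Bs; rewrite sq_piD ?sq_piN //; apply: BN. Qed.

Lemma sq_piM r s : B r -> B s -> sq_pi (r * s) = sq_pi r * sq_pi s :> T.
Proof. by move=> Br Bs; rewrite -sq_mulE. Qed.

Lemma sq_pi1 : sq_pi 1 = 1 :> T. Proof. by []. Qed.

Lemma sq_pi0 : sq_pi 0 = 0 :> T. Proof. by []. Qed.

Lemma sq_pi_eq0 r : B r -> sq_pi r = 0 :> T <-> I r.
Proof. by move=> Br; rewrite -sq_pi0 sq_pi_eq // subr0. Qed.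
End SubQuotient.

Lemma quotient_exists (R : comPzRingType) (I : set R) : is_ideal I ->
  exists (Q : comPzRingType) (pi : {rmorphism R -> Q}), is_quotient I pi.
Proof.
move=> hI; have h : subquotient_axiom setT I.
  split=> //; [by id0|]. move=> u v Iv; split=> [w Iw|_]; [by idB|by idM].
pose f r : subquotient h := sq_pi h r.
have fB : zmod_morphism f by move=> r s; rewrite /f sq_piB.
have fM : monoid_morphism f by split=> [|r s]; rewrite /f ?sq_piM.
pose af := GRing.isZmodMorphism.Build _ _ f fB.
pose mf := GRing.isMonoidMorphism.Build _ _ f fM.
pose F : {rmorphism R -> subquotient h} := HB.pack f af mf.
exists (subquotient h : comPzRingType), F; split=> [y|r].
  by exists (sq_repr y); apply: sq_reprK.
exact: sq_pi_eq0.
Qed.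

Section LocalizationRing.
Variables (R : comPzRingType) (S : set R) (hS : mult_closed S).

Definition localization_ring (h : mult_closed S) := {C : set (R * R) |
  exists x, S x.2 /\ C = [set y | S y.2 /\ exists2 t, S t & t * (y.1 * x.2 - x.1 * y.2) = 0]}.
Local Notation T := (localization_ring hS).

HB.instance Definition _ := gen_eqMixin T.
HB.instance Definition _ := gen_choiceMixin T.

Let S1 : S 1. Proof. by case: hS. Qed.
Let SM u v : S u -> S v -> S (u * v). Proof. by case: (hS) => _; apply. Qed.

Let den s := if `[< S s >] then s else 1.
Let denE s : S s -> den s = s. Proof. by move=> Ss; rewrite /den asboolT. Qed.
Let Sden s : S (den s). Proof. by rewrite /den; case: asboolP. Qed.

Fact lpi_subproof r s : exists x, S x.2 /\
  [set y | S y.2 /\ exists2 t, S t & t * (y.1 * den s - r * y.2) = 0] =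
  [set y | S y.2 /\ exists2 t, S t & t * (y.1 * x.2 - x.1 * y.2) = 0].
Proof. by exists (r, den s); split=> //; exact: Sden. Qed.

Definition lpi r s : T := exist _ _ (lpi_subproof r s).
Definition lrepr (x : T) : R * R := sval (cid (svalP x)).

Lemma lreprS x : S (lrepr x).2.
Proof. exact: (proj1 (svalP (cid (svalP x)))). Qed.

Lemma lpi_eq r s r' s' : S s -> S s' ->
  lpi r s = lpi r' s' <-> exists2 t, S t & t * (r * s' - r' * s) = 0.
Proof.
move=> Ss Ss'; split=> [e|[t St ht]].
  have : sval (lpi r' s') (r, s).
    by rewrite -e /= denE //; split=> //; exists 1 => //; rewrite subrr mulr0.
  by rewrite /= denE // => -[_].
apply: eq_exist => /=; rewrite !denE //; apply/seteqP.
split=> -[a b] /= [Sb [u Su hu]]; split=> //.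
  exists (s * t * u); first by apply: SM => //; apply: SM.
  have -> : s * t * u * (a * s' - r' * b) =
    t * s' * (u * (a * s - r * b)) + b * u * (t * (r * s' - r' * s)) by ring.
  by rewrite hu ht !mulr0 addr0.
exists (s' * t * u); first by apply: SM => //; apply: SM.
have -> : s' * t * u * (a * s - r * b) =
  t * s * (u * (a * s' - r' * b)) - b * u * (t * (r * s' - r' * s)) by ring.
by rewrite hu ht !mulr0 subrr.
Qed.

Lemma lreprK x : lpi (lrepr x).1 (lrepr x).2 = x.
Proof.
have e : sval (lpi (lrepr x).1 (lrepr x).2) = sval x.
  rewrite /= denE; last exact: lreprS.
  exact: (esym (proj2 (svalP (cid (svalP x))))).
by move: (lpi _ _) e; case: x => C hC [C' hC'] /= e; apply: eq_exist.
Qed.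

Lemma lpi_ind (P : T -> Prop) : (forall r s, S s -> P (lpi r s)) -> forall x, P x.
Proof. by move=> hP x; rewrite -(lreprK x); apply: hP; apply: lreprS. Qed.

Lemma lrepr_pi r s : S s -> exists2 t, S t &
  t * ((lrepr (lpi r s)).1 * s - r * (lrepr (lpi r s)).2) = 0.
Proof. by move=> Ss; apply/lpi_eq => //; [exact: lreprS|rewrite lreprK]. Qed.

Definition ladd (x y : T) : T := lpi
  ((lrepr x).1 * (lrepr y).2 + (lrepr y).1 * (lrepr x).2) ((lrepr x).2 * (lrepr y).2).
Definition lopp (x : T) : T := lpi (- (lrepr x).1) (lrepr x).2.
Definition lmul (x y : T) : T :=
  lpi ((lrepr x).1 * (lrepr y).1) ((lrepr x).2 * (lrepr y).2).

Lemma laddE r s r' s' : S s -> S s' ->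
  ladd (lpi r s) (lpi r' s') = lpi (r * s' + r' * s) (s * s').
Proof.
move=> Ss Ss'; rewrite /ladd.
have [t St ht] := lrepr_pi r Ss; have [t' St' ht'] := lrepr_pi r' Ss'.
move: (lrepr _) (lreprS (lpi r s)) ht => [a x] /= Sx ht.
move: (lrepr _) (lreprS (lpi r' s')) ht' => [a' x'] /= Sx' ht'.
apply/lpi_eq; [exact: SM|exact: SM|exists (t * t'); first exact: SM].
have -> : t * t' * ((a * x' + a' * x) * (s * s') - (r * s' + r' * s) * (x * x')) =
   t' * s' * x' * (t * (a * s - r * x)) + t * s * x * (t' * (a' * s' - r' * x')) by ring.
by rewrite ht ht' !mulr0 addr0.
Qed.

Lemma loppE r s : S s -> lopp (lpi r s) = lpi (- r) s.
Proof.
move=> Ss; rewrite /lopp; have [t St ht] := lrepr_pi r Ss.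
move: (lrepr _) (lreprS (lpi r s)) ht => [a x] /= Sx ht.
apply/lpi_eq => //; exists t => //.
have -> : t * (- a * s - - r * x) = - (t * (a * s - r * x)) by ring.
by rewrite ht oppr0.
Qed.

Lemma lmulE r s r' s' : S s -> S s' ->
  lmul (lpi r s) (lpi r' s') = lpi (r * r') (s * s').
Proof.
move=> Ss Ss'; rewrite /lmul.
have [t St ht] := lrepr_pi r Ss; have [t' St' ht'] := lrepr_pi r' Ss'.
move: (lrepr _) (lreprS (lpi r s)) ht => [a x] /= Sx ht.
move: (lrepr _) (lreprS (lpi r' s')) ht' => [a' x'] /= Sx' ht'.
apply/lpi_eq; [exact: SM|exact: SM|exists (t * t'); first exact: SM].
have -> : t * t' * (a * a' * (s * s') - r * r' * (x * x')) =
   t' * a' * s' * (t * (a * s - r * x)) + t * r * x * (t' * (a' * s' - r' * x')) by ring.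
by rewrite ht ht' !mulr0 addr0.
Qed.

Let lpi_congr r s r' s' : S s -> S s' -> r * s' = r' * s -> lpi r s = lpi r' s'.
Proof. by move=> Ss Ss' e; apply/lpi_eq => //; exists 1; rewrite // e subrr mulr0. Qed.

Fact laddA : associative ladd.
Proof.
apply: lpi_ind => a x Sx; apply: lpi_ind => b y Sy; apply: lpi_ind => c z Sz.
by rewrite !laddE //; try exact: SM; congr lpi; ring.
Qed.
Fact laddC : commutative ladd.
Proof.
by apply: lpi_ind => a x Sx; apply: lpi_ind => b y Sy; rewrite !laddE //; congr lpi; ring.
Qed.
Fact ladd0 : left_id (lpi 0 1) ladd.
Proof. by apply: lpi_ind => a x Sx; rewrite laddE //; congr lpi; ring. Qed.
Fact laddN : left_inverse (lpi 0 1) lopp ladd.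
Proof.
apply: lpi_ind => a x Sx; rewrite loppE // laddE //.
by apply: lpi_congr => //; [exact: SM|ring].
Qed.

HB.instance Definition _ := GRing.isZmodule.Build T laddA laddC ladd0 laddN.

Fact lmulA : associative lmul.
Proof.
apply: lpi_ind => a x Sx; apply: lpi_ind => b y Sy; apply: lpi_ind => c z Sz.
by rewrite !lmulE //; try exact: SM; congr lpi; ring.
Qed.
Fact lmulC : commutative lmul.
Proof.
by apply: lpi_ind => a x Sx; apply: lpi_ind => b y Sy; rewrite !lmulE //; congr lpi; ring.
Qed.
Fact lmul1 : left_id (lpi 1 1) lmul.
Proof. by apply: lpi_ind => a x Sx; rewrite lmulE //; congr lpi; ring. Qed.
Fact lmulD : left_distributive lmul +%R.
Proof.
apply: lpi_ind => a x Sx; apply: lpi_ind => b y Sy; apply: lpi_ind => c z Sz.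
rewrite /GRing.add /= !(laddE, lmulE) //; try by do ?apply: SM.
by apply: lpi_congr; [by do ?apply: SM|by do ?apply: SM|ring].
Qed.

HB.instance Definition _ :=
  GRing.Zmodule_isComPzRing.Build T lmulA lmulC lmul1 lmulD.

Lemma localization_exists :
  exists (L : comPzRingType) (phi : {rmorphism R -> L}), is_localization S phi.
Proof.
pose f r : T := lpi r 1.
have fB : zmod_morphism f.
  move=> r s; rewrite /f; have -> : lpi s 1 = - lpi (- s) 1 :> T.
    by rewrite [RHS](loppE _ S1) opprK.
  rewrite opprK; change (lpi (r - s) 1 = ladd (lpi r 1) (lpi (- s) 1)).
  by rewrite laddE //; congr lpi; ring.
have fM : monoid_morphism f.
  split=> // r s; rewrite /f; change (lpi (r * s) 1 = lmul (lpi r 1) (lpi s 1)).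
  by rewrite lmulE //; congr lpi; ring.
pose af := GRing.isZmodMorphism.Build _ _ f fB.
pose mf := GRing.isMonoidMorphism.Build _ _ f fM.
pose F : {rmorphism R -> T} := HB.pack f af mf.
exists (T : comPzRingType), F; split=> [s Ss|y|r].
- exists (lpi 1 s); change (lmul (lpi s 1) (lpi 1 s) = lpi 1 1).
  by rewrite lmulE //; apply: lpi_congr => //; [exact: SM|ring].
- move: y; apply: lpi_ind => r s Ss; exists r, s; split=> //.
  change (lmul (lpi s 1) (lpi r s) = lpi r 1).
  by rewrite lmulE //; apply: lpi_congr => //; [exact: SM|ring].
- change (lpi r 1 = lpi 0 1 <-> exists2 s, S s & s * r = 0).
  have e t : t * (r * 1 - 0 * 1) = t * r by ring.
  by rewrite lpi_eq //; split=> -[t St ht]; exists t => //; rewrite ?e // -e.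
Qed.
End LocalizationRing.

Lemma rmorphism_exists (R T : comPzRingType) (f : R -> T) :
  f 1 = 1 -> (forall a b, f (a - b) = f a - f b) ->
  (forall a b, f (a * b) = f a * f b) -> exists F : {rmorphism R -> T}, F =1 f.
Proof.
move=> f1 fB fM.
have fM' : monoid_morphism f by split.
pose af := GRing.isZmodMorphism.Build _ _ f fB.
pose mf := GRing.isMonoidMorphism.Build _ _ f fM'.
by exists (HB.pack_for {rmorphism R -> T} f af mf).
Qed.

(** An equality instead of an isomorphism, so that [subst] turns a ring constructed as a
    [comPzRingType] into one over which polynomials and power series are available. *)
Lemma comnz_exists (R : comPzRingType) : (1 : R) <> 0 ->
  exists T : comNzRingType, (T : comPzRingType) = R.
Proof.
move=> /eqP h; pose m := GRing.PzSemiRing_isNonZero.Build R h.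
by exists (HB.pack_for comNzRingType R m); case: R h m.
Qed.

Lemma field_exists (R : comPzRingType) : (1 : R) <> 0 ->
  (forall x : R, x <> 0 -> exists y, y * x = 1) ->
  exists (K : fieldType) (f : {rmorphism R -> K}), injective f /\
    forall y, exists x, f x = y.
Proof.
move=> /eqP h1 hinv; pose m := GRing.PzSemiRing_isNonZero.Build R h1.
pose R' := HB.pack_for comNzRingType R m.
have /choice [inv hv] : forall x : R, exists y, (x <> 0 -> y * x = 1) /\ (x = 0 -> y = 0).
  move=> x; have [->|x0] := pselect (x = 0); first by exists 0.
  by have [y hy] := hinv x x0; exists y.
have mulVf (x : R') : x != 0 -> inv x * x = 1.
  by move=> /eqP x0; case: (hv x) => + _; apply.
have inv0 : inv (0 : R') = 0 by case: (hv 0) => _; apply.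
pose fm := GRing.ComNzRing_isField.Build R' mulVf inv0.
pose K := HB.pack_for fieldType R' fm.
have [F hF] := @rmorphism_exists R K (fun x => x) erefl (fun _ _ => erefl) (fun _ _ => erefl).
by exists K, F; split=> [x y|y]; [rewrite !hF|exists y; rewrite hF].
Qed.

Definition seqring (R : Type) := nat -> R.

Section SeqRing.
Variable R : comPzRingType.
Local Notation T := (seqring R).

HB.instance Definition _ := gen_eqMixin T.
HB.instance Definition _ := gen_choiceMixin T.

Fact seq_addA : associative (fun (x y : T) n => x n + y n).
Proof. by move=> x y z; apply/funext => n; rewrite addrA. Qed.
Fact seq_addC : commutative (fun (x y : T) n => x n + y n).
Proof. by move=> x y; apply/funext => n; rewrite addrC. Qed.
Fact seq_add0 : left_id (fun=> 0) (fun (x y : T) n => x n + y n).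
Proof. by move=> x; apply/funext => n; rewrite add0r. Qed.
Fact seq_addN : left_inverse (fun=> 0) (fun (x : T) n => - x n)
  (fun (x y : T) n => x n + y n).
Proof. by move=> x; apply/funext => n; rewrite addNr. Qed.
HB.instance Definition _ := GRing.isZmodule.Build T seq_addA seq_addC seq_add0 seq_addN.

Fact seq_mulA : associative (fun (x y : T) n => x n * y n).
Proof. by move=> x y z; apply/funext => n; rewrite mulrA. Qed.
Fact seq_mulC : commutative (fun (x y : T) n => x n * y n).
Proof. by move=> x y; apply/funext => n; rewrite mulrC. Qed.
Fact seq_mul1 : left_id (fun=> 1) (fun (x y : T) n => x n * y n).
Proof. by move=> x; apply/funext => n; rewrite mul1r. Qed.
Fact seq_mulD : left_distributive (fun (x y : T) n => x n * y n) +%R.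
Proof. by move=> x y z; apply/funext => n; rewrite mulrDl. Qed.
HB.instance Definition _ :=
  GRing.Zmodule_isComPzRing.Build T seq_mulA seq_mulC seq_mul1 seq_mulD.

Lemma seq_BE (x y : T) n : (x - y) n = x n - y n. Proof. by []. Qed.

Lemma seq_ME (x y : T) n : (x * y) n = x n * y n. Proof. by []. Qed.

Lemma seq_XE (x : T) k n : (x ^+ k) n = x n ^+ k.
Proof. by elim: k => [//|k IH]; rewrite !exprS seq_ME IH. Qed.
End SeqRing.

Section IdealExtension.
Variables (R A : comPzRingType) (phi : {rmorphism R -> A}).

Lemma ideal_ext_ideal I : is_ideal (ideal_ext phi I).
Proof. exact: gen_ideal_ideal. Qed.

Lemma ideal_ext_in (I : set R) r : I r -> ideal_ext phi I (phi r).
Proof. by move=> Ir; apply: gen_sub; exists r. Qed.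

Lemma ideal_ext_min (I : set R) (J : set A) : is_ideal J ->
  (forall r, I r -> J (phi r)) -> ideal_ext phi I `<=` J.
Proof. by move=> hJ h; apply: gen_min => // _ [r Ir <-]; apply: h. Qed.

Lemma ideal_extS (I J : set R) : I `<=` J -> ideal_ext phi I `<=` ideal_ext phi J.
Proof.
move=> IJ; apply: ideal_ext_min; first exact: ideal_ext_ideal.
by move=> r /IJ; apply: ideal_ext_in.
Qed.

Lemma ideal_ext_gen (E : set R) :
  ideal_ext phi (gen_ideal E) = gen_ideal (phi @` E).
Proof.
apply/seteqP; split; last first.
  by apply: gen_idealS => _ [r Er <-]; exists r => //; apply: gen_sub.
apply: ideal_ext_min => // r.
apply: (gen_min (I := [set r | gen_ideal (phi @` E) (phi r)])) => [|u Eu].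
  split=> [|u v hu hv|s u hu] /=; first by rewrite rmorph0; id0.
    by rewrite rmorphD; idD.
  by rewrite rmorphM; idM.
by apply: gen_sub; exists u.
Qed.

Lemma preim_ideal (J : set A) : is_ideal J -> is_ideal (phi @^-1` J).
Proof.
move=> hJ; split=> [|u v hu hv|s u hu] /=; first by rewrite rmorph0; id0.
  by rewrite rmorphD; idD.
by rewrite rmorphM; idM.
Qed.

Lemma preim_prime (J : set A) : prime_ideal J -> prime_ideal (phi @^-1` J).
Proof.
move=> [hJ J1 Jm]; split; first exact: preim_ideal.
  by rewrite /= rmorph1.
by move=> u v; rewrite /= rmorphM => /Jm.
Qed.

Lemma ideal_ext_idealX (I : set R) n u : is_ideal I ->
  idealX I n u -> idealX (ideal_ext phi I) n (phi u).
Proof.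
move=> hI; elim: n u => [//|n IH]; apply: idealM_min.
  by apply: preim_ideal.
move=> u v Iu /IH h; rewrite /= rmorphM; apply: idealX_mulS => //.
exact: ideal_ext_in.
Qed.

Lemma surj_noetherian : (forall y, exists r, phi r = y) -> noetherian R -> noetherian A.
Proof.
move=> sf nR; apply: fg_noetherian => J hJ.
have [n [x ex]] := noetherian_fg nR (preim_ideal hJ).
exists n, (fun i => phi (x i)); apply/seteqP; split=> [y Jy|].
  have [r er] := sf y; have : (phi @^-1` J) r by rewrite /= er.
  rewrite ex => /gen_rangeP [c ec]; apply/gen_rangeP; exists (fun i => phi (c i)).
  by rewrite -er ec rmorph_sum; apply: eq_bigr => i _; rewrite rmorphM.
apply: gen_min => // _ [i _ <-]; have : (phi @^-1` J) (x i) by rewrite ex; apply: gen_sub; exists i.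
by [].
Qed.
End IdealExtension.

#[export] Hint Resolve ideal_ext_ideal : core.

Section Localization.
Variables (R L : comPzRingType) (S : set R) (phi : {rmorphism R -> L}).
Hypothesis loc : is_localization S phi.
Hypothesis hS : mult_closed S.

Lemma loc_inv s : S s -> exists y, y * phi s = 1.
Proof. by case: loc => h _ _ /h [y hy]; exists y; rewrite mulrC. Qed.

Lemma loc_cancel (J : set L) s y : is_ideal J -> S s -> J (phi s * y) -> J y.
Proof.
move=> hJ /loc_inv [z hz] h; have -> : y = z * (phi s * y) by rewrite mulrA hz mul1r.
by idM.
Qed.

Lemma loc_inj s x y : S s -> phi s * x = phi s * y -> x = y.
Proof.
move=> Ss e; apply/eqP; rewrite -subr_eq0; apply/eqP.
by apply: (loc_cancel (set0_ideal L) Ss); rewrite /= mulrBr e subrr.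
Qed.

Lemma loc_frac y : exists r s, S s /\ phi s * y = phi r.
Proof. by case: loc => _ + _; apply. Qed.

Lemma loc_eq0 r : phi r = 0 <-> exists2 s, S s & s * r = 0.
Proof. by case: loc. Qed.

Lemma loc_extP I y : is_ideal I -> ideal_ext phi I y <->
  exists r s, [/\ I r, S s & phi s * y = phi r].
Proof.
move=> hI; have [S1 SM] := hS; split=> [|[r [s [Ir Ss e]]]]; last first.
  by apply: (loc_cancel (ideal_ext_ideal phi _) Ss); rewrite e; apply: ideal_ext_in.
apply: (ideal_ext_min (J := [set y | exists r s, [/\ I r, S s & phi s * y = phi r]])) => [|r Ir].
  split=> [|u v [r [s [Ir Ss e]]] [r' [s' [Ir' Ss' e']]]|x u [r [s [Ir Ss e]]]].
  - by exists 0, 1; rewrite mulr0 rmorph0; split=> //; id0.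
  - exists (s' * r + s * r'), (s * s'); split; [by idD => //; idM|exact: SM|].
    by rewrite rmorphD !rmorphM -e -e'; ring.
  - have [a [t [St et]]] := loc_frac x.
    exists (a * r), (t * s); split; [by idM|exact: SM|].
    by rewrite !rmorphM -e -et; ring.
by exists r, 1; rewrite rmorph1 mul1r.
Qed.

Lemma loc_ext_phi I r : is_ideal I -> ideal_ext phi I (phi r) <->
  exists2 s, S s & I (s * r).
Proof.
move=> hI; have [S1 SM] := hS; rewrite loc_extP //; split=> [[a [s [Ia Ss e]]]|[s Ss hs]].
  have /loc_eq0 [t St ht] : phi (s * r - a) = 0 by rewrite rmorphB rmorphM e subrr.
  exists (t * s); first exact: SM.
  by rewrite -mulrA -(subrK a (s * r)) mulrDr ht add0r; idM.
by exists (s * r), s; rewrite rmorphM.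
Qed.

Lemma loc_ext_contr J : is_ideal J -> ideal_ext phi (phi @^-1` J) = J.
Proof.
move=> hJ; apply/seteqP; split; first exact: ideal_ext_min.
move=> y Jy; have [r [s [Ss e]]] := loc_frac y.
apply: (loc_cancel (ideal_ext_ideal phi _) Ss); rewrite e.
by apply: ideal_ext_in; rewrite /= -e; idM.
Qed.

Lemma loc_prime_disj J s : prime_ideal J -> S s -> ~ J (phi s).
Proof.
move=> [hJ J1 _] Ss Js; apply: J1; apply: (loc_cancel hJ Ss).
by rewrite mulr1.
Qed.

Lemma loc_contr_ext P : prime_ideal P -> (forall s, S s -> ~ P s) ->
  phi @^-1` (ideal_ext phi P) = P.
Proof.
move=> pP PS; apply/seteqP; split=> [r /loc_ext_phi|r Pr]; last exact: ideal_ext_in.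
move=> /(_ (prime_is_ideal pP)) [s Ss]; case: (pP) => _ _ h /h [Ps|//].
by case: (PS _ Ss).
Qed.

Lemma loc_ext_prime P : prime_ideal P -> (forall s, S s -> ~ P s) ->
  prime_ideal (ideal_ext phi P).
Proof.
move=> pP PS; have cP := loc_contr_ext pP PS.
have Pphi r : ideal_ext phi P (phi r) -> P r by move=> h; rewrite -cP.
split=> [//||u v].
  by rewrite -(rmorph1 phi) => /Pphi; case: pP.
have [r [s [Ss e]]] := loc_frac u; have [r' [s' [Ss' e']]] := loc_frac v.
move=> huv; have : P (r * r').
  apply: Pphi; rewrite rmorphM -e -e'.
  by rewrite mulrACA; idM.
case: (pP) => _ _ h /h [Pr|Pr']; [left|right].
  by apply: (loc_cancel (ideal_ext_ideal phi _) Ss); rewrite e; apply: ideal_ext_in.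
by apply: (loc_cancel (ideal_ext_ideal phi _) Ss'); rewrite e'; apply: ideal_ext_in.
Qed.

Lemma loc_universal (C : comPzRingType) (f : {rmorphism R -> C}) :
  (forall s, S s -> exists y, y * f s = 1) ->
  exists g : {rmorphism L -> C}, forall r, g (phi r) = f r.
Proof.
move=> hf; have [S1 SM] := hS.
have /choice [g hg] : forall y, exists z, exists r s w,
    [/\ S s, phi s * y = phi r, w * f s = 1 & z = f r * w].
  move=> y; have [r [s [Ss e]]] := loc_frac y; have [w hw] := hf s Ss.
  by exists (f r * w), r, s, w.
have gE y r s : S s -> phi s * y = phi r -> f s * g y = f r.
  move=> Ss e; have [r' [s' [w [Ss' e' hw ->]]]] := hg y.
  have /loc_eq0 [t St ht] : phi (s * r' - s' * r) = 0.
    by rewrite rmorphB !rmorphM -e -e'; ring.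
  have [z hz] := hf t St.
  have : f (s * r') = f (s' * r).
    apply/eqP; rewrite -subr_eq0 -rmorphB -[f _]mul1r -hz -mulrA -rmorphM ht.
    by rewrite rmorph0 mulr0.
  rewrite !rmorphM => h; rewrite mulrA h -[RHS]mul1r -hw; ring.
have fcan s x y : S s -> f s * x = f s * y -> x = y.
  move=> Ss e; have [z hz] := hf s Ss.
  by rewrite -(mul1r x) -(mul1r y) -hz -!mulrA e.
have g1 : g 1 = 1.
  by apply: (fcan 1) => //; rewrite (gE 1 1 1) // ?rmorph1 ?mulr1 // mul1r.
have gB a b : g (a - b) = g a - g b.
  have [r [s [Ss e]]] := loc_frac a; have [r' [s' [Ss' e']]] := loc_frac b.
  apply: (fcan (s * s')); first exact: SM.
  rewrite (gE (a - b) (s' * r - s * r')); [|exact: SM|].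
    by rewrite rmorphB !rmorphM -(gE a r s) // -(gE b r' s') //; ring.
  by rewrite rmorphB !rmorphM -e -e'; ring.
have gM a b : g (a * b) = g a * g b.
  have [r [s [Ss e]]] := loc_frac a; have [r' [s' [Ss' e']]] := loc_frac b.
  apply: (fcan (s * s')); first exact: SM.
  rewrite (gE (a * b) (r * r')); [|exact: SM|].
    by rewrite !rmorphM -(gE a r s) // -(gE b r' s') //; ring.
  by rewrite !rmorphM -e -e'; ring.
have [G hG] := rmorphism_exists g1 gB gM; exists G => r; rewrite hG.
by apply: (fcan 1) => //; rewrite (gE (phi r) r 1) // rmorph1 mul1r.
Qed.

Lemma loc_unique (C : comPzRingType) (g h : {rmorphism L -> C}) :
  (forall r, g (phi r) = h (phi r)) -> g =1 h.
Proof.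
move=> e y; have [r [s [Ss ey]]] := loc_frac y.
have [z hz] := loc_inv Ss.
have cs x : h z * (h (phi s) * x) = x by rewrite mulrA -rmorphM hz rmorph1 mul1r.
rewrite -(cs (g y)) -(cs (h y)); congr (_ * _).
by rewrite -(rmorphM h) ey -e -e -rmorphM ey.
Qed.
End Localization.

Section Quotient.
Variables (R Q : comPzRingType) (I : set R) (pi : {rmorphism R -> Q}).
Hypotheses (hI : is_ideal I) (quo : is_quotient I pi).

Lemma quo_surj y : exists r, pi r = y. Proof. by case: quo => h _; apply: h. Qed.

Lemma quo_eq0 r : pi r = 0 <-> I r. Proof. by case: quo. Qed.

Lemma quo_eq r s : pi r = pi s <-> I (r - s).
Proof.
rewrite -quo_eq0 rmorphB; split=> [->|/eqP]; first by rewrite subrr.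
by rewrite subr_eq0 => /eqP.
Qed.

Lemma quo_noetherian : noetherian R -> noetherian Q.
Proof. exact: surj_noetherian quo_surj. Qed.

Lemma quo_universal (C : comPzRingType) (f : {rmorphism R -> C}) :
  (forall r, I r -> f r = 0) ->
  exists g : {rmorphism Q -> C}, forall r, g (pi r) = f r.
Proof.
move=> hf; have /choice [rp hrp] := quo_surj.
have fE r s : pi r = pi s -> f r = f s.
  by move=> /quo_eq /hf; rewrite rmorphB => /eqP; rewrite subr_eq0 => /eqP.
pose g y := f (rp y).
have gE r : g (pi r) = f r by apply: fE; rewrite hrp.
have g1 : g 1 = 1 by rewrite -(rmorph1 pi) gE rmorph1.
have gB a b : g (a - b) = g a - g b.
  by rewrite -(hrp a) -(hrp b) -rmorphB !gE rmorphB.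
have gM a b : g (a * b) = g a * g b.
  by rewrite -(hrp a) -(hrp b) -rmorphM !gE rmorphM.
by have [G hG] := rmorphism_exists g1 gB gM; exists G => r; rewrite hG.
Qed.

Lemma quo_preim_sub (J : set Q) : is_ideal J -> I `<=` pi @^-1` J.
Proof. by move=> hJ r /quo_eq0 /= ->; id0. Qed.
End Quotient.

(** * Regular local rings *)

Section LocalRing.
Variables (R : comPzRingType) (m : set R).
Hypotheses (nR : noetherian R) (lR : local_ring m).

Lemma local_prime : prime_ideal m.
Proof. by apply: maximal_prime; case: lR. Qed.

Lemma local_sub I : is_ideal I -> ~ I 1 -> I `<=` m.
Proof.
move=> hI I1; have [|M [hM [IM M1] mM]] := noetherian_max nR
    (Phi := fun J => I `<=` J /\ ~ J 1); first by exists I; split=> //; split.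
suff <- : M = m by [].
case: lR => _; apply; split=> // J hJ J1 MJ; apply: mM => //; split=> //.
exact: subset_trans IM MJ.
Qed.

Lemma local_prime_sub P : prime_ideal P -> P `<=` m.
Proof. by move=> [hP P1 _]; apply: local_sub. Qed.

Lemma local_unit r : ~ m r -> exists s, s * r = 1.
Proof.
move=> mr; apply: contrapT => nr; apply: mr.
apply: (local_sub (prI_ideal r)); last exact: prI_self.
by move=> [s e]; apply: nr; exists s.
Qed.

Lemma local_jac : jac m.
Proof.
move=> r mr; apply: local_unit => h; have [hm m1 _] := local_prime.
by apply: m1; rewrite -(subrK r 1); idD.
Qed.

Lemma jac_sub (I : set R) : I `<=` m -> jac I.
Proof. by move=> Im r /Im; apply: local_jac. Qed.
End LocalRing.

Section RegularLocal.
Variables (p : nat) (R : comPzRingType) (m : set R).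
Hypotheses (pp : prime p) (pR : p%:R = 0 :> R).
Hypotheses (nR : noetherian R) (lR : local_ring m).

Let mM : maximal_ideal m. Proof. by case: lR. Qed.
Let pm := local_prime lR.
Let lP := local_prime_sub nR lR.

Lemma prime_chain_trunc (l k : nat) (c : nat -> set R) : (k <= l)%N ->
  prime_chain l c -> prime_chain k c.
Proof.
move=> kl [cp cs]; split=> i ik; first by apply: cp; apply: leq_trans kl.
by apply: cs; apply: leq_trans kl.
Qed.

(** Otherwise fewer than [j] parameters suffice for [J + (y)], and together with [y] at most [j]
    suffice for [J], against the chain of length [j.+1]. *)
Lemma chain_drop j J y c : is_ideal J -> m y -> prime_chain j.+1 c ->
  J `<=` c 0%N -> exists c', prime_chain j c' /\ addI J (prI y) `<=` c' 0%N.
Proof.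
move=> hJ my hc Jc; apply: contrapT => nc.
have hm := prime_is_ideal pm.
have Jm : J `<=` m.
  by apply: subset_trans Jc _; apply: lP; case: hc => cp _; apply: cp.
have Jym : addI J (prI y) `<=` m by apply: addI_min => //; apply: prI_sub.
case: j hc nc => [|j] hc nc.
  by apply: nc; exists (fun=> m); split=> //; split.
have [||x [mx hx]] := sop_exists nR mM lP (k := j) (J := addI J (prI y)).
- by auto.
- move=> l c' hc' Jc'; rewrite leqNgt; apply/negP => jl; apply: nc.
  by exists c'; split=> //; apply: prime_chain_trunc hc'.
suff : (j.+2 <= j.+1)%N by rewrite ltnn.
pose x' (i : 'I_j.+1) := if unlift ord0 i is Some i' then x i' else y.
apply: (dim_le nR mM lP (x := x') hJ _ _ hc Jc) => [P pP JP hP|i].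
  apply: hx => // [|i].
    apply: addI_min => //; first by case: pP.
    apply: prI_sub; first by case: pP.
    by have := hP ord0; rewrite /x' unlift_none.
  by have := hP (lift ord0 i); rewrite /x' liftK.
by rewrite /x'; case: unliftP => [i' _|_].
Qed.

(** Some parameter [y] lies outside the bottom prime [c 0] of the chain. The induction makes
    [J + (y)] prime, a dimension count identifies it with [c 0 + (y)], and Nakayama gives [J = c 0].
    So [J] is prime, [y] is a nonzero-divisor modulo [J], and flatness lifts from [J + (y)]. *)
Lemma regular_tower j : forall J (x : 'I_j -> R) c, is_ideal J ->
  m = addI J (gen_ideal (range x)) -> prime_chain j c -> J `<=` c 0%N ->
  prime_ideal J /\ frob_flat J p.
Proof.
have hm := prime_is_ideal pm.
elim: j => [|j IH] J x c hJ em hc Jc.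
  have -> : J = m.
    rewrite em; apply/seteqP; split; first exact: addI_l.
    by apply: addI_min => // u /gen_rangeP [c' ->]; rewrite big_ord0; id0.
  split=> //; apply: frob_flat_field => // r /(local_unit nR lR) [s e].
  by exists s; rewrite e subrr; id0.
have pc0 : prime_ideal (c 0%N) by case: hc => cp _; apply: cp.
have hc0 := prime_is_ideal pc0.
have [i ci] : exists i, ~ c 0%N (x i).
  apply: contrapT => ni; have [_ cs] := hc; have [_] := cs 0%N isT; case.
  have mc : m `<=` c 0%N.
    rewrite em; apply: addI_min => //; apply: gen_min => // _ [i _ <-].
    by apply: contrapT => nc; apply: ni; exists i.
  by apply: subset_trans mc; apply: lP; case: hc => cp _; apply: cp.
set y := x i; pose x' k := x (lift i k).
have gx : gen_ideal (range x) `<=` m by rewrite em; apply: addI_r.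
have my : m y by apply: gx; apply: gen_sub; exists i.
have mx' : gen_ideal (range x') `<=` m.
  by apply: gen_min => // _ [k _ <-]; apply: gx; apply: gen_sub; exists (lift i k).
have em' J' : is_ideal J' -> J `<=` J' -> J' `<=` m ->
    m = addI (addI J' (prI y)) (gen_ideal (range x')).
  move=> hJ' JJ' J'm; apply/seteqP; split; last first.
    by apply: addI_min => //; apply: addI_min => //; apply: prI_sub.
  rewrite {1}em; apply: addI_min; first by auto.
    by move=> u /JJ' J'u; do 2!apply: addI_l => //.
  apply: gen_min => [|_ [k _ <-]]; first by auto.
  have [k' ->|->] := unliftP i k.
    by apply: addI_r; [auto|apply: gen_sub; exists k'].
  by apply: addI_l => //; apply: addI_r => //; apply: prI_self.
have Jm : J `<=` m by apply: subset_trans Jc _; apply: lP.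
have [c1 [hc1 Jc1]] := chain_drop hJ my hc Jc.
have [pJy ffy] := IH _ x' c1 (addI_ideal hJ (prI_ideal y)) (em' _ hJ (fun _ h => h) Jm) hc1 Jc1.
have [c2 [hc2 Jc2]] := chain_drop hc0 my hc (fun _ h => h).
(* Otherwise the prime [J + (y)] could be put below the chain over [c 0 + (y)], which would give
   length [j.+1] with only [j] parameters. *)
have e : addI J (prI y) = addI (c 0%N) (prI y).
  apply: contrapT => ne.
  have s1 : addI J (prI y) `<=` addI (c 0%N) (prI y).
    apply: addI_min; [by auto| |exact: addI_r].
    by move=> u /Jc; apply: addI_l.
  have s2 : ~ addI (c 0%N) (prI y) `<=` addI J (prI y) by move=> s2; apply: ne; apply/seteqP.
  suff : (j.+1 <= j)%N by rewrite ltnn.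
  apply: (dim_le nR mM lP (J := addI J (prI y)) (x := x') _ _ _
     (c := fun n => if n is n'.+1 then c2 n' else addI J (prI y))).
  - by auto.
  - move=> P pP JP xP; have hP := prime_is_ideal pP.
    apply/seteqP; split; first exact: lP.
    rewrite (em' J) //; apply: addI_min => //; apply: gen_min => // _ [k _ <-].
    exact: xP.
  - by move=> k; apply: mx'; apply: gen_sub; exists k.
  - case: hc2 => cp2 cs2; split=> -[|n] //= nj; [exact: cp2| |exact: cs2].
    split; first exact: subset_trans s1 Jc2.
    by move=> h; apply: s2; apply: subset_trans Jc2 h.
  - by [].
have eJ : c 0%N = J.
  apply/seteqP; split=> //.
  (* In [v = (v - r * y) + r * y] the second term lies in the prime [c 0], which does not contain
     [y]; so [r] lies in [c 0], and [c 0] is contained in [J + m * c 0]. *)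
  apply: (nak_ideal nR hm (local_jac nR lR) hJ hc0) => v cv.
  have : addI J (prI y) v by rewrite e; apply: addI_l.
  move=> /addI_prP [r hr].
  exists (v - r * y), (r * y); rewrite subrK; split=> //.
  rewrite mulrC; apply: idealM_in => //.
  have : c 0%N (r * y).
    have -> : r * y = v - (v - r * y) by ring.
    by idB => //; apply: Jc.
  by case: (pc0) => _ _ h /h [].
have pJ : prime_ideal J by rewrite -eJ.
split=> //; apply: (kunz_step pp pR nR hJ _ _ ffy).
  by apply: (jac_sub nR lR); apply: prI_sub.
move=> u; case: (pJ) => _ _ h /h [Jy|//]; case: ci; exact: Jc.
Qed.
End RegularLocal.

Lemma regular_local_props (p : nat) (R : comPzRingType) :
  prime p -> p%:R = 0 :> R -> regular_local R ->
  [/\ noetherian R, exists m : set R, local_ring m,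
      (forall u v : R, u * v = 0 -> u = 0 \/ v = 0) & frob_flat ([set 0] : set R) p].
Proof.
move=> pp pR [m [d [nR lR [[c hc] _] [x ex]]]].
have em : m = addI [set 0] (gen_ideal (range x)).
  rewrite -ex; apply/seteqP; split; first exact: addI_r.
  have hm := prime_is_ideal (local_prime lR).
  by apply: addI_min => // _ ->; id0.
have c0 : [set 0] `<=` c 0%N.
  by move=> _ ->; id0; apply: prime_is_ideal; case: hc => cp _; apply: cp.
have [[h0 _ hz] ff] := regular_tower pp pR nR lR (set0_ideal R) em hc c0.
by split=> //; exists m.
Qed.

(** * Linear forms on a finite algebra over a ring with flat Frobenius *)

Lemma submodule_fg (A : comPzRingType) (r : nat) (N : ('I_r -> A) -> Prop) :
  noetherian A -> N (fun=> 0) -> (forall u v, N u -> N v -> N (fun j => u j + v j)) ->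
  (forall c u, N u -> N (fun j => c * u j)) ->
  exists k (g : 'I_k -> 'I_r -> A), (forall i, N (g i)) /\
    forall u, N u -> exists c, forall j, u j = \sum_i c i * g i j.
Proof.
move=> nA; elim: r N => [|r IH] N N0 ND NZ.
  exists 0%N, (fun _ _ => 0); split=> [[]//|u _]; by exists (fun=> 0) => -[].
pose I := [set a | exists u, N u /\ u ord0 = a].
have hI : is_ideal I.
  split=> [|_ _ [u [Nu <-]] [v [Nv <-]]|c _ [u [Nu <-]]].
  - by exists (fun=> 0).
  - by exists (fun j => u j + v j); split=> //; apply: ND.
  - by exists (fun j => c * u j); split=> //; apply: NZ.
have [k [x ex]] := noetherian_fg nA hI.
have /choice [g0 hg0] : forall i, exists u, N u /\ u ord0 = x i.
  by move=> i; have : I (x i) by rewrite ex; apply: gen_sub; exists i.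
pose cons0 (u : 'I_r -> A) j := if unlift ord0 j is Some j' then u j' else 0.
have [|u v|c u|k' [g1 [hg1 sg1]]] := IH (fun u => N (cons0 u)).
- suff -> : cons0 (fun=> 0) = (fun=> 0) by [].
  by apply/funext => j; rewrite /cons0; case: unlift.
- move=> Nu Nv; suff -> : cons0 (fun j => u j + v j) = (fun j => cons0 u j + cons0 v j).
    exact: ND.
  by apply/funext => j; rewrite /cons0; case: unlift => //; rewrite addr0.
- move=> Nu; suff -> : cons0 (fun j => c * u j) = (fun j => c * cons0 u j).
    exact: NZ.
  by apply/funext => j; rewrite /cons0; case: unlift => //; rewrite mulr0.
exists (k + k')%N, (fun i => match split i with inl i => g0 i | inr i => cons0 (g1 i) end).
split=> [i|u Nu]; first by case: split => i' //; case: (hg0 i').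
have : I (u ord0) by exists u.
rewrite ex => /gen_rangeP [c ec].
pose u' j := u j - \sum_i c i * g0 i j.
have Nsum (s : seq 'I_k) : N (fun j => \sum_(i <- s) c i * g0 i j).
  elim: s => [|i s IHs].
    suff -> : (fun j => \sum_(i <- [::]) c i * g0 i j) = (fun=> 0) by [].
    by apply/funext => j; rewrite big_nil.
  suff -> : (fun j => \sum_(i <- i :: s) c i * g0 i j) =
      (fun j => c i * g0 i j + \sum_(i <- s) c i * g0 i j).
    by apply: ND => //; apply: NZ; case: (hg0 i).
  by apply/funext => j; rewrite big_cons.
have Nu' : N u'.
  suff -> : u' = (fun j => u j + -1 * \sum_i c i * g0 i j) by apply: ND => //; apply: NZ.
  by apply/funext => j; rewrite mulN1r.
have u'0 : u' ord0 = 0.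
  by rewrite /u' ec; apply/eqP; rewrite subr_eq0; apply/eqP/eq_bigr => i _; case: (hg0 i) => _ ->.
have [|c' ec'] := sg1 (fun j => u' (lift ord0 j)).
  suff -> : cons0 (fun j => u' (lift ord0 j)) = u' by [].
  by apply/funext => j; rewrite /cons0; case: unliftP => [j' ->|->].
exists (fun i => match split i with inl i => c i | inr i => c' i end) => j.
rewrite big_split_ord /=.
under eq_bigr do rewrite (unsplitK (inl _ _)).
under [X in _ + X]eq_bigr do rewrite (unsplitK (inr _ _)).
suff -> : \sum_i c' i * cons0 (g1 i) j = u' j by rewrite addrC subrK.
rewrite /cons0; case: unliftP => [j' ->|->]; first by rewrite -ec'.
by rewrite u'0 big1 // => i _; rewrite mulr0.
Qed.

Section Factors.
Variables (A B : comPzRingType) (iota : {rmorphism A -> B}).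

(* Multiplication by [c] on [B] factors through a finite free [A]-module. *)
Definition factors (c : B) := exists (K : finType) (phi : K -> B -> A) (w : K -> B),
  [/\ forall i b b', phi i (b + b') = phi i b + phi i b',
      forall i a b, phi i (iota a * b) = a * phi i b &
      forall b, c * b = \sum_i iota (phi i b) * w i].

(** This makes [prime_avoiding] applicable: if no prime that avoids a given multiplicative set
    contains [factors], then [factors] meets that set. *)
Lemma factors_ideal : is_ideal factors.
Proof.
split=> [|c c' [K [f [w [fD fZ fE]]]] [K' [f' [w' [fD' fZ' fE']]]]
  |r c [K [f [w [fD fZ fE]]]]].
- exists void, (fun _ _ => 0), (fun=> 0); split=> [[]|[]|b] //.
  by rewrite mul0r big1 // => -[].
- exists (K + K')%type, (fun i => match i with inl i => f i | inr i => f' i end),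
    (fun i => match i with inl i => w i | inr i => w' i end).
  by split=> [[]|[]|b] //; rewrite big_sumType /= mulrDl fE fE'.
- exists K, f, (fun i => r * w i); split=> // b.
  by rewrite -mulrA fE mulr_sumr; apply: eq_bigr => i _; rewrite mulrCA.
Qed.

Lemma scaled_linear_sum (phi : B -> A) (T : finType) (a : T -> A) (b : T -> B) :
  (forall b b', phi (b + b') = phi b + phi b') ->
  (forall a b, phi (iota a * b) = a * phi b) ->
  phi (\sum_j iota (a j) * b j) = \sum_j a j * phi (b j).
Proof.
move=> fD fZ; have f0 : phi 0 = 0 by rewrite -(mul0r 0) -(rmorph0 iota) fZ mul0r.
rewrite (big_morph phi fD f0); apply: eq_bigr => j _; exact: fZ.
Qed.

Section AtPrime.
Variables (p r : nat) (e : 'I_r -> B).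
Hypotheses (pp : prime p) (pA : p%:R = 0 :> A).
Hypothesis gen_e : forall b, exists a : 'I_r -> A, b = \sum_j iota (a j) * e j.
Hypotheses (nA : noetherian A) (ffA : frob_flat ([set 0] : set A) p).
Variables (Q : set B) (L : comPzRingType) (psi : {rmorphism B -> L}).
Hypotheses (pQ : prime_ideal Q) (loc : is_localization (~` Q) psi).
Hypothesis regL : regular_local L.

(** A dual basis of [B] over [A] near [Q], obtained from Frobenius instead of depth. The linear
    forms belonging to [c0] are applied to [e j ^+ q], [q = p ^ N]: flatness for [A] expresses the
    values by [q]-th powers of linear forms on [B], and flatness for [L] then expresses [psi c0] by
    [q]-th powers of elements of [D]. If [D] were proper, [psi c0] would lie in all powers of the
    maximal ideal and vanish. So [1] lies in [D], and denominators are cleared. *)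
Lemma factors_at_prime c0 : factors c0 -> psi c0 <> 0 ->
  exists s, ~ Q s /\ factors s.
Proof.
move=> [K [phi [w [fD fZ fE]]]] c0n.
have pL : p%:R = 0 :> L by rewrite -(rmorph_nat psi) -(rmorph_nat iota) pA !rmorph0.
have pB : p%:R = 0 :> B by rewrite -(rmorph_nat iota) pA rmorph0.
have [nL [n lL] _ ffL] := regular_local_props pp pL regL.
have [|u v|c u|k [g [hg sg]]] := submodule_fg
    (N := fun rho : 'I_r -> A => \sum_j iota (rho j) * e j = 0) nA.
- by rewrite big1 // => j _; rewrite rmorph0 mul0r.
- move=> hu hv; under eq_bigr do rewrite rmorphD mulrDl.
  by rewrite big_split /= hu hv addr0.
- move=> hu; under eq_bigr do rewrite rmorphM -mulrA.
  by rewrite -mulr_sumr hu mulr0.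
(* A vector in [M] respects the relations among the [e j]; it lists the values at the [e j] of an
   [A]-linear map from [B] to [A]. *)
pose M (h : 'I_r -> A) := forall i, \sum_j g i j * h j = 0.
pose D := [set z : L | exists (T : finType) (W : T -> L) (h : T -> 'I_r -> A),
  (forall t, M (h t)) /\ forall j, z * psi (e j) = \sum_t W t * psi (iota (h t j))].
have hD : is_ideal D.
  split=> [|z z' [T [W [h [hM hz]]]] [T' [W' [h' [hM' hz']]]]|c z [T [W [h [hM hz]]]]].
  - exists void, (fun=> 0), (fun _ _ => 0); split=> [[]//|j].
    by rewrite mul0r big1 // => -[].
  - exists (T + T')%type, (fun i => match i with inl i => W i | inr i => W' i end),
      (fun i => match i with inl i => h i | inr i => h' i end).
    by split=> [[]//|j]; rewrite big_sumType /= mulrDl hz hz'.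
  - exists T, (fun t => c * W t), h; split=> // j.
    by rewrite -mulrA hz mulr_sumr; apply: eq_bigr => t _; rewrite mulrA.
have D1 : D 1.
  apply: contrapT => D1; apply: c0n.
  have Dn := local_sub nL lL hD D1.
  have hn := prime_is_ideal (local_prime lL).
  apply: (krull_intersection nL hn (local_jac nL lL) (set0_ideal L)) => N.
  apply: addI_r => //.
  have -> : psi c0 = psi c0 * 1 by rewrite mulr1.
  pose q := (p ^ N)%N.
  (* The [q]-th powers of the coefficients of a relation among the [e j] give a relation among the
     [e j ^+ q], and [phi i] is linear. *)
  have hv i : frspan q M (fun j => phi i (e j ^+ q)).
    have fs := frob_flat_iter pp pA (n := N) (set0_ideal A) ffA.
    have [|v0 hv0 e0] := fs _ [seq g i | i : 'I_k] (fun j => phi i (e j ^+ q)).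
      move=> _ /mapP [i' _ ->] /=; rewrite -scaled_linear_sum; [|exact: fD|exact: fZ].
      have -> : \sum_j iota (g i' j ^+ (p ^ N)) * e j ^+ q =
          (\sum_j iota (g i' j) * e j) ^+ q.
        rewrite /q (frob_sum pp pB); apply: eq_bigr => j _.
        by rewrite rmorphXn exprMn.
      rewrite hg /q (frob0 _ pp) -(mul0r 0) -(rmorph0 iota) fZ mul0r.
      by [].
    have -> : (fun j => phi i (e j ^+ q)) = v0.
      by apply/funext => j; apply/eqP; rewrite -subr_eq0; apply/eqP/e0.
    apply: frspan_sub hv0 => h hh i'.
    by apply: hh; apply/mapP; exists i'; rewrite ?mem_enum.
  pose T i : finType := sval (cid (hv i)).
  pose W i : T i -> A := sval (cid (svalP (cid (hv i)))).
  pose h i : T i -> 'I_r -> A := sval (cid (svalP (cid (svalP (cid (hv i)))))).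
  have hh i : (forall t, M (h i t)) /\
      forall j, phi i (e j ^+ q) = \sum_t W i t * h i t j ^+ q.
    exact: (svalP (cid (svalP (cid (svalP (cid (hv i))))))).
  have [T' [W' [h' [hM' hc']]]] : exists (T' : finType) (W' : T' -> L) (h' : T' -> 'I_r -> A),
      (forall t, M (h' t)) /\
      forall j, psi c0 * psi (e j) ^+ q = \sum_t W' t * psi (iota (h' t j)) ^+ q.
    exists {i : K & T i}, (fun t => psi (iota (W _ (tagged t))) * psi (w (tag t))),
      (fun t => h _ (tagged t)); split=> [t|j]; first by case: (hh (tag t)).
    rewrite -rmorphXn -rmorphM fE rmorph_sum.
    rewrite (eq_bigr (fun i => \sum_(t : T i) psi (iota (W i t)) * psi (w i) *
        psi (iota (h i t j)) ^+ q)); last first.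
      move=> i _; case: (hh i) => _ ->; rewrite rmorphM !rmorph_sum mulr_suml.
      by apply: eq_bigr => t _; rewrite rmorphM rmorphM !rmorphXn; ring.
    by rewrite sig_big_dep.
  have fs := frob_flat_iter pp pL (n := N) (set0_ideal L) ffL.
  (* One equation for each [j], all with the same unknowns: [psi c0] and the [- W' t] solve the
     system whose coefficients are [q]-th powers. A solution of the system without exponents has its
     first coordinate in [D]. *)
  pose f j (x : unit + T') := match x with inl _ => psi (e j) | inr t => psi (iota (h' t j)) end.
  pose v (x : unit + T') := match x with inl _ => psi c0 | inr t => - W' t end.
  have [|v0 [K0 [w0 [h0 [hh0 ev0]]]] e0] := fs _ [seq f j | j : 'I_r] v.
    move=> _ /mapP [j _ ->]; rewrite big_sumType /= (big_pred1 tt) => [|[]//] /=.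
    rewrite mulrC -/q hc' -big_split /= big1 // => t _; rewrite mulrN.
    by rewrite mulrC addrN.
  have -> : psi c0 * 1 = v0 (inl tt).
    by rewrite mulr1; apply/eqP; rewrite -subr_eq0; apply/eqP/(e0 (inl tt)).
  rewrite ev0; idS => // x; idM => //; apply: (@idealX_le _ n N (p ^ N)%N).
    by apply: ltnW; apply: ltn_expl; apply: prime_gt1.
  apply: idealX_exp; apply: Dn.
  exists T', (fun t => - h0 x (inr t)), h'; split=> // j.
  have := hh0 x (f j); rewrite map_f ?mem_enum // => /(_ isT).
  rewrite big_sumType /= (big_pred1 tt) => [|[]//] /= /eqP.
  rewrite addr_eq0 mulrC => /eqP ->; rewrite -sumrN.
  by apply: eq_bigr => t _; rewrite mulNr mulrC.
have [T [W [h [hM hz]]]] := D1.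
have mQ := prime_mult_closed pQ; have [Q1 QM] := mQ.
have Qprod (I : finType) (F : I -> B) : (forall i, ~ Q (F i)) -> ~ Q (\prod_i F i).
  by move=> hF; apply: (big_ind (fun u => ~ Q u)) => //; apply: QM.
have /choice [bs hbs] : forall t, exists bs : B * B, ~ Q bs.2 /\ psi bs.2 * W t = psi bs.1.
  by move=> t; have [b [s [Qs es]]] := loc_frac loc (W t); exists (b, s).
pose s := \prod_t (bs t).2.
have Qs : ~ Q s by apply: Qprod => t; case: (hbs t).
have /choice [b hb] : forall t, exists b, psi s * W t = psi b.
  move=> t; rewrite /s (bigD1 t) //= rmorphM mulrAC; case: (hbs t) => _ ->.
  by exists ((bs t).1 * \prod_(i | i != t) (bs i).2); rewrite rmorphM.
have /choice [t ht] : forall j, exists t, ~ Q t /\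
    t * (s * e j - \sum_t b t * iota (h t j)) = 0.
  move=> j; have : psi (s * e j - \sum_t b t * iota (h t j)) = 0.
    rewrite rmorphB rmorphM rmorph_sum; apply/eqP; rewrite subr_eq0; apply/eqP.
    have := hz j; rewrite mul1r => ->; rewrite mulr_sumr.
    by apply: eq_bigr => t _; rewrite mulrA hb rmorphM.
  by move=> /(loc_eq0 loc) [t Qt ht]; exists t.
pose tt := \prod_j t j.
have hte j : tt * s * e j = \sum_i tt * b i * iota (h i j).
  apply/eqP; rewrite -subr_eq0.
  have -> : tt * s * e j - \sum_i tt * b i * iota (h i j) =
     tt * (s * e j - \sum_i b i * iota (h i j)).
    by rewrite mulrBr mulr_sumr mulrA; congr (_ - _); apply: eq_bigr => i _; rewrite mulrA.
  rewrite /tt (bigD1 j) //= mulrAC; case: (ht j) => _ ->.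
  by rewrite mul0r.
exists (tt * s); split; first by apply: QM => //; apply: Qprod => j; case: (ht j).
have /choice [al hal] := gen_e.
have well (a a' : 'I_r -> A) i : \sum_j iota (a j) * e j = \sum_j iota (a' j) * e j ->
    \sum_j a j * h i j = \sum_j a' j * h i j.
  move=> ea; have [|c hc] := sg (fun j => a j - a' j).
    under eq_bigr do rewrite rmorphB mulrBl.
    by rewrite sumrB ea subrr.
  apply/eqP; rewrite -subr_eq0 -sumrB; apply/eqP.
  rewrite (eq_bigr (fun j => \sum_i0 c i0 * (g i0 j * h i j))).
    rewrite exchange_big big1 //= => i0 _; rewrite -mulr_sumr (hM i i0).
    by rewrite mulr0.
  by move=> j _; rewrite -mulrBl hc mulr_suml; apply: eq_bigr => i0 _; rewrite mulrA.
exists T, (fun i x => \sum_j al x j * h i j), (fun i => tt * b i); split.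
- move=> i x x'; rewrite -big_split /=.
  rewrite (well (al (x + x')) (fun j => al x j + al x' j)).
    by apply: eq_bigr => j _; rewrite mulrDl.
  rewrite -hal (hal x) (hal x') -big_split /=; apply: eq_bigr => j _.
  by rewrite -!hal rmorphD mulrDl.
- move=> i a x; rewrite mulr_sumr (well (al (iota a * x)) (fun j => a * al x j)).
    by apply: eq_bigr => j _; rewrite mulrA.
  rewrite -hal (hal x) mulr_sumr; apply: eq_bigr => j _.
  by rewrite -!hal rmorphM mulrA.
- move=> x; rewrite {1}(hal x) mulr_sumr.
  rewrite (eq_bigr (fun j => \sum_i tt * b i * iota (al x j * h i j))).
    rewrite exchange_big /=; apply: eq_bigr => i _.
    by rewrite rmorph_sum mulr_suml; apply: eq_bigr => j _; rewrite mulrC.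
  move=> j _; rewrite mulrCA hte mulr_sumr; apply: eq_bigr => i _.
  by rewrite rmorphM; ring.
Qed.
End AtPrime.
End Factors.

Lemma loc_loc (B F L : comPzRingType) (U Q : set B) (phi : {rmorphism B -> F})
    (psi : {rmorphism B -> L}) : mult_closed U -> is_localization U phi ->
  prime_ideal Q -> (forall u, U u -> ~ Q u) -> is_localization (~` Q) psi ->
  exists g : {rmorphism F -> L}, is_localization (~` (ideal_ext phi Q)) g.
Proof.
move=> hU lF pQ QU lL; have mQ := prime_mult_closed pQ.
have [|g hg] := loc_universal lF hU (f := psi).
  by move=> s Us; apply: (loc_inv lL); apply: QU.
have cQ := loc_contr_ext lF hU pQ QU.
have Qphi b : ideal_ext phi Q (phi b) <-> Q b.
  by split=> [h|]; [rewrite -cQ|exact: ideal_ext_in].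
have unit f : ~ ideal_ext phi Q f -> exists y, g f * y = 1.
  move=> nf; have [b [u [Uu e]]] := loc_frac lF f.
  have Qb : ~ Q b.
    move=> Qb; apply: nf; apply: (loc_cancel lF (ideal_ext_ideal _ _) Uu).
    by rewrite e; apply: ideal_ext_in.
  have [z hz] := loc_inv lL Qb; exists (z * psi u).
  by rewrite mulrCA -hg -rmorphM mulrC [f * _]mulrC e hg mulrC.
exists g; split=> // [y|f].
  have [b [s [Qs e]]] := loc_frac lL y; exists (phi b), (phi s).
  by split; [move=> /Qphi|rewrite !hg].
split=> [gf|[s ns sf]].
  have [b [u [Uu e]]] := loc_frac lF f.
  have : psi b = 0 by rewrite -hg -e rmorphM gf mulr0.
  move=> /(loc_eq0 lL) [s Qs sb]; exists (phi s); first by move=> /Qphi.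
  apply: (loc_inj lF Uu); rewrite mulr0 mulrCA e -rmorphM sb.
  by rewrite rmorph0.
have [y hy] := unit s ns.
by rewrite -(mul1r (g f)) -hy mulrAC -rmorphM sf rmorph0 mul0r.
Qed.

(** * Power series *)

Definition pseries (R : Type) := nat -> R.

Section PowerSeries.
Variable R : comNzRingType.
Local Notation T := (pseries R).
Implicit Types (f g h : T).

HB.instance Definition _ := gen_eqMixin T.
HB.instance Definition _ := gen_choiceMixin T.

Definition trunc n f : {poly R} := \poly_(i < n) f i.
(** A coefficient of a product involves finitely many coefficients of the factors; computed on
    truncations, it inherits the ring axioms from polynomials through [agree]. *)
Definition ps_mul f g : T := fun n => (trunc n.+1 f * trunc n.+1 g)`_n.

Lemma coef_trunc n f i : (i < n)%N -> (trunc n f)`_i = f i.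
Proof. by move=> h; rewrite coef_poly h. Qed.

Let agree n (q : {poly R}) f := forall i, (i <= n)%N -> q`_i = f i.

Let agreeM n q q' f g : agree n q f -> agree n q' g -> agree n (q * q') (ps_mul f g).
Proof.
move=> hq hq' i il; rewrite /ps_mul !coefM; apply: eq_bigr => j _.
have ji : (j <= i)%N by rewrite -ltnS.
by rewrite hq ?(leq_trans ji) // hq' ?(leq_trans (leq_subr _ _)) // !coef_trunc // ltnS leq_subr.
Qed.

Let agree_trunc n f : agree n (trunc n.+1 f) f.
Proof. by move=> i il; rewrite coef_trunc. Qed.

Fact ps_addA : associative (fun f g n => f n + g n : R).
Proof. by move=> x y z; apply/funext => n; rewrite addrA. Qed.
Fact ps_addC : commutative (fun f g n => f n + g n : R).
Proof. by move=> x y; apply/funext => n; rewrite addrC. Qed.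
Fact ps_add0 : left_id (fun=> 0) (fun f g n => f n + g n : R).
Proof. by move=> x; apply/funext => n; rewrite add0r. Qed.
Fact ps_addN : left_inverse (fun=> 0) (fun f n => - f n) (fun f g n => f n + g n : R).
Proof. by move=> x; apply/funext => n; rewrite addNr. Qed.
HB.instance Definition _ := GRing.isZmodule.Build T ps_addA ps_addC ps_add0 ps_addN.

Definition psC (c : R) : T := fun n => (c%:P)`_n.
Definition psX : T := fun n => ('X : {poly R})`_n.

Fact ps_mulA : associative ps_mul.
Proof.
move=> f g h; apply/funext => n.
have a1 := agreeM (agree_trunc f) (agreeM (agree_trunc g) (agree_trunc h)).
have a2 := agreeM (agreeM (agree_trunc f) (agree_trunc g)) (agree_trunc h).
by rewrite -(a1 n) // -(a2 n) // mulrA.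
Qed.
Fact ps_mulC : commutative ps_mul.
Proof. by move=> f g; apply/funext => n; rewrite /ps_mul mulrC. Qed.
Let agree1 n : agree n 1 (psC 1). Proof. by move=> i _; rewrite /psC polyC1. Qed.
Fact ps_mul1 : left_id (psC 1) ps_mul.
Proof.
move=> f; apply/funext => n.
by rewrite -(agreeM (@agree1 n) (agree_trunc f)) // mul1r coef_trunc.
Qed.
Fact ps_mulD : left_distributive ps_mul +%R.
Proof.
move=> f g h; apply/funext => n.
have aD : agree n (trunc n.+1 f + trunc n.+1 g) (f + g).
  by move=> i il; rewrite coefD !coef_trunc.
rewrite -(agreeM aD (agree_trunc h)) // mulrDl coefD.
by rewrite (agreeM (agree_trunc f) (agree_trunc h)) // (agreeM (agree_trunc g) (agree_trunc h)).
Qed.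
Fact ps_1n0 : psC 1 != 0 :> T.
Proof.
apply/eqP => /(congr1 (fun f : T => f 0%N)); rewrite /psC coefC eqxx.
by apply/eqP/oner_neq0.
Qed.
HB.instance Definition _ :=
  GRing.Zmodule_isComNzRing.Build T ps_mulA ps_mulC ps_mul1 ps_mulD ps_1n0.

Lemma ps_addE f g n : (f + g) n = f n + g n. Proof. by []. Qed.

Lemma ps_oppE f n : (- f) n = - f n. Proof. by []. Qed.

Lemma ps_subE f g n : (f - g) n = f n - g n. Proof. by []. Qed.

Lemma ps_sumE (I : Type) (s : seq I) (F : I -> T) n :
  (\sum_(i <- s) F i) n = \sum_(i <- s) F i n.
Proof. by elim: s => [|a s IH]; rewrite ?big_nil // !big_cons ps_addE IH. Qed.

Lemma ps_mul_coef f g (q q' : {poly R}) n : (forall i, (i <= n)%N -> q`_i = f i) ->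
  (forall i, (i <= n)%N -> q'`_i = g i) -> (q * q')`_n = (f * g) n.
Proof. by move=> h h'; apply: (agreeM h h'). Qed.

Lemma ps_mulE f g n : (f * g) n = \sum_(i < n.+1) f i * g (n - i)%N.
Proof.
rewrite -(ps_mul_coef (agree_trunc f) (agree_trunc g)) coefM.
apply: eq_bigr => i _; rewrite !coef_trunc // ?ltnS ?leq_subr //.
Qed.

Lemma ps_mul0E f g : (f * g) 0%N = f 0%N * g 0%N.
Proof. by rewrite ps_mulE big_ord1. Qed.

Lemma psX_mul f n : (psX * f) n = if n is n'.+1 then f n' else 0.
Proof.
rewrite -(ps_mul_coef (q := 'X) (fun _ _ => erefl) (agree_trunc f)) coefXM.
by case: n => //= n; rewrite coef_trunc.
Qed.

Lemma psC_mul c f n : (psC c * f) n = c * f n.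
Proof.
by rewrite -(ps_mul_coef (q := c%:P) (fun _ _ => erefl) (agree_trunc f)) coefCM coef_trunc.
Qed.

Lemma psC_rmorphism : exists F : {rmorphism R -> T}, F =1 psC.
Proof.
apply: rmorphism_exists => [//|a b|a b]; apply/funext => n.
  by rewrite /psC ps_subE !coefC; case: ifP; rewrite ?subr0.
by rewrite psC_mul /psC !coefC; case: ifP; rewrite ?mulr0.
Qed.

Lemma psC0 c : psC c 0%N = c. Proof. by rewrite /psC coefC. Qed.

Definition ps_shift f : T := fun n => f n.+1.
Lemma ps_decomp f : f = psC (f 0%N) + psX * ps_shift f.
Proof.
apply/funext => n; rewrite ps_addE psX_mul /psC coefC.
by case: n => [|n]; rewrite /= ?addr0 ?add0r.
Qed.

Lemma ps_divX f : f 0%N = 0 -> f = psX * ps_shift f.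
Proof.
move=> f0; rewrite {1}(ps_decomp f) f0; have -> : psC 0 = 0 :> T; last by rewrite add0r.
by apply/funext => n; rewrite /psC coefC; case: ifP.
Qed.

Definition ps_ord n f := forall i, (i < n)%N -> f i = 0.

Lemma ps_ordD n f g : ps_ord n f -> ps_ord n g -> ps_ord n (f + g).
Proof. by move=> hf hg i il; rewrite ps_addE hf // hg // addr0. Qed.

Lemma ps_ordN n f : ps_ord n f -> ps_ord n (- f).
Proof. by move=> hf i il; rewrite ps_oppE hf // oppr0. Qed.

Lemma ps_ord0 n : ps_ord n 0. Proof. by []. Qed.

Lemma ps_ord_sum n (I : finType) (F : I -> T) :
  (forall i, ps_ord n (F i)) -> ps_ord n (\sum_i F i).
Proof.
by move=> h; apply: big_ind => [|f g|i _]; [exact: ps_ord0|exact: ps_ordD|exact: h].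
Qed.

Lemma ps_ordM m n f g : ps_ord m f -> ps_ord n g -> ps_ord (m + n) (f * g).
Proof.
move=> hf hg i il; rewrite ps_mulE big1 // => j _.
have [jm|mj] := ltnP j m; first by rewrite hf // mul0r.
by rewrite [g _]hg ?mulr0 // ltn_subLR ?(leq_trans il) ?leq_add2r // -ltnS.
Qed.

Lemma ps_ordMl n f g : ps_ord n f -> ps_ord n (g * f).
Proof. by move=> hf; rewrite -(add0n n); apply: ps_ordM. Qed.

Lemma ps_ordX n : ps_ord n (psX ^+ n).
Proof.
elim: n => [//|n IH]; rewrite exprS -add1n; apply: ps_ordM => // -[|i] //= _.
by rewrite /psX coefX.
Qed.

Lemma ps_ord_le m n f : (m <= n)%N -> ps_ord n f -> ps_ord m f.
Proof. by move=> mn hf i il; apply: hf; apply: leq_trans mn. Qed.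

Lemma ps_ord_eq0 f : (forall n, ps_ord n f) -> f = 0.
Proof. by move=> h; apply/funext => n; apply: (h n.+1). Qed.

Lemma psXn_mul n f i : (psX ^+ n * f) (n + i)%N = f i.
Proof. by elim: n => [|n IH]; rewrite ?mul1r // exprS -mulrA addSn psX_mul. Qed.

(** The geometric series: [u ^+ n] has order at least [n], so the coefficient of degree [m] needs
    only the terms with [n] at most [m]. *)
Lemma ps_jac : jac (prI psX).
Proof.
move=> _ [r ->]; set u := r * psX.
have ou n : ps_ord n (u ^+ n) by rewrite exprMn; apply: ps_ordMl; apply: ps_ordX.
pose s : T := fun m => \sum_(n < m.+1) (u ^+ n) m.
exists s; apply/eqP; rewrite -subr_eq0; apply/eqP/ps_ord_eq0 => N.
have oN : ps_ord N (s - \sum_(n < N) u ^+ n).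
  move=> i iN; rewrite ps_subE ps_sumE /s.
  rewrite -!(big_mkord xpredT (fun n => (u ^+ n) i)).
  rewrite [X in _ - X](big_cat_nat _ (n := i.+1)) //= opprD addrA subrr sub0r big_nat big1 ?oppr0 //.
  by move=> n /andP[ni _]; apply: (ou n).
have -> : s * (1 - u) - 1 = (1 - u) * (s - \sum_(n < N) u ^+ n) - u ^+ N.
  have -> : u ^+ N = 1 - (1 - u) * \sum_(n < N) u ^+ n.
    by rewrite -{1}(subrK 1 (u ^+ N)) subrX1; ring.
  ring.
by apply: ps_ordD; [exact: ps_ordMl|apply: ps_ordN].
Qed.

Lemma ps_domain : (forall u v : R, u * v = 0 -> u = 0 \/ v = 0) ->
  forall f g, f * g = 0 -> f = 0 \/ g = 0.
Proof.
move=> dR f g fg; apply: contrapT => /not_orP [f0 g0].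
have low h : h <> 0 -> exists n, ps_ord n h /\ h n <> 0.
  move=> h0; have : exists n, h n != 0.
    apply: contrapT => n; apply: h0; apply/funext => i; apply: contrapT => hi.
    by apply: n; exists i; apply/eqP.
  move=> /ex_minnP [n /eqP hn mn]; exists n; split=> // i il.
  by apply/eqP; apply: contraTT il => /mn; rewrite -leqNgt.
have [m [om fm]] := low f f0; have [n [on gn]] := low g g0.
have : (f * g) (m + n)%N = f m * g n.
  have mn : (m < (m + n).+1)%N by rewrite ltnS leq_addr.
  rewrite ps_mulE (bigD1 (Ordinal mn)) //= addKn big1 ?addr0 // => i ni.
  have [im|mi] := ltnP i m; first by rewrite om // mul0r.
  rewrite [g _]on ?mulr0 // ltn_subLR; last by rewrite -ltnS.
  rewrite ltn_add2r ltn_neqAle mi andbT; apply: contra ni => /eqP e.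
  by apply/eqP/val_inj; exact: esym e.
by rewrite fg => /esym /dR [].
Qed.

Lemma fin_gen_T (A : comPzRingType) (K : finType) (x : K -> A) :
  fin_gen (gen_ideal (range x)).
Proof.
exists #|K|, (fun i => x (enum_val i)); congr gen_ideal; apply/seteqP.
split=> [_ [i _ <-]|_ [i _ <-]]; last by exists (enum_val i).
by exists (enum_rank i); rewrite // enum_rankK.
Qed.

(** Hilbert's argument with lowest instead of leading coefficients: the ideals [L n] are stable from
    [N] on. Series of order at least [N] are reduced infinitely often by the generators of level
    [N], the multipliers adding up to power series; lower orders take finitely many reductions. *)
Lemma ps_noetherian : noetherian R -> noetherian T.
Proof.
move=> nR; apply: fg_noetherian => J hJ.
pose L n := [set a : R | exists f, [/\ J f, ps_ord n f & f n = a]].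
have hL n : is_ideal (L n).
  split=> [|_ _ [f [Jf fo <-]] [g [Jg og <-]]|c _ [f [Jf fo <-]]].
  - by exists 0; split=> //; id0.
  - by exists (f + g); split=> //; [idD|exact: ps_ordD].
  - exists (psC c * f); split; [by idM|exact: ps_ordMl|by rewrite psC_mul].
have LS n : L n `<=` L n.+1.
  move=> _ [f [Jf fo <-]]; exists (psX * f); split; [by idM| |by rewrite psX_mul].
  by move=> [|i] il; rewrite psX_mul // fo.
have [N hN] := noetherian_acc nR hL LS.
have /choice [k hk] : forall n, exists k, exists x : 'I_k -> R, L n = gen_ideal (range x).
  by move=> n; have [k [x ex]] := noetherian_fg nR (hL n); exists k, x.
have hg n : exists g : 'I_(k n) -> T, (forall i, J (g i) /\ ps_ord n (g i)) /\
    forall a, L n a -> exists c : 'I_(k n) -> R, a = \sum_i c i * g i n.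
  have [x ex] := hk n.
  have /choice [g hg] : forall i, exists f, [/\ J f, ps_ord n f & f n = x i].
    by move=> i; have : L n (x i) by rewrite ex; apply: gen_sub; exists i.
  exists g; split=> [i|a]; first by case: (hg i).
  rewrite ex => /gen_rangeP [c ->]; exists c.
  by apply: eq_bigr => i _; case: (hg i) => _ _ ->.
pose g n := sval (cid (hg n)).
have Jg n i : J (g n i) by case: (svalP (cid (hg n))) => h _; case: (h i).
have og n i : ps_ord n (g n i) by case: (svalP (cid (hg n))) => h _; case: (h i).
have Lg n a : L n a -> exists c : 'I_(k n) -> R, a = \sum_i c i * g n i n.
  by case: (svalP (cid (hg n))) => _; apply.
pose x (t : {n : 'I_N.+1 & 'I_(k n)}) := g _ (tagged t).
suff -> : J = gen_ideal (range x) by exact: fin_gen_T.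
apply/seteqP; split; last by apply: gen_min => // _ [t _ <-]; apply: Jg.
have gx n i : (n <= N)%N -> gen_ideal (range x) (g n i).
  rewrite -ltnS => nN; apply: gen_sub.
  by exists (Tagged (fun n : 'I_N.+1 => 'I_(k n)) (i : 'I_(k (Ordinal nN)))).
have top f : J f -> ps_ord N f -> gen_ideal (range x) f.
  move=> Jf fo.
  have /choice [st hst] : forall fs : T * nat, exists c : 'I_(k N) -> R,
      J fs.1 /\ ps_ord (N + fs.2) fs.1 -> fs.1 (N + fs.2)%N = \sum_i c i * g N i N.
    move=> [f' s]; have [[/= Jf' fo']|n] := pselect (J f' /\ ps_ord (N + s) f').
      have : L (N + s)%N (f' (N + s)%N) by exists f'.
      rewrite hN ?leq_addr // => /Lg [c ec]; by exists c.
    by exists (fun=> 0) => /n.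
  pose fs := fix F s := if s is s'.+1 then
    F s' - psX ^+ s' * \sum_i psC (st (F s', s') i) * g N i else f.
  have hfs s : J (fs s) /\ ps_ord (N + s) (fs s).
    elim: s => [|s [Js os]]; first by rewrite addn0.
    split=> /=.
      by idB => //; idM => //; idS => // i; idM.
    have o1 : ps_ord (N + s) (psX ^+ s * \sum_i psC (st (fs s, s) i) * g N i).
      rewrite addnC; apply: ps_ordM; first exact: ps_ordX.
      by apply: ps_ord_sum => i; apply: ps_ordMl.
    rewrite addnS => i; rewrite ltnS leq_eqVlt => /predU1P [->|il].
      have /= e := hst (fs s, s) (conj Js os).
      rewrite ps_subE e [in X in _ - X]addnC psXn_mul ps_sumE.
      apply/eqP; rewrite subr_eq0; apply/eqP.
      by apply: eq_bigr => j _; rewrite psC_mul.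
    by rewrite ps_subE os // o1 // subrr.
  pose a (s : nat) i := st (fs s, s) i.
  pose c i : T := fun s => a s i.
  suff -> : f = \sum_i c i * g N i.
    by idS => // i; idM => //; apply: gx.
  apply/eqP; rewrite -subr_eq0; apply/eqP/ps_ord_eq0 => S.
  have ef : f = fs S + \sum_(s < S) psX ^+ s * \sum_i psC (a s i) * g N i.
    elim: S => [|S IH]; first by rewrite big_ord0 addr0.
    by rewrite big_ord_recr /= addrCA subrK addrC -IH.
  have -> : f - \sum_i c i * g N i = fs S -
      \sum_i (c i - \sum_(s < S) psX ^+ s * psC (a s i)) * g N i.
    rewrite {1}ef -addrA; congr (_ + _).
    have -> : \sum_(s < S) psX ^+ s * (\sum_i psC (a s i) * g N i) =
       \sum_i (\sum_(s < S) psX ^+ s * psC (a s i)) * g N i.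
      under eq_bigr do rewrite mulr_sumr.
      rewrite exchange_big /=; apply: eq_bigr => i _; rewrite mulr_suml.
      by apply: eq_bigr => s _; rewrite mulrA.
    rewrite -!sumrB -sumrN; apply: eq_bigr => i _.
    ring.
  apply: ps_ordD; first by apply: ps_ord_le (leq_addl N S) _; case: (hfs S).
  apply: ps_ordN; apply: ps_ord_sum => i; rewrite mulrC; apply: ps_ordMl.
  move=> j jS; rewrite ps_subE ps_sumE (bigD1 (Ordinal jS)) //= big1 => [|s sj].
    have := psXn_mul j (psC (a j i)) 0; rewrite addn0 => ->.
    by rewrite addr0 psC0 /c subrr.
  have [sj'|js] := ltnP s j.
    by rewrite -(subnKC (ltnW sj')) psXn_mul /psC coefC subn_eq0 leqNgt sj'.
  rewrite mulrC (ps_ordMl _ (@ps_ordX s)) // ltn_neqAle js andbT.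
  by apply: contra sj => /eqP e; apply/eqP/val_inj.
have all n : (n <= N)%N -> forall f, J f -> ps_ord (N - n) f -> gen_ideal (range x) f.
  elim: n => [|n IH] nN f Jf fo; first by apply: top => //; rewrite subn0 in fo.
  have [c ec] : exists c : 'I_(k (N - n.+1)%N) -> R,
      f (N - n.+1)%N = \sum_i c i * g (N - n.+1)%N i (N - n.+1)%N by apply: Lg; exists f.
  pose f' := \sum_i psC (c i) * g (N - n.+1)%N i.
  have Jf' : gen_ideal (range x) f' by idS => // i; idM => //; apply: gx; rewrite leq_subr.
  rewrite -(subrK f' f); idD => //; apply: IH; first exact: ltnW.
    by idB => //; idS => // i; idM.
  have fo' : ps_ord (N - n.+1) f' by apply: ps_ord_sum => i; apply: ps_ordMl.
  rewrite -(subnSK nN) => i; rewrite ltnS leq_eqVlt => /predU1P [->|il].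
    rewrite ps_subE ec /f' ps_sumE; apply/eqP; rewrite subr_eq0; apply/eqP.
    by apply: eq_bigr => j _; rewrite psC_mul.
  by rewrite ps_subE fo // fo' // subrr.
by move=> f Jf; apply: (all N) => //; rewrite subnn.
Qed.

Lemma ps_frob_flat p : prime p -> p%:R = 0 :> R -> noetherian R ->
  frob_flat ([set 0] : set R) p -> frob_flat ([set 0] : set T) p.
Proof.
move=> pp pR nR ff; have [F hF] := psC_rmorphism.
have pT : p%:R = 0 :> T by rewrite -(rmorph_nat F) pR rmorph0.
apply: (@kunz_step p T pp pT (ps_noetherian nR) [set 0] psX) => //.
- exact: ps_jac.
- move=> u /(congr1 (fun f : T => f _)) h; apply/funext => n.
  by have := h n.+1; rewrite psX_mul.
have e0 (f : T) : addI [set 0] (prI psX) f <-> f 0%N = 0.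
  split=> [[_ [_ [-> [r ->] ->]]]|f0]; first by rewrite add0r mulrC psX_mul.
  by apply: addI_r => //; rewrite (ps_divX f0); exists (ps_shift f); rewrite mulrC.
have X0 n (f : T) : (f ^+ n) 0%N = f 0%N ^+ n.
  by elim: n => [|n IH]; [exact: (psC0 1)|rewrite !exprS ps_mul0E IH].
move=> I f v /e0; rewrite ps_sumE => hv.
have [|v0 hv0 ev] := ff I (fun j => f j 0%N) (fun j => v j 0%N).
  by rewrite /= -[RHS]hv; apply: eq_bigr => j _; rewrite ps_mul0E X0.
exists (fun j => psC (v0 j)) => [|j]; last first.
  by apply/e0; rewrite ps_subE psC0; apply: ev.
move: v0 hv0 {ev}; apply: frspan_ind => [|v1 v2 h1 h2|c h hh].
- have -> : (fun=> psC 0) = (fun=> 0 : T) :> (I -> T).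
    by apply/funext => j; rewrite -hF rmorph0.
  exact: frspan0.
- have -> : (fun j => psC (v1 j + v2 j)) = (fun j => psC (v1 j) + psC (v2 j)).
    by apply/funext => j; rewrite -!hF rmorphD.
  exact: frspanD.
have -> : (fun j => psC (c * h j ^+ p)) = (fun j => psC c * psC (h j) ^+ p).
  by apply/funext => j; rewrite -!hF rmorphM rmorphXn.
apply: (@frspan_in _ _ _ _ (fun j => psC (h j))); apply/e0.
rewrite ps_sumE -[RHS]hh; apply: eq_bigr => j _.
by rewrite ps_mul0E psC0.
Qed.
End PowerSeries.

(** * Complete filtrations *)

Definition complete_filtration (B : comPzRingType) (J : nat -> set B) :=
  [/\ J 0%N 1, forall n, is_ideal (J n) /\ J n.+1 `<=` J n,
      forall m n u v, J m u -> J n v -> J (m + n)%N (u * v),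
      forall u, (forall n, J n u) -> u = 0 &
      forall x : nat -> B, (forall n, J n (x n.+1 - x n)) ->
        exists y, forall n, J n (y - x n)].

Section CompleteFiltration.
Variables (B : comPzRingType) (J : nat -> set B).
Hypothesis cJ : complete_filtration J.

Lemma cf_ideal n : is_ideal (J n). Proof. by case: cJ => _ /(_ n) []. Qed.

Lemma cf_le m n : (m <= n)%N -> J n `<=` J m.
Proof.
move=> /subnK <-; elim: (n - m)%N => [|k IH]; first by rewrite add0n.
apply: subset_trans IH; by case: cJ => _ /(_ (k + m)%N) [].
Qed.

Lemma cf_mul m n u v : J m u -> J n v -> J (m + n)%N (u * v).
Proof. by case: cJ => _ _ + _ _; apply. Qed.

Lemma cf_sep u v : (forall n, J n (u - v)) -> u = v.
Proof. by case: cJ => _ _ _ h _ /h /eqP; rewrite subr_eq0 => /eqP. Qed.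

Lemma cf_0 u : J 0 u.
Proof. by apply: (idl1 u (cf_ideal 0)); case: cJ. Qed.

Lemma cf_exp u n : J 1 u -> J n (u ^+ n).
Proof.
move=> Ju; elim: n => [|n IH]; first exact: cf_0.
by rewrite exprS -add1n; apply: cf_mul.
Qed.

Lemma cf_expM u k n : J k u -> J (k * n)%N (u ^+ n).
Proof.
move=> Ju; elim: n => [|n IH]; first by rewrite muln0; apply: cf_0.
by rewrite exprS mulnS; apply: cf_mul.
Qed.

Lemma cf_series (u : nat -> B) : (forall n, J n (u n)) ->
  exists s, forall n, J n (s - \sum_(i < n) u i).
Proof.
move=> hu; case: cJ => _ _ _ _; apply=> n.
by rewrite big_ord_recr /= addrAC subrr add0r.
Qed.

Lemma cf_unit u : J 1 u -> exists s, s * (1 - u) = 1.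
Proof.
move=> Ju; have [s hs] := cf_series (fun n => cf_exp n Ju).
exists s; apply: cf_sep => n.
have -> : s * (1 - u) - 1 = (1 - u) * (s - \sum_(i < n) u ^+ i) - u ^+ n.
  by rewrite -[in RHS](subrK 1 (u ^+ n)) subrX1; ring.
have hJ := cf_ideal n.
by idB => //; [idM|exact: cf_exp].
Qed.
End CompleteFiltration.

Section Evaluation.
Variables (A B : comNzRingType) (J : nat -> set B) (h : {rmorphism A -> B}) (b : B).
Hypotheses (cJ : complete_filtration J) (Jb : J 1%N b).

Let cfu : commr_rmorph h b. Proof. by move=> x; apply: mulrC. Qed.
Let H : {rmorphism {poly A} -> B} := horner_morph cfu.

Let H_low n (q : {poly A}) : (forall i, (i < n)%N -> q`_i = 0) -> J n (H q).
Proof.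
move=> hq; rewrite -(poly_take_drop n q).
have -> : take_poly n q = 0.
  apply/polyP => i; rewrite coef_take_poly coef0; case: ifP => // /hq; exact.
rewrite add0r rmorphM rmorphXn /= /H horner_morphX; have hJ := cf_ideal cJ n.
by idM => //; apply: cf_exp.
Qed.

Let H_trunc n (f : pseries A) : H (trunc n f) = \sum_(i < n) h (f i) * b ^+ i.
Proof.
rewrite /trunc poly_def rmorph_sum; apply: eq_bigr => i _.
by rewrite -mul_polyC rmorphM rmorphXn /= /H horner_morphX horner_morphC.
Qed.

(** Up to [J n], the value is that of any polynomial agreeing with the series below degree [n];
    multiplicativity is thus inherited from polynomials. *)
Lemma eval_ps : exists ev : {rmorphism pseries A -> B}, forall f n,
  J n (ev f - \sum_(i < n) h (f i) * b ^+ i).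
Proof.
have /choice [ev hev] : forall f : pseries A, exists s,
    forall n, J n (s - \sum_(i < n) h (f i) * b ^+ i).
  move=> f; apply: (@cf_series _ _ cJ (fun i => h (f i) * b ^+ i)) => n; have hJ := cf_ideal cJ n.
  by idM => //; apply: cf_exp.
have evq (f : pseries A) n (q : {poly A}) :
    (forall i, (i < n)%N -> q`_i = f i) -> J n (ev f - H q).
  move=> hq; have hJ := cf_ideal cJ n.
  have -> : ev f - H q = (ev f - H (trunc n f)) + H (trunc n f - q) by rewrite rmorphB; ring.
  idD => //; first by rewrite H_trunc.
  by apply: H_low => i il; rewrite coefB coef_trunc // hq // subrr.
have ct n f i : (i < n)%N -> (trunc n f)`_i = f i :> A by move=> il; rewrite coef_trunc.
have ev1 : ev 1 = 1.
  by apply: (cf_sep cJ) => n; rewrite -(rmorph1 H); apply: evq => i _; rewrite -polyC1.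
have evB f g : ev (f - g) = ev f - ev g.
  apply: (cf_sep cJ) => n; have hJ := cf_ideal cJ n.
  have -> : ev (f - g) - (ev f - ev g) = (ev (f - g) - H (trunc n f - trunc n g))
      - ((ev f - H (trunc n f)) - (ev g - H (trunc n g))) by rewrite rmorphB; ring.
  idB => //; first by apply: evq => i il; rewrite coefB !ct.
  by idB => //; apply: evq => i il; rewrite ct.
have evM f g : ev (f * g) = ev f * ev g.
  apply: (cf_sep cJ) => n; have hJ := cf_ideal cJ n.
  have -> : ev (f * g) - ev f * ev g = (ev (f * g) - H (trunc n f * trunc n g))
     - (ev f * (ev g - H (trunc n g)) + H (trunc n g) * (ev f - H (trunc n f))).
    by rewrite rmorphM; ring.
  idB => //; last by idD => //; idM => //; apply: evq => i il; rewrite ct.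
  apply: evq => i il; apply: ps_mul_coef => j ji; apply: ct; exact: leq_ltn_trans il.
by have [F hF] := rmorphism_exists ev1 evB evM; exists F => f n; rewrite hF.
Qed.
End Evaluation.

(** The properties of [k[[X_1, ..., X_d]]] in use: a Noetherian local domain with flat Frobenius,
    evaluation at elements of [J 1], and finiteness, by which generators of [B] over [k] modulo the
    variables generate [B] over [A]. The additional elements [z] serve the induction on [d]. *)
Definition power_series_ring (p : nat) (k : comNzRingType) (d : nat) :=
  exists (A : comNzRingType) (sigma : {rmorphism k -> A}) (X : 'I_d -> A),
  [/\ noetherian A /\ frob_flat ([set 0] : set A) p,
      forall u v : A, u * v = 0 -> u = 0 \/ v = 0,
      forall r, ~ gen_ideal (range X) r -> exists s, s * r = 1,
      ~ gen_ideal (range X) 1 &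
      forall (B : comNzRingType) (J : nat -> set B) (tau : {rmorphism k -> B})
        (b : 'I_d -> B), complete_filtration J -> (forall i, J 1%N (b i)) ->
      exists ev : {rmorphism A -> B}, [/\ forall c, ev (sigma c) = tau c,
        forall i, ev (X i) = b i &
        forall l (z : 'I_l -> B) r (e : 'I_r -> B),
          (forall y, exists c : 'I_r -> k,
            addI (gen_ideal (range z)) (gen_ideal (range b)) (y - \sum_j tau (c j) * e j)) ->
          forall y, exists a : 'I_r -> A,
            gen_ideal (range z) (y - \sum_j ev (a j) * e j)]].

Lemma power_series_ring_exists p (k : comNzRingType) d : prime p -> p%:R = 0 :> k ->
  (forall r : k, r <> 0 -> exists s, s * r = 1) -> power_series_ring p k d.
Proof.
move=> pp pk kinv; elim: d => [|d [A [sigma [X [[nA ffA] dA uA A1 evA]]]]].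
  have z0 r : gen_ideal (range (fun _ : 'I_0 => 0 : k)) r <-> r = 0.
    split=> [/gen_rangeP [c ->]|->]; first by rewrite big_ord0.
    by id0.
  exists k, idfun, (fun=> 0); split.
  - split.
      apply: fg_noetherian => I hI; have [[r [Ir r0]]|nI] := pselect (exists r, I r /\ r <> 0).
        have [s e] := kinv r r0.
        exists 1%N, (fun=> 1); apply/seteqP; split=> [u _|].
          by apply/gen_rangeP; exists (fun=> u); rewrite big_ord1 mulr1.
        by apply: gen_min => // _ [_ _ <-]; rewrite -e; idM.
      exists 0%N, (fun=> 0); apply/seteqP; split=> [u Iu|u /z0 ->]; last by id0.
      by apply/z0; apply: contrapT => u0; apply: nI; exists u.
    apply: (frob_flat_field pp pk) => // r r0.
    by have [s e] := kinv r r0; exists s; rewrite e subrr.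
  - move=> u v uv; apply: contrapT => /not_orP [u0 v0].
    have [s e] := kinv u u0; apply: v0.
    by rewrite -(mul1r v) -e -mulrA uv mulr0.
  - by move=> r r0; apply: kinv => e; apply: r0; apply/z0.
  - by move=> /z0; apply/eqP/oner_neq0.
  move=> B J tau b cJ _; exists tau; split=> // [[]//|l z r e hy y].
  have [c [u [v [zu /gen_rangeP [c' ->]]]]] := hy y.
  by rewrite big_ord0 addr0 => ey; exists c; rewrite ey.
have [F hF] := psC_rmorphism A.
pose X' i := if unlift ord0 i is Some j then psC (X j) else psX A.
exists (pseries A), (F \o sigma), X'.
have X'0 : X' ord0 = psX A by rewrite /X' unlift_none.
have X'S j : X' (lift ord0 j) = psC (X j) by rewrite /X' liftK.
have pA : p%:R = 0 :> A by rewrite -(rmorph_nat sigma) pk rmorph0.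
have gX' (f : pseries A) : gen_ideal (range X') f <-> gen_ideal (range X) (f 0%N).
  split=> [/gen_rangeP [c ->]|/gen_rangeP [c ec]].
    rewrite ps_sumE; idS => // i; rewrite ps_mul0E; idM => //.
    have [j ->|->] := unliftP ord0 i.
      by rewrite X'S psC0; apply: gen_sub; exists j.
    by rewrite X'0; have -> : psX A 0%N = 0 by [rewrite /psX coefX]; id0.
  rewrite (ps_decomp f); idD => //.
    rewrite ec -hF rmorph_sum; idS => // i; rewrite rmorphM; idM => //.
    by apply: gen_sub; exists (lift ord0 i) => //; rewrite X'S hF.
  by idMr => //; apply: gen_sub; exists ord0.
split.
- by split; [exact: ps_noetherian|exact: ps_frob_flat].
- exact: ps_domain.
- move=> f /gX' /uA [s hs].
  have [t ht] : exists t, t * (1 - (- psC s * ps_shift f) * psX A) = 1.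
    by apply: ps_jac; exists (- psC s * ps_shift f).
  exists (t * psC s); rewrite -mulrA; have -> : psC s * f = 1 - (- psC s * ps_shift f) * psX A.
    rewrite {1}(ps_decomp f) mulrDr -!hF -rmorphM hs rmorph1; ring.
  exact: ht.
- by move=> /gX'; have -> : (1 : pseries A) 0%N = 1 by exact: psC0.
move=> B J tau b cJ Jb; set b0 := b ord0; pose b' j := b (lift ord0 j).
have [|h [hs hX hfin]] := evA B J tau b' cJ; first by move=> i; apply: Jb.
have [ev hev] := eval_ps h cJ (Jb ord0); rewrite -/b0 in hev.
have evC c : ev (psC c) = h c.
  apply: (cf_sep cJ) => -[|n]; first exact: cf_0.
  have := hev (psC c) n.+1; rewrite big_ord_recl /= psC0 mulr1 big1 ?addr0 // => i _.
  by rewrite /psC coefC /= rmorph0 mul0r.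
exists ev; split.
- by move=> c; rewrite /= hF evC hs.
- move=> i; have [j ->|->] := unliftP ord0 i; first by rewrite X'S evC hX.
  rewrite X'0; apply: (cf_sep cJ) => n.
  apply: (cf_le cJ (n := n.+2)); first by do 2!apply: leqW.
  have pX m : psX A m = (m == 1%N)%:R by rewrite /psX coefX.
  have := hev (psX A) n.+2; rewrite 2!big_ord_recl /= !pX rmorph0 mul0r add0r.
  rewrite rmorph1 mul1r expr1 big1 ?addr0 // => i0 _.
  by rewrite pX rmorph0 mul0r.
move=> l z r e hy.
(* For the use of the induction hypothesis, the value [b0] of the new variable joins the elements
   [z]. *)
pose z' i := if unlift ord0 i is Some j then z j else b0.
have gz' u : gen_ideal (range z') u <->
    exists y w, u = b0 * y + \sum_i z i * w i.
  split=> [/gen_rangeP [c ->]|[y [w ->]]].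
    exists (c ord0), (fun i => c (lift ord0 i)); rewrite big_ord_recl /z' unlift_none mulrC.
    by congr (_ + _); apply: eq_bigr => i _; rewrite liftK mulrC.
  idD => //; first by idMr => //; apply: gen_sub; exists ord0; rewrite // /z' unlift_none.
  by idS => // i; idMr => //; apply: gen_sub; exists (lift ord0 i); rewrite // /z' liftK.
have /choice [st hst] : forall y, exists awy : ('I_r -> A) * ('I_l -> B) * B,
    y = \sum_j h (awy.1.1 j) * e j + \sum_i z i * awy.1.2 i + b0 * awy.2.
  move=> y; have [|a /gz' [y' [w ey]]] := hfin _ z' _ e _ y.
    move=> {}y; have [c [u [v [zu bv ey]]]] := hy y; exists c; rewrite ey.
    idD.
    - by auto.
    - apply: addI_l => //; apply/gz'; move/gen_rangeP: zu => [w ->].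
      exists 0, w; rewrite mulr0 add0r; apply: eq_bigr => i _; exact: mulrC.
    - move/gen_rangeP: bv => [w ->]; rewrite big_ord_recl; idD.
      + by auto.
      + apply: addI_l => //; apply/gz'; exists (w ord0), (fun=> 0).
        by rewrite mulrC big1 ?addr0 // => i _; rewrite mulr0.
      + by apply: addI_r => //; apply/gen_rangeP; exists (fun i => w (lift ord0 i)).
  exists (a, w, y') => /=; rewrite -addrA [_ + b0 * _]addrC -ey addrC subrK.
  by [].
(* The part divisible by [b0] is decomposed again and again. The coefficients met on the way are
   those of power series in the new variable, and the contributions of the [z i] converge. *)
move=> y; pose ys n := iter n (fun y => (st y).2) y.
pose a j : pseries A := fun n => (st (ys n)).1.1 j.
exists a.
pose w n i := (st (ys n)).1.2 i.
have /choice [W hW] : forall i, exists s, forall n, J n (s - \sum_(m < n) b0 ^+ m * w m i).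
  move=> i; apply: (@cf_series _ _ cJ (fun m => b0 ^+ m * w m i)) => n; have hJ := cf_ideal cJ n.
  by idMr => //; apply: (cf_exp cJ); apply: Jb.
apply/gen_rangeP; exists W; apply: (cf_sep cJ) => n; have hJ := cf_ideal cJ n.
have ey : y = \sum_(m < n) b0 ^+ m * (\sum_j h (a j m) * e j + \sum_i z i * w m i)
    + b0 ^+ n * ys n.
  elim: n {hJ} => [|n IH]; first by rewrite big_ord0 add0r mul1r.
  rewrite big_ord_recr /= {1}IH -addrA; congr (_ + _).
  by rewrite {1}(hst (ys n)) -/(ys n.+1) exprS /a /w; ring.
have -> : y - \sum_j ev (a j) * e j - \sum_i W i * z i =
  b0 ^+ n * ys n - \sum_j e j * (ev (a j) - \sum_(m < n) h (a j m) * b0 ^+ m)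
   - \sum_i z i * (W i - \sum_(m < n) b0 ^+ m * w m i).
  have -> : \sum_j e j * (ev (a j) - \sum_(m < n) h (a j m) * b0 ^+ m) =
     \sum_j ev (a j) * e j - \sum_(m < n) b0 ^+ m * \sum_j h (a j m) * e j.
    have -> : \sum_(m < n) b0 ^+ m * (\sum_j h (a j m) * e j) =
        \sum_j e j * \sum_(m < n) h (a j m) * b0 ^+ m.
      under eq_bigr do rewrite mulr_sumr.
      rewrite exchange_big; apply: eq_bigr => j _; rewrite mulr_sumr.
      by apply: eq_bigr => m _; ring.
    by rewrite -sumrB; apply: eq_bigr => j _; ring.
  have -> : \sum_i z i * (W i - \sum_(m < n) b0 ^+ m * w m i) =
     \sum_i W i * z i - \sum_(m < n) b0 ^+ m * \sum_i z i * w m i.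
    have -> : \sum_(m < n) b0 ^+ m * (\sum_i z i * w m i) =
        \sum_i z i * \sum_(m < n) b0 ^+ m * w m i.
      under eq_bigr do rewrite mulr_sumr.
      rewrite exchange_big; apply: eq_bigr => j _; rewrite mulr_sumr.
      by apply: eq_bigr => m _; ring.
    by rewrite -sumrB; apply: eq_bigr => j _; ring.
  rewrite {1}ey; under eq_bigr do rewrite mulrDr.
  rewrite big_split /=; ring.
idB => //; first idB => //.
- by idMr => //; apply: (cf_exp cJ); apply: Jb.
- by idS => // j; idM.
- by idS => // i; idM.
Qed.

(** * Coefficient fields *)

Definition is_subring (B : comPzRingType) (X : set B) :=
  X 1 /\ forall u v, X u -> X v -> X (u - v) /\ X (u * v).

Section Subring.
Variables (B : comPzRingType) (X : set B).
Hypothesis hX : is_subring X.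
Lemma subr_1 : X 1. Proof. by case: hX. Qed.

Lemma subr_B u v : X u -> X v -> X (u - v).
Proof. by case: hX => _ h Xu Xv; case: (h u v). Qed.

Lemma subr_M u v : X u -> X v -> X (u * v).
Proof. by case: hX => _ h Xu Xv; case: (h u v). Qed.

Lemma subr_0 : X 0. Proof. by rewrite -(subrr 1); apply: subr_B; apply: subr_1. Qed.

Lemma subr_N u : X u -> X (- u).
Proof. by move=> Xu; rewrite -sub0r; apply: subr_B => //; apply: subr_0. Qed.

Lemma subr_D u v : X u -> X v -> X (u + v).
Proof. by move=> Xu /subr_N Xv; rewrite -(opprK v); apply: subr_B. Qed.

Lemma subr_X u n : X u -> X (u ^+ n).
Proof. by move=> Xu; elim: n => [|n IH]; [exact: subr_1|rewrite exprS; apply: subr_M]. Qed.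

Lemma subr_nat n : X n%:R.
Proof. by elim: n => [|n IH]; [exact: subr_0|rewrite mulrS; apply: subr_D => //; exact: subr_1]. Qed.

Lemma subr_sum (T : finType) (f : T -> B) : (forall t, X (f t)) -> X (\sum_t f t).
Proof.
by move=> h; apply: big_ind => [|u v|t _]; [exact: subr_0|exact: subr_D|exact: h].
Qed.
End Subring.

(** [L] is closed under inverses, as [x^-1 = x ^+ p.-1 * x^-1 ^+ p]. A monic polynomial [g] over [L]
    of least degree [n] with root [b] divides [('X - b%:P) ^+ p], hence equals [('X - b%:P) ^+ n]; a
    dependence gives [n < p], and then the coefficient [- (b *+ n)] puts [b] in [L]. *)
Lemma p_root_independent (k : fieldType) p (L : set k) (b : k) : p \in [pchar k] ->
  is_subring L -> (forall x, L (x ^+ p)) -> ~ L b ->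
  forall l : 'I_p -> k, (forall i, L (l i)) -> \sum_i l i * b ^+ i = 0 ->
  forall i, l i = 0.
Proof.
move=> pk sL Lp nLb l hl sl i; apply/eqP/negPn/negP => li.
have pp := pcharf_prime pk.
pose over (q : {poly k}) := forall i, L q`_i.
pose P n := `[< exists q : {poly k}, [/\ over q, size q = n.+1 & q.[b] = 0] >].
have exP : exists n, P n.
  pose q := \poly_(j < p) (if insub j is Some j' then l j' else 0).
  have qi : q`_i != 0.
    rewrite coef_poly ltn_ord; case: insubP => [j _ /val_inj ->//|].
    by rewrite ltn_ord.
  have q0 : q != 0 by apply: contraNneq qi => ->; rewrite coef0.
  exists (size q).-1; apply/asboolP; exists q; split.
  - move=> j; rewrite coef_poly; case: ifP => _; last exact: subr_0.
    by case: insubP => [j' _ _|_]; [exact: hl|exact: subr_0].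
  - by rewrite prednK // lt0n size_poly_eq0.
  rewrite horner_poly -[RHS]sl; apply: eq_bigr => j _; congr (_ * _).
  by case: insubP => [j' _ /val_inj ->|]; rewrite ?ltn_ord.
case: (ex_minnP exP) => n /asboolP [q0 [oq0 sq0 rq0]] mn.
have Linv x : L x -> L x^-1.
  move=> Lx; have [->|x0] := eqVneq x 0; first by rewrite invr0; apply: subr_0.
  have -> : x^-1 = x ^+ p.-1 * x^-1 ^+ p.
    by rewrite -{2}(prednK (prime_gt0 pp)) exprS mulrCA -exprMn divff // expr1n mulr1.
  by apply: subr_M => //; apply: subr_X.
pose g := (lead_coef q0)^-1 *: q0.
have lq0 : lead_coef q0 != 0 by rewrite lead_coef_eq0 -size_poly_gt0 sq0.
have og : over g.
  by move=> j; rewrite coefZ; apply: subr_M => //; apply: Linv; apply: oq0.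
have sg : size g = n.+1 by rewrite size_scale ?invr_eq0.
have rg : g.[b] = 0 by rewrite hornerZ rq0 mulr0.
have mg : g \is monic by rewrite monicE lead_coefZ mulVf.
have np : (n < p)%N.
  pose q := \poly_(j < p) (if insub j is Some j' then l j' else 0).
  have qi : q`_i != 0.
    rewrite coef_poly ltn_ord; case: insubP => [j _ /val_inj ->//|].
    by rewrite ltn_ord.
  have q0' : q != 0 by apply: contraNneq qi => ->; rewrite coef0.
  have : (n <= (size q).-1)%N.
    apply: mn; apply/asboolP; exists q; split.
    - move=> j; rewrite coef_poly; case: ifP => _; last exact: subr_0.
      by case: insubP => [j' _ _|_]; [exact: hl|exact: subr_0].
    - by rewrite prednK // lt0n size_poly_eq0.
    rewrite horner_poly -[RHS]sl; apply: eq_bigr => j _; congr (_ * _).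
    by case: insubP => [j' _ /val_inj ->|]; rewrite ?ltn_ord.
  move=> h; apply: leq_ltn_trans h _; rewrite prednK ?lt0n ?size_poly_eq0 //.
  exact: size_poly.
have n0 : (0 < n)%N.
  rewrite lt0n; apply/eqP => e; move: rg; rewrite (size1_polyC (p := g)); last by rewrite sg e.
  have -> : g`_0 = 1 by have := monicP mg; rewrite lead_coefE sg e.
  by rewrite hornerC; apply/eqP/oner_neq0.
have small (r : {poly k}) : over r -> (size r <= n)%N -> r.[b] = 0 -> r = 0.
  move=> Or sr rr; apply/eqP; apply: contraLR (sr) => r0.
  have sr0 : (0 < size r)%N by rewrite size_poly_gt0.
  rewrite -ltnNge; apply: leq_ltn_trans (mn (size r).-1 _) _; last by rewrite prednK.
  by apply/asboolP; exists r; rewrite prednK.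
(* Division by the monic [g] with remainder over [L]. For ['X^p] the remainder must be [b ^+ p],
   which lies in [L], by minimality of [n]. *)
have divg N : exists q r : {poly k}, [/\ over r, (size r <= n)%N & 'X^N = q * g + r].
  elim: N => [|N [q [r [Or sr e]]]].
    exists 0, 1; rewrite mul0r add0r size_poly1; split=> // j.
    by rewrite coef1; apply: subr_nat.
  exists ('X * q + (r`_n.-1)%:P), ('X * r - r`_n.-1 *: g); split.
  - move=> j; rewrite coefB coefXM coefZ; apply: subr_B => //.
      by case: ifP => _; [exact: subr_0|exact: Or].
    by apply: subr_M.
  - apply/leq_sizeP => j nj; rewrite coefB coefXM coefZ.
    have j0 : j != 0%N by rewrite -lt0n (leq_trans n0).
    rewrite (negPf j0); move: nj; rewrite leq_eqVlt => /predU1P [<-|nj].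
      have -> : g`_n = 1 by have := monicP mg; rewrite lead_coefE sg.
      by rewrite mulr1 subrr.
    rewrite [g`_j]nth_default ?sg // mulr0 subr0 nth_default //.
    by apply: leq_trans sr _; rewrite -ltnS prednK // lt0n.
  - by rewrite exprS e mulrDr mulrDl -!mul_polyC; ring.
have [q [r [Or sr e]]] := divg p.
have gdvd : g %| ('X - b%:P) ^+ p.
  have -> : ('X - b%:P) ^+ p = q * g; last by rewrite dvdp_mull.
  have pP : p%:R = 0 :> {poly k} by rewrite -(rmorph_nat (@polyC k)) (pcharf0 pk) rmorph0.
  have := frobB pp pP 1 'X b%:P; rewrite !expn1 => ->.
  rewrite e -addrA; suff -> : r - b%:P ^+ p = 0 by rewrite addr0.
  apply: small.
  - move=> j; rewrite coefB; apply: subr_B => //; rewrite -rmorphXn coefC.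
    by case: ifP => _; [exact: Lp|exact: subr_0].
  - apply: leq_trans (size_polyD _ _) _; rewrite geq_max sr size_polyN -rmorphXn.
    by apply: leq_trans (size_polyC_leq1 _) _.
  have er : b ^+ p = r.[b].
    have := congr1 (fun q : {poly k} => q.[b]) e.
    by rewrite hornerXn hornerD hornerM rg mulr0 add0r.
  by rewrite hornerD hornerN -rmorphXn hornerC er subrr.
have /dvdp_exp_XsubCP [m mp] := gdvd.
rewrite eqp_monic ?monic_exp ?monicXsubC // => /eqP eg.
have em : m = n by move: sg; rewrite eg size_exp_XsubC => -[].
have : g`_n.-1 = - (b *+ n).
  rewrite eg em; have -> : ('X - b%:P) ^+ n = \prod_(x <- nseq n b) ('X - x%:P).
    by rewrite big_nseq; elim: (n) => [|n' IH]; rewrite ?expr0 // exprS IH.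
  have := @coefPn_prod_XsubC _ (nseq n b); rewrite size_nseq -lt0n => /(_ n0) ->.
  by rewrite big_nseq; congr (- _); elim: (n) => [|n' IH]; rewrite ?mulr0n // mulrS -IH.
move=> eb; apply: nLb.
have nk : n%:R != 0 :> k.
  rewrite -(dvdn_pcharf pk); apply: contraL np => /dvdn_leq h.
  by rewrite -leqNgt; apply: h.
have -> : b = - (n%:R^-1 * g`_n.-1).
  by rewrite eb mulrN opprK -[b *+ n]mulr_natl mulKf.
by apply: subr_N => //; apply: subr_M => //; apply: Linv; apply: subr_nat.
Qed.

Section CoefficientField.
Variables (p : nat) (B : comNzRingType) (J : nat -> set B).
Variables (k : fieldType) (rho : {rmorphism B -> k}).
Hypotheses (pp : prime p) (pB : p%:R = 0 :> B) (cJ : complete_filtration J).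
Hypothesis rho_surj : forall y, exists x, rho x = y.
Hypothesis rho_ker : forall x, rho x = 0 <-> J 1%N x.

Definition mon (S : set B) : set B := smallest (@mult_closed B) S.

Lemma mon_mult S : mult_closed (mon S).
Proof.
split=> [X [[X1 _] _]|u v hu hv X [hX SX]]; first exact: X1.
by case: (hX) => _; apply; [exact: hu|exact: hv].
Qed.

Lemma mon_sub S : S `<=` mon S. Proof. by move=> u Su X [_ SX]; apply: SX. Qed.

Lemma mon_min (S X : set B) : mult_closed X -> S `<=` X -> mon S `<=` X.
Proof. by move=> hX SX u; apply; split. Qed.

Lemma monS (S S' : set B) : S `<=` S' -> mon S `<=` mon S'.
Proof.
by move=> SS; apply: mon_min; [exact: mon_mult|move=> u /SS; apply: mon_sub].
Qed.

(** For a subring [X] this is the subring generated by [S] and the [p]-th powers of elements of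
    [X]. *)
Definition pspan (S X : set B) : set B := [set y |
  exists (T : finType) (x mu : T -> B), (forall t, X (x t) /\ mon S (mu t)) /\
    y = \sum_t x t ^+ p * mu t].

Lemma pspan0 S X : pspan S X 0.
Proof. by exists void, (fun=> 0), (fun=> 0); split=> [[]//|]; rewrite big1 // => -[]. Qed.

Lemma pspanD S X u v : pspan S X u -> pspan S X v -> pspan S X (u + v).
Proof.
move=> [T [x [mu [h ->]]]] [T' [x' [mu' [h' ->]]]].
exists (T + T')%type, (fun i => match i with inl i => x i | inr i => x' i end),
  (fun i => match i with inl i => mu i | inr i => mu' i end).
by split=> [[]//|]; rewrite big_sumType.
Qed.

Lemma pspan_in (S X : set B) x mu : X x -> mon S mu -> pspan S X (x ^+ p * mu).
Proof.
move=> Xx Smu; exists unit, (fun=> x), (fun=> mu); split=> //.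
by rewrite (big_pred1 tt) => // -[].
Qed.

Lemma pspan_ind (S X : set B) (Psi : B -> Prop) : Psi 0 ->
  (forall u v, Psi u -> Psi v -> Psi (u + v)) ->
  (forall x mu, X x -> mon S mu -> Psi (x ^+ p * mu)) ->
  forall y, pspan S X y -> Psi y.
Proof.
move=> P0 PD Pin y [T [x [mu [h ->]]]].
by apply: big_ind => // t _; apply: Pin; case: (h t).
Qed.

Lemma pspanS (S S' X X' : set B) : S `<=` S' -> X `<=` X' -> pspan S X `<=` pspan S' X'.
Proof.
move=> SS XX y [T [x [mu [h ->]]]]; exists T, x, mu; split=> // t.
by case: (h t) => /XX Xx /(monS SS).
Qed.

Lemma pspan_subring (S X : set B) : is_subring X -> is_subring (pspan S X).
Proof.
move=> sX; have [m1 mM] := mon_mult S.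
have hN u : pspan S X u -> pspan S X (- u).
  move: u; apply: pspan_ind => [|u v hu hv|x mu Xx Smu].
  - by rewrite oppr0; apply: pspan0.
  - by rewrite opprD; apply: pspanD.
  have -> : - (x ^+ p * mu) = (- x) ^+ p * mu.
    by have := frobN pp pB 1 x; rewrite !expn1 => ->; rewrite mulNr.
  by apply: pspan_in => //; apply: subr_N.
split=> [|u v hu hv].
  by rewrite -(mulr1 1) -{1}(expr1n _ p); apply: pspan_in => //; apply: subr_1.
split; first by apply: pspanD => //; apply: hN.
move: u hu; apply: pspan_ind => [|u u' hu hu'|x mu Xx Smu].
- by rewrite mul0r; apply: pspan0.
- by rewrite mulrDl; apply: pspanD.
move: v hv; apply: pspan_ind => [|u u' hu hu'|x' mu' Xx' Smu'].
- by rewrite mulr0; apply: pspan0.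
- by rewrite mulrDr; apply: pspanD.
by rewrite mulrACA -exprMn; apply: pspan_in; [exact: subr_M|exact: mM].
Qed.

Let M := J 1%N.
Let hM : is_ideal M. Proof. exact: cf_ideal. Qed.

(** A form of [p]-independence suited to lifting: a combination that vanishes in [k] can be
    rewritten with coefficients that vanish in [k]. The quantification over [X] allows its use at
    each stage of the construction of the coefficient field. *)
Let pindep (S : set B) := forall X, is_subring X -> S `<=` X ->
  forall e, pspan S X e -> M e -> pspan S (X `&` M) e.

Let pk : p \in [pchar k].
Proof. by rewrite inE /= pp -(rmorph_nat rho) pB rmorph0 eqxx. Qed.

Let MX x : M (x ^+ p) -> M x.
Proof.
by move=> /rho_ker /eqP; rewrite rmorphXn expf_eq0 => /andP[_ /eqP /rho_ker].
Qed.

Let pindep0 : pindep set0.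
Proof.
move=> X sX _ e; have m1 u : mon set0 u -> u = 1.
  by move: u; apply: (mon_min (X := [set 1])) => //; split=> // u v -> ->; rewrite /= mulr1.
move=> [T [x [mu [h ->]]]].
have -> : \sum_t x t ^+ p * mu t = (\sum_t x t) ^+ p * 1.
  have := frob_sum pp pB 1 (index_enum T) xpredT x; rewrite expn1 => ->.
  by rewrite mulr1; apply: eq_bigr => t _; case: (h t) => _ /m1 ->; rewrite mulr1.
rewrite mulr1 => /MX Mx; rewrite -[_ ^+ p]mulr1; apply: pspan_in; last by case: (mon_mult set0).
by split=> //; apply: subr_sum => // t; case: (h t).
Qed.

Let max_pindep : exists S, pindep S /\ forall S', S `<` S' -> ~ pindep S'.
Proof.
apply: Zorn_bigcup => F FP tF X sX SX e.
have [[S0 FS0]|nF] := pselect (exists S, F S); last first.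
  have -> : \bigcup_(X0 in F) X0 = set0.
    by apply/seteqP; split=> // u [S FS]; case: nF; exists S.
  exact: pindep0.
have two S S' : F S -> F S' -> exists S2, [/\ F S2, S `<=` S2 & S' `<=` S2].
  move=> FS FS'; case: (tF _ _ FS FS') => h.
    by exists S'; split=> // u.
  by exists S; split=> // u.
have monU mu : mon (\bigcup_(S in F) S) mu -> exists2 S, F S & mon S mu.
  apply: (mon_min (X := [set mu | exists2 S, F S & mon S mu])) => [|u [S FS Su]].
    split=> [|u v [S FS Su] [S' FS' Sv]].
      by exists S0 => //; case: (mon_mult S0).
    have [S2 [FS2 h h']] := two _ _ FS FS'; exists S2 => //.
    by case: (mon_mult S2) => _; apply; [apply: (monS h)|apply: (monS h')].
  by exists S => //; apply: mon_sub.
have spU y : pspan (\bigcup_(S in F) S) X y -> exists2 S, F S & pspan S X y.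
  move: y; apply: pspan_ind => [|u v [S FS Su] [S' FS' Sv]|x mu Xx /monU [S FS Smu]].
  - by exists S0 => //; apply: pspan0.
  - have [S2 [FS2 h h']] := two _ _ FS FS'; exists S2 => //.
    by apply: pspanD; [apply: (pspanS h _ Su)|apply: (pspanS h' _ Sv)].
  - by exists S => //; apply: pspan_in.
move=> /spU [S FS Se] Me.
apply: (pspanS (S := S) (X := X `&` M)) => //; first by move=> u Su; exists S.
by apply: (FP _ FS) => // u Su; apply: SX; exists S.
Qed.

(** If [y] were not reached, a lift [b] of it could be adjoined to [S]: the powers of [y] below [p]
    are independent over [L], which contains all [p]-th powers of [k], so the coefficients of a
    vanishing combination vanish separately. *)
Let pbasis_surj S : pindep S -> (forall S', S `<` S' -> ~ pindep S') ->
  forall y : k, exists2 e, pspan S setT e & rho e = y.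
Proof.
move=> hS mS y; apply: contrapT => ny.
have sT : is_subring (setT : set B) by [].
have [b eb] := rho_surj y.
have nb : ~ pspan S setT b by move=> h; apply: ny; exists b.
pose L := [set z : k | exists2 e, pspan S setT e & rho e = z].
have sL : is_subring L.
  have sS := pspan_subring S sT.
  split=> [|_ _ [e he <-] [e' he' <-]]; first by exists 1; [exact: subr_1|rewrite rmorph1].
  split; first by exists (e - e'); rewrite ?rmorphB //; apply: subr_B.
  by exists (e * e'); rewrite ?rmorphM //; apply: subr_M.
have [Sm1 SmM] := mon_mult S.
have Lp x : L (x ^+ p).
  have [x' <-] := rho_surj x; exists (x' ^+ p * 1); first exact: pspan_in.
  by rewrite mulr1 rmorphXn.
pose S' := S `|` [set b].
apply: (mS S').
  split=> [u|h]; first by left.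
  apply: nb; rewrite -(mul1r b) -{1}(expr1n _ p); apply: pspan_in => //.
  by apply: mon_sub; apply: h; right.
have Sb : mon S' b by apply: mon_sub; right.
have [S'1 S'M] := mon_mult S'.
have SS' : mon S `<=` mon S' by apply: monS => u Su; left.
move=> X sX SX e he Me.
have Xb : X b by apply: SX; right.
have monb mu : mon S' mu -> exists j nu, mon S nu /\ mu = nu * b ^+ j.
  apply: (mon_min (X := [set mu | exists j nu, mon S nu /\ mu = nu * b ^+ j])).
    split=> [|_ _ [j [nu [hnu ->]]] [j' [nu' [hnu' ->]]]].
      by exists 0%N, 1; rewrite mulr1.
    by exists (j + j')%N, (nu * nu'); split; [exact: SmM|rewrite exprD; ring].
  move=> u [Su|->]; first by exists 0%N, u; rewrite mulr1; split=> //; apply: mon_sub.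
  by exists 1%N, 1; rewrite mul1r.
have [s [hs es]] : exists s : 'I_p -> B, (forall i, pspan S X (s i)) /\
    e = \sum_i s i * b ^+ i.
  move: e he {Me}; apply: pspan_ind => [|u v [s [hs ->]] [s' [hs' ->]]|x mu Xx /monb].
  - exists (fun=> 0); split=> [i|]; first exact: pspan0.
    by rewrite big1 // => i _; rewrite mul0r.
  - exists (fun i => s i + s' i); split=> [i|]; first exact: pspanD.
    by rewrite -big_split; apply: eq_bigr => i _; rewrite mulrDl.
  move=> [j [nu [hnu ->]]].
  (* Exponents are reduced modulo [p]: the factor [b ^+ (j %/ p)], an element of [X], moves into the
     [p]-th power. *)
  pose i0 := Ordinal (ltn_pmod j (prime_gt0 pp)).
  exists (fun i => if i == i0 then (x * b ^+ (j %/ p)) ^+ p * nu else 0); split=> [i|].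
    case: ifP => _; last exact: pspan0.
    by apply: pspan_in => //; apply: subr_M => //; apply: subr_X.
  rewrite (bigD1 i0) //= eqxx big1 ?addr0 => [|i /negPf ->]; last by rewrite mul0r.
  by rewrite {1}(divn_eq j p) exprD [b ^+ (_ * _)]exprM exprMn; ring.
have s0 : forall i, M (s i).
  have := p_root_independent pk sL Lp (b := y) _ (l := fun i => rho (s i)).
  move=> h i; apply/rho_ker; apply: h => [[e' he' e'y]|j|].
  - by apply: ny; exists e'.
  - by exists (s j) => //; apply: pspanS (hs j).
  - have /rho_ker := Me; rewrite es rmorph_sum => h; rewrite -[RHS]h.
    by apply: eq_bigr => j _; rewrite rmorphM rmorphXn eb.
rewrite es.
have : forall i, pspan S' (X `&` M) (s i * b ^+ i).
  move=> i; have : pspan S (X `&` M) (s i).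
    by apply: (hS X sX) => // u Su; apply: SX; left.
  move: (s i); apply: pspan_ind => [|u v hu hv|x mu Xx Smu].
  - by rewrite mul0r; apply: pspan0.
  - by rewrite mulrDl; apply: pspanD.
  - rewrite -mulrA; apply: pspan_in => //; apply: S'M; first exact: SS'.
    by apply: (@mult_closedX B (mon S') b i (mon_mult S') Sb).
by move=> h; apply: big_ind => [|u v|i _]; [exact: pspan0|exact: pspanD|exact: h].
Qed.

(* With [S] a lift of a [p]-basis, the ring [E n.+1] is spanned by the products
   of [p]-th powers of [E n] and monomials in [S]; it meets the kernel of [rho]
   in [J (p ^ n.+1)], so that lifts of [c] to the [E n] converge to [sigma c]. *)
Lemma coefficient_field : exists sigma : {rmorphism k -> B}, forall c, rho (sigma c) = c.
Proof.
have [S [hS mS]] := max_pindep.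
have surj := pbasis_surj hS mS.
pose E n := iter n (pspan S) setT.
have [Sm1 SmM] := mon_mult S.
have sE n : is_subring (E n) by elim: n => [//|n IH]; apply: pspan_subring.
have SE n : S `<=` E n.
  elim: n => [//|n IH] u Su; rewrite -(mul1r u) -(expr1n _ p).
  by apply: pspan_in; [exact: subr_1|exact: mon_sub].
have EM n : E n `&` M `<=` J (p ^ n)%N.
  elim: n => [|n IH] u [Eu Mu]; first by rewrite expn0.
  have := hS _ (sE n) (SE n) _ Eu Mu; have hJ := cf_ideal cJ (p ^ n.+1).
  move: u {Eu Mu}; apply: pspan_ind => [|u v hu hv|x mu /IH Jx _].
  - by id0.
  - by idD.
  - by idMr => //; rewrite expnSr; apply: (cf_expM cJ).
have EMn n u : E n u -> M u -> J n u.
  move=> Eu Mu; apply: (cf_le cJ (n := (p ^ n)%N)); last exact: EM.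
  by apply: ltnW; apply: ltn_expl; apply: prime_gt1.
have Esurj n y : exists2 e, E n e & rho e = y.
  elim: n y => [|n IH] y; first by have [x <-] := rho_surj y; exists x.
  have [_ [T [x [mu [h ->]]]] <-] := surj y.
  have /choice [x' hx'] : forall t, exists z, E n z /\ rho z = rho (x t).
    by move=> t; have [z Ez ez] := IH (rho (x t)); exists z.
  exists (\sum_t x' t ^+ p * mu t).
    by exists T, x', mu; split=> // t; case: (h t) => _ mt; case: (hx' t).
  rewrite !rmorph_sum; apply: eq_bigr => t _; rewrite !rmorphM !rmorphXn.
  by case: (hx' t) => _ ->.
have ES n : E n.+1 `<=` E n.
  by elim: n => [|n IH]; [|apply: pspanS].
have /choice [e he] : forall ny : nat * k, exists e, E ny.1 e /\ rho e = ny.2.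
  by move=> [n y]; have [e Ee ee] := Esurj n y; exists e.
have /choice [sg hsg] : forall y, exists s, forall n, J n (s - e (n, y)).
  move=> y; case: (cJ) => _ _ _ _; apply=> n.
  have [E1 e1] := he (n.+1, y); have [E2 e2] := he (n, y).
  apply: EMn; first by apply: subr_B => //; apply: ES.
  by apply/rho_ker; rewrite rmorphB e1 e2 subrr.
(* An approximation at level [n] may be exchanged for any element of [E n] with the same residue.
   Hence the limits respect sums and products although the lifts [e] are chosen arbitrarily. *)
have key (x y : B) n : J n (x - y) -> forall z, E n y -> E n z -> rho y = rho z -> J n (x - z).
  move=> h z Ey Ez r; have hJ := cf_ideal cJ n.
  rewrite -(subrK y x) -addrA; idD => //; apply: EMn; first exact: subr_B.
  by apply/rho_ker; rewrite rmorphB r subrr.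
have sE' n y : E n (e (n, y)) by case: (he (n, y)).
have rE' n y : rho (e (n, y)) = y by case: (he (n, y)).
have s1 : sg 1 = 1.
  apply: (cf_sep cJ) => n; apply: (key _ (e (n, 1))) => //; first exact: subr_1.
  by rewrite rE' rmorph1.
have sB a b : sg (a - b) = sg a - sg b.
  apply: (cf_sep cJ) => n; have hJ := cf_ideal cJ n.
  have -> : sg (a - b) - (sg a - sg b) = (sg (a - b) - (e (n, a) - e (n, b)))
    - ((sg a - e (n, a)) - (sg b - e (n, b))) by ring.
  idB => //; last by idB.
  apply: (key _ (e (n, a - b))) => //; first exact: subr_B.
  by rewrite rmorphB !rE'.
have sM a b : sg (a * b) = sg a * sg b.
  apply: (cf_sep cJ) => n; have hJ := cf_ideal cJ n.
  have -> : sg (a * b) - sg a * sg b = (sg (a * b) - e (n, a) * e (n, b))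
    - (sg a * (sg b - e (n, b)) + e (n, b) * (sg a - e (n, a))) by ring.
  idB => //; last by idD => //; idM.
  apply: (key _ (e (n, a * b))) => //; first exact: subr_M.
  by rewrite rmorphM !rE'.
have [F hF] := rmorphism_exists s1 sB sM; exists F => c; rewrite hF.
have /rho_ker := hsg c 1%N; rewrite rmorphB rE' => /eqP.
by rewrite subr_eq0 => /eqP.
Qed.
End CoefficientField.

(** * Completions *)

(** Cauchy sequences of prescribed rate modulo null sequences of the same rate; membership in [J n]
    then depends on the entry of index [n] only. *)
Lemma completion_exists (R : comPzRingType) (m : set R) : is_ideal m ->
  exists (A : comPzRingType) (phi : {rmorphism R -> A}), is_completion m phi.
Proof.
move=> hm; have hX n : is_ideal (idealX m n) by [].
pose C : set (seqring R) := [set x | forall n, idealX m n (x n.+1 - x n)].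
pose I : set (seqring R) := [set x | C x /\ forall n, idealX m n (x n)].
have CB u v : C u -> C v -> C (u - v).
  move=> Cu Cv n; rewrite !seq_BE.
  have -> : u n.+1 - v n.+1 - (u n - v n) = (u n.+1 - u n) - (v n.+1 - v n) by ring.
  by idB.
have CM u v : C u -> C v -> C (u * v).
  move=> Cu Cv n; rewrite !seq_ME.
  have -> : u n.+1 * v n.+1 - u n * v n = u n.+1 * (v n.+1 - v n) + v n * (u n.+1 - u n) by ring.
  by idD => //; idM.
have C0 : C 0 by move=> n; rewrite subrr; id0.
have CD u v : C u -> C v -> C (u + v).
  by move=> Cu Cv; have := CB u (0 - v) Cu (CB 0 v C0 Cv); rewrite sub0r opprK.
have h : subquotient_axiom C I.
  split=> [n|u v Cu Cv|u [] //||u v].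
  - by rewrite subrr; id0.
  - by split; [exact: CB|exact: CM].
  - by refine (conj _ _) => n; [rewrite subrr; id0|exact: (idl0 (hX n))].
  move=> -[Cv Iv]; split=> [w [Cw Iw]|Cu].
    by refine (conj _ _) => [|n]; [exact: CB|rewrite seq_BE; idB].
  by refine (conj _ _) => [|n]; [exact: CM|rewrite seq_ME; idM].
pose T := subquotient h.
have CC r : C (fun=> r) by move=> n; rewrite subrr; id0.
pose f r : T := sq_pi h (fun=> r).
have [phi hphi] : exists phi : {rmorphism R -> T}, phi =1 f.
  apply: rmorphism_exists => [//|a b|a b].
    by rewrite /f -sq_piB.
  by rewrite /f -sq_piM.
pose rep (y : T) : seqring R := @sq_repr _ _ _ h y.
pose J n : set T := [set y | idealX m n (rep y n)].
have Jpi n x : C x -> J n (sq_pi h x) <-> idealX m n (x n).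
  move=> Cx; move: (sq_repr_pi h Cx) => [_ /(_ n)]; rewrite seq_BE => hx.
  split=> h'; last first.
    have : idealX m n (rep (sq_pi h x) n - x n + x n) by idD.
    by rewrite subrK.
  change (idealX m n (rep (sq_pi h x) n)) in h'.
  have -> : x n = rep (sq_pi h x) n - (rep (sq_pi h x) n - x n) by ring.
  by idB.
have hJ n : is_ideal (J n).
  split.
  - by rewrite -(sq_pi0 h); apply/(Jpi n _ C0); apply: (idl0 (hX n)).
  - apply: sq_ind => x Cx; apply: sq_ind => y Cy.
    rewrite -sq_piD // => /(Jpi n _ Cx) hx /(Jpi n _ Cy) hy.
    by apply/(Jpi n _ (CD _ _ Cx Cy)); exact: (idlD (hX n)).
  - apply: sq_ind => x Cx; apply: sq_ind => y Cy.
    rewrite -sq_piM // => /(Jpi n _ Cy) hy.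
    by apply/(Jpi n _ (CM _ _ Cx Cy)); exact: (idlM (x n) (hX n) hy).
have Jdiff n x y : C x -> C y -> J n (sq_pi h x - sq_pi h y) <-> idealX m n (x n - y n).
  by move=> Cx Cy; rewrite -sq_piB // Jpi ?seq_BE //; apply: CB.
exists T, phi, J; split.
- move=> n; split=> //; apply: sq_ind => x Cx; rewrite !Jpi // => hx.
  have -> : x n = x n.+1 - (x n.+1 - x n) by ring.
  by idB => //; apply: (@idealX_le _ m n n.+1).
- move=> n; apply/seteqP; split=> r; rewrite /= hphi /f Jpi //.
- move=> n; apply: sq_ind => x Cx; exists (x n); rewrite hphi /f Jdiff //.
  by rewrite subrr; id0.
move=> x Cx; exists (sq_pi h x); split=> [n|].
  by rewrite hphi /f Jdiff // subrr; id0.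
apply: sq_ind => y Cy hy; apply/sq_pi_eq => //; split; first exact: CB.
move=> n; have := hy n; rewrite hphi /f Jdiff // seq_BE => hn.
by rewrite -opprB; idN.
Qed.

Section Completion.
Variables (R A : comPzRingType) (m : set R) (phi : {rmorphism R -> A}).
Hypotheses (nR : noetherian R) (lR : local_ring m) (cA : is_completion m phi).

Let hm : is_ideal m. Proof. exact/prime_is_ideal/local_prime/lR. Qed.

(** For the last equality, an element of [J n] is a limit of [r i] with differences in
    [m ^ (n + i)], contained in [m ^ i * m ^ n]. Written in finitely many generators of [m ^ n],
    these differences have coefficients that form convergent series. *)
Lemma completion_filtration : exists J : nat -> set A,
  [/\ complete_filtration J,
      forall n r, J n (phi r) <-> idealX m n r,
      forall n y, exists r, J n (y - phi r) &
      forall n, J n = ideal_ext phi (idealX m n)].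
Proof.
case: cA => J [hJ phiJ appr lim].
have iJ n : is_ideal (J n) by case: (hJ n).
have JS n : J n.+1 `<=` J n by case: (hJ n).
have Jphi n r : J n (phi r) <-> idealX m n r by rewrite -phiJ.
have Jle a b : (a <= b)%N -> J b `<=` J a.
  move=> /subnK <-; elim: (b - a)%N => [|k IH]; first by rewrite add0n.
  by apply: subset_trans IH; apply: JS.
have sep u : (forall n, J n u) -> u = 0.
  move=> hu; have [|y [_ uy]] := lim (fun=> 0); first by move=> n; rewrite subrr; id0.
  by rewrite -(uy u) ?(uy 0) // => n; rewrite rmorph0 subr0 //; id0.
have Japp a b y : (a <= b)%N -> J a y -> exists2 r, idealX m a r & J b (y - phi r).
  move=> ab Ja; have [r hr] := appr b y; exists r => //; apply/Jphi.
  have -> : phi r = y - (y - phi r) by ring.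
  by idB => //; apply: (Jle a b).
have cJ : complete_filtration J.
  split=> // [|a b u v Ja Jb|x hx].
  - by rewrite -(rmorph1 phi); apply/Jphi.
  - have [r hr er] := Japp a (a + b)%N u (leq_addr _ _) Ja.
    have [s hs es] := Japp b (a + b)%N v (leq_addl _ _) Jb.
    have -> : u * v = u * (v - phi s) + phi s * (u - phi r) + phi (r * s).
      by rewrite rmorphM; ring.
    idD => //; first by idD => //; idM.
    by apply/Jphi; apply: idealX_mul.
  - have /choice [r hr] : forall n, exists r, J n (x n - phi r) by move=> n; apply: appr.
    have [n|y [hy _]] := lim r.
      apply/Jphi; rewrite rmorphB.
      have -> : phi (r n.+1) - phi (r n) = (x n.+1 - x n) + (x n - phi (r n))
        - (x n.+1 - phi (r n.+1)) by ring.
      by idB => //; [idD|apply: JS].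
    exists y => n; have -> : y - x n = (y - phi (r n)) - (x n - phi (r n)) by ring.
    by idB.
exists J; split=> // n; apply/seteqP; split; last first.
  by apply: ideal_ext_min => // r /Jphi.
move=> y Jy; have [k [g eg]] := noetherian_fg nR (idealX_ideal m n).
have /choice [r hr] : forall i, exists r, J (n + i)%N (y - phi r) by move=> i; apply: appr.
have r0 : idealX m n (r 0%N).
  apply/Jphi; have -> : phi (r 0%N) = y - (y - phi (r 0%N)) by ring.
  by idB => //; have := hr 0%N; rewrite addn0.
have /choice [c hc] : forall i, exists c, (forall j, idealX m i (c j)) /\
    r i.+1 - r i = \sum_(j < k) c j * g j.
  move=> i; apply: idealM_gen => //; rewrite -eg; apply: idealXD; rewrite addnC.
  apply/Jphi; rewrite rmorphB.
  have -> : phi (r i.+1) - phi (r i) = (y - phi (r i)) - (y - phi (r i.+1)) by ring.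
  by idB => //; apply: (Jle _ (n + i.+1)%N) => //; rewrite addnS.
have /choice [Y hY] : forall j, exists s, forall N, J N (s - \sum_(i < N) phi (c i j)).
  move=> j; apply: (@cf_series _ _ cJ (fun i => phi (c i j))) => i.
  by apply/Jphi; case: (hc i).
move: r0; rewrite eg => /gen_rangeP [c0 e0].
suff -> : y = \sum_j phi (g j) * (phi (c0 j) + Y j).
  have hE : is_ideal (ideal_ext phi (gen_ideal (range g))) by exact: ideal_ext_ideal.
  idS => [//|j]; apply: (idlMr _ hE); apply: gen_sub; exists (g j) => //.
  by apply: gen_sub; exists j.
apply: (cf_sep cJ) => N.
have er : phi (r N) = \sum_j phi (g j) * (phi (c0 j) + \sum_(i < N) phi (c i j)).
  elim: N => [|N IH].
    rewrite e0 rmorph_sum; apply: eq_bigr => j _.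
    by rewrite big_ord0 addr0 rmorphM mulrC.
  rewrite -(subrK (phi (r N)) (phi (r N.+1))) -rmorphB; case: (hc N) => _ ->.
  rewrite IH rmorph_sum -big_split /=; apply: eq_bigr => j _.
  by rewrite big_ord_recr rmorphM /=; ring.
have -> : y - \sum_j phi (g j) * (phi (c0 j) + Y j) =
    (y - phi (r N)) - \sum_j phi (g j) * (Y j - \sum_(i < N) phi (c i j)).
  have -> : \sum_j phi (g j) * (Y j - \sum_(i < N) phi (c i j)) =
     \sum_j phi (g j) * (phi (c0 j) + Y j) - phi (r N).
    by rewrite er -sumrB; apply: eq_bigr => j _; ring.
  ring.
idB => //; first by apply: (Jle _ (n + N)%N) => //; rewrite leq_addl.
by idS => // j; idM.
Qed.

(** Approximating the coefficients of [phi r] by elements of [R] puts [r] in [I + m ^ n] for every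
    [n]; Krull's intersection theorem concludes. *)
Lemma completion_contract I r : is_ideal I -> ideal_ext phi I (phi r) -> I r.
Proof.
move=> hI; have [J [cJ Jphi appr eJ]] := completion_filtration.
move=> /gen_idealP [k [c [e [he er]]]].
have /choice [x hx] : forall i, exists x, I x /\ phi x = e i.
  by move=> i; have [x Ix <-] := he i; exists x.
apply: (krull_intersection nR hm (local_jac nR lR) hI) => n.
have /choice [c' hc'] : forall i, exists c', J n (c i - phi c') by move=> i; apply: appr.
have hJ := cf_ideal cJ n.
exists (\sum_i c' i * x i), (r - \sum_i c' i * x i); split; last by ring.
  by idS => // i; idM => //; case: (hx i).
apply/Jphi; rewrite rmorphB er rmorph_sum -sumrB; idS => // i.
by case: (hx i) => _ <-; rewrite rmorphM -mulrBl; idMr.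
Qed.
End Completion.

Lemma finite_noetherian (A B : comPzRingType) (iota : {rmorphism A -> B}) r
    (e : 'I_r -> B) : noetherian A ->
  (forall b, exists a : 'I_r -> A, b = \sum_j iota (a j) * e j) -> noetherian B.
Proof.
move=> nA gen_e; apply: fg_noetherian => I hI.
have [||c u|k [g [Ig gI]]] := submodule_fg (N := fun u => I (\sum_j iota (u j) * e j)) nA.
- by rewrite big1 => [|j _]; [id0|rewrite rmorph0 mul0r].
- move=> u v Iu Iv; have -> : \sum_j iota (u j + v j) * e j =
    \sum_j iota (u j) * e j + \sum_j iota (v j) * e j; last by idD.
  by rewrite -big_split; apply: eq_bigr => j _; rewrite rmorphD mulrDl.
- move=> Iu; have -> : \sum_j iota (c * u j) * e j = iota c * \sum_j iota (u j) * e j.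
    by rewrite mulr_sumr; apply: eq_bigr => j _; rewrite rmorphM mulrA.
  by idM.
exists k, (fun i => \sum_j iota (g i j) * e j); apply/seteqP; split=> [b Ib|]; last first.
  by apply: gen_min => // _ [i _ <-].
have [a ea] := gen_e b; rewrite ea in Ib *; have [c hc] := gI _ Ib.
apply/gen_rangeP; exists (fun i => iota (c i)).
under [RHS]eq_bigr do rewrite mulr_sumr.
rewrite exchange_big /=; apply: eq_bigr => j _; rewrite hc rmorph_sum mulr_suml.
by apply: eq_bigr => i _; rewrite rmorphM mulrA.
Qed.

Section Cohen.
Variables (p : nat) (R A' : comNzRingType) (m : set R) (phi : {rmorphism R -> A'}).
Hypotheses (pp : prime p) (pR : p%:R = 0 :> R).
Hypotheses (nR : noetherian R) (lR : local_ring m) (cA : is_completion m phi).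

Let hm : is_ideal m. Proof. exact/prime_is_ideal/local_prime/lR. Qed.

Lemma completion_unit (J : nat -> set A') : complete_filtration J ->
  (forall n r, J n (phi r) <-> idealX m n r) ->
  (forall n y, exists r, J n (y - phi r)) ->
  forall y, ~ J 1 y -> exists s, s * y = 1.
Proof.
move=> cJ Jphi appr y Jy; have [r hr] := appr 1 y.
have hJ := cf_ideal cJ 1.
have [|s es] := local_unit nR lR (r := r).
  rewrite -[m](idealX1 hm) => /Jphi hr'; apply: Jy.
  by rewrite -(subrK (phi r) y); idD.
have [|t et] := cf_unit cJ (u := 1 - phi s * y).
  have -> : 1 - phi s * y = - (phi s * (y - phi r)) + (1 - phi (s * r)) by rewrite rmorphM; ring.
  by rewrite es rmorph1 subrr addr0; idN => //; idM.
by exists (t * phi s); rewrite -et; ring.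
Qed.

Lemma completion_cohen d (x : 'I_d -> R) : (forall i, m (x i)) ->
  (exists N, idealX m N `<=` gen_ideal (range x)) ->
  exists (A : comNzRingType) (X : 'I_d -> A) (ev : {rmorphism A -> A'}),
  [/\ [/\ noetherian A, p%:R = 0 :> A & frob_flat ([set 0] : set A) p],
      forall u v : A, u * v = 0 -> u = 0 \/ v = 0,
      (forall r, ~ gen_ideal (range X) r -> exists s, s * r = 1) /\
        ~ gen_ideal (range X) 1,
      forall i, ev (X i) = phi (x i) &
      exists r (e : 'I_r -> A'), forall y, exists a : 'I_r -> A,
        y = \sum_j ev (a j) * e j].
Proof.
move=> mx [N mN]; have [J [cJ Jphi appr eJ]] := completion_filtration nR cA.
have hJ n : is_ideal (J n) := cf_ideal cJ n.
have J11 : ~ J 1 1.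
  rewrite -(rmorph1 phi) => /Jphi; rewrite idealX1 //.
  by case: (local_prime lR).
have pA : p%:R = 0 :> A' by rewrite -(rmorph_nat phi) pR rmorph0.
have [Q [pi [pis pi0]]] := quotient_exists (hJ 1%N).
have [||k [f [fi fs]]] := @field_exists Q.
- by rewrite -(rmorph1 pi) => /pi0.
- move=> q q0; have [y ey] := pis q.
  have [|s es] := completion_unit cJ Jphi appr (y := y).
    by move=> /pi0; rewrite ey.
  by exists (pi s); rewrite -ey -rmorphM es rmorph1.
pose rho : {rmorphism A' -> k} := (f \o pi : {rmorphism A' -> k}).
have rho0 y : rho y = 0 <-> J 1 y.
  rewrite -pi0 /=; split=> [e|-> /=]; last exact: rmorph0.
  by apply: fi; rewrite rmorph0.
have rhos c : exists y, rho y = c.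
  by have [q <-] := fs c; have [y <-] := pis q; exists y.
have [sigma rs] := coefficient_field pp pA cJ rhos rho0.
have pk : p%:R = 0 :> k by rewrite -(rmorph_nat rho) pA rmorph0.
have [|A [s0 [X [nA dA uA A1 evA]]]] := @power_series_ring_exists p k d pp pk.
  by move=> r /eqP r0; exists r^-1; rewrite mulVf.
have [i|ev [_ evX fin]] := evA A' J sigma (fun i => phi (x i)) cJ.
  by apply/Jphi; rewrite idealX1.
exists A, X, ev; split=> //.
  by case: nA => nA ffA; split=> //; rewrite -(rmorph_nat s0) pk rmorph0.
(* Modulo each [J n] the completion is finitely spanned over the coefficient field, since one
   further layer needs only generators of [m ^ n]. A level [N] with [m ^ N] inside the parameter
   ideal yields generators over [A]. *)
have app n : exists r (e : 'I_r -> A'), forall y, exists c : 'I_r -> k,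
    J n (y - \sum_j sigma (c j) * e j).
  elim: n => [|n [r [e he]]].
    by exists 0%N, (fun=> 0) => y; exists (fun=> 0); apply: cf_0.
  have [l [g eg]] := noetherian_fg nR (idealX_ideal m n).
  exists (r + l)%N, (fun i => match split i with inl i => e i | inr i => phi (g i) end) => y.
  have [c hc] := he y; move: (hc); rewrite eJ eg ideal_ext_gen.
  have -> : phi @` range g = range (phi \o g).
    by rewrite image_comp.
  move=> /gen_rangeP [u eu].
  exists (fun i => match split i with inl i => c i | inr i => rho (u i) end).
  rewrite big_split_ord /=.
  under eq_bigr do rewrite (unsplitK (inl _)).
  under [X in _ - (_ + X)]eq_bigr do rewrite (unsplitK (inr _)).
  rewrite opprD addrA eu -sumrB; idS => // i; rewrite -mulrBl.
  rewrite -add1n; apply: (cf_mul cJ); first by apply/rho0; rewrite rmorphB rs subrr.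
  by apply/Jphi; rewrite eg; apply: gen_sub; exists i.
have [r [e he]] := app N; exists r, e => y.
have [y'|a] := fin 0%N (fun=> 0) r e _ y.
  have [c hc] := he y'; exists c; apply: addI_r => //.
  move: hc; rewrite eJ => /(ideal_extS mN); rewrite ideal_ext_gen image_comp.
  by rewrite /comp.
move=> /gen_rangeP [c]; rewrite big_ord0 => /eqP; rewrite subr_eq0 => /eqP ->.
by exists a.
Qed.
End Cohen.

(** * Formal fibres *)

Lemma residue_field_exists (R : comPzRingType) (P : set R) : prime_ideal P ->
  exists (K : fieldType) (f : {rmorphism R -> K}), is_residue_field P f /\
    forall (C : comPzRingType) (g : {rmorphism R -> C}), (forall r, P r -> g r = 0) ->
      (forall s, ~ P s -> exists y, y * g s = 1) ->
      exists h : {rmorphism K -> C}, forall r, h (f r) = g r.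
Proof.
move=> pP; have hP := prime_is_ideal pP.
have [D [pd [pds pd0]]] := quotient_exists hP.
pose S : set D := [set s | s <> 0].
have Spd r : S (pd r) <-> ~ P r by rewrite /S /= pd0.
have hS : mult_closed S.
  split=> [|u v]; first by rewrite -(rmorph1 pd); apply/Spd; case: pP.
  have [[r <-] [s <-]] := (pds u, pds v); rewrite -rmorphM => /Spd Pr /Spd Ps.
  by apply/Spd; case: pP => _ _ h /h [].
have [K0 [l loc]] := localization_exists hS.
have l0 r : l (pd r) = 0 <-> P r.
  split=> [/(loc_eq0 loc) [s]|/pd0 ->]; last exact: rmorph0.
  have [s' <-] := pds s; move=> /Spd Ps; rewrite -rmorphM => /pd0.
  by case: pP => _ _ h /h [].
have unit s : ~ P s -> exists y, y * l (pd s) = 1.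
  by move=> Ps; apply: (loc_inv loc); apply/Spd.
have frac y : exists r s, ~ P s /\ l (pd s) * y = l (pd r).
  have [r [s [Ss e]]] := loc_frac loc y; have [[r' er] [s' es]] := (pds r, pds s).
  by exists r', s'; rewrite er es; split=> //; apply/Spd; rewrite es.
have [||K [f0 [fi fs]]] := @field_exists K0.
- by rewrite -(rmorph1 l) -(rmorph1 pd) => /l0; case: pP.
- move=> x x0; have [r [s [Ps e]]] := frac x.
  have [|y ey] := unit r.
    move=> /l0 Pr; apply: x0; have [y ey] := unit s Ps.
    by rewrite -[x]mul1r -ey -mulrA e Pr mulr0.
  by exists (y * l (pd s)); rewrite -mulrA e ey.
have [v hv] : exists v : {rmorphism K -> K0}, cancel v f0.
  have /choice [v hv] := fs; have [|a b|a b|v' ev] := @rmorphism_exists _ _ v.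
  - by apply: fi; rewrite hv rmorph1.
  - by apply: fi; rewrite rmorphB !hv.
  - by apply: fi; rewrite rmorphM !hv.
  by exists v' => y; rewrite ev hv.
exists K, (f0 \o (l \o pd) : {rmorphism R -> K}); split.
  have f00 r : f0 (l (pd r)) = 0 <-> P r.
    by rewrite -l0; split=> [e|->]; [apply: fi|]; rewrite rmorph0.
  split=> [r|y]; first exact: f00.
  have [x <-] := fs y; have [r [s [Ps e]]] := frac x.
  exists r, s; split=> //=; rewrite -e rmorphM mulrC mulrA mulVf ?mul1r //.
  by apply/eqP => /f00.
move=> C g gP gS; have [|g1 hg1] := @quo_universal _ _ _ _ (conj pds pd0) C g.
  exact: gP.
have [|g2 hg2] := loc_universal loc hS (f := g1).
  by move=> s; have [s' <-] := pds s; move=> /Spd /gS [y ey]; exists y; rewrite hg1.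
exists (g2 \o v : {rmorphism K -> C}) => r /=.
have -> : v (f0 (l (pd r))) = l (pd r) by apply: fi; rewrite hv.
by rewrite hg2 hg1.
Qed.

Lemma residue_field_unique (R : comPzRingType) (K : fieldType) (P : set R)
    (f : {rmorphism R -> K}) (C : comPzRingType) (g h : {rmorphism K -> C}) :
  is_residue_field P f -> (forall r, g (f r) = h (f r)) -> g =1 h.
Proof.
move=> [f0 frac] e y; have [r [s [Ps ->]]] := frac y.
have s0 : f s != 0 by apply/eqP => /f0.
rewrite !rmorphM e; congr (_ * _).
rewrite -[LHS]mulr1 -(rmorph1 h) -(mulfV s0) rmorphM -e mulrA -rmorphM mulVf //.
by rewrite rmorph1 mul1r.
Qed.

Section FormalFibre.
Variables (R A' B : comPzRingType) (m P : set R).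
Variables (phi : {rmorphism R -> A'}) (pi : {rmorphism A' -> B}).
Hypotheses (nR : noetherian R) (lR : local_ring m) (cA : is_completion m phi).
Hypotheses (nA' : noetherian A') (pP : prime_ideal P).
Hypothesis quo : is_quotient (ideal_ext phi P) pi.

Let hm : is_ideal m. Proof. exact/prime_is_ideal/local_prime/lR. Qed.
Let hP : is_ideal P. Proof. exact: prime_is_ideal. Qed.
Let hE (I : set R) : is_ideal (ideal_ext phi I). Proof. exact: ideal_ext_ideal. Qed.
Local Notation theta := (pi \o phi : {rmorphism R -> B}).

Lemma formal_ext I y : is_ideal I ->
  ideal_ext theta I (pi y) -> addI (ideal_ext phi I) (ideal_ext phi P) y.
Proof.
move=> hI; have hS : is_ideal (addI (ideal_ext phi I) (ideal_ext phi P)) by [].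
suff /(_ (pi y)) h : ideal_ext theta I `<=` [set b | forall y, pi y = b ->
    addI (ideal_ext phi I) (ideal_ext phi P) y] by move=> /h; apply.
apply: ideal_ext_min => [|r Ir y' e]; last first.
  rewrite -(subrK (phi r) y'); idD => //; first by apply: addI_r => //; apply/(quo_eq quo).
  by apply: addI_l => //; apply: ideal_ext_in.
split=> [y' e|u v hu hv y' e|r u hu y' e].
- by apply: addI_r => //; apply/(quo_eq0 quo).
- have [[a ea] [b eb]] := (quo_surj quo u, quo_surj quo v).
  rewrite -(subrK (a + b) y'); idD => //; last by idD; [|exact: hu|exact: hv].
  by apply: addI_r => //; apply/(quo_eq quo); rewrite rmorphD ea eb.
- have [[a ea] [b eb]] := (quo_surj quo u, quo_surj quo r).
  rewrite -(subrK (b * a) y'); idD => //; last by idM; [|exact: hu].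
  by apply: addI_r => //; apply/(quo_eq quo); rewrite rmorphM ea eb.
Qed.

Lemma formal_contract I r : is_ideal I -> ideal_ext theta I (theta r) -> addI I P r.
Proof.
move=> hI /(formal_ext hI) [u [v [hu hv e]]].
apply: (completion_contract nR lR cA); first by [].
rewrite e; idD => //; first by apply: (ideal_extS (@addI_l _ I P hP)).
by apply: (ideal_extS (@addI_r _ I P hI)).
Qed.

Lemma formal_ker r : theta r = 0 <-> P r.
Proof.
split=> [e|Pr]; last by apply/(quo_eq0 quo); apply: ideal_ext_in.
have e0 : ideal_ext theta [set 0] (theta r) by rewrite e; exact: idl0.
by have [u [v [-> Pv ->]]] := formal_contract (set0_ideal R) e0; rewrite add0r.
Qed.

Lemma formal_approx n b : exists r, ideal_ext theta (idealX m n) (b - theta r).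
Proof.
have [J [cJ Jphi appr eJ]] := completion_filtration nR cA.
have [y <-] := quo_surj quo b; have [r hr] := appr n y; exists r.
rewrite /= -rmorphB; move: hr; rewrite eJ => /(@ideal_ext_in _ _ pi _ _).
apply: gen_min; first exact: ideal_ext_ideal.
move=> _ [z hz <-]; move: z hz; apply: gen_min => [|_ [s hs <-]].
  exact/preim_ideal/ideal_ext_ideal.
by apply: (@ideal_ext_in _ _ theta).
Qed.

Lemma formal_nonunit : ~ ideal_ext theta m 1.
Proof.
rewrite -(rmorph1 theta) => /(formal_contract hm).
have Pm : P `<=` m by apply: (local_prime_sub nR lR).
by move=> /(addI_min hm (@subset_refl _ m) Pm); case: (local_prime lR).
Qed.

(** A fragment of the flatness of completion. If [u * y] lies in [P A'], approximate [y] by [r] in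
    [R]: then [u * r] lies in [P + m ^ n], by Artin-Rees in [P + m ^ k * u], so [r] lies in
    [P + m ^ k] and [y] in [P A' + m ^ k A'] for every [k]. *)
Lemma formal_nzd u b : ~ P u -> theta u * b = 0 -> b = 0.
Proof.
move=> Pu; have [J [cJ Jphi appr eJ]] := completion_filtration nR cA.
have hJ := cf_ideal cJ; have [y <-] := quo_surj quo b.
rewrite /= -rmorphM => /(quo_eq0 quo) uy; apply/(quo_eq0 quo).
apply: (krull_intersection nA' (hJ 1%N)) => // [r /(cf_unit cJ) //|k].
have [n hn] := weak_artin_rees nR k hm hP (prI_ideal u).
have [r hr] := appr (n + k)%N y.
have hrn : J n (y - phi r) by apply: (cf_le cJ (leq_addr k n)).
have /hn : addI P (idealX m n) (r * u).
  apply: (completion_contract nR lR cA) => //; rewrite rmorphM mulrC.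
  have -> : phi u * phi r = phi u * y - phi u * (y - phi r) by ring.
  idB => //; first by apply: (ideal_extS (@addI_l _ P _ (idealX_ideal m n))).
  apply: (ideal_extS (@addI_r _ P _ hP)); idM => //; by rewrite -eJ.
case=> [|v [w [Pv + e]]]; first by exists r.
have -> : prI u = gen_ideal (range (fun _ : 'I_1 => u)).
  apply/seteqP; split=> [_ [t ->]|]; first by idM => //; apply: gen_sub; exists ord0.
  by apply: gen_min => // _ [_ _ <-]; apply: prI_self.
move=> /(idealM_gen (idealX_ideal m k)) [c [hc]]; rewrite big_ord1 => ew.
have Prs : P (r - c ord0).
  have : P (u * (r - c ord0)).
    by have -> : u * (r - c ord0) = v by rewrite -(addrK w v) -e ew; ring.
  by case: pP => _ _ h /h [].
have -> : y = phi (r - c ord0) + ((y - phi r) + phi (c ord0)) by rewrite rmorphB; ring.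
have hX : is_ideal (idealX (J 1) k) by [].
idD => //; first by apply: addI_l => //; apply: ideal_ext_in.
apply: addI_r => //.
have JX : ideal_ext phi (idealX m k) `<=` idealX (J 1) k.
  apply: ideal_ext_min => // t ht; have := ideal_ext_idealX phi hm ht.
  by rewrite eJ idealX1.
idD => //; apply: JX; last exact: ideal_ext_in.
by rewrite -eJ; apply: (cf_le cJ (leq_addl n k)).
Qed.

(** Inverting the image of the complement of [P] turns [B] into the formal fibre [F] at [P]; the
    localization of [B] at [Q] is one of [F] as well. *)
Lemma formal_fibre_regular (Q : set B) : G_ring R -> prime_ideal Q ->
  (forall u, ~ P u -> ~ Q (theta u)) -> regular_at Q.
Proof.
move=> gR pQ QU L psi locL.
pose U : set B := theta @` (~` P).
have hU : mult_closed U.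
  split=> [|_ _ [u Pu <-] [v Pv <-]]; first by exists 1; [case: pP|exact: rmorph1].
  by exists (u * v); [move=> /=; case: pP => _ _ h /h []|exact: (rmorphM theta)].
have [F [chi locF]] := localization_exists hU.
have [K [f [fres funiv]]] := residue_field_exists pP.
have [||i hi] := funiv F (chi \o theta : {rmorphism R -> F}).
- by move=> r Pr; rewrite /= (_ : pi (phi r) = 0) ?rmorph0 //; apply/formal_ker.
- by move=> s Ps; apply: (loc_inv locF); exists s.
have lid : is_localization (~` m) (idfun : {rmorphism R -> R}).
  split=> [s ms|y|r].
  - by have [t et] := local_unit nR lR ms; exists t; rewrite mulrC.
  - by exists y, 1; split; [case: (local_prime lR)|rewrite mul1r].
  - split=> [/= ->|[s ms e]]; first by exists 1; [case: (local_prime lR)|rewrite mulr0].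
    by have [t et] := local_unit nR lR ms; rewrite -[r]mul1r -et -mulrA e mulr0.
have tens : is_tensor f phi i (chi \o pi : {rmorphism A' -> F}).
  split=> [r|C u v uv]; first exact: hi.
  have [y hy|v' hv'] := quo_universal quo (f := v).
    move: y hy; apply: gen_min => [|_ [r Pr <-]].
      split=> [|a b|a b] /=; first exact: rmorph0.
        by rewrite rmorphD => -> ->; rewrite addr0.
      by rewrite rmorphM => ->; rewrite mulr0.
    by rewrite /= -uv (proj2 (proj1 fres r)) ?rmorph0.
  have [_ [s Ps <-]|w hw] := loc_universal locF hU (f := v').
    exists (u (f s)^-1); rewrite /= hv' -uv -rmorphM mulVf ?rmorph1 //.
    by apply/eqP => /(proj1 fres s).
  exists w; split=> [|b|w' h1 h2]; last 2 first.
  - by rewrite /= hw hv'.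
  - apply: (loc_unique locF) => b; have [y <-] := quo_surj quo b.
    by rewrite hw hv' -h2.
  apply: (@residue_field_unique _ _ _ f _ (w \o i) u fres) => r.
  by rewrite /= hi /= hw hv' uv.
have gi := gR m (local_prime lR) R idfun lid m lR A' phi cA P pP K f fres F i _ tens.
(* Geometric regularity is used for the trivial extension [K^o] of [K], whose tensor product with
   [F] is [F]. *)
have [_ regF] : regular_ring F.
  apply: (gi K^o F i idfun); split=> [r|C u v uv].
    by rewrite /= /GRing.in_alg /= -[in RHS](mulr1 r).
  exists v; split=> [a|b|w' h1 h2]; [|by []|by move=> y; exact: (h2 y)].
  by rewrite -uv /= /GRing.in_alg /= -[in RHS](mulr1 a).
have [|g locg] := loc_loc hU locF pQ _ locL.
  by move=> _ [s Ps <-]; apply: QU.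
apply: (regF (ideal_ext chi Q) _ L g locg).
by apply: (loc_ext_prime locF hU pQ) => _ [s Ps <-]; apply: QU.
Qed.
End FormalFibre.

(** * Extended Rees rings and dimension *)

Lemma hilbert_basis (S : comNzRingType) : noetherian S -> noetherian {poly S}.
Proof.
move=> nS; apply: fg_noetherian => J hJ.
pose L n := [set a : S | exists f : {poly S}, [/\ J f, (size f <= n.+1)%N & f`_n = a]].
have hL n : is_ideal (L n).
  split=> [|_ _ [f [Jf fo <-]] [g [Jg og <-]]|c _ [f [Jf fo <-]]].
  - by exists 0; rewrite size_poly0 coef0; split=> //; id0.
  - exists (f + g); rewrite coefD; split=> //; first by idD.
    by apply: leq_trans (size_polyD _ _) _; rewrite geq_max fo.
  - exists (c%:P * f); rewrite coefCM; split=> //; first by idM.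
    by rewrite mul_polyC; apply: leq_trans (size_scale_leq _ _) _.
have LS n : L n `<=` L n.+1.
  move=> _ [f [Jf fo <-]]; exists ('X * f); rewrite coefXM; split=> //; first by idM.
  by apply/leq_sizeP => -[//|j] nj; rewrite coefXM; apply: (leq_sizeP _ _ fo).
have [N hN] := noetherian_acc nS hL LS.
have /choice [k hk] : forall n, exists k, exists x : 'I_k -> S, L n = gen_ideal (range x).
  by move=> n; have [k [x ex]] := noetherian_fg nS (hL n); exists k, x.
have hg n : exists g : 'I_(k n) -> {poly S},
    (forall i, J (g i) /\ (size (g i) <= n.+1)%N) /\
    forall a, L n a -> exists c : 'I_(k n) -> S, a = \sum_i c i * (g i)`_n.
  have [x ex] := hk n.
  have /choice [g hg] : forall i, exists f : {poly S},
      [/\ J f, (size f <= n.+1)%N & f`_n = x i].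
    by move=> i; have : L n (x i) by rewrite ex; apply: gen_sub; exists i.
  exists g; split=> [i|a]; first by case: (hg i).
  rewrite ex => /gen_rangeP [c ->]; exists c.
  by apply: eq_bigr => i _; case: (hg i) => _ _ ->.
pose g n := sval (cid (hg n)).
have Jg n i : J (g n i) by case: (svalP (cid (hg n))) => h _; case: (h i).
have og n i : (size (g n i) <= n.+1)%N.
  by case: (svalP (cid (hg n))) => h _; case: (h i).
have Lg n a : L n a -> exists c : 'I_(k n) -> S, a = \sum_i c i * (g n i)`_n.
  by case: (svalP (cid (hg n))) => _; apply.
pose x (t : {n : 'I_N.+1 & 'I_(k n)}) := g _ (tagged t).
suff -> : J = gen_ideal (range x) by exact: fin_gen_T.
apply/seteqP; split; last by apply: gen_min => // _ [t _ <-]; apply: Jg.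
have gx n i : (n <= N)%N -> gen_ideal (range x) (g n i).
  rewrite -ltnS => nN; apply: gen_sub.
  by exists (Tagged (fun n : 'I_N.+1 => 'I_(k n)) (i : 'I_(k (Ordinal nN)))).
move=> f; move: {2}(size f) (leqnn (size f)) => s; elim: s f => [|s IH] f fs Jf.
  by have -> : f = 0; [apply/eqP; rewrite -size_poly_leq0|id0].
pose n := minn s N; have ns : (n <= s)%N by rewrite geq_minl.
have nN : (n <= N)%N by rewrite geq_minr.
have Ls : L n f`_s.
  have -> : L n = L s; last by exists f.
  by rewrite /n /minn; case: ltnP => // /hN ->.
have [c ec] := Lg _ _ Ls.
pose h := 'X^(s - n) * \sum_i (c i)%:P * g n i.
have hc j : h`_j = if (j < s - n)%N then 0 else \sum_i c i * (g n i)`_(j - (s - n)).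
  rewrite /h coefXnM; case: ifP => // _; rewrite coef_sum.
  by apply: eq_bigr => i _; rewrite coefCM.
have hX : is_ideal (gen_ideal (range x)) by [].
have hI : gen_ideal (range x) h.
  by apply: (idlM _ hX); idS => // i; idM => //; apply: gx.
rewrite -(subrK h f); idD => //; apply: IH; last first.
  by idB => //; apply: (idlM _ hJ); idS => // i; idM.
apply/leq_sizeP => j; rewrite leq_eqVlt => /orP [/eqP <-|sj].
  by rewrite coefB hc ltnNge leq_subr subKn // -ec subrr.
rewrite coefB hc (leq_sizeP _ _ fs) // ltnNge (leq_trans (leq_subr _ _) (ltnW sj)) /=.
rewrite big1 ?subr0 // => i _.
rewrite (leq_sizeP _ _ (og n i)) ?mulr0 //.
by move: ns sj; clear; lia.
Qed.

(** In the Rees argument this polynomial ring stands in for the Rees ring: ideals are pulled back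
    along [g] from Laurent polynomials. The last clause has the shape that [finite_type] asks
    for. *)
Lemma polynomial_extension (R A : comNzRingType) (f : {rmorphism R -> A}) n
    (x : 'I_n -> A) : noetherian R ->
  exists (S : comNzRingType) (h : {rmorphism R -> S}) (T : 'I_n -> S) (g : {rmorphism S -> A}),
  [/\ noetherian S, forall r, g (h r) = f r, forall i, g (T i) = x i &
      smallest (fun B : set S => (forall u v, B u -> B v -> B (u + v)) /\
        (forall u v, B u -> B v -> B (u * v))) (range h `|` range T) = setT].
Proof.
move=> nR; elim: n x => [|n IH] x.
  exists R, idfun, (fun=> 0), f; split=> [//|//|[]//|].
  by apply/seteqP; split=> // r _ G [_ hG]; apply: hG; left; exists r.
have [S [h [T [g [nS gh gT hS]]]]] := IH (fun i => x (lift ord0 i)).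
have cfx : commr_rmorph g (x ord0) by move=> y; apply: mulrC.
exists {poly S}, (polyC \o h : {rmorphism R -> {poly S}}),
  (fun i => if unlift ord0 i is Some j then (T j)%:P else 'X), (horner_morph cfx).
split.
- exact: hilbert_basis.
- by move=> r /=; rewrite horner_morphC.
- move=> i; case: unliftP => [j|] -> /=; first by rewrite horner_morphC.
  exact: horner_morphX.
apply/seteqP; split=> // q _ G [[GD GM] hG].
have GC s : G s%:P.
  have : [set: S] s by []; rewrite -hS => /(_ [set s | G s%:P]); apply; split.
    by split=> u v Gu Gv /=; [rewrite polyCD; apply: GD|rewrite polyCM; apply: GM].
  move=> _ [[r _ <-]|[j _ <-]]; apply: hG; first by left; exists r.
  by right; exists (lift ord0 j); rewrite ?liftK.
have GX : G 'X by apply: hG; right; exists ord0; rewrite ?unlift_none.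
elim/poly_ind: q => [|q c Gq]; first exact: (GC 0).
by apply: GD => //; apply: GM.
Qed.

Section ChainSurgery.
Variable R : comPzRingType.

Lemma chain_cons (P : set R) l c : prime_ideal P -> P `<` c 0%N -> prime_chain l c ->
  prime_chain l.+1 (fun i => if i is j.+1 then c j else P).
Proof. by move=> pP Pc [hc cc]; split=> [[|i]|[|i]] //; [apply: hc|apply: cc]. Qed.

Lemma chain_insert l (c : nat -> set R) i (P : set R) : prime_chain l c -> (i < l)%N -> prime_ideal P ->
  c i `<` P -> P `<` c i.+1 ->
  prime_chain l.+1 (fun j => if (j <= i)%N then c j else if j == i.+1 then P else c j.-1).
Proof.
move=> [hc cc] il pP ciP Pci; split=> [j jl|j jl].
  by case: leqP => ij; [apply: hc; lia|case: eqP => // ne; apply: hc; lia].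
case: (ltngtP j i) => ji.
- by apply: cc; lia.
- rewrite eqSS (gtn_eqF ji); case: eqP => [->//|ne].
  by have := cc j.-1; rewrite prednK; [apply; lia|lia].
- by rewrite ji eqxx.
Qed.
End ChainSurgery.

Definition poly_ideal (R : comNzRingType) (c : set R) : set {poly R} :=
  [set F | forall i, c F`_i].

Lemma poly_ideal_prime (R : comNzRingType) (c : set R) :
  prime_ideal c -> prime_ideal (poly_ideal c).
Proof.
move=> pc; have [K [f [[f0 _] _]]] := residue_field_exists pc.
have h F : poly_ideal c F <-> map_poly f F = 0.
  split=> [hF|/polyP hF i]; last by apply/f0; have := hF i; rewrite coef_map coef0.
  by apply/polyP => i; rewrite coef_map coef0; apply/f0.
have h1 F : poly_ideal c F -> map_poly f F = 0 by case: (h F).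
have h2 F : map_poly f F = 0 -> poly_ideal c F by case: (h F).
split; first split=> [|F G hF hG|F G hG].
- by apply: h2; exact: rmorph0.
- by apply: h2; rewrite rmorphD /= !h1 // addr0.
- by apply: h2; rewrite rmorphM /= [X in _ * X]h1 // mulr0.
- by move=> /(_ 0%N); rewrite coef1; case: pc.
move=> F G /h1; rewrite rmorphM /= => /eqP.
by rewrite mulf_eq0 => /orP [] /eqP /h2 e; [left|right].
Qed.

(** * Laurent polynomials and the extended Rees ring *)

Section LaurentPolynomials.
Variables (R L : comNzRingType) (lam : {rmorphism {poly R} -> L}).
Hypothesis loc : is_localization [set ('X^n : {poly R}) | n in [set: nat]] lam.
Local Notation t := (lam 'X).

Lemma laurent_mult_closed : mult_closed [set ('X^n : {poly R}) | n in [set: nat]].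
Proof.
split=> [|_ _ [i _ <-] [j _ <-]]; first by exists 0%N.
by exists (i + j)%N; rewrite ?exprD.
Qed.

Lemma laurent_inj F G : lam F = lam G -> F = G.
Proof.
move=> e; have /(loc_eq0 loc) [_ [n _ <-] /polyP h] : lam (F - G) = 0.
  by rewrite rmorphB e subrr.
apply/polyP => i; have := h (n + i)%N; rewrite coefXnM ltnNge leq_addr /= addKn.
by rewrite coefB coef0 => /eqP; rewrite subr_eq0 => /eqP.
Qed.

Lemma laurent_unit : exists v, v * t = 1.
Proof. by apply: (loc_inv loc); exists 1%N; rewrite ?expr1. Qed.

Lemma laurent_coef_unique K K' F F' y :
  t ^+ K * y = lam F -> t ^+ K' * y = lam F' -> F`_K = F'`_K'.
Proof.
move=> e e'; have /laurent_inj /polyP /(_ (K + K')%N) : lam ('X^K' * F) = lam ('X^K * F').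
  by rewrite !rmorphM !rmorphXn /= -e -e'; ring.
by rewrite !coefXnM !ltnNge leq_addl leq_addr /= addnK addKn.
Qed.

Lemma laurent_extP (c : set R) y : prime_ideal c ->
  ideal_ext lam (poly_ideal c) y <->
  exists K F, t ^+ K * y = lam F /\ forall i, c F`_i.
Proof.
move=> /poly_ideal_prime /prime_is_ideal hc.
have hE := loc_extP loc laurent_mult_closed y hc; split=> [/hE|].
  by move=> [F [s [hF [n _ es] e]]]; exists n, F; rewrite -e -es (rmorphXn lam).
move=> [K [F [e hF]]]; apply/hE; exists F, 'X^K; split; first exact: hF.
  by exists K.
by rewrite (rmorphXn lam).
Qed.

Lemma laurent_ext_prime (c : set R) : prime_ideal c ->
  prime_ideal (ideal_ext lam (poly_ideal c)).
Proof.
move=> pc; apply: (loc_ext_prime loc laurent_mult_closed (poly_ideal_prime pc)).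
move=> _ [n _ <-] /(_ n); rewrite coefXn eqxx; by case: pc.
Qed.

Lemma laurent_ext_C (c : set R) r : prime_ideal c ->
  ideal_ext lam (poly_ideal c) (lam r%:P) <-> c r.
Proof.
move=> pc; split=> [|cr]; last first.
  apply: ideal_ext_in => i; rewrite coefC; case: ifP => // _.
  exact: (idl0 (prime_is_ideal pc)).
move=> /(laurent_extP _ pc) [K [F [e hF]]].
have -> : r = F`_K; last exact: hF.
have e0 : t ^+ 0 * lam r%:P = lam r%:P by rewrite expr0 mul1r.
by rewrite -(laurent_coef_unique e0 e) coefC.
Qed.

Lemma laurent_ext_X (c : set R) : prime_ideal c -> ~ ideal_ext lam (poly_ideal c) t.
Proof.
move=> pc; have [_ h1 hM] := laurent_ext_prime pc; have [v ev] := laurent_unit.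
by move=> ht; apply: h1; rewrite -ev; apply: (idlM v (prime_is_ideal (laurent_ext_prime pc)) ht).
Qed.

Variables (I m : set R).
Hypotheses (pm : prime_ideal m) (hI : is_ideal I) (Im : I `<=` m).
Let hm := prime_is_ideal pm.

(* The extended Rees ring of [I] consists of the Laurent polynomials whose
   coefficient in degree [- n] lies in [I ^ n]. *)
Definition rees y := exists K F, t ^+ K * y = lam F /\ forall i, idealX I (K - i) F`_i.

Lemma rees_ge y : rees y -> exists K0, forall j, exists F,
  t ^+ (K0 + j) * y = lam F /\ forall i, idealX I (K0 + j - i) F`_i.
Proof.
move=> [K [F [e hF]]]; exists K => j; exists ('X^j * F); split=> [|i].
  by rewrite rmorphM rmorphXn /= -e exprD; ring.
rewrite coefXnM; case: ltnP => ij; first by id0.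
by have -> : (K + j - i = K - (i - j))%N by lia.
Qed.

Lemma rees_D y z : rees y -> rees z -> rees (y + z).
Proof.
move=> /rees_ge [K hK] /rees_ge [K' hK'].
have [[F [e hF]] [F' [e' hF']]] := (hK K', hK' K).
exists (K + K')%N, (F + F'); split=> [|i]; last first.
  by rewrite coefD; idD => //; rewrite addnC.
by rewrite rmorphD -e -e' addnC; ring.
Qed.

Lemma rees_M y z : rees y -> rees z -> rees (y * z).
Proof.
move=> [K [F [e hF]]] [K' [F' [e' hF']]].
exists (K + K')%N, (F * F'); split=> [|i]; first by rewrite rmorphM -e -e' exprD; ring.
rewrite coefM; idS => // j; have ji : (j <= i)%N by rewrite -ltnS.
apply: (@idealX_le _ I _ ((K - j) + (K' - (i - j)))%N); first lia.
exact: idealX_mul.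
Qed.

Lemma rees_C r : rees (lam r%:P).
Proof. by exists 0%N, r%:P; rewrite expr0 mul1r; split=> // i; rewrite sub0n. Qed.

Lemma rees_X : rees t.
Proof. by exists 0%N, 'X; rewrite expr0 mul1r; split=> // i; rewrite sub0n. Qed.

Lemma rees_V v r : v * t = 1 -> I r -> rees (v * lam r%:P).
Proof.
move=> ev Ir; exists 1%N, r%:P; rewrite expr1 mulrA [t * v]mulrC ev mul1r.
split=> // -[|i]; rewrite coefC /=; last by apply: (idl0 (idealX_ideal I (1 - i.+1))).
by change (idealX I 1 r); rewrite idealX1.
Qed.

(* The ideal of the elements whose coefficient in degree [0] lies in [m]. *)
Definition rees_max y := exists K F, t ^+ K * y = lam F /\ m F`_K.

Lemma rees_maxP K F y : t ^+ K * y = lam F -> rees_max y <-> m F`_K.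
Proof.
move=> e; split=> [[K' [F' [e' h]]]|h]; last by exists K, F.
by rewrite (laurent_coef_unique e e').
Qed.

(** In the coefficient of degree [0] of the product, every term except the product of the two
    coefficients of degree [0] has a factor of negative degree, which lies in [I] and so in [m]. *)
Lemma rees_max_M y z : rees y -> rees z ->
  rees_max (y * z) <-> (rees_max y \/ rees_max z).
Proof.
move=> [K [F [e hF]]] [K' [F' [e' hF']]].
have ee : t ^+ (K + K') * (y * z) = lam (F * F') by rewrite rmorphM -e -e' exprD; ring.
rewrite (rees_maxP e) (rees_maxP e') (rees_maxP ee).
suff h : m ((F * F')`_(K + K') - F`_K * F'`_K').
  split=> [h'|h'].
    have : m (F`_K * F'`_K').
      by rewrite -(subKr (F * F')`_(K + K') (F`_K * F'`_K')); idB.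
    by case: pm => _ _ hp /hp.
  rewrite -(subrK (F`_K * F'`_K') (F * F')`_(K + K')); idD => //.
  by case: h' => h'; [idMr|idM].
have KK : (K < (K + K').+1)%N by rewrite ltnS leq_addr.
rewrite coefM (bigD1 (Ordinal KK)) //= addKn addrAC subrr add0r; idSP => // j.
move=> /eqP jK; have ji : (j <= K + K')%N by rewrite -ltnS.
have {}jK : nat_of_ord j <> K by move=> h; apply: jK; apply: val_inj.
have pos n : (0 < n)%N -> idealX I n `<=` m.
  by move=> n0 u /(idealX_sub hI n0) /Im.
have [jK'|jK'] := ltnP j K; first by idMr => //; apply: (pos (K - j)%N) => //; lia.
by idM => //; apply: (pos (K' - (K + K' - j))%N) => //; lia.
Qed.

Lemma rees_max_D y z : rees_max y -> rees_max z -> rees_max (y + z).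
Proof.
move=> [K [F [e hF]]] [K' [F' [e' hF']]].
exists (K + K')%N, ('X^K' * F + 'X^K * F'); split.
  by rewrite rmorphD !rmorphM !rmorphXn /= -e -e' exprD; ring.
rewrite coefD !coefXnM !ltnNge leq_addl leq_addr /= addnK addKn; idD => //.
Qed.

Lemma rees_max_C r : rees_max (lam r%:P) <-> m r.
Proof.
have e : t ^+ 0 * lam r%:P = lam r%:P by rewrite expr0 mul1r.
by rewrite (rees_maxP e) coefC.
Qed.

Lemma rees_max_X : rees_max t.
Proof. by exists 0%N, 'X; rewrite expr0 mul1r coefX; split=> //; apply: (idl0 hm). Qed.

Lemma rees_max_V v r : v * t = 1 -> rees_max (v * lam r%:P).
Proof.
move=> ev; exists 1%N, r%:P; rewrite expr1 mulrA [t * v]mulrC ev mul1r coefC.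
by split=> //; apply: (idl0 hm).
Qed.

Lemma rees_max_ext c y : prime_ideal c -> c `<=` m ->
  ideal_ext lam (poly_ideal c) y -> rees_max y.
Proof. by move=> pc cm /(laurent_extP _ pc) [K [F [e hF]]]; exists K, F; split=> //; apply: cm. Qed.

(* Compare the coefficients of degree [- N] in the relation. *)
Lemma rees_initial (P : set R) v r N s u h : prime_ideal P -> v * t = 1 ->
  (forall x, ~ m x -> exists y, y * x = 1) ->
  rees s -> ~ rees_max s -> rees h -> ideal_ext lam (poly_ideal P) u ->
  s * (v * lam r%:P) ^+ N = u + h * t -> addI (idealX I N.+1) P (r ^+ N).
Proof.
move=> pP ev unit /rees_ge [K1 hs] ms /rees_ge [K2 hh] /(laurent_extP _ pP) [K3 [U [eU hU]]] e.
have hP := prime_is_ideal pP.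
have [F [eF hF]] := hs (K2 + K3 + N.+1)%N; have [H [eH hH]] := hh (K1 + K3 + N.+1)%N.
pose K := (K1 + (K2 + K3 + N.+1))%N.
have K2E : (K2 + (K1 + K3 + N.+1) = K)%N by rewrite /K; lia.
rewrite K2E in eH hH; rewrite -/K in eF hF.
have tv n : t ^+ n * v ^+ n = 1 by rewrite -exprMn mulrC ev expr1n.
have /laurent_inj /polyP /(_ K) : lam (F * (r ^+ N)%:P) =
    lam ('X^(K - K3 + N) * U + 'X^(N.+1) * H).
  rewrite rmorphD !rmorphM !rmorphXn /= -eF -eH -eU.
  have -> : lam r%:P ^+ N = t ^+ N * (v * lam r%:P) ^+ N by rewrite exprMn mulrA tv mul1r.
  have -> : t ^+ K * s * (t ^+ N * (v * lam r%:P) ^+ N) = t ^+ K * t ^+ N * (u + h * t).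
    by rewrite -e; ring.
  have -> : t ^+ (K - K3 + N) * (t ^+ K3 * u) = t ^+ K * t ^+ N * u.
    rewrite mulrA -!exprD; congr (_ ^+ _ * _); rewrite /K; lia.
  by rewrite exprS; ring.
rewrite coefMC coefD !coefXnM; have -> : (K < N.+1)%N = false by rewrite /K; lia.
move=> eK; have [|y ey] := unit F`_K; first by move: ms; rewrite (rees_maxP eF).
have -> : r ^+ N = y * (H`_(K - N.+1) + (if (K < K - K3 + N)%N then 0 else U`_(K - (K - K3 + N)))).
  by rewrite addrC -eK mulrA ey mul1r.
exists (y * H`_(K - N.+1)), (y * if (K < K - K3 + N)%N then 0 else U`_(K - (K - K3 + N))).
split; last by rewrite mulrDr.
  idM => //; have := hH (K - N.+1)%N.
  by rewrite (_ : (K - (K - N.+1) = N.+1)%N) // /K; lia.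
by idM => //; case: ifP => // _; id0.
Qed.
End LaurentPolynomials.

Lemma saturated_chain_exists (S : comPzRingType) (P Q : set S) e : prime_ideal P ->
  prime_ideal Q -> P `<=` Q -> (forall l c, chain_between P Q l c -> (l <= e)%N) ->
  exists l c, chain_between P Q l c /\ saturated_chain l c.
Proof.
move=> pP pQ PQ bound; pose has l := `[< exists c, chain_between P Q l c >].
have exl : exists l, has l.
  have [eq|ne] := pselect (P = Q).
    exists 0%N; apply/asboolP; exists (fun=> P); split=> //; split=> //.
  exists 1%N; apply/asboolP; exists (fun i => if i is 0%N then P else Q); split=> //.
  split=> [[|i] //|[|i] // _]; split=> // QP; apply: ne; exact/seteqP.
have [|l /asboolP [c [hc c0 cl]] lmax] := @ex_maxnP has e exl.
  by move=> l /asboolP [c /bound].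
exists l, c; split=> // i il [P' pP' [h1 h2]].
suff /lmax : has l.+1 by rewrite ltnn.
apply/asboolP; exists (fun j => if (j <= i)%N then c j else if j == i.+1 then P' else c j.-1).
split=> //; first exact: chain_insert.
by rewrite ltnNge (ltnW il) /= eqSS gtn_eqF.
Qed.

Section ReesDimension.
Variables (R : comNzRingType) (m P : set R) (e r : nat) (a : 'I_(e + r) -> R).
Variables (i1 : 'I_(e + r)) (d N0 : nat) (c : nat -> set R).
Hypotheses (nR : noetherian R) (lR : local_ring m) (ucR : universally_catenary R).
Local Notation I := (gen_ideal (range a)).
Hypothesis ma : forall i, m (a i).
Hypothesis mI : idealX m N0 `<=` addI I P.
Hypothesis init : forall N, ~ addI (idealX I N.+1) P (a i1 ^+ N).
Hypothesis rel : forall j, addI (idealX I 3) P (a i1 * a (rshift e j)).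
Hypotheses (hc : prime_chain d c) (c0 : c 0%N = P).

(* In the extended Rees ring [S] of [I] over [R / P], the chain [c] gives a
   chain of length [d + 1] below [M], whereas [t] and the relations
   [a_1 a_(e + j) in I ^ 3] give a saturated chain of length at most [e + 1]. *)
Lemma rees_dimension : (d <= e)%N.
Proof.
have pm := local_prime lR; have hm := prime_is_ideal pm.
have pc i : (i <= d)%N -> prime_ideal (c i) by case: (hc) => h _; apply: h.
have pP : prime_ideal P by rewrite -c0; apply: pc.
have hP := prime_is_ideal pP.
have hI : is_ideal I by [].
have Im : I `<=` m by apply: gen_min => // _ [i _ <-].
have [L [lam loc]] := localization_exists (laurent_mult_closed R).
have L1 : (1 : L) <> 0.
  rewrite -(rmorph1 lam) => /(loc_eq0 loc) [_ [n _ <-]] /eqP.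
  by rewrite mulr1 -size_poly_eq0 size_polyXn.
have [L' eL] := comnz_exists L1; subst L; rename L' into L.
have [v ev] := laurent_unit loc.
pose x (i : 'I_(e + r).+1) := if unlift ord0 i is Some j then v * lam (a j)%:P else lam 'X.
have [S [h [T [g [nS gh gT hS]]]]] :=
  polynomial_extension (lam \o polyC : {rmorphism R -> L}) x nR.
have gT0 : g (T ord0) = lam 'X by rewrite gT /x unlift_none.
have gTa i : g (T (lift ord0 i)) = v * lam (a i)%:P by rewrite gT /x liftK.
have Sind (G : set S) : (forall u v, G u -> G v -> G (u + v)) ->
    (forall u v, G u -> G v -> G (u * v)) -> (forall r, G (h r)) -> G (T ord0) ->
    (forall i, G (T (lift ord0 i))) -> forall s, G s.
  move=> GD GM Gh G0 Gi s; have : [set: S] s by []; rewrite -hS => /(_ G); apply.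
  split=> // _ [[r' _ <-] //|[i _ <-]]; by case: (unliftP ord0 i) => [j|] ->.
have rS : forall s, rees lam I (g s).
  apply: Sind => [u w|u w|y||i].
  - by rewrite rmorphD; apply: rees_D.
  - by rewrite rmorphM; apply: rees_M.
  - by rewrite gh; apply: rees_C.
  - by rewrite gT0; apply: rees_X.
  - by rewrite gTa; apply: rees_V => //; apply: gen_sub; exists i.
pose Pc (q : set R) : set S := g @^-1` (ideal_ext lam (poly_ideal q)).
have pPc q : prime_ideal q -> prime_ideal (Pc q).
  by move=> pq; apply: preim_prime; apply: laurent_ext_prime.
pose M : set S := [set s | rees_max lam m (g s)].
have Mh y : M (h y) <-> m y by rewrite /M /= gh; apply: rees_max_C.
have MT i : M (T i).
  rewrite /M /=; case: (unliftP ord0 i) => [j|] ->; first by rewrite gTa; apply: rees_max_V.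
  by rewrite gT0; apply: rees_max_X.
have MM u w : M (u * w) <-> M u \/ M w.
  by rewrite /M /= rmorphM; apply: (rees_max_M loc pm hI Im).
have pM : prime_ideal M.
  split=> [|/= M1|u w /MM //].
    split=> [|u w|u w Mw].
    - by rewrite -(rmorph0 h); apply/Mh; id0.
    - by rewrite /M /= rmorphD; apply: rees_max_D.
    - by apply/MM; right.
  by move: M1; rewrite -(rmorph1 h) => /Mh; case: pm.
have hM := prime_is_ideal pM.
have PcM q : prime_ideal q -> Pc q `<` M.
  move=> pq; split=> [s|]; first exact: (rees_max_ext loc pq (local_prime_sub nR lR pq)).
  by move=> /(_ _ (MT ord0)); rewrite /Pc /= gT0; apply: laurent_ext_X.
have catS : catenary S.
  apply: (ucR (f := h)); exists (codom T).
  rewrite (_ : [set` codom T] = range T) //; apply/seteqP; split=> s /=.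
    by move=> /codomP [i ->]; exists i.
  by move=> [i _ <-]; apply: codom_f.
set P0 := Pc P; have pP0 : prime_ideal P0 := pPc _ pP; have hP0 := prime_is_ideal pP0.
have [n hn] := catS _ _ pP0 pM (proj1 (PcM _ pP)).
(* The pullback of [c] to [S] with [M] on top; the variable lies in [M] but in no pulled back
   prime. *)
have dn : (d.+1 <= n)%N.
  case: (hn d.+1 (fun i => if (i <= d)%N then Pc (c i) else M)) => //.
  split; rewrite ?c0 ?ltnn //; split=> i.
    by move=> _; case: (leqP i d) => id //; exact: (pPc (c i) (pc i id)).
  move=> id'; have [->|id] : i = d \/ (i < d)%N by lia.
    by rewrite leqnn ltnn; apply: PcM; apply: pc.
  rewrite (ltnW id) id; have [ss ns] : c i `<` c i.+1 by case: hc => _; apply.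
  split=> [s|hs]; first by apply: ideal_extS => F hF j; apply: ss.
  apply: ns => y hy; have := hs (h y); rewrite /Pc /= gh /=.
  by rewrite !(laurent_ext_C loc) //; [apply|apply: pc; lia|apply: pc; lia].
set T0 := T ord0; set T1 := T (lift ord0 i1).
set J := addI P0 (prI T0); have hJ : is_ideal J by apply: addI_ideal.
have P0T0 : ~ P0 T0 by rewrite /P0 /Pc /= gT0; apply: laurent_ext_X.
(* Sought is a prime below [M] over [P0] and the variable that misses [T1]. By [rees_initial] and
   [init], no [s * T1 ^+ N] with [s] outside [M] lies in [J]. *)
pose U : set S := [set u | exists s N, ~ M s /\ u = s * T1 ^+ N].
have M1 : ~ M 1 by case: pM.
have hU : mult_closed U.
  split=> [|_ _ [s [N [Ms ->]]] [s' [N' [Ms' ->]]]].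
    by exists 1, 0%N; rewrite mul1r.
  exists (s * s'), (N + N')%N; split; first by move=> /MM [].
  by rewrite exprD; ring.
have [u|Q [pQ JQ QU]] := prime_avoiding nS hJ hU.
  move=> [u0 [_ [hu0 [y ->] ->]]] [s [N [Ms es]]]; apply: (init (N := N)).
  have := rees_initial loc pP ev (local_unit nR lR) (rS s) Ms (rS y) hu0.
  by apply; rewrite -gTa -gT0 -rmorphXn -!rmorphM -es rmorphD.
have QM : Q `<=` M.
  move=> s Qs; apply: contrapT => Ms; apply: (QU s) => //.
  by exists s, 0%N; rewrite mulr1.
have QT1 : ~ Q T1 by move=> /QU; apply; exists 1, 1%N; rewrite mul1r.
have [n' [pn' Jn' n'Q minn']] := minimal_over nS hJ pQ JQ.
have hn' := prime_is_ideal pn'.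
have n'M : n' `<=` M := subset_trans n'Q QM.
have P0n' : P0 `<=` n' := subset_trans (@addI_l _ P0 _ (prI_ideal T0)) Jn'.
have n'T0 : n' T0 by apply/Jn'/addI_r => //; apply: prI_self.
(* In the Rees ring, elements of [I ^ k] are divisible by the [k]-th power of the variable. *)
have cub k y : idealX I k y -> exists s, lam 'X ^+ k * g s = lam y%:P.
  have sP k' : is_ideal [set y : R | exists s, lam 'X ^+ k' * g s = lam y%:P].
    split=> [|u w [s es] [s' es']|u w [s es]].
    - by exists 0; rewrite !rmorph0 mulr0.
    - by exists (s + s'); rewrite !rmorphD mulrDr es es'.
    - by exists (h u * s); rewrite polyCM !rmorphM -es gh /=; ring.
  elim: k y => [|k IH] y; first by exists (h y); rewrite expr0 mul1r gh.
  apply: (idealM_min (sP k.+1)) => u w Iu /IH [s es].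
  move: u Iu; apply: (gen_min (I := [set u | exists s, _])) => [|_ [i _ <-]].
    split=> [|u u' [t et] [t' et']|u u' [t et]].
    - by exists 0; rewrite mul0r !rmorph0 mulr0.
    - by exists (t + t'); rewrite mulrDl !rmorphD mulrDr et et'.
    - exists (h u * t); rewrite (_ : (u * u' * w)%:P = u%:P * (u' * w)%:P).
        by rewrite (rmorphM lam) (rmorphM g) -et gh /=; ring.
      by rewrite -polyCM mulrA.
  exists (T (lift ord0 i) * s); rewrite polyCM !rmorphM -es gTa exprS.
  by rewrite -[lam (a i)%:P in RHS]mul1r -ev; ring.
(* The two generators have one denominator each, so the third power of [I] in [rel] leaves one
   factor of the variable: the product lies in [n'], while [T1] does not. *)
have n'Z j : n' (T (lift ord0 (rshift e j))).
  have [y [p' [/cub [s es] Pp' ea]]] := rel j.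
  have : n' (T1 * T (lift ord0 (rshift e j))).
    rewrite -(subrK (s * T0) (T1 * _)); idD => //; last by idM.
    apply: P0n'; apply/(laurent_extP loc _ pP); exists 2, p'%:P.
    split=> [|i]; last by rewrite coefC; case: ifP => // _; id0.
    rewrite rmorphB !rmorphM !gTa gT0 mulrBr.
    have -> : lam 'X ^+ 2 * (v * lam (a i1)%:P * (v * lam (a (rshift e j))%:P)) =
        lam (a i1 * a (rshift e j))%:P.
      by rewrite polyCM rmorphM -[RHS]mul1r -[1](expr1n _ 2) -ev exprMn; ring.
    have -> : lam 'X ^+ 2 * (g s * lam 'X) = lam 'X ^+ 3 * g s by ring.
    by rewrite es ea polyCD rmorphD addrC addKr.
  by case: pn' => _ _ hp /hp [/n'Q|].
have n'I y : I y -> n' (h y).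
  have hh : is_ideal (h @^-1` n') by apply: preim_ideal.
  move: y; apply: (gen_min hh) => _ [i _ <-] /=.
  rewrite -(subrK (T (lift ord0 i) * T0) (h _)); idD => //; last by idM.
  apply: P0n'; rewrite /P0 /Pc /= rmorphB rmorphM gTa gT0 gh /=.
  have -> : v * lam (a i)%:P * lam 'X = lam (a i)%:P * (v * lam 'X) by ring.
  rewrite ev mulr1 subrr; exact: (idl0 (ideal_ext_ideal _ _)).
have n'm y : m y -> n' (h y).
  move=> my; apply: (@prime_X _ _ _ N0 pn'); rewrite -rmorphXn.
  have [u [w [Iu Pw ->]]] := mI (idealX_exp N0 my).
  rewrite rmorphD; idD => //; first exact: n'I.
  by apply: P0n'; rewrite /P0 /Pc /= gh /=; apply/(laurent_ext_C loc).
(* Since [n'] contains the image of [m], the variable and the last [r] generators, only the first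
   [e] generators of [M] are left, and Krull's height theorem applies. *)
have bound l c' : chain_between n' M l c' -> (l <= e)%N.
  move=> [hc' c'0 c'l].
  apply: (krull_height nS (x := fun i => T (lift ord0 (lshift r i))) hn' pM n'M) hc' _ c'l;
    last by rewrite c'0.
  - by move=> i; apply: MT.
  move=> P' pP' n'P' P'x P'M; have hP' := prime_is_ideal pP'.
  apply/seteqP; split=> // s.
  have : exists y, P' (s - h y).
    move: s; apply: Sind => [u w [y hy] [z hz]|u w [y hy] [z hz]|y||i].
    - exists (y + z); rewrite rmorphD.
      have -> : u + w - (h y + h z) = (u - h y) + (w - h z) by ring.
      by idD.
    - exists (y * z); rewrite rmorphM.
      have -> : u * w - h y * h z = w * (u - h y) + h y * (w - h z) by ring.
      by idD => //; idM.
    - by exists y; rewrite subrr; id0.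
    - by exists 0; rewrite rmorph0 subr0; apply: n'P'.
    - exists 0; rewrite rmorph0 subr0; rewrite -[i](@splitK e r).
      by case: (split i) => j //=; apply: n'P'.
  move=> [y hy] Ms; rewrite -(subrK (h y) s); idD => //.
  apply/n'P'/n'm/Mh; rewrite -(subKr s (h y)); idB => //; exact: P'M.
have [l [c' [[hc' c'0 c'l] sat]]] := saturated_chain_exists pn' pM n'M bound.
have le : (l <= e)%N by apply: (bound l c').
have n'P0 : P0 `<` n' by split=> // /(_ _ n'T0).
have [|_ /(_ _) en] := hn l.+1 (fun i => if i is j.+1 then c' j else P0).
  by split=> //; apply: chain_cons; rewrite ?c'0.
rewrite -en in dn; first by lia.
move=> [|i]; last by rewrite ltnS; apply: sat.
rewrite c'0 => _ [w pw [P0w wn']]; apply: (proj2 P0w).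
(* [n'] is minimal over [P0] and the variable, so by the principal ideal theorem no prime lies
   strictly between [P0] and [n']. *)
suff -> : w = P0 by [].
apply: (principal_ideal_theorem nS pP0 pw (proj1 P0w) (proj1 wn') _ (P := n') (y := T0)).
  by move=> ew; apply: (proj2 wn'); rewrite ew.
by split.
Qed.
End ReesDimension.

Section IdealPowerInclusions.
Variable R : comPzRingType.
Implicit Types (I J L D : set R).

Lemma idealX_mulS_sub I D n k : idealX I n `<=` D -> idealX I (k * n) `<=` idealX D k.
Proof.
move=> ID; elim: k => [|k IH]; first by [].
rewrite mulSn => u /idealXD; rewrite idealXS.
by apply: idealMS.
Qed.

Lemma idealX_mod_principal L D g k : is_ideal L -> D `<=` addI L (prI g) ->
  idealX D k `<=` addI L (prI (g ^+ k)).
Proof.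
move=> hL DL; elim: k => [|k IH].
  by move=> u _; apply/addI_prP; exists u; rewrite mulr1 subrr; id0.
rewrite idealXS; apply: idealM_min => // u v /DL /addI_prP [a ha] /IH /addI_prP [b hb].
apply/addI_prP; exists (a * b).
have -> : u * v - a * b * g ^+ k.+1 = v * (u - a * g) + a * g * (v - b * g ^+ k).
  by rewrite exprS; ring.
by idD => //; idM.
Qed.

Lemma idl_subXX L (x y : R) n : is_ideal L -> L (x - y) -> L (x ^+ n - y ^+ n).
Proof.
move=> hL h; elim: n => [|n IH]; first by rewrite subrr; id0.
have -> : x ^+ n.+1 - y ^+ n.+1 = x * (x ^+ n - y ^+ n) + y ^+ n * (x - y).
  by rewrite !exprS; ring.
by idD => //; idM.
Qed.

Lemma local_of_units (M : set R) : is_ideal M -> ~ M 1 ->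
  (forall b, ~ M b -> exists s, s * b = 1) -> local_ring M.
Proof.
move=> hM M1 unit; have sub J : is_ideal J -> ~ J 1 -> J `<=` M.
  move=> hJ J1 b Jb; apply: contrapT => /unit [s es].
  by apply: J1; rewrite -es; idM.
split=> [|M' [hM' M'1 mM']].
  by split=> // J hJ J1 MJ; apply/seteqP; split=> //; apply: sub.
by rewrite (mM' M) //; apply: sub.
Qed.
End IdealPowerInclusions.

Lemma idealX_ideal_ext (R B : comPzRingType) (theta : {rmorphism R -> B}) (I : set R) n :
  idealX (ideal_ext theta I) n `<=` ideal_ext theta (idealX I n).
Proof.
elim: n => [|n IH].
  move=> u _; apply: (idl1 u (ideal_ext_ideal theta _)).
  by rewrite -(rmorph1 theta); apply: ideal_ext_in.
have hE : is_ideal (ideal_ext theta (idealX I n.+1)) by exact: ideal_ext_ideal.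
rewrite idealXS; apply: idealM_min => [|u v hu /IH hv]; first exact: ideal_ext_ideal.
move: u hu; apply: (gen_min (I := [set u | ideal_ext theta (idealX I n.+1) (u * v)])).
  split=> [|a b ha hb|a b hb] /=.
  - by rewrite mul0r; exact: (idl0 hE).
  - by rewrite mulrDl; apply: (idlD hE).
  - by rewrite -mulrA; apply: (idlM _ hE).
move=> _ [a Ia <-] /=; move: v hv.
apply: (gen_min (I := [set v | ideal_ext theta (idealX I n.+1) (theta a * v)])).
  split=> [|b c hb hc|b c hc] /=.
  - by rewrite mulr0; exact: (idl0 hE).
  - by rewrite mulrDr; apply: (idlD hE).
  - by rewrite mulrCA; apply: (idlM _ hE).
move=> _ [b Ib <-] /=; rewrite -rmorphM; apply: ideal_ext_in.
exact: idealX_mulS.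
Qed.

(** * Ratliff's theorem on minimal primes of the completion *)

Section Ratliff.
Variables (p : nat) (R : comNzRingType) (B : comPzRingType) (m P : set R).
Variables (theta : {rmorphism R -> B}) (Q : set B) (d : nat) (c : nat -> set R).
Hypotheses (pp : prime p) (pB : p%:R = 0 :> B).
Hypotheses (nR : noetherian R) (lR : local_ring m) (ucR : universally_catenary R).
Hypotheses (hc : prime_chain d c) (c0 : c 0%N = P).
Hypotheses (nB : noetherian B).
Local Notation M := (ideal_ext theta m).
Hypothesis lB : local_ring M.
Hypothesis ker : forall r, P r -> theta r = 0.
Hypothesis contract : forall I r, is_ideal I -> ideal_ext theta I (theta r) -> addI I P r.
Hypothesis approx : forall n b, exists r, ideal_ext theta (idealX m n) (b - theta r).
Hypotheses (pQ : prime_ideal Q) (minQ : minimal_prime_over [set 0] Q) (regQ : regular_at Q).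

Let hQ := prime_is_ideal pQ.
Let pM := local_prime lB.
Let hM := prime_is_ideal pM.
Let QM : Q `<=` M := local_prime_sub nB lB pQ.
Let mP := local_prime lR.
Let hm := prime_is_ideal mP.

(** The localization at [Q] is a domain, and the image of [Q] in it is nilpotent by minimality,
    hence zero; finitely many generators of [Q] have a common annihilator outside [Q]. *)
Lemma regular_minimal_annihilator : exists2 g, ~ Q g & forall q, Q q -> g * q = 0.
Proof.
have mc := prime_mult_closed pQ.
have [L [psi loc]] := localization_exists mc.
have pL : p%:R = 0 :> L by rewrite -(rmorph_nat psi) pB rmorph0.
have [_ _ dL _] := regular_local_props pp pL (regQ loc).
have psi0 q : Q q -> exists s, ~ Q s /\ s * q = 0.
  move=> Qq; have [s [N [Qs es]]] := minimal_prime_pow nB (set0_ideal B) minQ Qq.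
  have {es} : psi (q ^+ N) = 0 by apply/(loc_eq0 loc); exists s.
  rewrite rmorphXn; elim: N => [|N IH].
    rewrite expr0 -(rmorph1 psi) => /(loc_eq0 loc) [t Qt]; rewrite mulr1 => t0.
    by case: Qt; rewrite t0; id0.
  by rewrite exprS => /dL [/(loc_eq0 loc) [t Qt et]|/IH //]; exists t.
have [k [z ez]] := noetherian_fg nB hQ.
have /choice [s hs] : forall j, exists s, ~ Q s /\ s * z j = 0.
  by move=> j; apply: psi0; rewrite ez; apply: gen_sub; exists j.
exists (\prod_j s j) => [|q].
  have : (~` Q) (\prod_j s j); last by [].
  apply: big_ind => [|u v|j _]; [by case: mc|by case: mc => _; apply|by case: (hs j)].
rewrite ez => /gen_rangeP [a ->]; rewrite mulr_sumr big1 // => j _.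
have -> : \prod_i s i * (a j * z j) = a j * (\prod_(i | i != j) s i) * (s j * z j).
  by rewrite (bigD1 j) //=; ring.
by case: (hs j) => _ ->; rewrite mulr0.
Qed.

(** Suppose that chains above [Q] have length at most [e < d]. Parameters for [Q], among them some
    [g] that kills [Q], and generators of [Q] are approximated by elements [a] of [R]. Because [g]
    annihilates [Q], the products of approximations are as small as [rees_dimension] requires, and
    that lemma forces [d <= e]. *)
Lemma ratliff : exists2 C, prime_chain d C & Q `<=` C 0%N.
Proof.
apply: contrapT => noC.
have small l C : prime_chain l C -> Q `<=` C 0%N -> (l < d)%N.
  move=> hC QC; rewrite ltnNge; apply/negP => dl; apply: noC; exists C => //.
  exact: prime_chain_trunc hC.
pose has l := `[< exists2 C, prime_chain l C & Q `<=` C 0%N >].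
have has0 : exists l, has l.
  by exists 0%N; apply/asboolP; exists (fun=> Q) => //; split.
have [|e /asboolP [C hC QC] emax] := @ex_maxnP has d has0.
  by move=> l /asboolP [C /small h /h /ltnW].
have ed := small _ _ hC QC.
have above l C' : prime_chain l C' -> Q `<=` C' 0%N -> (l <= e)%N.
  by move=> h1 h2; apply: emax; apply/asboolP; exists C'.
have [g0 Qg0 g0Q] := regular_minimal_annihilator.
have pc i : (i <= d)%N -> prime_ideal (c i) by case: hc => h _; apply: h.
have pP : prime_ideal P by rewrite -c0; apply: pc.
have Pm : P `<=` m by apply: (local_prime_sub nR lR).
have nQM : ~ M `<=` Q.
  move=> MQ; have g0M : ~ M g0 by move=> /MQ.
  have [s es] := local_unit nB lB g0M.
  have mP' : m `<=` P.
    move=> r mr; have e0 : theta r = 0.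
      rewrite -[theta r]mul1r -es -mulrA g0Q ?mulr0 //; apply: MQ; exact: ideal_ext_in.
    have [|u [w [-> Pw ->]]] := contract (set0_ideal R) (r := r).
      by rewrite e0; exact: (idl0 (ideal_ext_ideal _ _)).
    by rewrite add0r.
  case: hc => _ /(_ 0%N (leq_ltn_trans (leq0n _) ed)) []; rewrite c0 => _; apply.
  by apply: subset_trans mP'; apply: (local_prime_sub nR lR); apply: pc; lia.
case: e => [|e] in hC emax ed above.
  suff : (1 <= 0)%N by [].
  apply: (above _ (fun i => if i is 0%N then Q else M)) => //.
  by split=> [[|i]|[|i]].
have [b0 Mb0 Qb0] : exists2 b, M b & ~ Q b.
  by apply: contrapT => h; apply: nQM => b Mb; apply: contrapT => Qb; apply: h; exists b.
have Mg : M (g0 * b0) by idM.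
have Qg : ~ Q (g0 * b0) by case: pQ => _ _ h /h [].
have gQ q : Q q -> g0 * b0 * q = 0 by move=> Qq; rewrite mulrAC g0Q // mul0r.
move: (g0 * b0) Mg Qg gQ => g Mg Qg gQ.
have hJ : is_ideal (addI Q (prI g)) by apply: addI_ideal.
have [l C' hC' JC'|y [My sop]] := sop_exists nB (proj1 lB) (local_prime_sub nB lB)
  (k := e) hJ.
  rewrite -ltnS; apply: (above _ _ (chain_cons pQ _ hC')) => //.
  split=> [q Qq|QC']; first by apply: JC'; apply: addI_l.
  by apply: Qg; apply: QC'; apply: JC'; apply: addI_r => //; apply: prI_self.
have [r [z ez]] := noetherian_fg nB hQ.
have Qz j : Q (z j) by rewrite ez; apply: gen_sub; exists j.
pose b (i : 'I_(e.+1 + r)) := match split i with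
  | inl i => if unlift ord0 i is Some j then y j else g | inr j => z j end.
have bz j : b (rshift e.+1 j) = z j by rewrite /b (unsplitK (inr _)).
have bg : b (lshift r ord0) = g by rewrite /b (unsplitK (inl _)) unlift_none.
have by_ j : b (lshift r (lift ord0 j)) = y j by rewrite /b (unsplitK (inl _)) liftK.
have Mb i : M (b i).
  rewrite /b; case: (split i) => j; last exact: QM.
  by case: unliftP => [k|] _ //; apply: My.
pose q := gen_ideal (range b).
have hq : is_ideal q by exact: gen_ideal_ideal.
have qb i : q (b i) by apply: gen_sub; exists i.
have Qq : Q `<=` q by rewrite ez; apply: gen_min => // _ [j _ <-]; rewrite -bz.
have [N0 MN0] : exists N, idealX M N `<=` q.
  apply: (idealX_of_rad nB) => // u Mu; apply: (radical_primes nB hq) => P' pP' qP'.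
  rewrite (sop P') //; last by move=> i; apply: qP'; rewrite -by_.
  apply: addI_min; [exact: prime_is_ideal|exact: subset_trans qP'|].
  by apply: prI_sub; [exact: prime_is_ideal|apply: qP'; rewrite -bg].
(* Errors in [M ^ n] then lie in the cube of [q], the power that [rees_dimension] asks for; [N0.+1]
   instead of [N0] leaves a factor [M] for Nakayama. *)
pose n := (3 * N0.+1)%N.
have /choice [a ha] : forall i, exists r, ideal_ext theta (idealX m n) (b i - theta r).
  by move=> i; apply: approx.
have dM i : idealX M n (b i - theta (a i)).
  move: (b i - _) (ha i); apply: ideal_ext_min => // u; exact: ideal_ext_idealX.
have Mn : idealX M n `<=` M by apply: idealX_sub.
have ma i : m (a i).
  have [|u [w [mu Pw ->]]] := contract hm (r := a i).
    by rewrite -(subKr (b i) (theta _)); idB => //; apply: Mn.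
  by idD => //; apply: Pm.
pose I := gen_ideal (range a); pose D := ideal_ext theta I.
have hD : is_ideal D by exact: ideal_ext_ideal.
have Da i : D (theta (a i)) by apply: ideal_ext_in; apply: gen_sub; exists i.
have MS k : (N0.+1 <= k)%N -> idealX M k `<=` idealM M q.
  move=> Nk u /(idealX_le Nk); rewrite idealXS; exact: idealMS.
have qD : q `<=` D.
  apply: (nak_ideal nB hM (local_jac nB lB) hD hq).
  apply: gen_min => [|_ [i _ <-]]; first by apply: addI_ideal => //; apply: idealM_ideal.
  rewrite -(subrK (theta (a i)) (b i)) addrC.
  exists (theta (a i)), (b i - theta (a i)); split=> //.
  by apply: (MS n) => //; rewrite /n; lia.
have MD3 : idealX M n `<=` idealX D 3.
  apply: idealX_mulS_sub => u hu; apply: qD; apply: MN0; exact: (@idealX_le _ M N0 N0.+1 (leqnSn N0) _ hu).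
suff : (d <= e.+1)%N by rewrite leqNgt ed.
apply: (rees_dimension (i1 := lshift r ord0) (N0 := N0) nR lR ucR ma _ _ _ hc c0).
- move=> u hu; apply: contract => //; apply: qD; apply: MN0; exact: ideal_ext_idealX.
- move=> N [u [w [Iu Pw ew]]].
  (* Modulo [L], the ideal [D] lies in the one generated by [g], and the first [a] becomes
     [g * (1 - s * g)]. If its [N]-th power were in [D ^ N.+1], then [g ^+ N] times a unit would lie
     in [L], and the [e] elements [y] would be parameters for [Q], against the chain of length
     [e.+1]. *)
  pose L := addI Q (gen_ideal (range y)).
  have hL : is_ideal L by apply: addI_ideal; [exact: hQ|exact: gen_ideal_ideal].
  have qL : q `<=` addI L (prI g).
    apply: gen_min => [|_ [i _ <-]]; first exact: addI_ideal.
    rewrite /b; case: (split i) => j; [case: unliftP => [k|] _|].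
    - by apply: addI_l => //; apply: addI_r => //; apply: gen_sub; exists k.
    - by apply: addI_r => //; apply: prI_self.
    - by apply: addI_l => //; apply: addI_l.
  have DL : D `<=` addI L (prI g).
    apply: ideal_ext_min => [|t]; first exact: addI_ideal.
    move=> It; apply: qL; move: t It; apply: (gen_min (preim_ideal theta hq)) => _ [i _ <-] /=.
    rewrite -(subKr (b i) (theta _)); idB => //; apply: MN0.
    by apply: (@idealX_le _ M N0 n) (dM i); rewrite /n; lia.
  have /addI_prP [s hs] : addI L (prI (g ^+ 2)) (g - theta (a (lshift r ord0))).
    apply: (idealX_mod_principal hL qL); rewrite -{1}bg.
    apply: (idealX_mulS_sub (k := 2) MN0).
    by apply: (@idealX_le _ M _ n) (dM _); rewrite /n; lia.
  have /addI_prP [t ht] : addI L (prI (g ^+ N.+1)) (theta (a (lshift r ord0)) ^+ N).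
    apply: (idealX_mod_principal hL DL); rewrite -rmorphXn ew rmorphD (ker Pw) addr0.
    exact: (ideal_ext_idealX theta (gen_ideal_ideal (range a)) Iu).
  suff : (e.+1 <= e)%N by rewrite ltnn.
  apply: (dim_le nB (proj1 lB) (local_prime_sub nB lB) (x := y) hQ _ My hC QC).
  move=> P' pP' QP' P'y; have hP' := prime_is_ideal pP'.
  apply: sop => //; apply: addI_min => //; apply: prI_sub => //.
  have LP' : L `<=` P' by apply: addI_min => //; apply: gen_min => // _ [i _ <-].
  have : P' (g ^+ N * ((1 - s * g) ^+ N - t * g)).
    have h1 : L ((theta (a (lshift r ord0))) ^+ N - (g * (1 - s * g)) ^+ N).
      apply: idl_subXX => //; rewrite -opprB; idN => //.
      have -> : g * (1 - s * g) - theta (a (lshift r ord0)) =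
        g - theta (a (lshift r ord0)) - s * g ^+ 2 by ring.
      by [].
    apply: LP'.
    have -> : g ^+ N * ((1 - s * g) ^+ N - t * g) =
       (theta (a (lshift r ord0)) ^+ N - t * g ^+ N.+1) -
       (theta (a (lshift r ord0)) ^+ N - (g * (1 - s * g)) ^+ N).
      by rewrite exprMn exprS; ring.
    by idB.
  case: (pP') => _ _ h /h [|/(local_prime_sub nB lB pP') Mu]; first exact: prime_X.
  have : M ((1 - s * g) ^+ N).
    by rewrite -(subrK (t * g) (_ ^+ N)); idD => //; idM.
  move=> /(prime_X pM) h1; case: pM => _ []; rewrite -(subrK (s * g) 1); idD => //.
  by idM.
(* As [g * z j = 0], the product of the two approximations consists of error terms, which lie in
   [M ^ n]. *)
move=> j; apply: contract => //; apply: idealX_ideal_ext; apply: MD3.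
rewrite rmorphM.
have zj : g * b (rshift e.+1 j) = 0 by rewrite bz gQ.
have -> : theta (a (lshift r ord0)) * theta (a (rshift e.+1 j)) =
  - (b (rshift e.+1 j) * (b (lshift r ord0) - theta (a (lshift r ord0))) +
  theta (a (lshift r ord0)) * (b (rshift e.+1 j) - theta (a (rshift e.+1 j)))).
  apply/eqP; rewrite -subr_eq0; apply/eqP; rewrite -[RHS]zj -bg; ring.
by idN => //; idD => //; idM.
Qed.
End Ratliff.

(** * Finite extensions *)

Section FiniteExtension.
Variables (A B : comPzRingType) (iota : {rmorphism A -> B}) (r : nat) (e : 'I_r -> B).
Hypothesis nA : noetherian A.
Hypothesis gen_e : forall b, exists a : 'I_r -> A, b = \sum_j iota (a j) * e j.

(** The vectors [u] for which the combination of the [e j] is a polynomial in [b] form a submodule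
    of [A ^ r]. Its finitely many generators need only degrees below some [M], so [b ^+ M] is a
    polynomial of degree below [M]. *)
Lemma integral_relation b : exists n (a : nat -> A),
  b ^+ n = \sum_(i < n) iota (a i) * b ^+ i.
Proof.
pose pol D y := exists a : nat -> A, y = \sum_(i < D) iota (a i) * b ^+ i.
have pol0 D : pol D 0 by exists (fun=> 0); rewrite big1 // => i _; rewrite rmorph0 mul0r.
have polD D u v : pol D u -> pol D v -> pol D (u + v).
  move=> [a ->] [a' ->]; exists (fun i => a i + a' i).
  by rewrite -big_split; apply: eq_bigr => i _; rewrite rmorphD mulrDl.
have polZ D c u : pol D u -> pol D (iota c * u).
  move=> [a ->]; exists (fun i => c * a i).
  by rewrite mulr_sumr; apply: eq_bigr => i _; rewrite rmorphM mulrA.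
have polW D D' u : (D <= D')%N -> pol D u -> pol D' u.
  move=> DD' [a ->]; exists (fun i => if (i < D)%N then a i else 0).
  rewrite (big_ord_widen D' (fun i => iota (a i) * b ^+ i)) // big_mkcond.
  by apply: eq_bigr => i _; case: ifP => // _; rewrite rmorph0 mul0r.
pose N (u : 'I_r -> A) := exists D, pol D (\sum_j iota (u j) * e j).
have [||c u [D hu]|k [g [Ng gN]]] := @submodule_fg A r N nA.
- by exists 0%N; rewrite big1 // => j _; rewrite rmorph0 mul0r.
- move=> u v [D hu] [D' hv]; exists (D + D')%N.
  have -> : \sum_j iota (u j + v j) * e j =
    \sum_j iota (u j) * e j + \sum_j iota (v j) * e j.
    by rewrite -big_split; apply: eq_bigr => j _; rewrite rmorphD mulrDl.
  by apply: polD; [apply: polW hu|apply: polW hv]; lia.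
- exists D; have -> : \sum_j iota (c * u j) * e j = iota c * \sum_j iota (u j) * e j.
    by rewrite mulr_sumr; apply: eq_bigr => j _; rewrite rmorphM mulrA.
  exact: polZ.
have /choice [D hD] := Ng; pose M := \max_i D i.
have [u eu] := gen_e (b ^+ M).
have Nu : N u.
  exists M.+1; rewrite -eu; exists (fun i => (i == M)%:R).
  rewrite big_ord_recr /= eqxx rmorph1 mul1r big1 ?add0r // => i _.
  by rewrite ltn_eqF ?ltn_ord // rmorph0 mul0r.
have [c hc] := gN u Nu; exists M.
suff [a ea] : pol M (b ^+ M) by exists a.
have -> : b ^+ M = \sum_i iota (c i) * \sum_j iota (g i j) * e j.
  rewrite eu; under [RHS]eq_bigr do rewrite mulr_sumr.
  rewrite exchange_big /=; apply: eq_bigr => j _; rewrite hc rmorph_sum mulr_suml.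
  by apply: eq_bigr => i _; rewrite rmorphM mulrA.
apply: big_ind => [|u' v'|i _]; [exact: pol0|exact: polD|].
by apply: polZ; apply: (polW (D i)) => //; rewrite /M; apply: leq_bigmax.
Qed.

(** For [b] in [C'] outside [C], the constant term of a monic relation modulo [C] lies in [C'],
    hence in [C] if the contractions agree, and [b] can be cancelled from the rest; degree [0] puts
    [1] in [C]. *)
Lemma incomparability (C C' : set B) : prime_ideal C -> prime_ideal C' ->
  C `<` C' -> iota @^-1` C `<` iota @^-1` C'.
Proof.
move=> pC pC' [CC' nC]; have hC := prime_is_ideal pC; have hC' := prime_is_ideal pC'.
split=> [a|le]; first exact: CC'.
apply: nC => b C'b; apply: contrapT => Cb.
have [n [a ea]] := integral_relation b.
have : C (b ^+ n - \sum_(i < n) iota (a i) * b ^+ i) by rewrite ea subrr; id0.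
move: (a) => {ea}; elim: n => [|n IH] {}a.
  by rewrite big_ord0 subr0; case: pC.
rewrite big_ord_recl expr0 mulr1 => h.
have e1 : \sum_(i < n) iota (a (lift ord0 i)) * b ^+ (lift ord0 i) =
    b * \sum_(i < n) iota (a i.+1) * b ^+ i.
  by rewrite mulr_sumr; apply: eq_bigr => i _; rewrite lift0 exprS; ring.
rewrite e1 exprS in h.
have Ca : C (iota (a 0%N)).
  apply: le => /=.
  have -> : iota (a 0%N) = b * (b ^+ n - \sum_(i < n) iota (a i.+1) * b ^+ i) -
    (b * b ^+ n - (iota (a 0%N) + b * \sum_(i < n) iota (a i.+1) * b ^+ i)) by ring.
  by idB => //; [idMr|apply: CC'].
have : C (b * (b ^+ n - \sum_(i < n) iota (a i.+1) * b ^+ i)).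
  have -> : b * (b ^+ n - \sum_(i < n) iota (a i.+1) * b ^+ i) = iota (a 0%N) +
    (b * b ^+ n - (iota (a 0%N) + b * \sum_(i < n) iota (a i.+1) * b ^+ i)) by ring.
  by idD.
by case: (pC) => _ _ hp /hp [//|]; apply: (IH (fun i => a i.+1)).
Qed.

(* A maximal [A]-independent set of the generators of [B] spans a free module
   into which [B] is carried by some nonzero [a]. *)
Lemma factors_nonzero : (forall u v : A, u * v = 0 -> u = 0 \/ v = 0) -> (1 : A) <> 0 ->
  exists2 a, a <> 0 & factors iota (iota a).
Proof.
move=> dA A1.
pose supp (I : {set 'I_r}) (u : 'I_r -> A) := forall i, i \notin I -> u i = 0.
pose ind (I : {set 'I_r}) := `[< forall u, supp I u -> \sum_i iota (u i) * e i = 0 ->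
  forall i, u i = 0 >].
have ind0 : ind finset.set0 by apply/asboolP => u hu _ i; apply: hu; rewrite finset.in_set0.
pose I := [arg max_(I > finset.set0 | ind I) #|I|]%N.
have [/asboolP indI maxI] : ind I /\ forall I', ind I' -> (#|I'| <= #|I|)%N.
  by rewrite /I; case: arg_maxnP => // I' h1 h2; split.
have dep j : exists a u, [/\ a <> 0, supp I u & iota a * e j = \sum_i iota (u i) * e i].
  have [jI|jI] := boolP (j \in I).
    exists 1, (fun i => (i == j)%:R); split=> //.
      by move=> i iI; case: eqP => // ij; rewrite ij jI in iI.
    rewrite (bigD1 j) //= eqxx big1 ?addr0 // => i ij.
    by rewrite (negbTE ij) rmorph0 mul0r.
  have nind : ~ ind (j |: I)%SET by move=> /maxI; rewrite cardsU1 jI ltnn.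
  have /existsNP [u /not_implyP [hu /not_implyP [e0 /existsNP [i ui]]]] :
      ~ forall u, supp (j |: I)%SET u -> \sum_i iota (u i) * e i = 0 -> forall i, u i = 0.
    by move=> h; apply/nind/asboolP.
  have uj : u j <> 0.
    move=> uj; apply: ui; apply: indI => // k kI.
    have [->//|kj] := eqVneq k j; apply: hu.
    by rewrite finset.in_setU1 negb_or kj.
  exists (u j), (fun k => if k == j then 0 else - u k); split=> //.
    move=> k kI; case: eqVneq => // kj; rewrite hu ?oppr0 //.
    by rewrite finset.in_setU1 negb_or kj.
  move: e0; rewrite (bigD1 j) //= => /eqP; rewrite addr_eq0 => /eqP ->.
  rewrite [RHS](bigD1 j) //= eqxx rmorph0 mul0r add0r -sumrN.
  by apply: eq_bigr => k /negbTE ->; rewrite rmorphN mulNr.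
have /choice [a ha] : forall j, exists a, a <> 0 /\ exists u, supp I u /\
    iota a * e j = \sum_i iota (u i) * e i.
  by move=> j; have [a [u [a0 hu eu]]] := dep j; exists a; split=> //; exists u.
pose t := \prod_j a j.
have t0 : t <> 0.
  apply: (big_ind (fun t => t <> 0)) => // [u v u0 v0 /dA [] //|j _].
  by case: (ha j).
exists t => //.
have sp b : exists u, supp I u /\ iota t * b = \sum_i iota (u i) * e i.
  have [c ->] := gen_e b.
  have spD x y : (exists u, supp I u /\ x = \sum_i iota (u i) * e i) ->
      (exists u, supp I u /\ y = \sum_i iota (u i) * e i) ->
      exists u, supp I u /\ x + y = \sum_i iota (u i) * e i.
    move=> [u [hu ->]] [v [hv ->]]; exists (fun i => u i + v i); split=> [i iI|].
      by rewrite hu // hv // addr0.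
    by rewrite -big_split; apply: eq_bigr => i _; rewrite rmorphD mulrDl.
  rewrite mulr_sumr.
  apply: (big_ind (fun x => exists u, supp I u /\ x = \sum_i iota (u i) * e i)) => [|x y|j _].
  - by exists (fun=> 0); split=> //; rewrite big1 // => i _; rewrite rmorph0 mul0r.
  - exact: spD.
  have [_ [u [hu eu]]] := ha j.
  exists (fun i => c j * (\prod_(k | k != j) a k) * u i); split=> [i iI|].
    by rewrite hu // mulr0.
  have -> : iota t * (iota (c j) * e j) =
      iota (c j * \prod_(k | k != j) a k) * (iota (a j) * e j).
    by rewrite /t (bigD1 j) //= !rmorphM; ring.
  by rewrite eu mulr_sumr; apply: eq_bigr => i _; rewrite [iota (_ * u i)]rmorphM mulrA.
have /choice [phi hphi] := sp.
have uniq u v : supp I u -> supp I v ->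
    \sum_i iota (u i) * e i = \sum_i iota (v i) * e i -> forall i, u i = v i.
  move=> hu hv euv i; apply/eqP; rewrite -subr_eq0; apply/eqP.
  apply: (indI (fun i => u i - v i)) => [k kI|]; first by rewrite hu // hv // subrr.
  by under eq_bigr do rewrite rmorphB mulrBl; rewrite sumrB euv subrr.
exists 'I_r, (fun i b => phi b i), e; split=> [i b b'|i c b|b].
- have [[h1 e1] [h2 e2]] := (hphi b, hphi b'); have [h3 e3] := hphi (b + b').
  apply: (uniq (phi (b + b')) (fun i => phi b i + phi b' i) h3) => [k kI|].
    by rewrite h1 // h2 // addr0.
  rewrite -e3 mulrDr e1 e2 -big_split; apply: eq_bigr => k _.
  by rewrite rmorphD mulrDl.
- have [[h1 e1] [h2 e2]] := (hphi b, hphi (iota c * b)).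
  apply: (uniq (phi (iota c * b)) (fun i => c * phi b i) h2) => [k kI|].
    by rewrite h1 // mulr0.
  rewrite -e2 mulrCA e1 mulr_sumr; apply: eq_bigr => k _.
  by rewrite rmorphM mulrA.
- by case: (hphi b).
Qed.
End FiniteExtension.

Lemma equidimensional_chain (R : comPzRingType) (P : set R) d : equidimensional R ->
  has_krull_dim R d -> minimal_prime P -> exists2 c, prime_chain d c & c 0%N = P.
Proof.
move=> eqR dR mP; have [pP _] := mP; have hP := prime_is_ideal pP.
have [Q [pi quo]] := quotient_exists hP.
have [[C [hC sC]] _] := proj2 (eqR P mP Q pi quo d) dR.
have PC i : (i <= d)%N -> P `<=` pi @^-1` C i.
  by move=> id; apply: (quo_preim_sub quo); apply/prime_is_ideal/hC.
(* Putting [P] at the bottom, in place of the preimage of [C 0], keeps the chain strict. *)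
exists (fun i => if i is 0%N then P else pi @^-1` C i) => //; split=> [[|i] id|i id] //.
  by apply: preim_prime; apply: hC.
have st : pi @^-1` C i `<` pi @^-1` C i.+1.
  have [h1 h2] := sC i id; split=> [r|h]; first exact: h1.
  by apply: h2 => y; have [r <-] := quo_surj quo y; apply: h.
case: i id st => [|i] id [h1 h2] //; split; first exact: PC.
by move=> h; apply: h2 => r /h; apply: PC.
Qed.

Lemma component_data (p d : nat) (R : comNzRingType) (m P : set R) (x : 'I_d -> R) :
  p \in [pchar R] -> local_ring m -> excellent R -> has_krull_dim R d ->
  equidimensional R -> system_of_parameters m x -> minimal_prime P ->
  exists (A B : comPzRingType) (iota : {rmorphism A -> B}) (theta : {rmorphism R -> B})
    (c0 : R),
  [/\ [/\ noetherian A, p%:R = 0 :> A & frob_flat ([set 0] : set A) p],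
      noetherian B /\ exists r (e : 'I_r -> B),
        forall b, exists a : 'I_r -> A, b = \sum_j iota (a j) * e j,
      ~ P c0 /\ factors iota (theta c0),
      forall i, exists a, iota a = theta (x i) &
      (forall r, theta r = 0 <-> P r) /\
      forall I r, is_ideal I -> ideal_ext theta I (theta r) -> addI I P r].
Proof.
move=> chR lR [nR ucR gR _] dR eqR [_ primx radx] mP.
have pp : prime p by case/andP: chR.
have pR : p%:R = 0 :> R by apply/eqP; case/andP: chR.
have [pP minP] := mP; have hP := prime_is_ideal pP.
have pm := local_prime lR; have hm := prime_is_ideal pm.
have mx i : m (x i) by rewrite -radx; exists 1%N; rewrite expr1; apply: gen_sub; exists i.
have mN : exists N, idealX m N `<=` gen_ideal (range x).
  by apply: (idealX_of_rad nR) => // r; rewrite -radx.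
have [A' [phi cA]] := completion_exists hm.
have [J [cJ Jphi appr eJ]] := completion_filtration nR cA.
have A1 : (1 : A') <> 0.
  move=> e1; case: (pm) => _ m1 _; apply: m1; rewrite -(idealX1 hm); apply/Jphi.
  by rewrite rmorph1 e1; exact: (idl0 (cf_ideal cJ 1)).
have [T eT] := comnz_exists A1; subst A'; rename T into A'.
have [A [X [ev [[nA pA ffA] dA [uA X1] evX [r [e gen_e]]]]]] :=
  completion_cohen pp pR nR lR cA mx mN.
have nA' := finite_noetherian nA gen_e.
have [B [pi quo]] := quotient_exists (ideal_ext_ideal phi P).
pose theta : {rmorphism R -> B} := pi \o phi.
pose iota : {rmorphism A -> B} := pi \o ev.
have nB : noetherian B := quo_noetherian quo nA'.
have gen_B b : exists a : 'I_r -> A, b = \sum_j iota (a j) * pi (e j).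
  have [y <-] := quo_surj quo b; have [a ->] := gen_e y; exists a.
  by rewrite rmorph_sum; apply: eq_bigr => j _; rewrite rmorphM.
have ker := formal_ker nR lR cA pP quo.
have contract := formal_contract nR lR cA pP quo.
have nzd := formal_nzd nR lR cA nA' pP quo.
have pB : p%:R = 0 :> B by rewrite -(rmorph_nat iota) pA rmorph0.
have lB : local_ring (ideal_ext theta m).
  apply: local_of_units; [exact: ideal_ext_ideal|exact: (formal_nonunit nR lR cA pP quo)|].
  move=> b Mb; have [y ey] := quo_surj quo b.
  have [J1|s es] := completion_unit nR lR cJ Jphi appr (y := y).
    apply: Mb; rewrite -ey; move: y J1 {ey}; rewrite eJ idealX1 //.
    apply: (gen_min (preim_ideal pi (ideal_ext_ideal theta m))) => _ [u mu <-].
    exact: (@ideal_ext_in _ _ theta).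
  by exists (pi s); rewrite -ey -rmorphM es rmorph1.
have mP' := local_prime lB.
have dX := formal_fibre_regular nR lR cA pP quo gR.
have [c hc c0] := equidimensional_chain eqR dR mP.
have lA : local_ring (gen_ideal (range X)) by apply: local_of_units.
(* Ratliff's theorem provides a chain of length [d] above [Q]. If [Q] contracted to a nonzero ideal,
   the contracted chain with [0] below it would have length [d.+1] in [A], whose maximal ideal has
   [d] generators. *)
have minQ0 (Q : set B) a : minimal_prime_over [set 0] Q -> Q (iota a) -> a = 0.
  move=> mQ Qa; have [pQ _ _] := mQ.
  have QU u : ~ P u -> ~ Q (theta u).
    move=> Pu Qu; have [s [N [Qs]]] := minimal_prime_pow nB (set0_ideal B) mQ Qu.
    elim: N => [|N IH]; first by rewrite mulr1 => s0; apply: Qs; rewrite s0; case: pQ => -[].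
    by rewrite exprS mulrCA => /(nzd _ _ Pu).
  have [C [hC sC] QC] := ratliff pp pB nR lR ucR hc c0 nB lB (fun r => proj2 (ker r))
    contract (formal_approx nR cA quo) pQ mQ (dX Q pQ QU).
  apply: contrapT => a0; suff : (d.+1 <= d)%N by rewrite ltnn.
  have hC' : prime_chain d.+1 (fun i => if i is j.+1 then iota @^-1` C j else [set 0]).
    apply: chain_cons.
    - split; [exact: set0_ideal|exact: (elimN eqP (oner_neq0 A))|exact: dA].
    - split=> [_ -> /=|/(_ a) h]; last by apply: a0; apply: h => /=; apply: QC.
      have C00 : C 0%N 0 by case: (hC 0%N (leq0n d)) => -[].
      by rewrite !rmorph0. 
    split=> i id; first by apply: preim_prime; apply: hC.
    by apply: (incomparability nA gen_B); [apply: hC; lia|apply: hC|apply: sC].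
  apply: (dim_le nA (proj1 lA) (local_prime_sub nA lA) (x := X) (set0_ideal A) _ _ hC') => //.
  - move=> P' pP' _ P'X; apply/seteqP; split; first exact: (local_prime_sub nA lA pP').
    by apply: gen_min => [|_ [i _ <-]] //; apply: prime_is_ideal.
  - by move=> i; apply: gen_sub; exists i.
have minQ (Q : set B) : prime_ideal Q -> exists2 Q', minimal_prime_over [set 0] Q' & Q' `<=` Q.
  move=> pQ; have [|Q' [h1 h2 h3 h4]] := minimal_over nB (set0_ideal B) pQ.
    by move=> _ ->; exact: (idl0 (prime_is_ideal pQ)).
  by exists Q'.
pose U : set B := theta @` (~` P).
have hU : mult_closed U.
  split=> [|_ _ [u Pu <-] [v Pv <-]]; first by exists 1; [case: pP|exact: rmorph1].
  by exists (u * v); [move=> /=; case: pP => _ _ h /h []|exact: (rmorphM theta)].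
(* If [v] is nonzero, its annihilator misses [U] by [formal_nzd] and lies in a prime [Q] at which
   [B] is a domain. There [iota a] vanishes, so [iota a] lies in a minimal prime of [B]. *)
have torsion a v : a <> 0 -> iota a * v = 0 -> v = 0.
  move=> a0 av; apply: contrapT => v0.
  pose Ann : set B := [set s | s * v = 0].
  have hAnn : is_ideal Ann.
    split=> [|s t hs ht|s t ht]; rewrite /Ann /=; first by rewrite mul0r.
      by rewrite mulrDl hs ht addr0.
    by rewrite -mulrA ht mulr0.
  have [b hu [u Pu eu]|Q [pQ AQ QU]] := prime_avoiding nB hAnn hU.
    have uv : theta u * v = 0 by rewrite eu.
    by apply: v0; exact: (nzd u v Pu uv).
  have [L [psi loc]] := localization_exists (prime_mult_closed pQ).
  have pL : p%:R = 0 :> L by rewrite -(rmorph_nat psi) pB rmorph0.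
  have QU' u : ~ P u -> ~ Q (theta u) by move=> Pu /QU; apply; exists u.
  have [_ _ dL _] := regular_local_props pp pL (dX Q pQ QU' L psi loc).
  have : psi (iota a) * psi v = 0 by rewrite -rmorphM av rmorph0.
  move=> /dL [/(loc_eq0 loc) [s Qs es]|/(loc_eq0 loc) [s Qs /AQ //]].
  have [Q' mQ' Q'Q] := minQ Q pQ; have [pQ' _ _] := mQ'.
  apply: a0; apply: (minQ0 Q' a mQ').
  have : Q' (s * iota a) by rewrite es; exact: (idl0 (prime_is_ideal pQ')).
  by case: pQ' => _ _ h /h [/Q'Q|].
have [a a0 fa] := factors_nonzero gen_B dA (elimN eqP (oner_neq0 A)).
(* The nonzero [a] serves as the multiplier that [factors_at_prime] starts from, at every prime that
   misses [U]; so the ideal [factors] meets [U]. *)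
have [c1 [Pc1 fc1]] : exists c1, ~ P c1 /\ factors iota (theta c1).
  apply: contrapT => nof.
  have [b hf [u Pu eu]|Q [pQ FQ QU]] := prime_avoiding nB (factors_ideal iota) hU.
    by apply: nof; exists u; rewrite eu.
  have QU' u : ~ P u -> ~ Q (theta u) by move=> Pu /QU; apply; exists u.
  have [L [psi loc]] := localization_exists (prime_mult_closed pQ).
  have [|s [Qs /FQ //]] := factors_at_prime pp pA gen_B nA ffA pQ loc (dX Q pQ QU' L psi loc) fa.
  move=> /(loc_eq0 loc) [s Qs]; rewrite mulrC => /(torsion a s a0) s0.
  by apply: Qs; rewrite s0; exact: (idl0 (prime_is_ideal pQ)).
exists A, B, iota, theta, c1; split=> //.
- by split=> //; exists r, (fun j => pi (e j)).
- by move=> i; exists (X i); rewrite /iota /= evX.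
Qed.

(** * Uniform families of components *)

(* For every [n], up to multiplication by [c0 \notin P] and modulo [P], the ideal
   [a ^ [p ^ n]] is the intersection of the [Z i n], where [Z i n] behaves like
   a [q i]-primary ideal containing the [p ^ n]-th powers of [q i ^ h i]. *)
Definition uniform_components (p : nat) (R : comPzRingType) (a P : set R) :=
  exists (I : finType) (q : I -> set R) (h : I -> nat) (Z : I -> nat -> set R) (c0 : R),
  [/\ forall i, prime_ideal (q i) /\ P `<=` q i,
      forall i n, [/\ is_ideal (Z i n), frob_power p a n `<=` Z i n & P `<=` Z i n],
      forall i n s z, ~ q i s -> Z i n (s * z) -> Z i n z,
      forall i n (f : 'I_(h i) -> R), (forall j, q i (f j)) ->
        Z i n ((\prod_j f j) ^+ (p ^ n)) &
      ~ P c0 /\ forall n z, (forall i, Z i n z) -> addI (frob_power p a n) P (c0 * z)].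

(** The origin of the exponents [h]: every element of [Q] has a power in the contraction [K] of the
    localization of [I], and [Q] is finitely generated. *)
Lemma minimal_prime_powers (B : comPzRingType) (I Q : set B) : noetherian B ->
  is_ideal I -> minimal_prime_over I Q ->
  exists h, forall y, idealX Q h y -> exists2 s, ~ Q s & I (s * y).
Proof.
move=> nB hI mQ; have [pQ _ _] := mQ; have hQ := prime_is_ideal pQ.
have [_ Q1 Qp] := pQ.
pose K : set B := [set y | exists2 s, ~ Q s & I (s * y)].
have hK : is_ideal K.
  split=> [|u v [s Qs hs] [t Qt ht]|u v [s Qs hs]].
  - by exists 1; rewrite // mulr0; id0.
  - exists (s * t); first by move=> /Qp [].
    have -> : s * t * (u + v) = t * (s * u) + s * (t * v) by ring.
    by idD => //; idM.
  - by exists s => //; rewrite mulrCA; idM.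
have [x Qx|h hh] := idealX_of_rad nB hQ hK; last by exists h => y /hh.
by have [s [N [Qs hs]]] := minimal_prime_pow nB hI mQ Qx; exists N, s.
Qed.

Lemma frob_power_ext (p : nat) (A B : comPzRingType) (iota : {rmorphism A -> B})
    (I : set A) n u : prime p -> p%:R = 0 :> B ->
  ideal_ext iota I u -> ideal_ext iota (frob_power p I n) (u ^+ (p ^ n)).
Proof.
move=> pp pB; have hE := ideal_ext_ideal iota (frob_power p I n).
move: u; apply: (gen_min (I := [set u | ideal_ext iota (frob_power p I n) (u ^+ (p ^ n))])).
  split=> [|u v hu hv|u v hv] /=.
  - by rewrite (frob0 _ pp); exact: (idl0 hE).
  - by rewrite (frobD pp pB); apply: (idlD hE).
  - by rewrite exprMn; apply: (idlM _ hE).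
move=> _ [v Iv <-] /=; rewrite -rmorphXn; apply: ideal_ext_in.
exact: frob_power_in.
Qed.

Section Components.
Variables (p : nat) (R A B : comPzRingType) (P E a : set R).
Variables (iota : {rmorphism A -> B}) (theta : {rmorphism R -> B}) (c0 : R).
Variables (r : nat) (e : 'I_r -> B).
Hypotheses (pp : prime p) (pA : p%:R = 0 :> A) (pP : prime_ideal P).
Hypotheses (nA : noetherian A) (ffA : frob_flat ([set 0] : set A) p) (nB : noetherian B).
Hypothesis gen_e : forall b, exists a : 'I_r -> A, b = \sum_j iota (a j) * e j.
Hypotheses (Pc0 : ~ P c0) (fc0 : factors iota (theta c0)).
Hypothesis ker : forall r, theta r = 0 <-> P r.
Hypothesis contract : forall I r, is_ideal I -> ideal_ext theta I (theta r) -> addI I P r.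
Hypotheses (aE : a = gen_ideal E) (iE : forall r, E r -> exists y, iota y = theta r).

(** The indices are the pairs of a primary component [q0] of [aA] and a minimal prime [Q0] of its
    extension to [B]; neither they nor the exponents involve [n]. [Z] is the contraction to [R] of
    the extension of [q0 ^ [p ^ n]] localized at [Q0]. *)
Lemma components_of_data : uniform_components p a P.
Proof.
have pB : p%:R = 0 :> B by rewrite -(rmorph_nat iota) pA rmorph0.
pose EA : set A := [set y | exists2 x, E x & iota y = theta x].
pose aA := gen_ideal EA.
have haA : is_ideal aA by exact: gen_ideal_ideal.
have [s [sprim sE]] := primary_decomposition nA haA.
have hE (q : set A) : is_ideal (ideal_ext iota q) by exact: ideal_ext_ideal.
have /choice [t ht] : forall q : set A, exists t : seq (set B),
    (forall Q, Q \in t -> prime_ideal Q /\ ideal_ext iota q `<=` Q) /\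
    (forall Q, prime_ideal Q -> ideal_ext iota q `<=` Q -> exists2 Q', Q' \in t & Q' `<=` Q).
  by move=> q; apply: prime_list.
pose l := [seq x <- [seq (q, Q) | q <- s, Q <- t q] |
  `[< minimal_prime_over (ideal_ext iota x.1) x.2 >]].
pose q0 (i : 'I_(size l)) : set A := (tnth (in_tuple l) i).1.
pose Q0 (i : 'I_(size l)) : set B := (tnth (in_tuple l) i).2.
have lP i : q0 i \in s /\ minimal_prime_over (ideal_ext iota (q0 i)) (Q0 i).
  have : tnth (in_tuple l) i \in l by apply: mem_tnth.
  rewrite mem_filter => /andP [/asboolP mQ /allpairsPdep [q [Q [qs _ eq]]]].
  by split=> //; rewrite /q0 eq.
have lI q Q : q \in s -> minimal_prime_over (ideal_ext iota q) Q ->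
    exists i, q0 i = q /\ Q0 i = Q.
  move=> qs mQ; have [pQ qQ minQ] := mQ.
  have [Q' Q't Q'Q] := (proj2 (ht q)) Q pQ qQ.
  have eQ : Q' = Q by have [pQ' qQ'] := (proj1 (ht q)) Q' Q't; apply: minQ.
  have : (q, Q) \in l.
    rewrite mem_filter; apply/andP; split; first exact/asboolP.
    by apply/allpairsPdep; exists q, Q; rewrite -eQ.
  by move=> /(tnthP (in_tuple l)) [i ei]; exists i; rewrite /q0 /Q0 -ei.
have pQ i : prime_ideal (Q0 i) by case: (lP i) => _ [].
have Q0P i : [/\ is_ideal (Q0 i), ~ Q0 i 1 & forall u v, Q0 i (u * v) -> Q0 i u \/ Q0 i v] := pQ i.
have /choice [h hh] : forall i, exists h, forall y, idealX (Q0 i) h y ->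
    exists2 s, ~ Q0 i s & ideal_ext iota (q0 i) (s * y).
  by move=> i; apply: minimal_prime_powers => //; case: (lP i).
pose Z i n : set R := [set z | exists2 sg, ~ Q0 i sg &
  ideal_ext iota (frob_power p (q0 i) n) (sg * theta z)].
have hZ i n : is_ideal (Z i n).
  have hF := hE (frob_power p (q0 i) n).
  split=> [|u v [s1 h1 e1] [s2 h2 e2]|u v [s1 h1 e1]].
  - by exists 1; [case: (Q0P i)|rewrite rmorph0 mulr0; exact: (idl0 hF)].
  - exists (s1 * s2); first by case: (Q0P i) => _ _ hp /hp [].
    have -> : s1 * s2 * theta (u + v) = s2 * (s1 * theta u) + s1 * (s2 * theta v).
      by rewrite rmorphD; ring.
    by apply: (idlD hF); apply: (idlM _ hF).
  - by exists s1 => //; rewrite rmorphM mulrCA; apply: (idlM _ hF).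
have aq i y : aA y -> q0 i y by move=> /sE; apply; case: (lP i).
have extA n z : ideal_ext iota (frob_power p aA n) z -> ideal_ext theta (frob_power p a n) z.
  move: z; apply: gen_min => [|_ [y + <-]]; first exact: ideal_ext_ideal.
  rewrite (frob_power_gen pp pA).
  have hT := ideal_ext_ideal theta (frob_power p a n).
  move: y; apply: (gen_min (preim_ideal iota hT)) => _ [y [x Ex ey] <-] /=.
  rewrite rmorphXn ey -rmorphXn; apply: ideal_ext_in; apply: frob_power_in.
  by rewrite aE; apply: gen_sub.
exists 'I_(size l), (fun i => theta @^-1` Q0 i), h, Z, c0; split.
- move=> i; split=> [|y /ker ey /=]; first exact: preim_prime.
  by rewrite ey; case: (Q0P i) => -[].
- move=> i n; split=> //; last first.
    move=> y /ker ey; exists 1; first by case: (Q0P i).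
    by rewrite ey mulr0; exact: (idl0 (hE _)).
  rewrite aE; apply: frob_power_min => // y.
  have hK : is_ideal [set y | Z i n (y ^+ (p ^ n))].
    split=> [|u v hu hv|u v hv] /=; have hZi := hZ i n.
    - exists 1; first by case: (Q0P i).
      by rewrite rmorphXn rmorph0 (frob0 _ pp) mulr0; exact: (idl0 (hE _)).
    - have [s1 h1 e1] := hu; have [s2 h2 e2] := hv; exists (s1 * s2).
        by case: (Q0P i) => _ _ hp /hp [].
      have -> : s1 * s2 * theta ((u + v) ^+ (p ^ n)) =
          s2 * (s1 * theta (u ^+ (p ^ n))) + s1 * (s2 * theta (v ^+ (p ^ n))).
        by rewrite !rmorphXn rmorphD (frobD pp pB); ring.
      by apply: (idlD (hE _)); apply: (idlM _ (hE _)).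
    - by rewrite exprMn; apply: (idlM _ hZi).
  move: y; apply: (gen_min hK) => y Ey /=; exists 1; first by case: (Q0P i).
  have [z ez] := iE Ey; rewrite mul1r rmorphXn -ez -rmorphXn; apply: ideal_ext_in.
  by apply: frob_power_in; apply: aq; apply: gen_sub; exists y.
- move=> i n y z Qy [s1 h1 e1]; exists (s1 * theta y).
    by case: (Q0P i) => _ _ hp /hp [].
  by rewrite -mulrA -rmorphM.
- move=> i n f qf; have [|s1 h1 e1] := hh i (\prod_j theta (f j)).
    exact: idealX_prod.
  exists (s1 ^+ (p ^ n)); first by move=> /(prime_X (pQ i)).
  by rewrite rmorphXn rmorph_prod -exprMn; apply: frob_power_ext.
split=> // n z hz; apply: contract; first exact: frob_power_ideal.
(* The linear forms reduce the claim to [phi k (theta z)] lying in [q ^ [p ^ n]] for each component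
   [q] in [A]; there, elements outside the radical of [q] can be cancelled. *)
rewrite rmorphM; have [K [phi [w [phiD phiZ phiE]]]] := fc0.
rewrite phiE; apply: extA; have hF := hE (frob_power p aA n).
apply: idl_sum => // k; apply: (idlMr _ hF); apply: ideal_ext_in.
have -> : aA = [set u | forall q, q \in s -> q u] by apply/seteqP; split=> y /sE.
apply: (frob_power_bigcap pp pA ffA) => q qs.
  by case: (sprim q qs).
suff [y [qy hy]] : exists y, ~ ideal_radical q y /\
    ideal_ext iota (frob_power p q n) (iota y * theta z).
  apply: (frob_power_primary pp pA ffA (sprim q qs) qy); rewrite -phiZ.
  move: hy => /gen_idealP [N [c [g [hg ->]]]].
  have /choice [u hu] : forall j, exists u, frob_power p q n u /\ iota u = g j.
    by move=> j; have [u qu <-] := hg j; exists u.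
  have -> : \sum_j c j * g j = \sum_j iota (u j) * c j.
    by apply: eq_bigr => j _; case: (hu j) => _ ->; rewrite mulrC.
  rewrite (scaled_linear_sum u c (phiD k) (phiZ k)).
  have hq := frob_power_ideal p q n.
  by apply: (idl_sum hq) => j; apply: (idlMr _ hq); case: (hu j).
(* Otherwise some prime [Q] of [B] contains [KK] and contracts into the radical of [q]. A minimal
   prime [Q'] of the extension of [q] inside [Q] has the same contraction, so [Q = Q'] by
   incomparability; but [hz] gives an element of [KK] outside [Q']. *)
apply: contrapT => noy.
have pq := radical_primary nA (sprim q qs).
pose KK : set B := [set b | ideal_ext iota (frob_power p q n) (b * theta z)].
have hF' := hE (frob_power p q n).
have hKK : is_ideal KK.
  split=> [|b b' hb hb'|b b' hb'] /=; rewrite /KK /=.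
  - by rewrite mul0r; exact: (idl0 hF').
  - by rewrite mulrDl; apply: (idlD hF').
  - by rewrite -mulrA; apply: (idlM _ hF').
pose U : set B := iota @` (~` ideal_radical q).
have hU : mult_closed U.
  split=> [|_ _ [u Pu <-] [v Pv <-]]; first by exists 1; [case: pq|exact: rmorph1].
  by exists (u * v); [move=> /=; case: pq => _ _ hp /hp []|exact: (rmorphM iota)].
have [b KKb [u Pu eu]|Q [prQ KQ QU]] := prime_avoiding nB hKK hU.
  by apply: noy; exists u; rewrite eu.
have hQ := prime_is_ideal prQ.
have qQ : ideal_ext iota q `<=` Q.
  apply: ideal_ext_min => // y qy; apply: (prime_X (n := (p ^ n)%N) prQ); apply: KQ.
  by rewrite /KK /= -rmorphXn; apply: (idlMr _ hF'); apply: ideal_ext_in; apply: frob_power_in.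
have [Q' [pQ' qQ' Q'Q minQ']] := minimal_over nB (hE q) prQ qQ.
have [i [ei1 ei2]] := lI q Q' qs (And3 pQ' qQ' minQ').
have [sg hsg esg] := hz i; rewrite ei1 in esg; rewrite ei2 in hsg.
suff QQ' : Q `<=` Q' by apply: hsg; apply: QQ'; apply: KQ.
apply: contrapT => nQQ.
have [_ h2] := incomparability nA gen_e pQ' prQ (conj Q'Q nQQ); apply: h2 => y /= Qy.
have [N hN] : ideal_radical q y by apply: contrapT => ry; apply: (QU _ Qy); exists y.
apply: (prime_X (n := N) pQ'); rewrite -rmorphXn; apply: qQ'; exact: ideal_ext_in.
Qed.
End Components.

(** * Tight closure *)

Lemma dep_choice (J : Type) (T : J -> Type) (Q : forall j, T j -> Prop) :
  (forall j, exists x, Q j x) -> exists f, forall j, Q j (f j).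
Proof. by move=> hQ; exists (fun j => sval (cid (hQ j))) => j; apply: svalP. Qed.

Lemma minimal_primes_seq (R : comPzRingType) : noetherian R ->
  exists s : seq (set R), [/\ uniq s, forall P, P \in s <-> minimal_prime P &
    forall Q, prime_ideal Q -> exists2 P, P \in s & P `<=` Q].
Proof.
move=> nR; have [s [sp sQ]] := prime_list nR (set0_ideal R).
pose t := undup [seq P <- s | `[< minimal_prime P >]].
have tP P : P \in t <-> minimal_prime P.
  rewrite mem_undup mem_filter; split=> [/andP [/asboolP]//|mP].
  apply/andP; split; first exact/asboolP.
  have [pP hP] := mP; have [|P' P's P'P] := sQ P pP.
    by move=> _ ->; exact: (idl0 (prime_is_ideal pP)).
  by rewrite -(hP P') //; case: (sp P' P's).
exists t; split=> [|//|Q pQ]; first exact: undup_uniq.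
have Q0 : [set 0] `<=` Q by move=> _ ->; exact: (idl0 (prime_is_ideal pQ)).
have [P [pP _ PQ hP]] := minimal_over nR (set0_ideal R) pQ Q0; exists P => //.
apply/tP; split=> // P' pP'; apply: hP => //.
by move=> _ ->; exact: (idl0 (prime_is_ideal pP')).
Qed.

Lemma nilradical_exponent (p : nat) (R : comPzRingType) : noetherian R -> prime p ->
  exists e, forall x : R, (forall P, minimal_prime P -> P x) -> x ^+ (p ^ e) = 0.
Proof.
move=> nR pp; have [s [us sP sQ]] := minimal_primes_seq nR.
pose Nil : set R := \bigcap_(P in [set P | minimal_prime P]) P.
have hN : is_ideal Nil by apply: bigcap_ideal => P [pP _]; apply: prime_is_ideal.
have [x Nx|N hNN] := idealX_of_rad nR hN (set0_ideal R).
  apply: (radical_primes nR (set0_ideal R)) => Q pQ _.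
  by have [P /sP mP PQ] := sQ Q pQ; apply: PQ; apply: Nx.
exists N => x hx; have : idealX Nil N (x ^+ N) by apply: idealX_exp.
move=> /hNN x0; rewrite -(subnK (ltnW (ltn_expl N (prime_gt1 pp)))) exprD.
by rewrite [x ^+ N]x0 mulr0.
Qed.

(** [D j] lies in all minimal primes but the [j]-th, so the sum [c2] of the [D j * C j] lies in
    none. Modulo each minimal prime, [c2 * u] is congruent to one and the same element of [a ^
    [p ^ n]]; the difference is nilpotent, and the additive power [p ^ e] kills it. *)
Lemma uniform_components_glue (p : nat) (R : comPzRingType) (a : set R) :
  prime p -> p%:R = 0 :> R -> noetherian R ->
  (forall P, minimal_prime P -> uniform_components p a P) ->
  exists (I : finType) (P q : I -> set R) (h : I -> nat) (Z : I -> nat -> set R),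
  [/\ forall i, [/\ minimal_prime (P i), prime_ideal (q i) & P i `<=` q i],
      forall i n, is_ideal (Z i n) /\ frob_power p a n `<=` Z i n,
      forall i n s z, ~ q i s -> Z i n (s * z) -> Z i n z,
      forall i n (f : 'I_(h i) -> R), (forall j, q i (f j)) ->
        Z i n ((\prod_j f j) ^+ (p ^ n)) &
      forall c : I -> R, (forall i, ~ P i (c i)) -> exists2 c1, ring_circ c1 &
        exists e, forall n u, (forall i, Z i n (c i * u)) ->
          frob_power p a (n + e) (c1 * u ^+ (p ^ e))].
Proof.
move=> pp pR nR comps; have [s [us sP _]] := minimal_primes_seq nR.
pose k := size s; pose P0 (j : 'I_k) := tnth (in_tuple s) j.
have mP0 j : minimal_prime (P0 j) by apply/sP; apply: mem_tnth.
have pP0 j : prime_ideal (P0 j) by case: (mP0 j).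
have P0inj j l : P0 j = P0 l -> j = l.
  rewrite /P0 !(tnth_nth set0) /= => /eqP; rewrite nth_uniq // => /eqP; exact: val_inj.
have P0s P : minimal_prime P -> exists j, P0 j = P.
  by move=> /sP /(tnthP (in_tuple s)) [j ->]; exists j.
have /choice [I0 hI0] := fun j => comps (P0 j) (mP0 j).
have [q0 hq0] := dep_choice hI0; have [h0 hh0] := dep_choice hq0.
have [Z0 hZ0] := dep_choice hh0; have [c0 hc0] := dep_choice hZ0.
pose I : finType := {j : 'I_k & I0 j}.
exists I, (fun i => P0 (tag i)), (fun i => q0 _ (tagged i)), (fun i => h0 _ (tagged i)),
  (fun i => Z0 _ (tagged i)); split.
- by move=> [j i] /=; case: (hc0 j) => /(_ i) [h1 h2] _ _ _ _.
- by move=> [j i] n /=; case: (hc0 j) => _ /(_ i n) [h1 h2 h3] _ _ _.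
- by move=> [j i] n s' z /=; case: (hc0 j) => _ _ h3 _ _; apply: h3.
- by move=> [j i] n f /=; case: (hc0 j) => _ _ _ h4 _; apply: h4.
move=> c Pc.
pose C j := c0 j * \prod_(i : I0 j) c (Tagged I0 i).
have PC j : ~ P0 j (C j).
  have [S1 SM] := prime_mult_closed (pP0 j); apply: (SM); first by case: (hc0 j) => _ _ _ _ [].
  apply: (big_ind (~` P0 j)) => [|u v|i _]; [exact: S1|exact: SM|exact: (Pc (Tagged I0 i))].
have /choice [y hy] : forall jl : 'I_k * 'I_k, exists y,
    jl.1 <> jl.2 -> P0 jl.2 y /\ ~ P0 jl.1 y.
  move=> [j l] /=; apply: contrapT => /forallNP hn.
  have jl : j <> l by move=> jl; apply: (hn 0) => /(_ jl).
  apply: jl; apply: P0inj; symmetry; apply: (proj2 (mP0 j)) => // z Pz.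
  by apply: contrapT => Pjz; apply: (hn z).
pose D j := \prod_(l | l != j) y (j, l).
have DP j l : j <> l -> P0 l (D j).
  move=> jl; rewrite /D (bigD1 l) /=; last by apply/eqP => e; apply: jl.
  by apply: (idlMr _ (prime_is_ideal (pP0 l))); case: (hy (j, l) jl).
have nDP j : ~ P0 j (D j).
  have [S1 SM] := prime_mult_closed (pP0 j).
  by apply: (big_ind (~` P0 j)) => // l /eqP lj; case: (hy (j, l)) => //= e; apply: lj.
pose c2 := \sum_j D j * C j.
have circ : ring_circ c2.
  move=> P /P0s [l <-]; have hl := prime_is_ideal (pP0 l).
  rewrite /c2 (bigD1 l) //= => hc2.
  have hrest : P0 l (\sum_(j | j != l) D j * C j).
    by apply: (idl_sumP hl) => j /eqP jl; apply: (idlMr _ hl); exact: DP.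
  have := idlDr hl hrest hc2; case: (pP0 l) => _ _ hp /hp [].
    exact: nDP.
  exact: PC.
have [e he] := nilradical_exponent nR pp.
exists (c2 ^+ (p ^ e)); first by move=> P mP; have [pP _] := mP; move=> /(prime_X pP); apply: circ.
exists e => n u hu.
have /choice [al hal] : forall j, exists al, frob_power p a n al /\ P0 j (C j * u - al).
  move=> j; have [_ _ _ _ [_ /(_ n (\prod_(i : I0 j) c (Tagged I0 i) * u))]] := hc0 j.
  case=> [i|al [w [h1 h2 h3]]].
    rewrite (bigD1 i) //= mulrAC; have [_ /(_ i n) [hZ _ _] _ _ _] := hc0 j.
    by apply: (idlMr _ hZ); apply: (hu (Tagged I0 i)).
  by exists al; split=> //; rewrite /C -mulrA h3 addrC addKr.
rewrite -exprMn -frob_powerD //.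
have -> : (c2 * u) ^+ (p ^ e) = (\sum_j D j * al j) ^+ (p ^ e).
  rewrite -(subrK (\sum_j D j * al j) (c2 * u)) (frobD pp pR) he ?add0r // => P /P0s [l <-].
  have hl := prime_is_ideal (pP0 l).
  rewrite /c2 mulr_suml -sumrB; apply: (idl_sum hl) => j.
  have -> : D j * C j * u - D j * al j = D j * (C j * u - al j) by ring.
  have [->|/eqP jl] := eqVneq j l; first by apply: (idlM _ hl); case: (hal l).
  by apply: (idlMr _ hl); apply: DP.
apply: frob_power_in; have ha := frob_power_ideal p a n.
by apply: (idl_sum ha) => j; apply: (idlM _ ha); case: (hal j).
Qed.

Lemma idealX_gen_ind (R : comPzRingType) (X E : set R) h w : is_ideal E ->
  (forall f : 'I_h -> R, (forall j, X (f j)) -> E (w * \prod_j f j)) ->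
  forall y, idealX (gen_ideal X) h y -> E (w * y).
Proof.
move=> hE; elim: h w => [|h IH] w hw y.
  by move=> _; have := hw (fun=> 0); rewrite big_ord0 mulr1 => Ew; idMr => //; apply: Ew => -[].
have hK y' : is_ideal [set u | E (w * (u * y'))].
  split=> [|u v hu hv|u v hv] /=.
  - by rewrite mul0r mulr0; id0.
  - by rewrite mulrDl mulrDr; idD.
  - by rewrite -mulrA mulrCA; idM.
have hL : is_ideal [set u | E (w * u)].
  split=> [|u v hu hv|u v hv] /=.
  - by rewrite mulr0; id0.
  - by rewrite mulrDr; idD.
  - by rewrite mulrCA; idM.
rewrite idealXS; apply: (idealM_min hL) => u v hu hv.
move: u hu; apply: (gen_min (hK v)) => u Xu /=; rewrite mulrA; apply: IH => // f Xf.
have := hw (fun i => if unlift ord0 i is Some j then f j else u).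
rewrite big_ord_recl unlift_none /= mulrA.
under eq_bigr do rewrite liftK.
by apply=> i; case: unliftP => [j|] _.
Qed.

Section TightClosureComponents.
Variables (p : nat) (R : comPzRingType) (a : set R) (I : finType).
Variables (P q : I -> set R) (h : I -> nat) (Z : I -> nat -> set R).
Hypotheses (pp : prime p) (pR : p%:R = 0 :> R) (nR : noetherian R) (ha : is_ideal a).
Hypothesis hP : forall i, [/\ minimal_prime (P i), prime_ideal (q i) & P i `<=` q i].
Hypothesis hZ : forall i n, is_ideal (Z i n) /\ frob_power p a n `<=` Z i n.
Hypothesis Zq : forall i n s z, ~ q i s -> Z i n (s * z) -> Z i n z.
Hypothesis Zh : forall i n (f : 'I_(h i) -> R), (forall j, q i (f j)) ->
  Z i n ((\prod_j f j) ^+ (p ^ n)).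
Hypothesis glue : forall c : I -> R, (forall i, ~ P i (c i)) ->
  exists2 c1, ring_circ c1 & exists e, forall n u, (forall i, Z i n (c i * u)) ->
    frob_power p a (n + e) (c1 * u ^+ (p ^ e)).

(** Tight closure as seen by one component. The multiplier has to avoid [P i] only and may depend on
    [u]. *)
Definition tc_component i n : set R := [set u | exists2 c, ~ P i c &
  exists N, forall k, (N <= k)%N -> Z i (n + k) (c * u ^+ (p ^ k))].
Local Notation E := tc_component.

Let pP i : prime_ideal (P i). Proof. by case: (hP i) => -[]. Qed.
Let pq i : prime_ideal (q i). Proof. by case: (hP i). Qed.
Let iZ i n : is_ideal (Z i n). Proof. by case: (hZ i n). Qed.
Let P1 i : ~ P i 1. Proof. by case: (pP i). Qed.
Let PM i u v : ~ P i u -> ~ P i v -> ~ P i (u * v).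
Proof. by case: (pP i) => _ _ hp Pu Pv /hp []. Qed.

Lemma tc_component_ideal i n : is_ideal (E i n).
Proof.
split=> [|u v [c Pc [N hN]] [d Pd [M hM]]|u v [c Pc [N hN]]].
- by exists 1 => //; exists 0%N => k _; rewrite (frob0 _ pp) mulr0; id0.
- exists (c * d); first exact: PM.
  exists (maxn N M) => k; rewrite geq_max => /andP [Nk Mk].
  have -> : c * d * (u + v) ^+ (p ^ k) = d * (c * u ^+ (p ^ k)) + c * (d * v ^+ (p ^ k)).
    by rewrite (frobD pp pR); ring.
  by idD => //; idM => //; [apply: hN|apply: hM].
- exists c => //; exists N => k Nk; rewrite exprMn mulrCA; idM => //; exact: hN.
Qed.

Lemma tc_component_cancel i n s u : ~ q i s -> E i n (s * u) -> E i n u.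
Proof.
move=> qs [c Pc [N hN]]; exists c => //; exists N => k /hN.
rewrite exprMn mulrCA; apply: Zq; by move=> /(prime_X (pq i)).
Qed.

Lemma tc_component_prod i n (f : 'I_(h i) -> R) : (forall j, q i (f j)) ->
  E i n ((\prod_j f j) ^+ (p ^ n)).
Proof.
move=> qf; exists 1 => //; exists 0%N => k _.
by rewrite mul1r -exprM -expnD; apply: Zh.
Qed.

Lemma tc_component_frob i n k u : E i (n + k) (u ^+ (p ^ k)) <-> E i n u.
Proof.
split=> -[c Pc [N hN]]; exists c => //.
  exists (N + k)%N => l Nl; have := hN (l - k)%N.
  by rewrite -exprM -expnD -addnA subnKC; [apply; lia|lia].
exists N => l Nl; rewrite -exprM -expnD -addnA; apply: hN.
by rewrite (leq_trans Nl) // leq_addl.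
Qed.

(** The same [h i] serves all [n]; this becomes the linear growth. *)
Lemma tc_component_powers i n :
  idealX (frob_power p (q i) n) (h i) `<=` E i n.
Proof.
move=> y hy; rewrite -[y]mul1r; apply: (idealX_gen_ind (tc_component_ideal i n) _ hy) => f hf.
have /choice [g hg] : forall j, exists g, q i g /\ g ^+ (p ^ n) = f j.
  by move=> j; have [g qg <-] := hf j; exists g.
rewrite mul1r; under eq_bigr do rewrite -(proj2 (hg _)).
rewrite prodrXl; by apply: tc_component_prod => j; case: (hg j).
Qed.

Lemma tc_component_primary i n : ~ E i n 1 ->
  primary_ideal (E i n) /\ ideal_radical (E i n) = q i.
Proof.
move=> E1; have hE := tc_component_ideal i n.
have qE u : q i u -> ideal_radical (E i n) u.
  move=> qu; exists (h i * p ^ n)%N.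
  have := @tc_component_prod i n (fun=> u) (fun=> qu).
  by rewrite prodr_const card_ord exprM.
split; first split=> // u v Euv.
  have [/qE qv|qv] := pselect (q i v); [by right|left].
  by apply: (tc_component_cancel qv); rewrite mulrC.
apply/seteqP; split=> // u [k hk]; apply: contrapT => qu; apply: E1.
apply: (@tc_component_cancel i n (u ^+ k)); last by rewrite mulr1.
by move=> /(prime_X (pq i)).
Qed.

(** Conversely, the multipliers of the finitely many components do not depend on [k] and are glued
    into one, at the cost of the shift by [e]. *)
Lemma tight_closure_components n u :
  tight_closure p (frob_power p a n) u <-> forall i, E i n u.
Proof.
split=> [[c hc [N hN]] i|].
  exists c; first by apply: hc; case: (hP i).
  by exists N => k /hN; rewrite frob_powerD //; case: (hZ i (n + k)%N) => _; apply.
move=> hu; have /choice [c hc] : forall i, exists c, ~ P i c /\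
    exists N, forall k, (N <= k)%N -> Z i (n + k) (c * u ^+ (p ^ k)).
  by move=> i; have [c h1 h2] := hu i; exists c.
have Pc i : ~ P i (c i) by case: (hc i).
have /choice [N hN] : forall i, exists N, forall k, (N <= k)%N ->
    Z i (n + k) (c i * u ^+ (p ^ k)) by move=> i; case: (hc i).
have [c1 hc1 [e he]] := glue Pc; exists c1 => //.
exists (\max_i N i + e)%N => k Nk; rewrite frob_powerD //.
have -> : (n + k = n + (k - e) + e)%N by lia.
have -> : u ^+ (p ^ k) = (u ^+ (p ^ (k - e))) ^+ (p ^ e).
  by rewrite -exprM -expnD subnK //; lia.
apply: he => i; apply: hN; have := leq_bigmax (F := N) i; lia.
Qed.

Lemma tight_closure_frob_f_sequence :
  f_sequence p (fun n => tight_closure p (frob_power p a n)).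
Proof.
have tcE n : tight_closure p (frob_power p a n) = \bigcap_(i in setT) E i n.
  apply/seteqP; split=> u; first by move=> /tight_closure_components hu i _.
  by move=> hu; apply/tight_closure_components => i; apply: hu.
split=> n.
  by rewrite tcE; apply: bigcap_ideal => i _; apply: tc_component_ideal.
have key i u : E i n.+1 (u ^+ p) <-> E i n u.
  by have := tc_component_frob i n 1 u; rewrite addn1 expn1.
apply/seteqP; split=> u /= /tight_closure_components hu; apply/tight_closure_components => i.
  by apply/key.
by apply/key.
Qed.

(** A component whose prime [q i] meets [S] is multiplied away by an element of [S]. For the others
    [P i] misses [S] too and extends to a minimal prime of [L], so that the numerator of a
    multiplier in [L] avoids [P i]. *)
Lemma tight_closure_localization (S : set R) (L : comPzRingType) (phi : {rmorphism R -> L}) :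
  mult_closed S -> is_localization S phi ->
  ideal_ext phi (tight_closure p a) = tight_closure p (ideal_ext phi a).
Proof.
move=> hS loc; have [S1 SM] := hS.
have pL : p%:R = 0 :> L by rewrite -(rmorph_nat phi) pR rmorph0.
have a0 : frob_power p a 0 = a by apply: frob_power0.
have hTC : is_ideal (tight_closure p a).
  by have [+ _] := tight_closure_frob_f_sequence => /(_ 0%N); rewrite a0.
have frE k r : frob_power p (ideal_ext phi a) k (phi r) ->
    exists2 s, S s & frob_power p a k (s * r).
  move=> hr; have hF := frob_power_ideal p a k; apply/(loc_ext_phi loc hS r hF).
  move: hr; apply: frob_power_min; first exact: ideal_ext_ideal.
  by move=> y; apply: frob_power_ext.
have Eh k r : frob_power p a k r -> frob_power p (ideal_ext phi a) k (phi r).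
  move: r; apply: frob_power_min => [|r ar /=].
    by apply: preim_ideal; exact: frob_power_ideal.
  by rewrite rmorphXn; apply: frob_power_in; apply: ideal_ext_in.
apply/seteqP; split=> y.
  move=> /(loc_extP loc hS y hTC) [r [s [[c hc [N hN]] Ss es]]].
  have [v ev] := loc_inv loc Ss.
  have -> : y = v * phi r by rewrite -es mulrA ev mul1r.
  exists (phi c).
    move=> W [pW minW] Wc; apply: (hc (phi @^-1` W)) Wc; split; first exact: preim_prime.
    move=> Q pQ QW; have QS s' : S s' -> ~ Q s' by move=> Ss' /QW; apply: (loc_prime_disj loc).
    rewrite -(loc_contr_ext loc hS pQ QS); congr (_ @^-1` _); apply: minW.
      exact: (loc_ext_prime loc hS pQ QS).
    by apply: ideal_ext_min => //; apply: prime_is_ideal.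
  exists N => k Nk; rewrite exprMn mulrCA -rmorphXn -rmorphM.
  by apply: (idlM _ (frob_power_ideal p _ k)); apply: Eh; apply: hN.
move=> [c' hc' [N hN]]; have [r [s [Ss es]]] := loc_frac loc y.
apply: (loc_cancel loc (ideal_ext_ideal _ _) Ss); rewrite es.
apply/(loc_ext_phi loc hS r hTC).
have [c [s' [Ss' es']]] := loc_frac loc c'.
have hr k : (N <= k)%N -> frob_power p (ideal_ext phi a) k (phi (c * r ^+ (p ^ k))).
  move=> Nk; rewrite rmorphM rmorphXn -es -es' exprMn.
  have -> : phi s' * c' * (phi s ^+ (p ^ k) * y ^+ (p ^ k)) =
    phi s' * phi s ^+ (p ^ k) * (c' * y ^+ (p ^ k)) by ring.
  by apply: (idlM _ (frob_power_ideal p _ k)); apply: hN.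
have /choice [t ht] : forall i, exists t, S t /\ E i 0 (t * r).
  move=> i; have [[t [qt St]]|nqS] := pselect (exists t, q i t /\ S t).
    exists (t ^+ h i); split; first exact: mult_closedX.
    apply: (idlMr _ (tc_component_ideal i 0)).
    by have := @tc_component_prod i 0 (fun=> t) (fun=> qt); rewrite prodr_const card_ord.
  have qS t : S t -> ~ q i t by move=> St qt; apply: nqS; exists t.
  have PS t : S t -> ~ P i t by case: (hP i) => _ _ Pq /qS hq /Pq.
  exists 1; split=> //; rewrite mul1r; exists c.
    move=> Pc; apply: (hc' (ideal_ext phi (P i))).
      split=> [|W pW WP]; first exact: (loc_ext_prime loc hS).
      rewrite -(loc_ext_contr loc (prime_is_ideal pW)); congr (ideal_ext phi _).
      have [[_ minP] _ _] := hP i; apply: minP; first exact: preim_prime.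
      by move=> z /= /WP; rewrite -{2}(loc_contr_ext loc hS (pP i) PS).
    apply: (loc_cancel loc (ideal_ext_ideal _ _) Ss'); rewrite es'.
    exact: ideal_ext_in.
  exists N => k Nk; have [t St ht] := frE _ _ (hr k Nk).
  by apply: (Zq (qS t St)); case: (hZ i (0 + k)%N) => _; apply.
exists (\prod_i t i).
  by apply: (big_ind S) => // i _; case: (ht i).
rewrite -a0; apply/tight_closure_components => i.
rewrite (bigD1 i) //= mulrAC; apply: (idlMr _ (tc_component_ideal i 0)).
by case: (ht i).
Qed.
End TightClosureComponents.

(** * Primary families and perfect closures *)

Section PrimaryFamilies.
Variables (R : comPzRingType) (I : finType) (b : set R) (E q : I -> set R).
Hypothesis nR : noetherian R.
Hypothesis iE : forall i, is_ideal (E i).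
Hypothesis Eq : forall i, ~ E i 1 -> primary_ideal (E i) /\ ideal_radical (E i) = q i.
Hypothesis bE : forall u, b u <-> forall i, E i u.

Lemma common_power y (A : pred I) : (forall i, A i -> ~ E i 1 -> q i y) ->
  exists n, forall i, A i -> E i (y ^+ n).
Proof.
move=> hy; have /choice [n hn] : forall i, exists n, A i -> E i (y ^+ n).
  move=> i; have [Ai|nA] := pselect (A i); last by exists 0%N.
  have [E1|E1] := pselect (E i 1); first by exists 0%N.
  have := hy i Ai E1; have [_ <-] := Eq E1; by move=> [n hn]; exists n.
exists (\sum_i n i)%N => i Ai; rewrite (bigD1 i) //= exprD mulrC.
by apply: (idlM _ (iE i)); apply: hn.
Qed.

(** Components with the same prime are merged, since a minimal decomposition has distinct radicals;
    unit ideals among them do no harm. *)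
Let F i : set R := [set u | forall l, q l = q i -> E l u].

Let F_primary i l : q l = q i -> ~ E l 1 -> primary_ideal (F i) /\ ideal_radical (F i) = q i.
Proof.
move=> li El1; have hF : is_ideal (F i).
  split=> [k _|u v hu hv k ki|u v hv k ki].
  - exact: (idl0 (iE k)).
  - by apply: (idlD (iE k)); [apply: hu|apply: hv].
  - by apply: (idlM _ (iE k)); apply: hv.
have qF v : q i v -> ideal_radical (F i) v.
  move=> qv; have [|n hn] := @common_power v (fun k => `[< q k = q i >]).
    by move=> k /asboolP ->.
  by exists n => k ki; apply: hn; apply/asboolP.
split; first split=> //.
- by move=> /(_ l li).
- move=> u v huv; have [qv|qv] := pselect (q i v); [by right; apply: qF|left => k ki].
  have [E1|E1] := pselect (E k 1); first exact: (idl1 u (iE k)).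
  have [[_ _ pr] rad] := Eq E1; have [//|] := pr u v (huv k ki).
  by rewrite rad ki.
apply/seteqP; split=> // u [n hn]; rewrite -li; have [_ <-] := Eq El1.
by exists n; apply: hn.
Qed.

Lemma minimal_decomposition : exists k (qq : 'I_k -> set R),
  is_minimal_primary_decomp b qq /\ forall j, exists i,
    ideal_radical (qq j) = q i /\ forall y, (forall l, q l = q i -> E l y) -> qq j y.
Proof.
pose good (T : {set I}) := `[< forall u, (forall i, i \in T -> F i u) -> b u >].
have gT : good [set: I]%SET.
  by apply/asboolP => u hu; apply/bE => i; apply: (hu i); rewrite ?finset.in_setT.
pose T := [arg min_(T < [set: I]%SET | good T) #|T|]%N.
have [/asboolP hT minT] : good T /\ forall T', good T' -> (#|T| <= #|T'|)%N.
  by rewrite /T; case: arg_minnP => // T' h1 h2; split.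
have drop i : i \in T -> (forall u, (forall j, j \in T -> j <> i -> F j u) -> F i u) -> False.
  move=> iT hi; have : good (T :\ i)%SET.
    apply/asboolP => u hu; have hu' j : j \in T -> j <> i -> F j u.
      by move=> jT /eqP ji; apply: hu; rewrite finset.in_setD1 ji.
    apply: hT => j jT; have [->|/eqP ji] := eqVneq j i; [exact: hi|exact: hu'].
  by move=> /minT; rewrite [in X in (X <= _)%N](cardsD1 i) iT ltnn.
have prop i : i \in T -> exists2 l, q l = q i & ~ E l 1.
  move=> iT; apply: contrapT => hn; apply: (drop i iT) => u _ l li.
  by apply: (idl1 u (iE l)); apply: contrapT => El; apply: hn; exists l.
have prF i : i \in T -> primary_ideal (F i) /\ ideal_radical (F i) = q i.
  by move=> /prop [l li El]; apply: (F_primary li El).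
exists #|T|, (fun j => F (enum_val j)); split=> [|j]; last first.
  by exists (enum_val j); split=> //; case: (prF _ (enum_valP j)).
split.
- split=> [j|]; first by case: (prF _ (enum_valP j)).
  apply/seteqP; split=> u hu.
    by move=> j _ l _; apply: (proj1 (bE u)).
  apply: hT => i iT; have := hu (enum_rank_in iT i) Logic.I; by rewrite enum_rankK_in.
- move=> j j' /= e; apply: enum_val_inj; apply: contrapT => ne.
  apply: (drop _ (enum_valP j)) => u /(_ _ (enum_valP j')) hu l ql.
  apply: hu => [e'|]; first by apply: ne.
  by rewrite ql; have [_ <-] := prF _ (enum_valP j); have [_ <-] := prF _ (enum_valP j').
- move=> j hj; apply: (drop _ (enum_valP j)) => u hu; apply: hj => l lj.
  by apply: hu; [exact: enum_valP|move=> /enum_val_inj].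
Qed.

(** Let [u] lie in all components but the [j]-th. Whenever [u] is outside [E i], the prime [P'] is
    contained in [q i]. Were all these inclusions strict, a product [w] of elements of the [q i]
    outside [P'] would satisfy [b (u * w ^+ n)] for some [n], which the [j]-th component
    excludes. *)
Lemma ass_family P : ass b P -> exists i, P = q i.
Proof.
move=> [k [qq [[[prq bq] _ irr] [j ->]]]]; set P' := ideal_radical (qq j).
have pP : prime_ideal P' := radical_primary nR (prq j).
have [_ P1 Pm] := pP.
have [u [hu uj]] : exists u, (forall l, l <> j -> qq l u) /\ ~ qq j u.
  apply: contrapT => hn; apply: (irr j) => u hu; apply: contrapT => uj.
  by apply: hn; exists u.
have Pq i : ~ E i u -> P' `<=` q i.
  move=> Eu y [n hn]; have E1 : ~ E i 1 by move=> /(idl1 u (iE i)).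
  have [[_ _ pr] <-] := Eq E1.
  have : E i (u * y ^+ n).
    apply: (proj1 (bE _)); rewrite bq => l _; have hl : is_ideal (qq l) by case: (prq l).
    have [->|/eqP lj] := eqVneq l j; last by apply: (idlMr _ hl); apply: hu.
    by apply: (idlM _ _ hn); case: (prq j).
  by move=> /pr [//|[l]]; rewrite -exprM => hl; exists (n * l)%N.
apply: contrapT => hn.
have /choice [y hy] : forall i, exists y, ~ E i u -> q i y /\ ~ P' y.
  move=> i; have [Eu|Eu] := pselect (E i u); first by exists 0.
  apply: contrapT => /forallNP hy; apply: hn; exists i; apply/seteqP; split; first exact: Pq.
  by move=> z qz; apply: contrapT => Pz; apply: (hy z).
pose A i := ~~ `[< E i u >].
pose w := \prod_(i | A i) y i.
have [|n hw] := @common_power w A.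
  move=> i Ai E1; have [[hE _ _] rad] := Eq E1; rewrite -rad.
  have hr := radical_ideal nR (iE i); rewrite /w (bigD1 i) //=; apply: (idlMr _ hr).
  by rewrite rad; move: Ai => /asboolPn Eu; case: (hy i Eu).
have : qq j (u * w ^+ n).
  have : b (u * w ^+ n).
    apply/bE => i; have [Eu|Eu] := pselect (E i u); first by apply: (idlMr _ (iE i)).
    by apply: (idlM _ (iE i)); apply: hw; apply/asboolPn.
  by rewrite bq; apply.
have [_ _ pr] := prq j; move=> /pr [//|hwn].
have : ~ P' w; last by apply; apply: (prime_X (n := n) pP).
apply: (big_ind (~` P')) => [//|v v' hv hv' /Pm []//|i /asboolPn Eu].
by case: (hy i Eu).
Qed.
End PrimaryFamilies.

(** The multiplier [c] for [1] would lie in every power of [m], hence be [0], which belongs to all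
    minimal primes. *)
Lemma tight_closure_proper (p : nat) (R : comPzRingType) (m b : set R) : prime p ->
  noetherian R -> local_ring m -> b `<=` m -> ~ tight_closure p b 1.
Proof.
move=> pp nR lR bm [c hc [N hN]]; have pm := local_prime lR.
have hm := prime_is_ideal pm.
have [s [_ sP sQ]] := minimal_primes_seq nR; have [P /sP mP _] := sQ m pm.
apply: (hc P mP); suff -> : c = 0 by case: mP => -[[]].
apply: (krull_intersection nR hm (local_jac nR lR) (set0_ideal R)) => n.
apply: addI_r => //; have := hN (maxn n N) (leq_maxr _ _); rewrite expr1n mulr1.
apply: frob_power_min => // r br.
apply: (@idealX_le _ m n (p ^ maxn n N)); last by apply: idealX_exp; apply: bm.
by apply: leq_trans (leq_maxl n N) (ltnW (ltn_expl _ (prime_gt1 pp))).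
Qed.

Lemma subring_exists (R : comPzRingType) (B : set R) : B 1 ->
  (forall u v, B u -> B v -> B (u - v) /\ B (u * v)) ->
  exists (T : comPzRingType) (inc : {rmorphism T -> R}), injective inc /\
    forall u, B u <-> exists x, inc x = u.
Proof.
move=> B1 hB.
have B0 : B 0 by have [+ _] := hB _ _ B1 B1; rewrite subrr.
have h : subquotient_axiom B [set 0].
  split=> // [_ ->//|u _ ->]; split=> [_ ->|_]; first by rewrite /= subrr.
  by rewrite /= mulr0.
have reprE u : B u -> sq_repr (sq_pi h u) = u.
  by move=> Bu; have := sq_repr_pi h Bu => /eqP; rewrite subr_eq0 => /eqP.
have [||x y|inc hinc] := @rmorphism_exists (subquotient h) R (@sq_repr _ _ _ h).
- exact: (reprE 1).
- apply: sq_ind => u Bu; apply: sq_ind => v Bv.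
  by rewrite -sq_piB // !reprE //; case: (hB u v).
- move: x y; apply: sq_ind => u Bu; apply: sq_ind => v Bv.
  by rewrite -sq_piM // !reprE //; case: (hB u v).
exists (subquotient h), inc; split.
  by move=> x y; rewrite !hinc => e; rewrite -(sq_reprK x) e sq_reprK.
move=> u; split=> [Bu|[x <-]]; last by rewrite hinc; apply: sq_reprB.
by exists (sq_pi h u); rewrite hinc reprE.
Qed.

Lemma inj_surj_bijective (A : Type) (f : A -> A) : injective f ->
  (forall y, exists x, f x = y) -> bijective f.
Proof.
move=> fi /choice [g gK]; exists g => // x.
by apply: fi; rewrite gK.
Qed.

Section PerfectClosure.
Variables (p : nat) (R Rinf : comPzRingType) (psi0 : {rmorphism R -> Rinf}).
Hypotheses (pp : prime p) (pR : p%:R = 0 :> R) (perf : is_perfect_closure p psi0).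

Let pinf : p%:R = 0 :> Rinf. Proof. by case: perf => -[]. Qed.

Lemma perfect_frob_inj n : injective (fun x : Rinf => x ^+ (p ^ n)).
Proof.
have fi : injective (fun x : Rinf => x ^+ p) by case: perf => -[_ /bij_inj].
by elim: n => [|n IH] x y; rewrite ?expr1 // expnS !exprM => /IH /fi.
Qed.

Lemma perfect_frob_surj n (y : Rinf) : exists x, x ^+ (p ^ n) = y.
Proof.
have [[_ [g _ gK]] _] := perf; elim: n y => [|n IH] y; first by exists y; rewrite expr1.
by have [x ex] := IH (g y); exists x; rewrite expnSr exprM ex gK.
Qed.

(** Only the universal property is available: the elements with some [p ^ n]-th power in the image
    of [psi0] form a perfect subring [T], and the induced map to [T] followed by the inclusion is
    the identity by uniqueness. *)
Lemma perfect_closure_root al : exists n r, al ^+ (p ^ n) = psi0 r.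
Proof.
pose Y : set Rinf := [set al | exists n r, al ^+ (p ^ n) = psi0 r].
have lift u n r k : u ^+ (p ^ n) = psi0 r -> u ^+ (p ^ (n + k)) = psi0 (r ^+ (p ^ k)).
  by move=> e; rewrite expnD exprM e rmorphXn.
have Y1 : Y 1 by exists 0%N, 1; rewrite expr1n rmorph1.
have [u v [n [r er]] [k [s es]]|T [inc [inci incY]]] := subring_exists Y1.
  have [e1 e2] := (lift _ _ _ k er, lift _ _ _ n es); rewrite [(k + n)%N]addnC in e2.
  split; exists (n + k)%N.
    by exists (r ^+ (p ^ k) - s ^+ (p ^ n)); rewrite rmorphB (frobB pp pinf) e1 e2.
  by exists (r ^+ (p ^ k) * s ^+ (p ^ n)); rewrite rmorphM exprMn e1 e2.
have perfT : perfect_ring p T.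
  split; first by apply: inci; rewrite rmorph_nat pinf rmorph0.
  apply: inj_surj_bijective => [x y /= e|y].
    by apply: inci; apply: (@perfect_frob_inj 1); rewrite expn1 -!rmorphXn e.
  have [x] := perfect_frob_surj 1 (inc y); rewrite expn1 => ex.
  have [n [r er]] : Y (inc y) by apply/incY; exists y.
  have /incY [z ez] : Y x by exists n.+1, r; rewrite expnS exprM ex.
  by exists z; apply: inci; rewrite rmorphXn ez.
have /choice [g hg] : forall r, exists x, inc x = psi0 r.
  by move=> r; apply/incY; exists 0%N, r; rewrite expr1.
have [||x y|G hG] := @rmorphism_exists R T g.
- by apply: inci; rewrite hg !rmorph1.
- by move=> x y; apply: inci; rewrite rmorphB !hg rmorphB.
- by apply: inci; rewrite rmorphM !hg rmorphM.
have [_ univ] := perf; have [h [hh _]] := univ T G perfT.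
have [h0 [_ uniq]] := univ Rinf psi0 (proj1 perf).
have e1 := uniq (inc \o h : {rmorphism Rinf -> Rinf}); have e2 := uniq idfun.
have : Y (inc (h al)) by apply/incY; exists (h al).
suff -> : inc (h al) = al by [].
by rewrite [LHS](e1 _ al) ?[RHS](e2 _ al) // => r /=; rewrite hh hG hg.
Qed.

(* [R] maps to the perfect ring of germs at infinity of the sequences with
   [u (n + 1) = u n ^ p], and the kernel of this map is nilpotent. *)
Lemma perfect_closure_ker r : psi0 r = 0 -> exists n, r ^+ (p ^ n) = 0.
Proof.
pose Y : set (seqring R) := [set u | exists N, forall n, (N <= n)%N -> u n.+1 = u n ^+ p].
pose I : set (seqring R) := [set u | exists N, forall n, (N <= n)%N -> u n = 0].
have YB u v : Y u -> Y v -> Y (u - v).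
  move=> [N hN] [M hM]; exists (N + M)%N => n nn; rewrite !seq_BE hN ?hM; [|lia|lia].
  by have := @frobB p R pp pR 1 (u n) (v n); rewrite expn1.
have YM u v : Y u -> Y v -> Y (u * v).
  move=> [N hN] [M hM]; exists (N + M)%N => n nn; rewrite !seq_ME hN ?hM; [|lia|lia].
  by rewrite exprMn.
have I0 : I 0 by exists 0%N.
have Y1 : Y 1 by exists 0%N => n _; rewrite (_ : (1 : seqring R) n = 1) // expr1n.
have h : subquotient_axiom Y I.
  split=> // [u v Yu Yv|u [N hN]|u v [N hN]].
  - by split; [apply: YB|apply: YM].
  - exists N => n Nn; rewrite !hN //; last exact: leqW.
    by rewrite expr0n; case: (p) (prime_gt0 pp).
  split=> [w [M hM]|_].
    by exists (N + M)%N => n nn; rewrite seq_BE hN ?hM ?subrr //; lia.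
  by exists N => n nn; rewrite seq_ME hN // mulr0.
pose T := subquotient h; pose gs (r : R) : seqring R := fun n => r ^+ (p ^ n).
have Ygs s : Y (gs s) by exists 0%N => n _; rewrite /gs expnSr exprM.
have [||x y|G hG] := @rmorphism_exists R T (fun s => sq_pi h (gs s)).
- by rewrite -sq_pi1; congr sq_pi; apply/funext => n; rewrite /gs expr1n.
- move=> x y; rewrite -sq_piB //; congr sq_pi; apply/funext => n.
  by rewrite seq_BE /gs (frobB pp pR).
- rewrite -sq_piM //; congr sq_pi; apply/funext => n.
  by rewrite seq_ME /gs exprMn.
have pT : p%:R = 0 :> T by rewrite -(rmorph_nat G) pR rmorph0.
have piX u k : Y u -> Y (u ^+ k) /\ sq_pi h u ^+ k = sq_pi h (u ^+ k) :> T.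
  move=> Yu; elim: k => [|k [Yk ek]]; first by rewrite !expr0 sq_pi1.
  by rewrite !exprS ek sq_piM //; split=> //; apply: YM.
have perfT : perfect_ring p T.
  split=> //; apply: inj_surj_bijective => [x y /= e|].
    have : (x - y) ^+ p = 0 by have := frobB pp pT 1 x y; rewrite expn1 e subrr.
    suff inj0 : forall z : T, z ^+ p = 0 -> z = 0.
      by move=> /inj0 /eqP; rewrite subr_eq0 => /eqP.
    apply: sq_ind => u Yu; have [Yp ->] := piX u p Yu => /(sq_pi_eq0 h Yp) [N hN].
    apply/(sq_pi_eq0 h Yu); case: (Yu) => M hM; exists (N + M).+1 => -[//|n] nn.
    by rewrite hM -?seq_XE ?hN //; lia.
  apply: sq_ind => u Yu; pose v : seqring R := fun n => u n.-1.
  have [N hN] := Yu.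
  have Yv : Y v by exists N.+1 => -[//|n] nn; rewrite /v /= hN.
  exists (sq_pi h v); have [Yp ->] := piX v p Yv; apply/sq_pi_eq => //.
  by exists N.+1 => -[//|n] nn; rewrite seq_BE seq_XE /v /= hN ?subrr.
have [_ univ] := perf; have [H [hH _]] := univ T G perfT.
move=> r0; have : G r = 0 by rewrite -hH r0 rmorph0.
rewrite hG => /(sq_pi_eq0 h (Ygs r)) [N hN]; exists N; exact: (hN N).
Qed.

(** [D i] corresponds to the f-sequence [E i]. By [wd], membership can be tested on any
    representation of an element as a root, because the kernel of [psi0] is nil and [E i] is
    compatible with Frobenius; so [D i] is primary when the [E i n] are. *)
Lemma f_sequence_primary_decomp (I : finType) (E : I -> nat -> set R) (t : nat -> set R) :
  (forall i n, is_ideal (E i n)) ->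
  (forall i n k u, E i (n + k)%N (u ^+ (p ^ k)) <-> E i n u) ->
  (forall i n, ~ E i n 1 -> primary_ideal (E i n)) ->
  (forall n u, t n u <-> forall i, E i n u) ->
  has_primary_decomp (f_sequence_ideal p psi0 t).
Proof.
move=> iE Ef Ep tE.
pose D i : set Rinf := [set al | exists n r, E i n r /\ al ^+ (p ^ n) = psi0 r].
have wd i al n r : al ^+ (p ^ n) = psi0 r -> D i al -> E i n r.
  move=> er [k [s [Es es]]].
  have : psi0 (r ^+ (p ^ k) - s ^+ (p ^ n)) = 0.
    by rewrite rmorphB !rmorphXn -er -es -!exprM -!expnD addnC subrr.
  move=> /perfect_closure_ker [e]; rewrite (frobB pp pR) -!exprM -!expnD => /eqP.
  rewrite subr_eq0 => /eqP ee.
  apply/(Ef i n (k + e)%N); rewrite ee.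
  by rewrite (_ : (n + (k + e) = k + (n + e))%N) ?Ef //; lia.
have psiP n r : psi p psi0 n r ^+ (p ^ n) = psi0 r.
  rewrite /psi; case: xgetP => [y _ //|hn].
  by have [y ey] := perfect_frob_surj n (psi0 r); case: (hn y).
have root2 al be : exists n r s, al ^+ (p ^ n) = psi0 r /\ be ^+ (p ^ n) = psi0 s.
  have [[n [r er]] [k [s es]]] := (perfect_closure_root al, perfect_closure_root be).
  exists (n + k)%N, (r ^+ (p ^ k)), (s ^+ (p ^ n)); rewrite !rmorphXn -er -es.
  by rewrite -!exprM -!expnD [(k + n)%N]addnC.
have D1 i : ~ E i 0 1 -> ~ D i 1.
  by move=> E1 /(wd i 1 0%N 1); rewrite expr1n rmorph1 => /(_ erefl).
have DP i : ~ E i 0 1 -> primary_ideal (D i).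
  move=> E1; have E1n n : ~ E i n 1.
    by move=> h; apply: E1; apply/(Ef i 0%N n); rewrite add0n expr1n.
  split; [split| exact: D1|].
  - by exists 0%N, 0; split; [exact: (idl0 (iE i 0%N))|rewrite rmorph0 (frob0 _ pp)].
  - move=> al be Da Db; have [n [r [s [er es]]]] := root2 al be.
    exists n, (r + s); rewrite (frobD pp pinf) er es rmorphD; split=> //.
    by apply: (idlD (iE i n)); [apply: wd Da|apply: wd Db].
  - move=> al be Db; have [n [r [s [er es]]]] := root2 al be.
    exists n, (r * s); rewrite exprMn er es rmorphM; split=> //.
    by apply: (idlM _ (iE i n)); apply: wd Db.
  - move=> al be Dab; have [n [r [s [er es]]]] := root2 al be.
    have : E i n (r * s) by apply: (wd _ (al * be)) => //; rewrite exprMn er es rmorphM.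
    have [_ _ pr] := Ep i n (E1n n); move=> /pr [Er|[k Ek]]; first by left; exists n, r.
    by right; exists k, n, (s ^+ k); split=> //; rewrite exprAC es rmorphXn.
(* If [E i 0] is the unit ideal, so are all [E i n]; such indices are dropped, as a primary ideal is
   proper. *)
pose A := [set i | ~~ `[< E i 0 1 >]]%SET.
have AP i : i \in A -> ~ E i 0 1 by rewrite finset.inE => /asboolPn.
exists #|A|, (fun j => D (enum_val j)); split=> [j|]; first exact/DP/AP/enum_valP.
apply/seteqP; split=> al.
  move=> [n _ [r tr <-]] j _; exists n, r; split; last exact: psiP.
  exact: (proj1 (tE n r)).
move=> hal; have [n [r er]] := perfect_closure_root al.
exists n => //; exists r; last by apply: (@perfect_frob_inj n); rewrite psiP er.
apply/tE => i; have [iA|iA] := boolP (i \in A).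
  by apply: (wd i al) => //; have := hal (enum_rank_in iA i) Logic.I; rewrite enum_rankK_in.
apply: (idl1 r (iE i n)).
have E1 : E i 0 1 by apply: contrapT => h; move: iA; rewrite finset.inE; move=> /negP; apply; apply/asboolPn.
by move/(Ef i 0%N n): E1; rewrite expr1n; apply.
Qed.
End PerfectClosure.

(** Coefficients in the prime field are evaluated as natural numbers, which every ring map respects;
    hence no coefficient field of [R] itself is involved. *)
Lemma mpeval_range (p d : nat) (R : comNzRingType) (A B : comPzRingType)
    (iota : {rmorphism A -> B}) (theta : {rmorphism R -> B}) (x : 'I_d -> R) g :
  (forall i, exists y, iota y = theta (x i)) -> exists y, iota y = theta (@mpeval p d R x g).
Proof.
move=> /choice [z hz]; rewrite /mpeval /mpoly.mmap rmorph_sum.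
apply: (big_ind (fun b => exists y, iota y = b)) => [|_ _ [u <-] [v <-]|m _].
- by exists 0; rewrite rmorph0.
- by exists (u + v); rewrite rmorphD.
rewrite rmorphM rmorph_nat /mpoly.mmap1 rmorph_prod.
have [y <-] : exists y, iota y = \prod_(i < d) theta (x i ^+ mpoly.fun_of_multinom m i).
  apply: (big_ind (fun b => exists y, iota y = b)) => [|_ _ [u <-] [v <-]|i _].
  - by exists 1; rewrite rmorph1.
  - by exists (u * v); rewrite rmorphM.
  - by exists (z i ^+ mpoly.fun_of_multinom m i); rewrite !rmorphXn hz.
by eexists; rewrite -(rmorph_nat iota) -rmorphM.
Qed.

Theorem corollary8p11 (p d : nat) (R : comNzRingType) (m : set R)
    (x : 'I_d -> R) (a : set R)
    (char_R : p \in [pchar R])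
    (local_R : local_ring m)
    (excellent_R : excellent R)
    (dim_R : has_krull_dim R d)
    (equidim_R : equidimensional R)
    (sop_x : system_of_parameters m x)
    (ideal_a : is_ideal a)
    (proper_a : ~ a 1)
    (gen_a : exists G : set (mpoly.mpoly d 'F_p),
       a = gen_ideal (mpeval x @` G)) :
  [/\ forall (S : set R), mult_closed S ->
        forall (L : comPzRingType) (phi : {rmorphism R -> L}),
          is_localization S phi ->
          ideal_ext phi (tight_closure p a) =
            tight_closure p (ideal_ext phi a),
      (forall (Rinf : comPzRingType) (psi0 : {rmorphism R -> Rinf}),
        is_perfect_closure p psi0 ->
        has_primary_decomp
          (f_sequence_ideal p psi0
             (fun n => tight_closure p (frob_power p a n)))) /\
      linear_growth p (fun n => tight_closure p (frob_power p a n))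
    & finite_set (\bigcup_n ass (tight_closure p (frob_power p a n)))].
Proof.
have pp : prime p by case/andP: char_R.
have pR : p%:R = 0 :> R by apply/eqP; case/andP: char_R.
have [nR _ _ _] := excellent_R.
have [G aG] := gen_a.
have comps P : minimal_prime P -> uniform_components p a P.
  move=> mP; have [A [B [iota [theta [c0 [[nA pA ffA] [nB [r [e gen_e]]] [Pc0 fc0] ix
    [ker contract]]]]]]] := component_data char_R local_R excellent_R dim_R equidim_R sop_x mP.
  apply: (components_of_data pp pA nA ffA nB gen_e Pc0 fc0 ker contract aG).
  by move=> _ [g _ <-]; apply: mpeval_range.
have [I [P [q [h [Z [hP hZ Zq Zh glue]]]]]] := uniform_components_glue pp pR nR comps.
pose E i n := tc_component p P Z i n.
have iE i n : is_ideal (E i n) := tc_component_ideal pp pR hP hZ i n.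
have Ep i n (E1 : ~ E i n 1) := tc_component_primary pp pR hP hZ Zq Zh E1.
have tE n u : tight_closure p (frob_power p a n) u <-> forall i, E i n u.
  exact: (tight_closure_components pp pR hP hZ glue).
split.
- move=> S hS L phi loc.
  exact: (tight_closure_localization pp pR ideal_a hP hZ Zq Zh glue hS loc).
- split.
    move=> Rinf psi0 perf; apply: (f_sequence_primary_decomp pp pR perf iE _ _ tE).
      by move=> i n k u; apply: tc_component_frob.
    by move=> i n /Ep [].
  split; first exact: (tight_closure_frob_f_sequence pp pR hP hZ glue).
    move=> n; apply: (tight_closure_proper pp nR local_R) => r /(frob_power_sub pp ideal_a).
    exact: (local_sub nR local_R ideal_a proper_a).
  (* The successor only ensures positivity. *)
  exists (\max_i h i).+1 => // n.
  have [k [qq [dec hqq]]] := minimal_decomposition (iE^~ n) (Ep^~ n) (tE n).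
  exists k, qq; split=> // j; have [i [-> hi]] := hqq j => y hy; apply: hi => l ql.
  apply: (tc_component_powers pp pR hP hZ Zh); rewrite ql; apply: idealX_le hy.
  by apply: leq_trans (leq_bigmax l) (leqnSn _).
apply: (@sub_finite_set _ _ (range q)); last exact/finite_image/finite_finset.
move=> Q [n _ /(ass_family nR (iE^~ n) (Ep^~ n) (tE n)) [i ->]]; by exists i.
Qed.
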